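(* Let $p\in(n,\infty)$, let $S\subset\mathbb{R}^n$ be closed, $\Omega:=\operatorname{int}(S)$, and let $\sigma$ be a positive regular Borel measure on $\mathbb{R}^n$ with $\operatorname{supp}\sigma=\partial S$ satisfying $\sigma(Q(x,kr))\le C_\sigma k^n\sigma(Q(x,r))$ for all $x\in\partial S$, $0<r\le1$, $1\le k\le1/r$, and $C'_\sigma\le\sigma(Q(x,1))\le C''_\sigma$ for all $x\in\partial S$, where $C_\sigma,C'_\sigma,C''_\sigma>0$. Suppose that $\partial S$ satisfies the ball condition with constant $\beta_{\partial S}$. Then, for every $f\in C(S)$, $$\|f\|_{W^1_p(\mathbb{R}^n)|_S}\sim\|f|_\Omega\|_{W^1_p(\Omega)}+\|f\|_{L_p(\sigma)}+\left(\iint_{\|x-y\|<1}\frac{|f(x)-f(y)|^p}{\|x-y\|^{p-n}\sigma(Q(x,\|x-y\|))^2}\,d\sigma(x)\,d\sigma(y)\right)^{1/p}$$ with constants of equivalence depending only on $n,p,C_\sigma,C'_\sigma,C''_\sigma$ and $\beta_{\partial S}$.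
   Context: Ball condition: a closed set $A$ satisfies the ball condition if there is a constant $\beta_A>0$ such that for each Euclidean ball $B$ of diameter at most $1$ whose center lies in $A$ there exists a ball $B'\subset B\setminus A$ with $\operatorname{diam}B\le\beta_A\operatorname{diam}B'$. Here $\|x\|=\max_i|x_i|$ and $Q(x,r)=\{y:\|y-x\|\le r\}$. For open $\Omega$, $W^1_p(\Omega)$ is the Sobolev space with norm $\|F\|_{L_p(\Omega)}+\|\nabla F\|_{L_p(\Omega)}$ ($+\infty$ for functions not in the space, $0$ if $\Omega=\emptyset$). As $p>n$, elements of $W^1_p(\mathbb{R}^n)$ are identified with their continuous representatives. $W^1_p(\mathbb{R}^n)|_S$ consists of all $f:S\to\mathbb{R}$ with $f=F|_S$ for some continuous $F\in W^1_p(\mathbb{R}^n)$, and $\|f\|_{W^1_p(\mathbb{R}^n)|_S}$ is the infimum of $\|F\|_{W^1_p(\mathbb{R}^n)}$ over all such $F$ ($+\infty$ if there is none). $C(S)$ is the set of continuous functions on $S$. $A\sim B$ means $A/C\le B\le CA$ (in $[0,\infty]$) for a constant $C\ge1$. The integrand is understood to be $0$ on the diagonal $x=y$. *)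

(* Defs.v *)
From HB Require Import structures.
From mathcomp Require Import all_boot all_order all_algebra.
From mathcomp Require Import all_classical all_reals all_analysis.
From mathcomp Require Import measurable_realfun.

Set Implicit Arguments.
Unset Strict Implicit.
Unset Printing Implicit Defensive.

Import Order.TTheory GRing.Theory Num.Theory.
Import numFieldNormedType.Exports.

Local Open Scope classical_set_scope.
Local Open Scope ring_scope.

(* R^n is 'rV[R]_n, whose library norm `|x| is max_i |x_i| and whose topology
   is the usual one; borelRn R n is the same type equipped with the Borel
   sigma-algebra. *)
Notation borelRn R n := (g_sigma_algebraType (@open 'rV[R]_n)).

Section lebesgueRn.
Context {R : realType}.

Definition cons_rV n (z : borelRn R n * measurableTypeR R) : borelRn R n.+1 :=
  row_mx (\row_(i < 1) z.2) (z.1 : 'rV[R]_n).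

Lemma open_measurableRn n (A : set 'rV[R]_n) :
  open A -> @measurable _ (borelRn R n) A.
Proof. exact: sub_sigma_algebra. Qed.

Lemma open_rat_balls n (U : set 'rV[R]_n) : open U ->
  U = \bigcup_(qk in [set qk : 'rV[rat]_n * nat |
         ball (map_mx ratr qk.1 : 'rV[R]_n) qk.2.+1%:R^-1 `<=` U])
        ball (map_mx ratr qk.1 : 'rV[R]_n) qk.2.+1%:R^-1.
Proof.
move=> oU; apply/seteqP; split=> [x Ux|x [qk /= sub]]; last exact: sub.
have /nbhs_ballP[e /= e0 sub] : nbhs x U by exact: open_nbhs_nbhs.
have [k ke] : exists k : nat, k.+1%:R^-1 < e / 2.
  have e2 : 0 < e / 2 by rewrite divr_gt0.
  have := near_infty_natSinv_lt (PosNum e2) => -[k _ /(_ k (leqnn k))] /= ?.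
  by exists k.
have k0 : 0 < k.+1%:R^-1 :> R by rewrite invr_gt0.
have qP i : exists q : rat, `|x ord0 i - ratr q| < k.+1%:R^-1.
  have : x ord0 i - k.+1%:R^-1 < x ord0 i + k.+1%:R^-1.
    by rewrite ltrBlDr -addrA ltrDl addr_gt0.
  move=> /rat_in_itvoo[q]; rewrite in_itv /= => /andP[h1 h2].
  by exists q; rewrite distrC ltr_distl h1.
pose q i := xchoose (qP i).
have qE i j : (map_mx ratr (\row_i q i) : 'rV[R]_n) i j = ratr (q j).
  by rewrite !mxE.
have bqx : ball (map_mx ratr (\row_i q i) : 'rV[R]_n) k.+1%:R^-1 x.
  split=> // i j; rewrite qE ord1 /ball /= distrC; exact: (xchooseP (qP j)).
exists ((\row_i q i), k) => //= y [_ By]; apply: sub; split=> // i j.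
case: bqx => _ /(_ i j) Bx.
have := ball_triangle (ball_sym Bx) (By i j); apply: le_ball.
by rewrite (splitr e) lerD // ltW.
Qed.

Lemma preimage_cons_rV_ball n (c : 'rV[R]_n.+1) (e : R) : 0 < e ->
  @cons_rV n @^-1` ball c e =
   ball (\row_j c ord0 (@rshift 1 n j) : 'rV[R]_n) e `*`
   ball (c ord0 (@lshift 1 n ord0)) e.
Proof.
move=> e0; apply/seteqP; split=> -[v x] /=.
  move=> [_ h]; split.
    split=> // i j; rewrite (ord1 i) mxE; have := h ord0 (@rshift 1 n j).
    by rewrite /cons_rV (@row_mxEr _ 1 1 n).
  by have := h ord0 (@lshift 1 n ord0); rewrite /cons_rV (@row_mxEl _ 1 1 n) mxE.
move=> [[_ hv] hx]; split=> // i j; rewrite (ord1 i).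
case: (@split_ordP 1 n j) => a ->.
  by rewrite /cons_rV (@row_mxEl _ 1 1 n) mxE (ord1 a).
by rewrite /cons_rV (@row_mxEr _ 1 1 n); have := hv ord0 a; rewrite mxE.
Qed.

Lemma measurable_cons_rV n : measurable_fun [set: _] (@cons_rV n).
Proof.
refine (@measurability _ _ (borelRn R n * measurableTypeR R)%type
  (borelRn R n.+1) setT _ (@open 'rV[R]_n.+1) erefl _) => _ [U oU <-].
rewrite setTI (open_rat_balls oU) preimage_bigcup bigcup_mkcond.
apply: countable_bigcupT_measurable => // -[c k]; case: ifP => // _ /=.
rewrite preimage_cons_rV_ball ?invr_gt0//; apply: measurableX.
  by apply: open_measurableRn; exact: ball_open.
exact: measurable_ball.
Qed.

Definition lebesgueRn_step n (mu : {measure set (borelRn R n) -> \bar R}) :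
    set (borelRn R n.+1) -> \bar R :=
  pushforward (mu \x @lebesgue_measure R)%E (@cons_rV n).

Section lebesgueRn_step_measure.
Variables (n : nat) (mu : {measure set (borelRn R n) -> \bar R}).
HB.instance Definition _ := Measure.copy (lebesgueRn_step mu)
  (measure_function_pushforward__canonical__measure_function_Measure
     (mu \x @lebesgue_measure R)%E (@measurable_cons_rV n)).
End lebesgueRn_step_measure.

(* The library has Lebesgue measure only on R; on R^(n+1) it is the product of
   the measure on R^n and the one on R. *)
Fixpoint lebesgueRn n : {measure set (borelRn R n) -> \bar R} :=
  if n is m.+1 then lebesgueRn_step (lebesgueRn m)
  else @dirac _ (borelRn R 0) (0 : 'rV[R]_0) R.

Lemma lebesgueRn_ball n (c : 'rV[R]_n) (r : R) : 0 < r ->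
  lebesgueRn n (ball c r) = ((r *+ 2) ^+ n)%:E.
Proof.
move=> r0; elim: n c => [|n IHn] c.
  by rewrite /= diracE mem_set//; split=> // i [].
rewrite /= /lebesgueRn_step /pushforward preimage_cons_rV_ball//.
rewrite product_measure1E; first last.
- exact: measurable_ball.
- by apply: open_measurableRn; exact: ball_open.
rewrite IHn exprSr EFinM; congr (_ * _)%E.
exact: (lebesgue_measure_ball _ (ltW r0)).
Qed.

End lebesgueRn.

Section definitions.
Context {R : realType} {n : nat}.
Implicit Types (x y : 'rV[R]_n) (A S Omega : set 'rV[R]_n)
  (u f F phi : 'rV[R]_n -> R).

Definition cube x (r : R) : set 'rV[R]_n := [set y | `|y - x| <= r].

Definition euclidean_norm x : R := Num.sqrt (\sum_(i < n) x ord0 i ^+ 2).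

Definition euclidean_ball x (r : R) : set 'rV[R]_n :=
  [set y | euclidean_norm (y - x) < r].

Definition boundary A : set 'rV[R]_n := closure A `\` interior A.

(* A ball of radius r has diameter 2 * r, as n > 0. *)
Definition ball_condition (beta : R) A : Prop :=
  forall x r, A x -> 0 < r -> 2 * r <= 1 ->
  exists y s, [/\ 0 < s, 2 * r <= beta * (2 * s) &
    euclidean_ball y s `<=` euclidean_ball x r `\` A].

Definition support_measure (mu : set (borelRn R n) -> \bar R) : set 'rV[R]_n :=
  [set x | forall U : set 'rV[R]_n, open U -> U x -> (0 < mu U)%E].

Definition regular_measure (mu : set (borelRn R n) -> \bar R) : Prop :=
  [/\ forall K : set 'rV[R]_n, compact K -> (mu K < +oo)%E,
      forall A : set (borelRn R n), measurable A ->
        mu A = ereal_inf [set mu U | U in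
                            [set U : set 'rV[R]_n | open U /\ A `<=` U]] &
      forall A : set (borelRn R n), measurable A ->
        mu A = ereal_sup [set mu K | K in
                            [set K : set 'rV[R]_n | compact K /\ K `<=` A]]].

Definition Lp_norm (mu : {measure set (borelRn R n) -> \bar R}) A (p : R) u :
    \bar R :=
  'N[mu]_(p%:E)[EFin \o (u \_ A)].

Definition partial (i : 'I_n) u : 'rV[R]_n -> R :=
  fun x => 'D_(delta_mx ord0 i) u x.

Definition smooth u : Prop :=
  forall s : seq 'I_n, continuous (foldr partial u s) /\
    forall i x, derivable (foldr partial u s) x (delta_mx ord0 i).

Definition test_function Omega phi : Prop :=
  [/\ smooth phi, compact (closure [set x | phi x != 0]) &
      closure [set x | phi x != 0] `<=` Omega].

Definition locally_integrableRn Omega u : Prop :=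
  measurable_fun (Omega : set (borelRn R n)) u /\
  forall K : set 'rV[R]_n, compact K -> K `<=` Omega ->
    (\int[lebesgueRn n]_(x in K) `|u x|%:E < +oo)%E.

Definition weak_gradient Omega u (G : 'rV[R]_n -> 'rV[R]_n) : Prop :=
  locally_integrableRn Omega u /\
  forall i, locally_integrableRn Omega (fun x => G x ord0 i) /\
    forall phi, test_function Omega phi ->
      (\int[lebesgueRn n]_(x in Omega) (u x * partial i phi x)%:E =
       - \int[lebesgueRn n]_(x in Omega) (G x ord0 i * phi x)%:E)%E.

(* The L_p norm of the gradient is taken with respect to the max norm on R^n. *)
Definition W1p Omega (p : R) : set ('rV[R]_n -> R) :=
  [set u | exists G, [/\ weak_gradient Omega u G,
     (Lp_norm (lebesgueRn n) Omega p u < +oo)%E &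
     (Lp_norm (lebesgueRn n) Omega p (fun x => `|G x|%R) < +oo)%E]].

(* Weak gradients are unique almost everywhere, so the infimum ranges over at
   most one value; it is +oo when u is not in W^1_p(Omega). *)
Definition W1p_norm Omega (p : R) u : \bar R :=
  ereal_inf [set (Lp_norm (lebesgueRn n) Omega p u +
                  Lp_norm (lebesgueRn n) Omega p (fun x => `|G x|%R))%E
            | G in weak_gradient Omega u].

Definition trace_norm S (p : R) f : \bar R :=
  ereal_inf [set W1p_norm setT p F | F in
    [set F | [/\ continuous F, W1p setT p F & forall x, S x -> F x = f x]]].

(* The strict lower bound 0 < `|x - y| makes the diagonal contribute 0.  The
   measure is carried by A, which is where f is evaluated. *)
Definition besov_seminorm (sigma : {measure set (borelRn R n) -> \bar R})
    A (p : R) f : \bar R :=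
  ((\int[sigma]_(y in A)
      \int[sigma]_(x in A `&` [set x : 'rV[R]_n | (0 < `|x - y| < 1)%R])
        (`|f x - f y| `^ p /
          (`|x - y| `^ (p - n%:R) *
           fine (sigma (cube x `|x - y|)) ^+ 2))%:E) `^ p^-1)%E.

Definition equivalent_up_to (C : R) (a b : \bar R) : Prop :=
  (C^-1%:E * a <= b <= C%:E * a)%E.

End definitions.

(* Main.v *)
(* Put E = bd S, a null set by porosity.

   Restriction.  Let F extend f, with weak gradient G.  Testing the weak gradient
   against fluxes that interpolate between bumps of geometrically decreasing scale
   bounds |F x - F y|^p by a weighted sum of the p-th powers of the integrals of |G|
   over cubes centred at x and y.  Integrating in sigma and applying Jensen's
   inequality with a weight that grows near E would cost a divergent factor, were it
   not for the ball condition, which makes the mass of neighbourhoods of E decay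
   geometrically; Tonelli then bounds the double integral by the L_p norm of G.

   Extension.  Averaging f|_E against sigma at scale 4^-k and gluing consecutive
   scales by cutoffs of the corresponding neighbourhoods of E gives smooth functions
   that stabilise off E.  They and their gradients are dominated by one majorant,
   whose integral is at most the L_p and Besov terms, so that the limit P is a Sobolev
   function equal to f on E.  On Omega = int S the function f - P vanishes continuously
   at the boundary; since p > n, such a function extended by zero is again a Sobolev
   function, and P + (f - P) 1_S extends f. *)

From HB Require Import structures.
Require Import Defs.
From mathcomp Require Import all_boot all_order all_algebra.
From mathcomp Require Import all_classical all_reals all_analysis.
From mathcomp Require Import measurable_realfun ring lra.

Set Implicit Arguments.
Unset Strict Implicit.
Unset Printing Implicit Defensive.

Import Order.TTheory GRing.Theory Num.Theory.
Import numFieldNormedType.Exports.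

Local Open Scope classical_set_scope.
Local Open Scope ring_scope.

(** One device drives both Sobolev estimates: the difference of two product bumps is the divergence
    of an explicit compactly supported field, so a weak gradient controls differences of means
    without mollifying the function. As the bumps shrink this gains the power p - n of the scale;
    half of it ([ratio]) pays for the sum along a chain, half for the sum over scales. The obstacle
    in the restriction is that a point at distance d from E is seen from E at every scale above d,
    so that unweighted Jensen counts its gradient once per scale. With the weight [growth ^+ i] on
    the i-th neighbourhood the finest scale dominates, and the mean of the weight over cubes of
    scale i stays of order [growth ^+ i] because [growth] lies below the inverse of [porosity_loss].
    In place of a Whitney decomposition, averages are made smooth on all of R^n, and the ratio 4 of
    consecutive radii places each cutoff where the preceding function is a single average. In the
    extension by zero, the largest open cube about a point lies in the open set and touches a zero,
    which bounds the function by its local energy. *)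

(** * Monotonicity of integrals of nonnegative functions *)

Section integral_monotone.
Context d (T : measurableType d) (R : realType).
Variable mu : {measure set T -> \bar R}.
Local Open Scope ereal_scope.

(** The integral of a nonnegative function is a supremum over the simple functions below it, so
    monotonicity holds for arbitrary nonnegative functions. This is what allows the Besov kernel to
    be estimated without establishing its joint measurability. *)
Lemma le_ge0_integral (D : set T) (f g : T -> \bar R) :
  (forall x, D x -> 0 <= f x) -> (forall x, D x -> f x <= g x) ->
  \int[mu]_(x in D) f x <= \int[mu]_(x in D) g x.
Proof.
move=> f0 fg; rewrite !(integral_mkcond D).
have h0 x : 0 <= (f \_ D) x by apply: erestrict_ge0.
have hg x : (f \_ D) x <= (g \_ D) x by apply: lee_restrict.
rewrite !ge0_integralTE//; last by move=> x; apply: le_trans (hg x).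
apply: ereal_sup_le => _ [h hf <-]; exists h => //= x.
exact: le_trans (hf x) (hg x).
Qed.

Lemma le_ge0_integral_subset (A B : set T) (f : T -> \bar R) :
  A `<=` B -> (forall x, B x -> 0 <= f x) ->
  \int[mu]_(x in A) f x <= \int[mu]_(x in B) f x.
Proof.
move=> AB f0; rewrite (integral_mkcond A) (integral_mkcond B).
apply: le_ge0_integral => x _.
  by apply: erestrict_ge0 => y /AB; exact: f0.
rewrite !patchE; case: ifPn => [/set_mem Ax|]; first by rewrite mem_set//; exact: AB.
by case: ifPn => // /set_mem Bx _; exact: f0.
Qed.
End integral_monotone.

(** * Borel sets, the max norm and cubes of R^n *)

Section borel.
Context {R : realType}.

Section fixed_dim.
Context {n : nat}.
Local Notation V := 'rV[R]_n.
Local Notation X := (borelRn R n).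

Lemma closed_measurableRn (A : set V) : closed A -> @measurable _ X A.
Proof.
move=> cA; rewrite -[A]setCK; apply: measurableC.
exact: open_measurableRn (closed_openC cA).
Qed.

Lemma continuous_measurableRn (f : V -> R) :
  continuous f -> measurable_fun [set: X] (f : X -> R).
Proof.
move=> cf; apply: (measurability _ (RGenOpens.measurableE R)) => _ [_ [a [b ->] <-]].
rewrite setTI; apply: (@open_measurableRn R n).
apply: open_comp => [x _|]; first exact: cf.
exact: interval_open.
Qed.

Lemma closed_cube (x : V) (r : R) : closed (cube x r).
Proof.
rewrite (_ : cube x r = closed_ball_ (@Num.norm _ V) x r); last first.
  by rewrite /cube /closed_ball_; apply/seteqP; split=> y /=; rewrite distrC.
exact: closed_closed_ball_.
Qed.

Lemma measurable_cube (x : V) (r : R) : @measurable _ X (cube x r).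
Proof. by apply: closed_measurableRn; exact: closed_cube. Qed.

Lemma subrvE (u v : V) i : (u - v) ord0 i = u ord0 i - v ord0 i.
Proof. by rewrite !mxE. Qed.

Lemma rV_norm_leP (v : V) (r : R) : 0 <= r ->
  `|v| <= r <-> forall i, `|v ord0 i| <= r.
Proof.
move=> r0; rewrite [leLHS]/Num.norm /= mx_normrE; split=> [/bigmax_leP[_ h] i|h].
  exact: (h (ord0, i)).
by apply/bigmax_leP; split=> // -[i j] _ /=; rewrite (ord1 i); exact: h.
Qed.

Lemma rV_norm_ltP (v : V) (r : R) : 0 < r ->
  `|v| < r <-> forall i, `|v ord0 i| < r.
Proof.
move=> r0; rewrite [ltLHS]/Num.norm /= mx_normrE; split=> [/bigmax_ltP[_ h] i|h].
  exact: (h (ord0, i)).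
by apply/bigmax_ltP; split=> // -[i j] _ /=; rewrite (ord1 i); exact: h.
Qed.

Lemma rV_coord_le (v : V) i : `|v ord0 i| <= `|v|.
Proof. by have /rV_norm_leP : `|v| <= `|v| by []; exact. Qed.

(* Specializations to ['rV[R]_n] of general facts about norms, stated so that
   [lra] sees syntactically equal norms. *)
Lemma rV_normD (x y : V) : `|x + y| <= `|x| + `|y|.
Proof. exact: ler_normD. Qed.

Lemma rV_distC (x y : V) : `|x - y| = `|y - x|.
Proof. exact: distrC. Qed.

Lemma rV_distD (y x z : V) : `|x - z| <= `|x - y| + `|y - z|.
Proof. exact: ler_distD. Qed.

Lemma rV_norm_dist (x y : V) : `|x| <= `|x - y| + `|y|.
Proof. by have := rV_normD (x - y) y; rewrite subrK. Qed.

Lemma rV_normZ (c : R) (x : V) : `|c *: x| = `|c| * `|x|.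
Proof. exact: normrZ. Qed.

Lemma rV_norm_ge0 (x : V) : 0 <= `|x|.
Proof. exact: normr_ge0. Qed.

Lemma compact_cube (x : V) (r : R) : compact (cube x r).
Proof.
apply: bounded_closed_compact; last exact: closed_cube.
exists (`|x| + r); split; first by rewrite num_real.
move=> M hM y; rewrite /cube /= => yx; apply: le_trans (ltW hM).
rewrite -[y](subrK x) addrC; apply: le_trans (ler_normD _ _) _.
by rewrite lerD2l.
Qed.

Lemma continuous_coord i : continuous (fun v : V => v ord0 i).
Proof. exact: coord_continuous. Qed.

Lemma measurable_coord i : measurable_fun [set: X] (fun v : X => (v : V) ord0 i).
Proof.
apply: (@continuous_measurableRn (fun v : V => v ord0 i)).
exact: continuous_coord.
Qed.

End fixed_dim.

(** Measurability refers to the product of the two Borel sigma-algebras. The superlevel sets are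
    finite unions over the coordinates, where measurability comes from the projections. *)
Lemma measurable_dist n : measurable_fun [set: borelRn R n * borelRn R n]
  (fun xy => `|(xy.1 : 'rV[R]_n) - (xy.2 : 'rV[R]_n)|).
Proof.
apply: (measurability _ (RGenOInfty.measurableE R)) => _ [_ [a ->] <-].
rewrite setTI.
have [a0|a0] := ltP a 0.
  rewrite (_ : _ @^-1` _ = setT)//; apply/seteqP; split=> // z _ /=.
  by rewrite in_itv/= andbT (lt_le_trans a0).
rewrite (_ : _ @^-1` _ = \bigcup_(i : 'I_n) ((fun xy : borelRn R n * borelRn R n =>
   `|(xy.1 : 'rV[R]_n) ord0 i - (xy.2 : 'rV[R]_n) ord0 i|) @^-1` `]a, +oo[)); last first.
  apply/seteqP; split=> [[x y] /=|[x y] [i _] /=]; rewrite !in_itv/= !andbT.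
    move=> axy; apply: contrapT => h; have := axy; apply/negP.
    rewrite -leNgt; apply/rV_norm_leP => // i; rewrite leNgt; apply/negP => ai.
    by apply: h; exists i => //=; rewrite in_itv/= andbT; rewrite !mxE in ai.
  move=> h; apply: lt_le_trans h _; have := rV_coord_le ((x : 'rV[R]_n) - y) i.
  by rewrite !mxE.
apply: fin_bigcup_measurable => // i _; rewrite -[X in measurable X]setTI.
have m1 : measurable_fun [set: borelRn R n * borelRn R n]
    (fun xy : borelRn R n * borelRn R n => (xy.1 : 'rV[R]_n) ord0 i).
  exact: measurableT_comp (measurable_coord i) measurable_fst.
have m2 : measurable_fun [set: borelRn R n * borelRn R n]
    (fun xy : borelRn R n * borelRn R n => (xy.2 : 'rV[R]_n) ord0 i).
  exact: measurableT_comp (measurable_coord i) measurable_snd.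
have /(_ measurableT) := measurableT_comp (@normr_measurable R setT) (measurable_funB m1 m2).
by apply.
Qed.

Lemma lebesgueRn_cube n (c : 'rV[R]_n) (r : R) : 0 < r ->
  lebesgueRn n (cube c r) = ((r *+ 2) ^+ n)%:E.
Proof.
move=> r0; elim: n c => [|n IHn] c.
  rewrite /= diracE mem_set// /cube/= (_ : _ - c = 0); last by apply/rowP => -[].
  by rewrite normr0 ltW.
rewrite /= /lebesgueRn_step /pushforward.
rewrite (_ : _ @^-1` _ = cube (\row_j c ord0 (@rshift 1 n j) : 'rV[R]_n) r `*`
   `[c ord0 (@lshift 1 n ord0) - r, c ord0 (@lshift 1 n ord0) + r]%classic); last first.
  apply/seteqP; split=> -[v x] /=; rewrite in_itv/=.
    move=> /(rV_norm_leP _ (ltW r0)) h; split.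
      apply/rV_norm_leP => [|j]; first exact: ltW.
      have := h (@rshift 1 n j).
      by rewrite subrvE /cons_rV (@row_mxEr _ 1 1 n) subrvE mxE.
    have := h (@lshift 1 n ord0).
    by rewrite subrvE /cons_rV (@row_mxEl _ 1 1 n) mxE ler_distl.
  move=> [/(rV_norm_leP _ (ltW r0)) hv hx]; apply/rV_norm_leP => [|j]; first exact: ltW.
  rewrite subrvE /cons_rV.
  case: (@split_ordP 1 n j) => a ->.
    by rewrite (@row_mxEl _ 1 1 n) !mxE (ord1 a) ler_distl.
  by have := hv a; rewrite subrvE (@row_mxEr _ 1 1 n) mxE.
rewrite product_measure1E; [|exact: measurable_cube|exact: measurable_itv].
rewrite IHn exprSr EFinM; congr (_ * _)%E.
apply: (eq_trans (lebesgue_measure_itv _)); rewrite /= lte_fin ltrD2l gt0_cp// -EFinB; congr (_%:E).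
by rewrite mulr2n; lra.
Qed.

End borel.

(** * Tonelli's theorem for measures that are sigma-finite by hypothesis *)

Section sigma_finite_copy.
Context d (T : measurableType d) (R : realType).
Variable mu : {measure set T -> \bar R}.
(** An alias that carries the proof of sigma-finiteness, so that the structure expected by Fubini
    and Tonelli can be attached to a measure for which sigma-finiteness is only a hypothesis. *)
Definition sigma_finite_copy (smu : sigma_finite setT mu) : set T -> \bar R := mu.
Variable smu : sigma_finite setT mu.
HB.instance Definition _ := Measure.copy (sigma_finite_copy smu) mu.
HB.instance Definition _ :=
  Measure_isSigmaFinite.Build _ _ _ (sigma_finite_copy smu) smu.
End sigma_finite_copy.

Section tonelli.
Context d1 d2 (T1 : measurableType d1) (T2 : measurableType d2) (R : realType).
Variables (mu : {measure set T1 -> \bar R}) (nu : {measure set T2 -> \bar R}).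
Hypotheses (smu : sigma_finite setT mu) (snu : sigma_finite setT nu).
Local Open Scope ereal_scope.

Let mu' : {sigma_finite_measure set T1 -> \bar R} := sigma_finite_copy smu.
Let nu' : {sigma_finite_measure set T2 -> \bar R} := sigma_finite_copy snu.

Lemma measurable_integral2 (f : T1 * T2 -> \bar R) :
  measurable_fun setT f -> (forall z, 0 <= f z) ->
  measurable_fun setT (fun x => \int[nu]_y f (x, y)).
Proof. by move=> mf f0; exact: (@measurable_fun_fubini_tonelli_F _ _ _ _ _ nu'). Qed.

Lemma tonelli (f : T1 * T2 -> \bar R) :
  measurable_fun setT f -> (forall z, 0 <= f z) ->
  \int[mu]_x \int[nu]_y f (x, y) = \int[nu]_y \int[mu]_x f (x, y).
Proof. by move=> mf f0; exact: (@fubini_tonelli _ _ _ _ _ mu' nu'). Qed.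

Lemma measurable_measure_xsection (A : set (T1 * T2)) : measurable A ->
  measurable_fun setT (fun x => nu (xsection A x)).
Proof. by move=> mA; exact: (@measurable_fun_xsection _ _ _ _ _ nu'). Qed.

End tonelli.

(** * Translation invariance of Lebesgue measure on R^n *)

Section borel2.
Context {R : realType}.

Lemma addrvE n (u v : 'rV[R]_n) i : (u + v) ord0 i = u ord0 i + v ord0 i.
Proof. by rewrite mxE. Qed.

Lemma cube_bigcup n : \bigcup_k cube (0 : 'rV[R]_n) k%:R = setT.
Proof.
apply/seteqP; split=> // x _; exists (Num.bound `|x|) => //.
by rewrite /cube/= subr0 ltW// archi_boundP.
Qed.

Lemma sigma_finite_cube n (mu : {measure set (borelRn R n) -> \bar R}) :
  (forall k, (mu (cube (0 : 'rV[R]_n) k%:R) < +oo)%E) -> sigma_finite setT mu.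
Proof.
move=> h; exists (fun k => cube (0 : 'rV[R]_n) k%:R); first by rewrite cube_bigcup.
by move=> k; split; [exact: measurable_cube|exact: h].
Qed.

Lemma sigma_finite_lebesgueRn n : sigma_finite setT (@lebesgueRn R n).
Proof.
apply: sigma_finite_cube => k; apply: (@le_lt_trans _ _ (lebesgueRn n (ball (0 : 'rV[R]_n) k.+1%:R))).
  apply: le_measure; rewrite ?inE; [exact: measurable_cube| |].
    by apply: open_measurableRn; exact: ball_open.
  move=> x; rewrite /cube/= subr0 -ball_normE/= sub0r normrN => /le_lt_trans; apply.
  by rewrite ltr_nat.
by rewrite lebesgueRn_ball// ltry.
Qed.

Definition transl n (v x : 'rV[R]_n) : 'rV[R]_n := x + v.

Lemma continuous_transl n (v : 'rV[R]_n) : continuous (transl v).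
Proof.
move=> x; have := @continuousD _ _ _ (@idfun 'rV[R]_n) (cst v) x; apply.
  by move=> ?.
exact: cst_continuous.
Qed.

Lemma measurable_transl n (v : 'rV[R]_n) :
  measurable_fun [set: borelRn R n] (transl v : borelRn R n -> borelRn R n).
Proof.
refine (@measurability _ _ (borelRn R n) (borelRn R n) setT _ (@open 'rV[R]_n) erefl _) => _ [U oU <-].
rewrite setTI; apply: (@open_measurableRn R n).
by apply: open_comp oU => x _; exact: continuous_transl.
Qed.

Lemma lebesgue_measure_transl (a : R) (A : set R) : measurable A ->
  lebesgue_measure ((fun x => x + a) @^-1` A) = lebesgue_measure A.
Proof.
move=> mA.
have mf : measurable_fun [set: measurableTypeR R] ((fun x => x + a) : measurableTypeR R -> measurableTypeR R).
  by apply: measurable_funD => //.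
pose m := measure_function_pushforward__canonical__measure_function_Measure (@lebesgue_measure R) mf.
suff h B : measurable B -> lebesgue_measure B = m B by rewrite [RHS]h.
move: B; apply: lebesgue_measure_unique => _ [[x y]] _ <- /=.
rewrite /pushforward (_ : _ @^-1` _ = `]x - a, y - a]%classic); last first.
  by apply/seteqP; split=> z /=; rewrite !in_itv/= ltrBlDr lerBrDr.
rewrite !lebesgue_measure_itv/= !lte_fin ltrD2r; case: ifPn => // _.
by rewrite -!EFinB; congr (_%:E); lra.
Qed.

(** Through [cons_rV] a translation of R^(n+1) becomes the product [tau] of a translation of R^n and
    one of R. The image of the product measure under [tau] agrees with it on rectangles by
    induction, and uniqueness of product measures concludes. *)
Lemma lebesgueRn_transl n (v : 'rV[R]_n) (A : set (borelRn R n)) : measurable A ->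
  lebesgueRn n (transl v @^-1` A) = lebesgueRn n A.
Proof.
elim: n v A => [|n IHn] v A mA.
  by congr (lebesgueRn _ _); apply/seteqP; split=> x /=; rewrite (_ : transl v x = x)//; apply/rowP => -[].
rewrite /= /lebesgueRn_step /pushforward.
set v' : 'rV[R]_n := \row_j v ord0 (@rshift 1 n j).
pose tau (z : borelRn R n * measurableTypeR R) : borelRn R n * measurableTypeR R :=
  (transl v' z.1, z.2 + v ord0 (@lshift 1 n ord0)).
have mtau : measurable_fun setT tau.
  apply/measurable_fun_pairP; split.
    exact: measurableT_comp (measurable_transl v') measurable_fst.
  apply: measurable_funD => //; exact: measurable_snd.
have E z : transl v (cons_rV z) = cons_rV (tau z).
  case: z => z x; apply/rowP => j; rewrite /transl addrvE /cons_rV /=.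
  case: (@split_ordP 1 n j) => a ->.
    by rewrite !(@row_mxEl _ 1 1 n) !mxE (ord1 a).
  by rewrite !(@row_mxEr _ 1 1 n) !mxE.
have -> : @cons_rV R n @^-1` (transl v @^-1` A) = tau @^-1` (@cons_rV R n @^-1` A).
  by apply/funext => z; rewrite /preimage /mkset E.
have mB : measurable (@cons_rV R n @^-1` A).
  by rewrite -[X in measurable X]setTI; exact: measurable_cons_rV.
move: (_ @^-1` A) mB => B mB.
pose mu : {sigma_finite_measure set (borelRn R n) -> \bar R} :=
  sigma_finite_copy (@sigma_finite_lebesgueRn n).
pose m := measure_function_pushforward__canonical__measure_function_Measure
  (mu \x @lebesgue_measure R)%E mtau.
apply/esym; apply: (@product_measure_unique _ _ _ _ _ mu (@lebesgue_measure R) m) => // C D mC mD.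
rewrite /m /= /pushforward.
rewrite (_ : tau @^-1` _ = (transl v' @^-1` C) `*`
   ((fun x => x + v ord0 (@lshift 1 n ord0)) @^-1` D)); last by [].
rewrite product_measure1E//.
- by congr (_ * _)%E; [exact: IHn|exact: lebesgue_measure_transl].
- by rewrite -[X in measurable X]setTI; exact: measurable_transl.
- rewrite -[X in measurable X]setTI.
  have : measurable_fun [set: measurableTypeR R] (fun x : R => x + v ord0 (@lshift 1 n ord0)).
    exact: measurable_funD.
  exact.
Qed.

Lemma ge0_integral_transl n (v : 'rV[R]_n) (f : 'rV[R]_n -> \bar R) :
  measurable_fun [set: borelRn R n] (f : borelRn R n -> \bar R) ->
  (forall x, 0 <= f x)%E ->
  (\int[lebesgueRn n]_x f (transl v x) = \int[lebesgueRn n]_x f x)%E.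
Proof.
move=> mf f0.
have := @ge0_integral_pushforward _ _ (borelRn R n) (borelRn R n) R _ (measurable_transl v) (lebesgueRn n)
  setT f measurableT mf (fun x _ => f0 x).
rewrite preimage_setT /= => <-.
apply: (@eq_measure_integral _ _ _ _ (lebesgueRn n)); first exact: measurable_transl.
move=> mtv A mA _; exact: (lebesgueRn_transl v mA).
Qed.

Lemma integral_transl n (v : 'rV[R]_n) (f : 'rV[R]_n -> R) :
  measurable_fun [set: borelRn R n] (f : borelRn R n -> R) ->
  (\int[lebesgueRn n]_x (f (transl v x))%:E = \int[lebesgueRn n]_x (f x)%:E)%E.
Proof.
move=> /measurable_EFinP mf.
rewrite [LHS]integralE [RHS]integralE.
have e1 := @ge0_integral_transl n v _ (measurable_funepos mf) (fun x => funepos_ge0 _ x).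
have e2 := @ge0_integral_transl n v _ (measurable_funeneg mf) (fun x => funeneg_ge0 _ x).
congr (_ - _)%E.
  by rewrite -[RHS]e1; apply: eq_integral => x _; rewrite !funeposE.
by rewrite -[RHS]e2; apply: eq_integral => x _; rewrite !funenegE.
Qed.
End borel2.

(** * Continuity of pointwise operations *)

Section continuity_pointwise.
Context {R : realType} {T : topologicalType}.
Implicit Types f g : T -> R.

Lemma continuous_add f g : continuous f -> continuous g -> continuous (fun x => f x + g x).
Proof. by move=> cf cg x; exact: (@continuousD _ _ _ f g x (cf x) (cg x)). Qed.

Lemma continuous_sub f g : continuous f -> continuous g -> continuous (fun x => f x - g x).
Proof. by move=> cf cg x; exact: (@continuousB _ _ _ f g x (cf x) (cg x)). Qed.

Lemma continuous_mul f g : continuous f -> continuous g -> continuous (fun x => f x * g x).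
Proof. by move=> cf cg x; exact: (@continuousM _ _ f g x (cf x) (cg x)). Qed.

Lemma continuous_inv f : (forall x, f x != 0) -> continuous f -> continuous (fun x => (f x)^-1).
Proof. by move=> f0 cf x; exact: (@continuousV _ _ f x (f0 x) (cf x)). Qed.

Lemma continuous_compose {U : topologicalType} (g : U -> R) (h : T -> U) :
  continuous h -> continuous g -> continuous (fun x => g (h x)).
Proof. by move=> ch cg x; exact: (@continuous_comp _ _ _ h g x (ch x) (cg _)). Qed.

End continuity_pointwise.

(** * A smooth transition function on the line *)

Section one_variable.
Context {R : realType}.
Implicit Types t : R.

(** The functions t^-k exp(-1/t), extended by 0. The exponent k is carried along because the span of
    this family, unlike the single function exp(-1/t), is stable under differentiation. *)
Definition expfl (k : nat) t : R := if 0 < t then t^-1 ^+ k * expR (- t^-1) else 0.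

Lemma expfl_ge0 k t : 0 <= expfl k t.
Proof.
rewrite /expfl; case: ifPn => // t0.
by rewrite mulr_ge0 ?expR_ge0// exprn_ge0// invr_ge0 ltW.
Qed.

Lemma expfl_gt0 k t : 0 < t -> 0 < expfl k t.
Proof.
by move=> t0; rewrite /expfl t0 mulr_gt0 ?expR_gt0// exprn_gt0// invr_gt0.
Qed.

Lemma expfl_eq0 k t : t <= 0 -> expfl k t = 0.
Proof. by move=> t0; rewrite /expfl ltNge t0. Qed.

(** One term of the power series of exp(1/t) already gives quadratic decay at 0, which makes the
    derivative at 0 exist and vanish. *)
Lemma expfl_le k t : expfl k t <= (k.+2)`!%:R * t ^+ 2.
Proof.
have [t0|t0] := leP t 0; first by rewrite expfl_eq0// mulr_ge0// sqr_ge0.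
rewrite /expfl t0 expRN.
have h : 1 + t^-1 ^+ k.+2 / (k.+2)`!%:R <= expR (t^-1).
  by apply: expR_ge1Dxn; rewrite invr_ge0 ltW.
rewrite ler_pdivrMr ?expR_gt0//.
have {}h : t^-1 ^+ k.+2 / (k.+2)`!%:R <= expR t^-1 by rewrite (le_trans _ h)// lerDr.
have f0 : 0 < (k.+2)`!%:R :> R by rewrite ltr0n fact_gt0.
have := h; rewrite ler_pdivrMr// => {}h.
have -> : t^-1 ^+ k = t ^+ 2 * t^-1 ^+ k.+2.
  by rewrite -[k.+2]addn2 exprD mulrCA -exprMn divff ?gt_eqF// expr1n mulr1.
by rewrite [X in _ <= X * _]mulrC -[leRHS]mulrA ler_wpM2l ?sqr_ge0// mulrC.
Qed.

Global Instance is_derive_expfl k t :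
  is_derive t 1 (expfl k) (- k%:R * expfl k.+1 t + expfl k.+2 t).
Proof.
have [t0|t0|->] := ltgtP t 0.
- rewrite !expfl_eq0 ?(ltW t0)// mulr0 addr0.
  have h0 : \near t, cst 0 t = expfl k t.
    by near=> u; rewrite expfl_eq0// ltW//; near: u; exact: lt_nbhsl.
  exact: (near_eq_is_derive h0 (is_derive_cst _ _ _)).
- have h0 : \near t, t^-1 ^+ k * expR (- t^-1) = expfl k t.
    by near=> u; rewrite /expfl ifT//; near: u; exact: lt_nbhsr.
  apply: (near_eq_is_derive h0).
  have dV : is_derive t 1 (fun t : R => t^-1) (- t ^- 2 *: 1).
    by apply: is_deriveV; rewrite gt_eqF.
  have dE := is_derive1_comp (is_derive_expR _) (is_deriveN dV).
  rewrite /expfl t0.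
  case: k {h0} => [|k].
    have -> : (fun t => t^-1 ^+ 0 * expR (- t^-1)) = expR \o (- (fun t => t^-1)).
      by apply/funext => u; rewrite expr0 mul1r.
    apply: is_derive_eq; rewrite mulr0n oppr0 mul0r add0r.
    by rewrite /GRing.scale /= mulr1 opprK -exprVn mulrC.
  have := is_deriveM (is_deriveX k.+1 dV) dE.
  set g := (X in is_derive _ _ X _).
  have -> : g = (fun t => t^-1 ^+ k.+1 * expR (- t^-1)).
    by apply/funext => u; rewrite /g /= mulrfctE exprfctE.
  move=> ?; apply: is_derive_eq.
  rewrite exprfctE /GRing.scale /= -exprVn !mulr1 opprK !exprS expr0 mulr1 opprfctE.
  by rewrite -[k.+1]addn1 natrD; ring.
(* At 0 the quadratic bound makes the difference quotient at most a constant times the increment. *)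
- rewrite !expfl_eq0// mulr0 addr0.
  suff h : h^-1 *: ((expfl k \o shift 0) (h *: (1 : R)) - expfl k 0) @[h --> 0^'] --> (0 : R).
    by apply: DeriveDef; [apply/cvg_ex; exists 0|exact/cvg_lim].
  apply/cvgrPdist_le => e e0 /=.
  have C0 : 0 < (k.+2)`!%:R :> R by rewrite ltr0n fact_gt0.
  near=> h.
  have hn0 : h != 0 by near: h; exact: nbhs_dnbhs_neq.
  have hs : `|h| <= e / (k.+2)`!%:R.
    by near: h; apply: dnbhs0_le; exact: divr_gt0.
  rewrite addr0 [expfl k 0]expfl_eq0// subr0 sub0r normrN /GRing.scale /= mulr1 normrM normfV.
  rewrite ler_pdivrMl ?normr_gt0// (ger0_norm (expfl_ge0 _ _)).
  rewrite (le_trans (expfl_le _ _))// -real_normK ?num_real//.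
  by rewrite expr2 mulrCA ler_wpM2l// mulrC -ler_pdivlMr.
Unshelve. all: end_near. Qed.

Lemma continuous_expfl k : continuous (expfl k).
Proof.
move=> t; apply: differentiable_continuous; apply/derivable1_diffP.
by have [] := is_derive_expfl k t.
Qed.

Definition step t : R := expfl 0 t / (expfl 0 t + expfl 0 (1 - t)).

(** The derivative of [step] by the quotient rule, after cancellation; [expfl 2] is the derivative
    of [expfl 0]. In this form the sign and the vanishing outside the unit interval are visible. *)
Definition dstep t : R :=
  (expfl 2 t * expfl 0 (1 - t) + expfl 0 t * expfl 2 (1 - t)) /
  (expfl 0 t + expfl 0 (1 - t)) ^+ 2.

Lemma step_denom_gt0 t : 0 < expfl 0 t + expfl 0 (1 - t).
Proof.
have [t0|t0] := leP t 0.
  by rewrite ltr_wpDl ?expfl_ge0// expfl_gt0//; lra.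
by rewrite ltr_pwDl ?expfl_ge0// expfl_gt0.
Qed.

Lemma is_derive_step t : is_derive t 1 step (dstep t).
Proof.
have D0 := step_denom_gt0 t.
have d1 := is_derive_expfl 0 t.
have da : is_derive t 1 (fun t : R => 1 - t) (- 1).
  have := is_deriveD (is_derive_cst (1 : R) t 1) (is_deriveN (is_derive_id t 1)).
  by rewrite add0r.
have d2 := is_derive1_comp (f := expfl 0) (g := fun t : R => 1 - t) (is_derive_expfl 0 (1 - t)) da.
have d3 := is_deriveD d1 d2.
have Dn0 : (expfl 0 + (expfl 0 \o (fun t => 1 - t))) t != 0 by rewrite gt_eqF.
have d4 := is_deriveV Dn0 d3.
have d5 := is_deriveM d1 d4.
apply: (is_derive_eq d5); rewrite /dstep /GRing.scale /= addrfctE /=.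
rewrite /= in Dn0.
by field.
Qed.

Lemma step_ge0 t : 0 <= step t.
Proof. by rewrite divr_ge0 ?expfl_ge0// ltW// step_denom_gt0. Qed.

Lemma step_le1 t : step t <= 1.
Proof. by rewrite ler_pdivrMr ?step_denom_gt0// mul1r lerDl expfl_ge0. Qed.

Lemma step_eq0 t : t <= 0 -> step t = 0.
Proof. by move=> t0; rewrite /step expfl_eq0// mul0r. Qed.

Lemma step_eq1 t : 1 <= t -> step t = 1.
Proof.
move=> t1; rewrite /step (@expfl_eq0 _ (1 - t)) ?subr_le0// addr0 divff// gt_eqF//.
by apply: expfl_gt0; lra.
Qed.

Lemma dstep_ge0 t : 0 <= dstep t.
Proof. by rewrite divr_ge0 ?sqr_ge0// addr_ge0// mulr_ge0 ?expfl_ge0. Qed.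

Lemma dstep_eq0 t : t <= 0 \/ 1 <= t -> dstep t = 0.
Proof.
by rewrite /dstep => -[t0|t1]; [rewrite !(@expfl_eq0 _ t)//|rewrite !(@expfl_eq0 _ (1 - t)) ?subr_le0//];
  rewrite ?mul0r ?mulr0 addr0 mul0r.
Qed.

Lemma dstep_half_gt0 : 0 < dstep 2^-1.
Proof.
rewrite /dstep divr_gt0 ?exprn_gt0 ?step_denom_gt0//.
by rewrite addr_gt0// mulr_gt0 ?expfl_gt0//; lra.
Qed.

Lemma continuous_dstep : continuous dstep.
Proof.
have c1 k : continuous (fun t => expfl k (1 - t)).
  have c : continuous (fun t : R => 1 - t).
    by apply: continuous_sub; [exact: cst_continuous|move=> ?].
  exact: continuous_compose c (@continuous_expfl k).
have c0 := continuous_expfl.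
have cD : continuous (fun t => expfl 0 t + expfl 0 (1 - t)) by exact: continuous_add.
apply: continuous_mul; first by apply: continuous_add; exact: continuous_mul.
apply: continuous_inv => [t|]; first by rewrite expf_neq0// gt_eqF// step_denom_gt0.
exact: continuous_mul.
Qed.

Lemma dstep_bounded : exists M : R, 0 < M /\ forall t, dstep t <= M.
Proof.
have [c _ hc] := @EVT_max R dstep 0 1 ler01 (continuous_subspaceT continuous_dstep).
exists (dstep c + 1); split; first by rewrite ltr_wpDl// dstep_ge0.
move=> t; have [t0|t0] := ltP t 0.
  by rewrite dstep_eq0; [rewrite addr_ge0// dstep_ge0|left; exact: ltW].
have [t1|t1] := ltP 1 t.
  by rewrite dstep_eq0; [rewrite addr_ge0// dstep_ge0|right; exact: ltW].
by rewrite (le_trans (hc t _)) ?in_itv/= ?t0// lerDl.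
Qed.
End one_variable.

(** * Functions of class C^N and their calculus *)

Section smooth_functions.
Context {R : realType} {n : nat}.
Local Notation V := 'rV[R]_n.
Local Notation e_ i := (delta_mx ord0 i : V).
Implicit Types (u v : V -> R) (N : nat).

(** A recursive form of the class C^N, which makes closure under sums, products, inverses and affine
    substitutions an induction on N, whereas [smooth] quantifies over sequences of indices. *)
Fixpoint Ck N u : Prop := continuous u /\
  if N is N'.+1 then forall i, (forall x, derivable u x (e_ i)) /\ Ck N' (partial i u)
  else True.

Lemma Ck_continuous N u : Ck N u -> continuous u.
Proof. by case: N => [|N] []. Qed.

Lemma Ck_derivable N u i x : Ck N.+1 u -> derivable u x (e_ i).
Proof. by move=> [_ /(_ i)[]]. Qed.

Lemma Ck_partial N u i : Ck N.+1 u -> Ck N (partial i u).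
Proof. by move=> [_ /(_ i)[]]. Qed.

Lemma Ck_pred N u : Ck N.+1 u -> Ck N u.
Proof.
elim: N u => [|N IHN] u /= [cu hu]; split=> // i.
by have [du /IHN] := hu i.
Qed.

Lemma smoothP u : smooth u <-> forall N, Ck N u.
Proof.
split=> [su N|Cu s].
  elim: N u su => [|N IHN] u su; first by split=> //; have [] := su [::].
  split=> [|i]; first by have [] := su [::].
  split=> [x|]; first by have [_] := su [::]; exact.
  by apply: IHN => s; have := su (rcons s i); rewrite foldr_rcons.
(* The innermost derivative in [foldr partial u s] is taken along the last index of [s], hence the
   induction from the right end. *)
elim/last_ind: s u Cu => [|s i IHs] u Cu.
  by split=> [|i x]; [exact: Ck_continuous (Cu 0)|exact: Ck_derivable (Cu 1)].
by rewrite foldr_rcons; apply: IHs => N; exact: Ck_partial (Cu N.+1).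
Qed.

Lemma eq_Ck N u v : u =1 v -> Ck N u -> Ck N v.
Proof. by move=> /funext ->. Qed.

Lemma partial_cst i (c : R) : partial i (cst c : V -> R) = cst 0.
Proof. by apply/funext => x; rewrite /partial derive_cst. Qed.

Lemma Ck_cst N (c : R) : Ck N (cst c).
Proof.
elim: N c => [|N IHN] c; (split; first exact: cst_continuous) => // i.
by split=> [x|]; [exact: derivable_cst|rewrite partial_cst].
Qed.

Lemma partialD i u v x : derivable u x (e_ i) -> derivable v x (e_ i) ->
  partial i (fun y => u y + v y) x = partial i u x + partial i v x.
Proof. move=> du dv; exact (deriveD du dv). Qed.

Lemma CkD N u v : Ck N u -> Ck N v -> Ck N (fun x => u x + v x).
Proof.
elim: N u v => [|N IHN] u v Cu Cv;
  (split; first by apply: continuous_add; [exact: Ck_continuous Cu|exact: Ck_continuous Cv]) => // i; split=> [x|].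
  by apply: derivableD; [exact: Ck_derivable Cu|exact: Ck_derivable Cv].
apply: (@eq_Ck _ (fun x => partial i u x + partial i v x)).
  by move=> x; rewrite partialD//; [exact: Ck_derivable Cu|exact: Ck_derivable Cv].
by apply: IHN; exact: Ck_partial.
Qed.

Lemma partialM i u v x : derivable u x (e_ i) -> derivable v x (e_ i) ->
  partial i (fun y => u y * v y) x = u x * partial i v x + v x * partial i u x.
Proof. move=> du dv; exact (deriveM du dv). Qed.

Lemma CkM N u v : Ck N u -> Ck N v -> Ck N (fun x => u x * v x).
Proof.
elim: N u v => [|N IHN] u v Cu Cv;
  (split; first by apply: continuous_mul; [exact: Ck_continuous Cu|exact: Ck_continuous Cv]) => // i; split=> [x|].
  by apply: derivableM; [exact: Ck_derivable Cu|exact: Ck_derivable Cv].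
apply: (@eq_Ck _ (fun x => u x * partial i v x + v x * partial i u x)).
  by move=> x; rewrite partialM//; [exact: Ck_derivable Cu|exact: Ck_derivable Cv].
by apply: CkD; apply: IHN; do ?[exact: Ck_pred|exact: Ck_partial].
Qed.

Lemma CkZ N (c : R) u : Ck N u -> Ck N (fun x => c * u x).
Proof. by move=> Cu; apply: CkM => //; exact: Ck_cst. Qed.

Lemma partialZ i (c : R) u x : derivable u x (e_ i) ->
  partial i (fun y => c * u y) x = c * partial i u x.
Proof.
move=> du; have := partialM (derivable_cst c x (e_ i)) du.
by rewrite partial_cst mulr0 addr0.
Qed.

Lemma CkB N u v : Ck N u -> Ck N v -> Ck N (fun x => u x - v x).
Proof.
move=> Cu Cv; apply: CkD => //.
by apply: eq_Ck (CkZ (- 1) Cv) => x; rewrite mulN1r.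
Qed.

Lemma partialB i u v x : derivable u x (e_ i) -> derivable v x (e_ i) ->
  partial i (fun y => u y - v y) x = partial i u x - partial i v x.
Proof. move=> du dv; exact (deriveB du dv). Qed.

Lemma partialV i u x : u x != 0 -> derivable u x (e_ i) ->
  partial i (fun y => (u y)^-1) x = - (u x ^- 2 * partial i u x).
Proof. by move=> u0 du; rewrite /partial (deriveV u0 du) /GRing.scale /= mulNr. Qed.

Lemma CkV N u : (forall x, u x != 0) -> Ck N u -> Ck N (fun x => (u x)^-1).
Proof.
move=> u0; elim: N => [|N IHN] Cu;
  (split; first by apply: continuous_inv; [|exact: Ck_continuous Cu])
  => // i; split=> [x|].
  by apply: derivableV => //; exact: Ck_derivable Cu.
apply: (@eq_Ck _ (fun x => -1 * (((u x)^-1 * (u x)^-1) * partial i u x))).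
  by move=> x; rewrite partialV//; [rewrite mulN1r -invfM|exact: Ck_derivable Cu].
have Cu' := IHN (Ck_pred Cu).
apply: CkZ; apply: CkM; [exact: CkM|exact: Ck_partial].
Qed.

Lemma Ck_prod N (I : Type) (s : seq I) (P : pred I) (F : I -> V -> R) :
  (forall i, P i -> Ck N (F i)) -> Ck N (fun x => \prod_(i <- s | P i) F i x).
Proof.
move=> CF; elim: s => [|a s IHs].
  by apply: eq_Ck (Ck_cst N 1) => x; rewrite big_nil.
case: (boolP (P a)) => Pa.
  by apply: eq_Ck (CkM (CF _ Pa) IHs) => x; rewrite big_cons Pa.
by apply: eq_Ck IHs => x; rewrite big_cons (negbTE Pa).
Qed.

(* The directional derivative is the derivative of the slice at 0. *)
Lemma is_derive_slice i u x (d : R) :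
  is_derive x (e_ i) u d <-> is_derive (0 : R) (1 : R) (fun h : R => u (h *: e_ i + x)) d.
Proof.
have e : (fun h : R => h^-1 *: (((fun h : R => u (h *: e_ i + x)) \o shift 0) (h *: (1 : R)) - u (0 *: e_ i + x))) =
    (fun h : R => h^-1 *: ((u \o shift x) (h *: e_ i) - u x)).
  by apply/funext => h /=; rewrite addr0 scale0r add0r /GRing.scale /= mulr1.
have dE : derivable u x (e_ i) = derivable (fun h : R => u (h *: e_ i + x)) 0 1.
  by rewrite /derivable e.
have DE : 'D_(e_ i) u x = 'D_1 (fun h : R => u (h *: e_ i + x)) 0.
  by rewrite /derive e.
by split=> -[du <-]; [rewrite dE in du; rewrite DE|rewrite -dE in du; rewrite -DE]; exact: DeriveDef.
Qed.

Lemma is_derive_partial i u x : derivable u x (e_ i) -> is_derive x (e_ i) u (partial i u x).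
Proof. by move=> du; exact: DeriveDef. Qed.

Lemma is_derive_partialE i u x d : is_derive x (e_ i) u d -> derivable u x (e_ i) /\ partial i u x = d.
Proof. by case. Qed.

Lemma is_derive_affine i (c : R) (w : V) u x : derivable u (c *: x + w) (e_ i) ->
  is_derive x (e_ i) (fun y => u (c *: y + w)) (c * partial i u (c *: x + w)).
Proof.
move=> /is_derive_partial /is_derive_slice du; apply/is_derive_slice.
have dc : is_derive (0 : R) (1 : R) (fun h : R => c * h) c.
  have := is_deriveZ c (is_derive_id (0 : R) (1 : R)).
  by rewrite /GRing.scale /= mulr1.
have c0 : c * (0 : R) = 0 by rewrite mulr0.
have := is_derive1_comp (f := fun h : R => u (h *: e_ i + (c *: x + w))) (g := fun h : R => c * h)
  (x := 0).
rewrite c0 => /(_ _ _ du dc); rewrite mulrC.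
congr (is_derive _ _ _ _); apply/funext => h /=.
by rewrite scalerDr scalerA addrA.
Qed.

Lemma Ck_affine N (c : R) (w : V) u : Ck N u -> Ck N (fun y => u (c *: y + w)).
Proof.
have cl : continuous (fun y : V => c *: y + w).
  by move=> y; apply: continuousD; [exact: scaler_continuous|exact: cst_continuous].
elim: N u => [|N IHN] u Cu;
  (split; first exact: continuous_compose cl (Ck_continuous Cu)) => // i; split=> [x|].
  by have /is_derive_affine[] := Ck_derivable (i := i) (x := c *: x + w) Cu.
apply: (@eq_Ck _ (fun x => c * partial i u (c *: x + w))) => [x|].
  by have /is_derive_affine/is_derive_partialE[_ ->] := Ck_derivable (i := i) (x := c *: x + w) Cu.
by apply: CkZ; apply: IHN; exact: Ck_partial.
Qed.

Lemma is_derive_coord (i j : 'I_n) (f : R -> R) (a b d : R) (x : V) :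
  is_derive (a * x ord0 j + b) 1 f d ->
  is_derive x (e_ i) (fun y : V => f (a * y ord0 j + b)) ((i == j)%:R * a * d).
Proof.
move=> df; apply/is_derive_slice.
have e h : a * (h *: e_ i + x) ord0 j + b = (i == j)%:R * a * h + (a * x ord0 j + b).
  by rewrite !mxE /= eq_sym; case: (i == j); rewrite /= ?mulr1 ?mulr0; ring.
under eq_fun do rewrite e.
have dc : is_derive (0 : R) (1 : R) (fun h : R => (i == j)%:R * a * h + (a * x ord0 j + b)) ((i == j)%:R * a).
  have := is_deriveD (is_deriveZ ((i == j)%:R * a) (is_derive_id (0 : R) (1 : R)))
    (is_derive_cst (a * x ord0 j + b) (0 : R) (1 : R)).
  by rewrite /GRing.scale /= mulr1 addr0.
have := is_derive1_comp (f := f) (g := fun h : R => (i == j)%:R * a * h + (a * x ord0 j + b)) (x := 0).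
by rewrite mulr0 add0r => /(_ _ _ df dc); rewrite [d * _]mulrC; exact.
Qed.

Lemma Ck_expfl N k (a b : R) j : Ck N (fun y : V => expfl k (a * y ord0 j + b)).
Proof.
have ck k' : continuous (fun y : V => expfl k' (a * y ord0 j + b)).
  have c : continuous (fun y : V => a * y ord0 j + b).
    apply: continuous_add; last exact: cst_continuous.
    by apply: continuous_mul; [exact: cst_continuous|exact: continuous_coord].
  exact: continuous_compose c (@continuous_expfl R k').
elim: N k => [|N IHN] k; (split; first exact: ck) => // i.
have dk (x : V) := is_derive_coord i (is_derive_expfl k (a * x ord0 j + b)).
split=> [x|]; first by have [] := dk x.
apply: (@eq_Ck _ (fun y : V => ((i == j)%:R * a) *
  (- k%:R * expfl k.+1 (a * y ord0 j + b) + expfl k.+2 (a * y ord0 j + b)))).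
  by move=> x; have /is_derive_partialE[_ ->] := dk x.
by apply: CkZ; apply: CkD => //; exact: CkZ.
Qed.

Lemma Ck_step N (a b : R) j : Ck N (fun y : V => step (a * y ord0 j + b)).
Proof.
rewrite /step; apply: CkM; first exact: Ck_expfl.
apply: CkV => [x|]; first by rewrite gt_eqF// step_denom_gt0.
apply: CkD; first exact: Ck_expfl.
by apply: eq_Ck (Ck_expfl N 0 (- a) (1 - b) j) => x; congr (expfl 0 _); ring.
Qed.

Lemma partial_step (i : 'I_n) (a b : R) (j : 'I_n) (x : V) :
  partial i (fun y : V => step (a * y ord0 j + b)) x = (i == j)%:R * a * dstep (a * x ord0 j + b).
Proof.
by have /is_derive_partialE[] := is_derive_coord i (is_derive_step (a * x ord0 j + b)).
Qed.

Lemma near_eq_partial i u v x : (\near x, u x = v x) -> partial i u x = partial i v x.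
Proof. by move=> uv; exact: near_eq_derive. Qed.

Definition plateau (z : V) : R :=
  \prod_(j < n) (step (2 * z ord0 j + 2) * step ((- 2) * z ord0 j + 2)).

Lemma Ck_plateau N : Ck N plateau.
Proof. by apply: Ck_prod => j _; apply: CkM; exact: Ck_step. Qed.

Lemma plateau_ge0 z : 0 <= plateau z.
Proof. by apply: prodr_ge0 => j _; rewrite mulr_ge0// step_ge0. Qed.

Lemma plateau_le1 z : plateau z <= 1.
Proof.
suff /andP[] : 0 <= plateau z <= 1 by [].
apply: (big_ind (fun x : R => 0 <= x <= 1)) => [|x y /andP[x0 x1] /andP[y0 y1]|j _].
- by rewrite ler01 lexx.
- by rewrite mulr_ge0// mulr_ile1.
- by rewrite mulr_ge0 ?step_ge0//= mulr_ile1 ?step_ge0 ?step_le1.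
Qed.

Lemma plateau_eq1 z : `|z| <= 2^-1 -> plateau z = 1.
Proof.
move=> /rV_norm_leP h; rewrite /plateau big1// => j _.
have : `|z ord0 j| <= 2^-1 by apply: h.
by rewrite ler_norml => /andP[h1 h2]; rewrite !step_eq1 ?mulr1//; lra.
Qed.

Lemma plateau_eq0 z : 1 <= `|z| -> plateau z = 0.
Proof.
move=> z1; have [j zj] : exists j, 1 <= `|z ord0 j|.
  apply: contrapT => h; move: z1; rewrite leNgt => /negP; apply.
  apply/rV_norm_ltP => // j; rewrite ltNge; apply/negP => zj; apply: h; by exists j.
rewrite /plateau (bigD1 j)//=; move: zj; rewrite ler_normr => /orP[h|h].
  by rewrite (@step_eq0 _ ((- 2) * _ + 2)) ?mulr0 ?mul0r//; lra.
by rewrite (@step_eq0 _ (2 * _ + 2)) ?mul0r//; lra.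
Qed.

End smooth_functions.

(** * Convolution of a locally integrable density with a smooth kernel *)

Section convolution.
Context {R : realType} {n : nat}.
Local Notation V := 'rV[R]_n.
Local Notation X := (borelRn R n).
Local Notation e_ i := (delta_mx ord0 i : V).
Implicit Types (u zeta : V -> R) (rho : R).

Definition vanish_off rho u := forall z, rho < `|z| -> u z = 0.

Lemma near_gt_norm (z : V) rho : rho < `|z| -> \forall y \near z, rho < `|y|.
Proof.
move=> h; have : `|y| @[y --> z] --> `|z| by exact: norm_continuous.
by move=> /(_ [set t | rho < t]); apply; exact: lt_nbhsr.
Qed.

Lemma vanish_off_partial rho u i : vanish_off rho u -> vanish_off rho (partial i u).
Proof.
move=> h z zr; rewrite (@near_eq_partial _ _ i u (cst 0)) ?partial_cst//.
by near do rewrite h//; exact: near_gt_norm.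
Unshelve. all: end_near. Qed.

Lemma vanish_off_bounded rho u : continuous u -> vanish_off rho u ->
  exists M, 0 < M /\ forall z, `|u z| <= M.
Proof.
move=> cu hu.
have : compact (u @` cube (0 : V) rho).
  apply: continuous_compact; last exact: compact_cube.
  by apply: continuous_subspaceT.
move=> /compact_bounded [M [_ hM]]; exists (`|M| + 1); split; first by rewrite ltr_wpDl.
move=> z; have [zr|zr] := leP `|z| rho; last by rewrite hu// normr0 addr_ge0.
by apply: (hM (`|M| + 1)); [rewrite (le_lt_trans (ler_norm _))// ltrDl|exists z => //; rewrite /cube/= subr0].
Qed.

Lemma near_dist (z : V) (e : R) : 0 < e -> \forall y \near z, `|y - z| < e.
Proof.
move=> e0; have := nbhsx_ballx z e e0; apply: filterS => y.
by rewrite -ball_normE /= distrC.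
Qed.

(** Dominated convergence concerns sequences, so continuity of an integral in its parameter is
    reduced to them. The prescribed rate keeps the whole sequence within distance 1 of its limit,
    hence in one cube. *)
Lemma continuous_seqP (F : V -> R) (z : V) :
  (forall z_ : nat -> V, (forall k, `|z_ k - z| <= k.+1%:R^-1) -> F (z_ k) @[k --> \oo] --> F z) ->
  {for z, continuous F}.
Proof.
move=> h; apply: contrapT => nc.
have [e [e0 he]] : exists e : R, 0 < e /\ forall k : nat, exists y, `|y - z| <= k.+1%:R^-1 /\ e <= `|F z - F y|.
  apply: contrapT => ne; apply: nc; apply: (proj2 (@cvgrPdist_lt _ _ _ (nbhs z) (nbhs_filter z) F (F z))) => e e0.
  apply: contrapT => nn; apply: ne; exists e; split=> // k.
  apply: contrapT => nk; apply: nn; have k0 : 0 < k.+1%:R^-1 :> R by rewrite invr_gt0.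
  apply: filterS (near_dist z k0) => y yz.
  rewrite ltNge; apply/negP => hy; apply: nk; exists y; split=> //; exact: ltW.
have [z_ hz] := choice he.
have /cvgrPdist_lt/(_ _ e0)[N _ /(_ N (leqnn N))] := h z_ (fun k => (hz k).1).
by rewrite ltNge (hz N).2.
Qed.

Variables (mu : {measure set X -> \bar R}) (A : set X) (b : V -> R).
Hypothesis mA : measurable A.
Hypothesis ib : forall r : R, mu.-integrable (A `&` cube (0 : V) r) (EFin \o (b : X -> R)).

(** The kernel is evaluated at x - z, which explains the minus sign in [is_derive_conv]. Measure and
    density stay general: Lebesgue measure with density 1 yields the cutoffs, sigma with the
    boundary function yields the averages. *)
Definition conv zeta : V -> R := fun z => \int[mu]_(x in A) (b x * zeta (x - z : V)).

(** One fixed cube carries the integrals for all z near a given point, so a single integrable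
    function dominates all of them. *)
Lemma conv_cubeE rho zeta (z : V) K : vanish_off rho zeta -> rho + `|z| <= K ->
  conv zeta z = \int[mu]_(x in A `&` cube (0 : V) K) (b x * zeta (x - z : V)).
Proof.
move=> hz zK; rewrite /conv Rintegral_mkcond [RHS]Rintegral_mkcond; apply: eq_Rintegral => x _.
rewrite !patchE in_setI; case: (boolP (x \in A)) => //= xA.
case: ifPn => // /negP xK; rewrite hz ?mulr0//.
rewrite ltNge; apply/negP => h; apply: xK; apply/mem_set; rewrite /cube/= subr0.
rewrite (le_trans _ zK)// -[X in `|X| <= _](subrK (z : V)); apply: le_trans (ler_normD _ _) _.
by rewrite lerD2r.
Qed.

Lemma integrable_conv zeta (z : V) K : continuous zeta -> (exists M, forall z, `|zeta z| <= M) ->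
  mu.-integrable (A `&` cube (0 : V) K) (EFin \o (fun x : X => b x * zeta ((x : V) - z))).
Proof.
move=> cz [M hM].
have mz : measurable_fun (A `&` cube (0 : V) K) (fun x : X => zeta ((x : V) - z)).
  apply: measurable_funTS; apply: (@continuous_measurableRn R n (fun x => zeta (x - z))).
  apply: continuous_compose => // x; apply: (@continuousB _ _ _ (fun x : V => x) (cst z)).
    by move=> ?.
  exact: cst_continuous.
have := integrableMl (measurableI _ _ mA (measurable_cube (0 : V) K)) (ib K) mz.
apply; exists M; split; first exact: num_real.
by move=> x Mx y _; apply: le_trans (hM _) (ltW Mx).
Qed.

Lemma continuous_conv rho zeta : continuous zeta -> vanish_off rho zeta -> continuous (conv zeta).
Proof.
move=> cz hz; suff h (z : V) : {for z, continuous (conv zeta)} by exact: h.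
have [M [M0 hM]] := vanish_off_bounded cz hz.
apply: continuous_seqP => z_ zz_.
pose K := rho + `|z| + 1.
have zK k : rho + `|z_ k| <= K.
  have h1 := rV_norm_dist (z_ k) z.
  have h2 : k.+1%:R^-1 <= 1 :> R by rewrite invf_le1// ler1n.
  by have h3 := le_trans (zz_ k) h2; rewrite /K; lra.
have zK0 : rho + `|z| <= K by rewrite /K lerDl.
have mB := measurableI _ _ mA (measurable_cube (0 : V) K).
rewrite (conv_cubeE hz zK0); under eq_fun do rewrite (conv_cubeE hz (zK _)).
have iz y := integrable_conv y K cz (ex_intro _ M hM).
apply: fine_cvg; rewrite fineK; last by apply: integrable_fin_num => //; exact: iz.
apply: (@dominated_cvg _ _ _ mu _ mB (fun k x => (b x * zeta ((x : V) - z_ k))%:E) _ (fun x => (M * `|b x|)%:E)).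
- by move=> k; exact: measurable_int (iz _).
- move=> x _; apply: cvg_EFin; first exact: nearW.
  apply: cvgM; first exact: cvg_cst.
  apply: continuous_cvg; first exact: cz.
  apply: cvgB; first exact: cvg_cst.
  apply/cvgrPdist_le => e e0; near=> k; rewrite rV_distC (le_trans (zz_ k))//.
  by apply: ltW; near: k; exact: (near_infty_natSinv_lt (PosNum e0)).
- by move=> x _.
- by under eq_fun do rewrite EFinM; apply: integrableZl => //; exact: integrable_abse (ib K).
- by move=> k x _; rewrite lee_fin normrM mulrC ler_wpM2r.
Unshelve. all: end_near. Qed.

Lemma is_derive_shift i zeta (w : V) (h : R) : (forall x, derivable zeta x (e_ i)) ->
  is_derive h (1 : R) (fun s : R => zeta (w - s *: e_ i)) (- partial i zeta (w - h *: e_ i)).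
Proof.
move=> dz; have /is_derive_partial/is_derive_slice dF := dz (w - h *: e_ i).
have dc : is_derive h (1 : R) (fun s : R => h - s) (- 1).
  have := is_deriveD (is_derive_cst (h : R) h (1 : R)) (is_deriveN (is_derive_id h (1 : R))).
  by rewrite add0r.
have := is_derive1_comp (f := fun t : R => zeta (t *: e_ i + (w - h *: e_ i))) (g := fun s : R => h - s) (x := h).
rewrite subrr => /(_ _ _ dF dc); rewrite mulrN1.
congr (is_derive _ _ _ _); apply/funext => s /=; congr zeta.
by rewrite scalerBl [LHS]addrC addrA subrK.
Qed.

Lemma is_derive_conv (i : 'I_n) rho zeta (z : V) : Ck 1 zeta -> vanish_off rho zeta ->
  is_derive z (e_ i) (conv zeta) (- conv (partial i zeta) z).
Proof.
move=> Cz hz; have [M [M0 hM]] := vanish_off_bounded (Ck_continuous Cz) hz.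
have hz' := vanish_off_partial i hz.
have cz' := Ck_continuous (Ck_partial i Cz).
have [M' [M'0 hM']] := vanish_off_bounded cz' hz'.
apply/is_derive_slice.
(* The extra 1 covers the translates of z by [h *: e_ i] with h in ]-1, 1[, the interval on which
   differentiation under the integral sign is applied. *)
pose K := rho + `|z| + 1.
have mB := measurableI _ _ mA (measurable_cube (0 : V) K).
have zK (h : R) : h \in `]-1, 1[ -> rho + `|h *: e_ i + z| <= K.
  rewrite in_itv/= => /andP[h1 h2]; have h3 := rV_normD (h *: e_ i) z; rewrite /K.
  suff : `|h *: e_ i| <= 1 by lra.
  rewrite rV_normZ; have : `|h| <= 1 by rewrite ler_norml !ltW.
  have : `|e_ i| <= 1.
    by apply/rV_norm_leP => // j; rewrite mxE /=; case: (j == i); rewrite ?normr1 ?normr0.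
  by move=> a1 a2; rewrite mulr_ile1.
pose f (h : R) (x : X) := b x * zeta ((x : V) - (h *: e_ i + z)).
have iz y := integrable_conv y K (Ck_continuous Cz) (ex_intro _ M hM).
have I0 : (`]-1, 1[%classic : set R) 0 by rewrite /= in_itv/=; apply/andP; split; lra.
have df x (h : R) : is_derive h (1 : R) (f^~ x) (- (b x * partial i zeta ((x : V) - (h *: e_ i + z)))).
  have := is_deriveZ (b x) (is_derive_shift ((x : V) - z) h (fun x => Ck_derivable (i := i) (x := x) Cz)).
  rewrite /GRing.scale /= mulrN.
  have e s : (x : V) - z - s *: e_ i = (x : V) - (s *: e_ i + z) by rewrite opprD addrAC addrA.
  by rewrite e; congr (is_derive _ _ _ _); apply/funext => s; rewrite /f -e.
have ig : mu.-integrable (A `&` cube (0 : V) K) (EFin \o (fun x => M' * `|b x|)).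
  by rewrite /comp; under eq_fun do rewrite EFinM; apply: integrableZl => //; exact: integrable_abse (ib K).
have g0 x : 0 <= M' * `|b x| by rewrite mulr_ge0// ltW.
have d1E h x : partial1of2 f h x = - (b x * partial i zeta ((x : V) - (h *: e_ i + z))).
  by rewrite partial1of2E; have [_ ->] := df x h.
have gub (h : R) (x : X) : (`]-1, 1[%classic : set R) h -> (A `&` cube (0 : V) K) x -> `|partial1of2 f h x| <= M' * `|b x|.
  by move=> _ _; rewrite d1E normrN normrM mulrC ler_wpM2r.
have dfd (h : R) (x : X) : (`]-1, 1[%classic : set R) h -> (A `&` cube (0 : V) K) x -> derivable (f^~ x) h 1.
  by move=> _ _; have [] := df x h.
have := @derivable_under_integral R _ X mu f _ mB 0 (-1) 1 I0 (fun h _ => iz _) dfd _ g0 ig gub.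
have := @differentiation_under_integral R _ X mu f _ mB 0 (-1) 1 I0 (fun h _ => iz _) dfd _ g0 ig gub.
rewrite derive1E => DE dE.
apply: is_derive_eq; first apply: near_eq_is_derive (DeriveDef dE DE).
  near=> h; rewrite /f -(conv_cubeE hz)//; apply: zK; rewrite in_itv/=.
  by apply/andP; split; near: h; [apply: lt_nbhsr|apply: lt_nbhsl]; lra.
rewrite (conv_cubeE (z := z) (K := K) hz'); last by rewrite /K lerDl.
rewrite -[RHS]mulN1r -RintegralZl//.
  by apply: eq_Rintegral => x _; rewrite d1E scale0r add0r mulN1r.
exact: integrable_conv cz' (ex_intro _ M' hM').
Unshelve. all: end_near. Qed.

Lemma Ck_conv N rho zeta : Ck N zeta -> vanish_off rho zeta -> Ck N (conv zeta).
Proof.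
elim: N zeta => [|N IHN] zeta Cz hz;
  (split; first exact: continuous_conv (Ck_continuous Cz) hz) => // i.
have C1 : Ck 1 zeta.
  by split=> [|j]; [exact: Ck_continuous Cz|split=> [x|];
    [exact: Ck_derivable Cz|split=> //; exact: Ck_continuous (Ck_partial j Cz)]].
split=> [x|]; first by have [] := is_derive_conv i x C1 hz.
apply: (@eq_Ck _ _ _ (fun x => - 1 * conv (partial i zeta) x)) => [x|].
  by have /is_derive_partialE[_ ->] := is_derive_conv i x C1 hz; rewrite mulN1r.
by apply: CkZ; apply: IHN; [exact: Ck_partial|exact: vanish_off_partial].
Qed.

End convolution.

(** * Integration by parts for smooth functions *)

Section integration_by_parts.
Context {R : realType} {n : nat}.
Local Notation V := 'rV[R]_n.
Local Notation X := (borelRn R n).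
Local Notation L := (@lebesgueRn R n).
Local Notation e_ i := (delta_mx ord0 i : V).

Lemma lebesgueRn_cube_lty (c : V) r : (L (cube c r) < +oo)%E.
Proof.
apply: (@le_lt_trans _ _ (L (cube c (`|r| + 1)))).
  apply: le_measure; rewrite ?inE; [exact: measurable_cube|exact: measurable_cube|].
  move=> x; rewrite /cube/= => /le_trans; apply.
  by rewrite (le_trans (ler_norm _))// lerDl.
by rewrite lebesgueRn_cube ?ltry// ltr_wpDl.
Qed.

Lemma integrable_vanish_off (mu : {measure set X -> \bar R}) rho (h : V -> R) :
  (forall r : R, (mu (cube (0 : V) r) < +oo)%E) ->
  continuous h -> vanish_off rho h -> mu.-integrable [set: X] (EFin \o (h : X -> R)).
Proof.
move=> mufin ch hh; have [M [M0 hM]] := vanish_off_bounded ch hh.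
have -> : EFin \o (h : X -> R) = (EFin \o (h : X -> R)) \_ (cube (0 : V) rho).
  apply/funext => x; rewrite patchE; case: ifPn => // /negP xK /=.
  rewrite hh// ltNge; apply/negP => xr; apply: xK; apply/mem_set.
  by rewrite /cube/= subr0.
apply/(integrable_mkcond _ (measurable_cube _ _)).
apply: measurable_bounded_integrable; [exact: measurable_cube|exact: mufin| |].
  by apply: measurable_funTS; exact: continuous_measurableRn.
by exists M; split; [exact: num_real|move=> y My z _; apply: le_trans (hM z) (ltW My)].
Qed.

(** By translation invariance the convolution of the constant 1 with h is constant in z; its
    derivative, which is 0, is also minus the integral of [partial i h]. *)
Lemma Rintegral_partial (i : 'I_n) rho (h : V -> R) :
  Ck 1 h -> vanish_off rho h -> \int[L]_x partial i h x = 0.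
Proof.
move=> Ch hh.
have i1 r : L.-integrable ([set: X] `&` cube (0 : V) r) (EFin \o ((cst 1 : V -> R) : X -> R)).
  rewrite setTI; apply: measurable_bounded_integrable; [exact: measurable_cube|exact: lebesgueRn_cube_lty| |].
    by apply: measurable_funTS; exact: measurable_cst.
  by exists 1; split; [exact: num_real|move=> y My z _ /=; rewrite normr1 ltW].
have := is_derive_conv measurableT i1 i (0 : V) Ch hh.
have -> : conv L [set: X] (cst 1) h = cst (\int[L]_x h x).
  apply/funext => z; rewrite /conv /=; under eq_Rintegral do rewrite mul1r.
  have mh : measurable_fun [set: X] (h : X -> R).
    by apply: continuous_measurableRn; exact: Ck_continuous Ch.
  by rewrite /Rintegral -(integral_transl (- z) mh).
move=> [_]; rewrite derive_cst => /esym/eqP; rewrite oppr_eq0 => /eqP <-.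
by apply: eq_Rintegral => x _; rewrite mul1r subr0.
Qed.

Lemma test_function_vanish_off (Omega : set V) phi : test_function Omega phi ->
  exists2 rho, 0 < rho & vanish_off rho phi.
Proof.
move=> [_ /compact_bounded[M [_ hM]] _]; exists (`|M| + 1); first by rewrite ltr_wpDl.
move=> z zM; apply/eqP; apply: contraTT zM => pz; rewrite -leNgt; apply: hM.
  by rewrite (le_lt_trans (ler_norm _))// ltrDl.
exact: subset_closure.
Qed.

Lemma vanish_offM rho (u v : V -> R) : vanish_off rho v -> vanish_off rho (fun x => u x * v x).
Proof. by move=> hv z zr; rewrite hv// mulr0. Qed.

Lemma integral_by_parts (i : 'I_n) rho (u phi : V -> R) :
  Ck 1 u -> Ck 1 phi -> vanish_off rho phi ->
  (\int[L]_x (u x * partial i phi x)%:E = - \int[L]_x (partial i u x * phi x)%:E)%E.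
Proof.
move=> Cu Cp hp; have hp' := vanish_off_partial i hp.
have [cu cu'] := (Ck_continuous Cu, Ck_continuous (Ck_partial i Cu)).
have [cp cp'] := (Ck_continuous Cp, Ck_continuous (Ck_partial i Cp)).
have i1 := integrable_vanish_off (lebesgueRn_cube_lty 0) (continuous_mul cu cp') (vanish_offM u hp').
have i2 := integrable_vanish_off (lebesgueRn_cube_lty 0) (continuous_mul cu' cp) (vanish_offM (partial i u) hp).
have := Rintegral_partial i (CkM Cu Cp) (vanish_offM u hp).
have pE x : partial i (fun y => u y * phi y) x = u x * partial i phi x + partial i u x * phi x.
  by rewrite (partialM (Ck_derivable Cu) (Ck_derivable Cp)) [X in _ + X]mulrC.
under eq_Rintegral => x _ do rewrite pE.
rewrite RintegralD// /Rintegral => h.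
have f1 := integrable_fin_num measurableT i1.
have f2 := integrable_fin_num measurableT i2.
rewrite -(fineK f1) -(fineK f2) -EFinN; congr (_%:E).
by apply/eqP; rewrite -addr_eq0; apply/eqP.
Qed.

End integration_by_parts.

(** * Product bumps and the fluxes between them *)

Section box_bumps.
Context {R : realType} {n : nat}.
Local Notation V := 'rV[R]_n.
Local Notation X := (borelRn R n).
Local Notation L := (@lebesgueRn R n).
Local Notation e_ i := (delta_mx ord0 i : V).
Implicit Types (a b c z : V) (r s t rho : R).

(** It rises from 0 to 1 while the j-th coordinate runs from [a ord0 j - r] to [a ord0 j + r]. The
    argument is kept in affine form to match [Ck_step] and [partial_step]; [box_coord] gives the
    readable one. *)
Definition box_step a r (j : 'I_n) z : R :=
  step ((2 * r)^-1 * z ord0 j + (2^-1 - (2 * r)^-1 * a ord0 j)).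

Definition box_factor a r (j : 'I_n) z : R :=
  (2 * r)^-1 * dstep ((2 * r)^-1 * z ord0 j + (2^-1 - (2 * r)^-1 * a ord0 j)).

Definition box_bump a r z : R := \prod_(j < n) box_factor a r j z.

Lemma Ck_box_step N a r j : Ck N (box_step a r j).
Proof. exact: Ck_step. Qed.

Lemma partial_box_step i a r j z : partial i (box_step a r j) z = (i == j)%:R * box_factor a r j z.
Proof. by rewrite partial_step -mulrA. Qed.

Lemma Ck_box_factor N a r j : Ck N (box_factor a r j).
Proof.
apply: eq_Ck (Ck_partial j (Ck_box_step N.+1 a r j)) => z.
by rewrite partial_box_step eqxx mul1r.
Qed.

Lemma partial_box_factor i a r j z : i != j -> partial i (box_factor a r j) z = 0.
Proof.
move=> ij; have dc := is_derive_slice i (box_factor a r j) z 0.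
suff /dc/is_derive_partialE[] : is_derive (0 : R) (1 : R) (fun h : R => box_factor a r j (h *: e_ i + z)) 0 by [].
have -> : (fun h : R => box_factor a r j (h *: e_ i + z)) = cst (box_factor a r j z).
  apply/funext => h; by rewrite /box_factor !mxE /= eq_sym (negbTE ij) mulr0 add0r.
exact: is_derive_cst.
Qed.

Lemma box_coord a r z (j : 'I_n) : 0 < r ->
  (2 * r)^-1 * z ord0 j + (2^-1 - (2 * r)^-1 * a ord0 j) = (z ord0 j - a ord0 j + r) / (2 * r).
Proof. by move=> r0; field; rewrite gt_eqF. Qed.

Lemma box_factor_ge0 a r j z : 0 < r -> 0 <= box_factor a r j z.
Proof. by move=> r0; rewrite mulr_ge0 ?dstep_ge0// invr_ge0; lra. Qed.

Lemma box_bump_ge0 a r z : 0 < r -> 0 <= box_bump a r z.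
Proof. by move=> r0; apply: prodr_ge0 => j _; exact: box_factor_ge0. Qed.

Lemma box_factor_eq0 a r j z : 0 < r -> r <= `|z ord0 j - a ord0 j| -> box_factor a r j z = 0.
Proof.
move=> r0 h; rewrite /box_factor dstep_eq0 ?mulr0// box_coord//.
have r20 : 0 < 2 * r by lra.
rewrite ler_pdivrMr// mul0r ler_pdivlMr// mul1r.
by move: h; rewrite ler_normr => /orP[h|h]; [right|left]; lra.
Qed.

Lemma box_step_le a r j z : 0 < r -> z ord0 j - a ord0 j <= - r -> box_step a r j z = 0.
Proof.
move=> r0 h; rewrite /box_step step_eq0// box_coord//.
have r20 : 0 < 2 * r by lra.
by rewrite ler_pdivrMr// mul0r; lra.
Qed.

Lemma box_step_ge a r j z : 0 < r -> r <= z ord0 j - a ord0 j -> box_step a r j z = 1.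
Proof.
move=> r0 h; rewrite /box_step step_eq1// box_coord//.
have r20 : 0 < 2 * r by lra.
by rewrite ler_pdivlMr// mul1r; lra.
Qed.

Lemma box_bump_eq0 a r z : 0 < r -> r < `|z - a| -> box_bump a r z = 0.
Proof.
move=> r0 h; have [j hj] : exists j, r < `|z ord0 j - a ord0 j|.
  apply: contrapT => nh; move: h; rewrite ltNge => /negP; apply.
  apply/rV_norm_leP => [|j]; first exact: ltW.
  by rewrite subrvE leNgt; apply/negP => hj; apply: nh; exists j.
by rewrite /box_bump (bigD1 j)//= box_factor_eq0 ?mul0r// ltW.
Qed.

(* The hybrid product interpolating coordinate by coordinate between two box bumps. *)
Definition hybrid a r b s (k : nat) (j : 'I_n) : V -> R :=
  if (j < k)%N then box_factor b s j else box_factor a r j.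

(** A primitive, in the k-th coordinate, of the difference of the hybrid products k.+1 and k. Taking
    the difference of two steps gives compact support: both are 0 far to the left and 1 far to the
    right. *)
Definition hybrid_flux a r b s (k : 'I_n) z : R :=
  (box_step b s k z - box_step a r k z) * \prod_(j < n | j != k) hybrid a r b s k j z.

Lemma Ck_hybrid N a r b s k j : Ck N (hybrid a r b s k j).
Proof. by rewrite /hybrid; case: ifP => _; exact: Ck_box_factor. Qed.

Lemma Ck_hybrid_flux N a r b s k : Ck N (hybrid_flux a r b s k).
Proof.
apply: CkM; first by apply: CkB; exact: Ck_box_step.
by apply: Ck_prod => j _; exact: Ck_hybrid.
Qed.

Lemma partial_prod0 i (I : Type) (l : seq I) (P : pred I) (F : I -> V -> R) z :
  (forall j, P j -> Ck 1 (F j)) -> (forall j, P j -> partial i (F j) z = 0) ->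
  partial i (fun x => \prod_(j <- l | P j) F j x) z = 0.
Proof.
move=> CF F0; elim: l => [|x l IHl].
  rewrite (_ : (fun _ => _) = cst 1) ?partial_cst//.
  by apply/funext => y; rewrite big_nil.
have [Px|Px] := boolP (P x); last first.
  by rewrite (_ : (fun _ => _) = (fun y => \prod_(j <- l | P j) F j y))//;
    apply/funext => y; rewrite big_cons (negbTE Px).
rewrite (_ : (fun _ => _) = (fun y => F x y * \prod_(j <- l | P j) F j y)); last first.
  by apply/funext => y; rewrite big_cons Px.
rewrite (partialM (Ck_derivable (CF _ Px)) (Ck_derivable (Ck_prod l CF))).
by rewrite IHl F0// !mulr0 addr0.
Qed.

Lemma partial_hybrid_flux a r b s (k : 'I_n) z :
  partial k (hybrid_flux a r b s k) z =
  \prod_(j < n) hybrid a r b s k.+1 j z - \prod_(j < n) hybrid a r b s k j z.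
Proof.
have C1 := CkB (Ck_box_step 1 b s k) (Ck_box_step 1 a r k).
have C2 : Ck 1 (fun z => \prod_(j < n | j != k) hybrid a r b s k j z).
  by apply: Ck_prod => j _; exact: Ck_hybrid.
rewrite (partialM (Ck_derivable C1) (Ck_derivable C2)) partial_prod0; last 2 first.
- by move=> j _; exact: Ck_hybrid.
- move=> j jk; rewrite /hybrid; case: ifP => _; apply: partial_box_factor; by rewrite eq_sym.
rewrite (partialB (Ck_derivable (Ck_box_step 1 b s k)) (Ck_derivable (Ck_box_step 1 a r k))).
rewrite !partial_box_step eqxx !mul1r mulr0 add0r mulrC mulrBl.
have e m : \prod_(j < n) hybrid a r b s m j z =
    hybrid a r b s m k z * \prod_(j < n | j != k) hybrid a r b s m j z by rewrite (bigD1 k).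
rewrite !e /hybrid ltnSn ltnn; congr (_ * _ - _).
apply: eq_bigr => j jk; rewrite ltnS [(j <= k)%N]leq_eqVlt.
by rewrite (_ : (j == k :> nat) = false)//; apply/negbTE.
Qed.

Lemma hybrid0 a r b s z : \prod_(j < n) hybrid a r b s 0 j z = box_bump a r z.
Proof. by []. Qed.

Lemma hybridn a r b s z : \prod_(j < n) hybrid a r b s n j z = box_bump b s z.
Proof. by apply: eq_bigr => j _; rewrite /hybrid ltn_ord. Qed.

(** Each component of the field exchanges one factor, so the divergence telescopes from one bump to
    the other. *)
Lemma sum_partial_hybrid_flux a r b s z :
  \sum_(k < n) partial k (hybrid_flux a r b s k) z = box_bump b s z - box_bump a r z.
Proof.
under eq_bigr do rewrite partial_hybrid_flux.
rewrite -(big_mkord xpredT (fun k => \prod_(j < n) hybrid a r b s k.+1 j z - \prod_(j < n) hybrid a r b s k j z)).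
by rewrite telescope_sumr// hybridn hybrid0.
Qed.

Lemma hybrid_flux_eq0 a r b s c rho k z : 0 < r -> 0 < s ->
  `|a - c| + r <= rho -> `|b - c| + s <= rho -> rho < `|z - c| -> hybrid_flux a r b s k z = 0.
Proof.
move=> r0 s0 ha hb hz.
have rho0 : 0 <= rho by have := rV_norm_ge0 (a - c); lra.
have [j hj] : exists j, rho < `|z ord0 j - c ord0 j|.
  apply: contrapT => nh; move: hz; rewrite ltNge => /negP; apply.
  apply/rV_norm_leP => // j.
  by rewrite subrvE leNgt; apply/negP => hj; apply: nh; exists j.
have aj : `|a ord0 j - c ord0 j| <= `|a - c| by have := rV_coord_le (a - c) j; rewrite subrvE.
have bj : `|b ord0 j - c ord0 j| <= `|b - c| by have := rV_coord_le (b - c) j; rewrite subrvE.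
move: aj bj; rewrite !ler_norml => /andP[aj1 aj2] /andP[bj1 bj2].
have [jk|jk] := eqVneq j k.
  rewrite /hybrid_flux -jk; move: hj; rewrite ltr_normr => /orP[hj|hj].
    by rewrite !box_step_ge ?subrr ?mul0r//; lra.
  by rewrite !box_step_le ?subrr ?mul0r//; lra.
rewrite /hybrid_flux (bigD1 j)//= /hybrid.
suff h : box_factor b s j z = 0 /\ box_factor a r j z = 0.
  by case: ifP => _; rewrite ?h.1 ?h.2 mul0r mulr0.
split; apply: box_factor_eq0 => //; rewrite ler_normr; apply/orP;
  move: hj; rewrite ltr_normr => /orP[hj|hj]; [left|right|left|right]; lra.
Qed.

Lemma box_step01 a r j z : 0 <= box_step a r j z <= 1.
Proof. by rewrite /box_step step_ge0 step_le1. Qed.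

Section bounds.
Variables (M : R) (M0 : 0 < M) (hM : forall t : R, dstep t <= M).

Lemma box_factor_le a r t j z : 0 < t -> t <= r -> box_factor a r j z <= M / t.
Proof.
move=> t0 tr; rewrite /box_factor mulrC; apply: ler_pM; rewrite ?dstep_ge0//.
  by rewrite invr_ge0; lra.
by rewrite lef_pV2 ?posrE//; lra.
Qed.

(** Only n - 1 factors of size M / t remain, the k-th having been integrated into a difference of
    steps bounded by 1. This exponent, one below the dimension, is the source of the gain for p >
    n. *)
Lemma hybrid_flux_le a r b s t k z : 0 < t -> t <= r -> t <= s ->
  `|hybrid_flux a r b s k z| <= (M / t) ^+ n.-1.
Proof.
move=> t0 tr ts; rewrite /hybrid_flux normrM.
have h1 : `|box_step b s k z - box_step a r k z| <= 1.
  have /andP[h1 h2] := box_step01 a r k z; have /andP[h3 h4] := box_step01 b s k z.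
  by rewrite ler_norml; apply/andP; split; lra.
have Mt0 : 0 <= M / t by rewrite divr_ge0 ?ltW.
have -> : (M / t) ^+ n.-1 = \prod_(j < n | j != k) (M / t).
  by rewrite prodr_const cardC1 card_ord.
rewrite -[leRHS]mul1r; apply: ler_pM => //.
rewrite normr_prod; apply: ler_prod => j _; rewrite normr_ge0/= /hybrid.
by case: ifP => _; rewrite ger0_norm ?box_factor_le// box_factor_ge0//; lra.
Qed.

End bounds.
End box_bumps.

(** * Measurability of the norm of a vector field *)

Section measurable_norm.
Context {R : realType} {n : nat} d (T : measurableType d).

Lemma measurable_rV_norm (D : set T) (G : T -> 'rV[R]_n) :
  (forall i, measurable_fun D (fun x => G x ord0 i)) -> measurable_fun D (fun x => `|G x|).
Proof.
move=> mG.
have -> : (fun x => `|G x|) = (fun x => \big[Num.max/0]_(ij : 'I_1 * 'I_n) `|G x ij.1 ij.2|).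
  by apply/funext => x; rewrite [LHS]/Num.norm /= mx_normrE.
elim: (index_enum _) => [|[i j] l IHl].
  by under eq_fun do rewrite big_nil; exact: measurable_cst.
under eq_fun do rewrite big_cons /=.
apply: measurable_maxr IHl; rewrite (ord1 i).
exact: measurableT_comp (@normr_measurable R setT) (mG j).
Qed.

End measurable_norm.

(** * Bump-weighted means of a function with a weak gradient *)

Section box_means.
Context {R : realType} {n : nat}.
Local Notation V := 'rV[R]_n.
Local Notation X := (borelRn R n).
Local Notation L := (@lebesgueRn R n).
Implicit Types (a b c z : V) (r s t rho : R) (W : set V) (u : V -> R) (G : V -> V).

Lemma integrable_cubeM (mu : {measure set X -> \bar R}) c rho u (phi : V -> R) :
  mu.-integrable (cube c rho) (EFin \o (u : X -> R)) -> continuous phi ->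
  mu.-integrable (cube c rho) (EFin \o (fun x : X => u x * phi x)).
Proof.
move=> iu cp.
have : compact (phi @` cube c rho).
  by apply: continuous_compact; [exact: continuous_subspaceT|exact: compact_cube].
move=> /compact_bounded [M [Mr hM]].
have mp : measurable_fun (cube c rho : set X) (phi : X -> R).
  by apply: measurable_funTS; exact: continuous_measurableRn.
have := integrableMl (measurable_cube c rho) iu mp; apply.
by exists M; split=> // y My x Kx; apply: hM My _ _; exists x.
Qed.

Lemma locally_integrable_cube W u c rho : open W -> locally_integrableRn W u -> cube c rho `<=` W ->
  L.-integrable (cube c rho) (EFin \o (u : X -> R)).
Proof.
move=> oW [mu iu] KW; apply/integrableP; split.
  apply/measurable_EFinP; apply: measurable_funS mu => //.
  exact: open_measurableRn.
by have := iu _ (@compact_cube R n c rho) KW.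
Qed.

Lemma integral_eq_cube (mu : {measure set X -> \bar R}) W (h : V -> R) c rho :
  cube c rho `<=` W -> (forall z, rho < `|z - c| -> h z = 0) ->
  (\int[mu]_(x in W) (h x)%:E = \int[mu]_(x in cube c rho) (h x)%:E)%E.
Proof.
move=> KW h0; rewrite [LHS]integral_mkcond [RHS]integral_mkcond.
apply: eq_integral => x _; rewrite !patchE.
case: (boolP (x \in cube c rho)) => [/set_mem/KW/mem_set -> //|/negP xK].
case: ifP => // _; rewrite h0// ltNge; apply/negP => xr; apply: xK; exact/mem_set.
Qed.

Lemma near_gt_dist c z rho : rho < `|z - c| -> \forall y \near z, rho < `|y - c|.
Proof.
move=> h; have e0 : 0 < `|z - c| - rho by rewrite subr_gt0.
apply: filterS (near_dist z e0) => y yz.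
by have := rV_distD y z c; rewrite (rV_distC z y) => ?; lra.
Qed.

Lemma test_function_cube W (psi : V -> R) c rho : smooth psi -> cube c rho `<=` W ->
  (forall z, rho < `|z - c| -> psi z = 0) -> test_function W psi.
Proof.
move=> sp KW p0.
have cl : closure [set x | psi x != 0] `<=` cube c rho.
  rewrite (closure_id (cube c rho)).1; last exact: closed_cube.
  apply: closure_subset => x /= px; rewrite /cube/= leNgt; apply/negP => xr.
  by rewrite p0// eqxx in px.
split=> //; last exact: subset_trans cl KW.
apply: subclosed_compact cl; [exact: closed_closure|exact: compact_cube].
Qed.

Lemma weak_gradient_cube W u G (psi : V -> R) c rho i : open W -> weak_gradient W u G ->
  smooth psi -> cube c rho `<=` W -> (forall z, rho < `|z - c| -> psi z = 0) ->
  \int[L]_(x in cube c rho) (u x * partial i psi x) =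
  - \int[L]_(x in cube c rho) (G x ord0 i * psi x).
Proof.
move=> oW [lu wG] sp KW p0; have [_ /(_ psi (test_function_cube sp KW p0))] := wG i.
have h1 z : rho < `|z - c| -> u z * partial i psi z = 0.
  move=> hz; rewrite (@near_eq_partial _ _ i psi (cst 0)) ?partial_cst ?mulr0//.
  by apply: filterS (near_gt_dist hz) => y; exact: p0.
have h2 z : rho < `|z - c| -> G z ord0 i * psi z = 0 by move=> hz; rewrite p0// mulr0.
rewrite (integral_eq_cube L KW h1) (integral_eq_cube L KW h2).
by rewrite /Rintegral => ->; rewrite fineN.
Qed.

(** Not normalised: a constant function has the mean [box_mass] times the constant, for every centre
    and every positive radius. *)
Definition box_mean u a r : R := \int[L]_(x in cube a r) (u x * box_bump a r x).

Lemma box_mean_cubeE u a r c rho : 0 < r -> `|a - c| + r <= rho ->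
  box_mean u a r = \int[L]_(x in cube c rho) (u x * box_bump a r x).
Proof.
move=> r0 ar; rewrite /box_mean /Rintegral.
have KW : cube a r `<=` cube c rho.
  by move=> x; rewrite /cube/= => xa; have := rV_distD a x c => ?; lra.
have h0 z : r < `|z - a| -> u z * box_bump a r z = 0.
  by move=> hz; rewrite box_bump_eq0// mulr0.
by rewrite (integral_eq_cube L KW h0).
Qed.

Lemma Rintegral_sum (mu : {measure set X -> \bar R}) (D : set X) (I : Type) (l : seq I) (F : I -> X -> R) :
  measurable D -> (forall k, mu.-integrable D (EFin \o F k)) ->
  \int[mu]_(x in D) (\sum_(k <- l) F k x) = \sum_(k <- l) \int[mu]_(x in D) F k x.
Proof.
move=> mD iF; elim: l => [|k l IHl].
  by rewrite big_nil; under eq_Rintegral do rewrite big_nil; rewrite Rintegral_cst// mul0r.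
rewrite big_cons -IHl -RintegralD//; first by apply: eq_Rintegral => x _; rewrite big_cons.
have := integrable_sum mD l (P := xpredT) (fun k _ => iF k).
congr (_.-integrable _ _); apply/funext => x /=.
by rewrite sumEFin.
Qed.

(** The components of the flux between the two bumps are test functions supported in [cube c rho].
    Tested against them, the weak gradient turns the difference of the means into an integral of G
    times the flux, and [hybrid_flux_le] bounds the flux. *)
Lemma box_mean_dist M W u G a r b s t c rho : (0 < n)%N -> 0 < M -> (forall x : R, dstep x <= M) ->
  open W -> weak_gradient W u G -> cube c rho `<=` W ->
  `|a - c| + r <= rho -> `|b - c| + s <= rho -> 0 < t -> t <= r -> t <= s ->
  (`|box_mean u a r - box_mean u b s|%:E <=
    (n%:R * (M / t) ^+ n.-1)%:E * \int[L]_(x in cube c rho) `|G x|%:E)%E.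
Proof.
move=> n0 M0 hM oW wG KW ha hb t0 tr ts; have [lu wGi] := wG.
have [r0 s0] : 0 < r /\ 0 < s by split; lra.
have iu := locally_integrable_cube oW lu KW.
have iG i := locally_integrable_cube oW (wGi i).1 KW.
have mK := measurable_cube c rho.
have Cf k := Ck_hybrid_flux _ a r b s k.
rewrite distrC (box_mean_cubeE u r0 ha) (box_mean_cubeE u s0 hb) -RintegralB//; last 2 first.
- by apply: integrable_cubeM => //; apply: (Ck_continuous (N := 0)); apply: Ck_prod => j _; exact: Ck_box_factor.
- by apply: integrable_cubeM => //; apply: (Ck_continuous (N := 0)); apply: Ck_prod => j _; exact: Ck_box_factor.
have -> : \int[L]_(x in cube c rho) (u x * box_bump b s x - u x * box_bump a r x) =
    \sum_(k < n) - \int[L]_(x in cube c rho) (G x ord0 k * hybrid_flux a r b s k x).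
  transitivity (\int[L]_(x in cube c rho) (\sum_(k < n) (u x * partial k (hybrid_flux a r b s k) x))).
    by apply: eq_Rintegral => x _; rewrite -mulrBr -sum_partial_hybrid_flux mulr_sumr.
  rewrite Rintegral_sum// => [|k]; last first.
    by apply: integrable_cubeM => //; exact: Ck_continuous (Ck_partial k (Cf 1 k)).
  apply: eq_bigr => k _; 
  have sf : smooth (hybrid_flux a r b s k) by apply/smoothP => N; exact: Cf.
  have := weak_gradient_cube k oW wG sf KW; apply => z hz.
  by apply: hybrid_flux_eq0 hz.
set B := (M / t) ^+ n.-1.
have B0 : 0 <= B by rewrite exprn_ge0// divr_ge0// ltW.
have mG : measurable_fun (cube c rho : set X) (fun x : X => `|G x|).
  by apply: measurable_rV_norm => i; apply/measurable_EFinP; exact: measurable_int (iG i).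
have hk k : (`|\int[L]_(x in cube c rho) (G x ord0 k * hybrid_flux a r b s k x)|%:E <=
    B%:E * \int[L]_(x in cube c rho) `|G x|%:E)%E.
  rewrite -ge0_integralZl_EFin//; last exact/measurable_EFinP.
  have ik := integrable_cubeM (iG k) (Ck_continuous (Cf 0 k)).
  apply: le_trans (_ : (\int[L]_(x in cube c rho) `|G x ord0 k * hybrid_flux a r b s k x|%:E <= _)%E).
    rewrite EFin_normr_Rintegral//.
    by apply: (le_abse_integral L mK); exact: measurable_int ik.
  apply: le_ge0_integral => x _ //; rewrite lee_fin normrM mulrC; apply: ler_pM => //.
    exact: hybrid_flux_le.
  exact: rV_coord_le.
apply: (@le_trans _ _ (\sum_(k < n) `|\int[L]_(x in cube c rho) (G x ord0 k * hybrid_flux a r b s k x)|%:E)%E).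
  rewrite sumEFin lee_fin (le_trans (ler_norm_sum _ _ _))//.
  by apply: ler_sum => k _; rewrite normrN.
apply: (@le_trans _ _ (\sum_(k < n) (B%:E * \int[L]_(x in cube c rho) `|G x|%:E))%E).
  by apply: lee_sum => k _; exact: hk.
rewrite -ge0_sume_distrl => [|k _]; last by rewrite lee_fin.
by rewrite sumEFin sumr_const card_ord mulr_natl.
Qed.

(** The exact value is never computed; what enters is its positivity and, through
    [integral_box_bump], its independence of centre and radius. *)
Definition box_mass : R := \int[L]_x box_bump (0 : V) 1 x.

Lemma box_bump_vanish a r : 0 < r -> vanish_off (`|a| + r) (box_bump a r).
Proof.
move=> r0 z hz; apply: box_bump_eq0 => //.
by have := rV_norm_dist z a => ?; lra.
Qed.

Lemma continuous_box_bump a r : continuous (box_bump a r).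
Proof. by apply: (Ck_continuous (N := 0)); apply: Ck_prod => j _; exact: Ck_box_factor. Qed.

Lemma integrable_box_bump a r : 0 < r -> L.-integrable [set: X] (EFin \o (box_bump a r : X -> R)).
Proof.
by move=> r0; exact: integrable_vanish_off (lebesgueRn_cube_lty 0) (@continuous_box_bump a r) (box_bump_vanish r0).
Qed.

(** Two bumps differ by the divergence of a compactly supported smooth field, whose integral is
    0. *)
Lemma integral_box_bump a r : 0 < r -> \int[L]_x box_bump a r x = box_mass.
Proof.
move=> r0; apply/eqP; rewrite eq_sym -subr_eq0 /box_mass -RintegralB//; last 2 first.
- exact: integrable_box_bump.
- exact: integrable_box_bump.
have Cf N k := Ck_hybrid_flux N a r (0 : V) 1 k.
have hf k : vanish_off (`|a| + r + 1) (hybrid_flux a r (0 : V) 1 k).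
  move=> z hz; apply: (@hybrid_flux_eq0 _ _ _ _ _ _ (0 : V) (`|a| + r + 1)) => //.
  - by rewrite subr0; lra.
  - by rewrite subrr normr0; have := rV_norm_ge0 a => ?; lra.
  - by rewrite subr0.
have ip k : L.-integrable [set: X] (EFin \o (partial k (hybrid_flux a r (0 : V) 1 k) : X -> R)).
  apply: integrable_vanish_off (lebesgueRn_cube_lty 0) (Ck_continuous (Ck_partial k (Cf 1 k))) _.
  exact: vanish_off_partial (hf k).
under eq_Rintegral => x _ do rewrite -sum_partial_hybrid_flux.
rewrite Rintegral_sum// big1// => k _.
exact: Rintegral_partial (Cf 1 k) (hf k).
Qed.

Lemma box_mass_gt0 : 0 < box_mass.
Proof.
pose O : V := 0.
have h0 : 0 < box_bump O 1 O.
  apply: prodr_gt0 => j _; rewrite /box_factor /O !mxE !mulr0 subr0 add0r.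
  by rewrite mulr_gt0 ?dstep_half_gt0//; lra.
set m := box_bump O 1 O in h0.
have : \forall z \near O, m / 2 < box_bump O 1 z.
  have /(_ [set t | m / 2 < t]) := @continuous_box_bump O 1 O; apply.
  by apply: lt_nbhsr; rewrite -/m; lra.
move=> /nbhs_ballP[e /= e0 he].
have : (0 < \int[L]_x (box_bump O 1 x)%:E)%E.
  have mB : @measurable _ X (ball O e) by apply: open_measurableRn; exact: ball_open.
  suff h : ((m / 2)%:E * L (ball O e) <= \int[L]_x (box_bump O 1 x)%:E)%E.
    apply: lt_le_trans h.
    rewrite lebesgueRn_ball// -EFinM lte_fin mulr_gt0 ?exprn_gt0 ?mulrn_wgt0//; lra.
  rewrite -integral_cst//.
  apply: le_trans (_ : \int[L]_(x in (ball O e : set X)) (box_bump O 1 x)%:E <= _)%E.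
    apply: le_ge0_integral => x; rewrite lee_fin; first lra.
    by move=> /he /ltW.
  by apply: le_ge0_integral_subset => // x _; rewrite lee_fin box_bump_ge0.
have fi := integrable_fin_num measurableT (integrable_box_bump O (ltr01 : 0 < 1 :> R)).
by rewrite /box_mass /Rintegral => h; rewrite fine_gt0//= h/= ltey_eq fi.
Qed.

Lemma box_mean_near u a r y e : 0 < r ->
  L.-integrable (cube a r) (EFin \o (u : X -> R)) ->
  (forall z, cube a r z -> `|u z - y| <= e) -> `|box_mean u a r - box_mass * y| <= box_mass * e.
Proof.
move=> r0 iu hu.
have mK := measurable_cube a r.
have ib : L.-integrable (cube a r) (EFin \o (box_bump a r : X -> R)).
  exact: integrableS (integrable_box_bump a r0).
have mE : box_mass = \int[L]_(x in cube a r) box_bump a r x.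
  have h0 z : r < `|z - a| -> box_bump a r z = 0 by exact: box_bump_eq0.
  by rewrite -(integral_box_bump a r0) /Rintegral (integral_eq_cube L (@subsetT _ (cube a r)) h0).
have iub := integrable_cubeM iu (@continuous_box_bump a r).
have iyb := integrable_cubeM ib (@cst_continuous V R y).
have ieb := integrable_cubeM ib (@cst_continuous V R e).
rewrite mE -!RintegralZr// -RintegralB//.
have idf : L.-integrable (cube a r) (EFin \o (fun x : X => u x * box_bump a r x - box_bump a r x * y)).
  exact: (integrableB mK iub iyb).
apply: le_trans (le_normr_Rintegral mK idf) _.
apply: le_Rintegral => //; first exact: (integrable_norm idf).
move=> x Kx; rewrite mulrC -mulrBr normrM ger0_norm ?box_bump_ge0//.
by rewrite ler_wpM2l ?box_bump_ge0// hu.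
Qed.

End box_means.

(** * Identities for real powers *)

Section poweR_facts.
Context {R : realType}.

Lemma one_powR (x : R) : 1 `^ x = 1.
Proof. by rewrite powR1. Qed.

Lemma powR_exprn (x q : R) j : 0 <= q -> (q ^+ j) `^ x = (q `^ x) ^+ j.
Proof.
move=> q0; rewrite -(powR_mulrn j q0) -(powR_mulrn j (powR_ge0 q x)).
by rewrite powRAC.
Qed.

Lemma powRKV (p x : R) : 0 < p -> 0 <= x -> (x `^ p) `^ p^-1 = x.
Proof. by move=> p0 x0; rewrite -powRrM mulfV ?gt_eqF// powRr1. Qed.

Lemma powRVK (p x : R) : 0 < p -> 0 <= x -> (x `^ p^-1) `^ p = x.
Proof. by move=> p0 x0; rewrite -powRrM mulVf ?gt_eqF// powRr1. Qed.

Implicit Types (p : R) (x y : \bar R).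
Local Open Scope ereal_scope.

Lemma poweRVK p x : (0 < p)%R -> 0 <= x -> (x `^ p^-1) `^ p = x.
Proof. by move=> p0 x0; rewrite -poweRrM mulVf ?gt_eqF// poweRe1. Qed.

Lemma poweRKV p x : (0 < p)%R -> 0 <= x -> (x `^ p) `^ p^-1 = x.
Proof. by move=> p0 x0; rewrite -poweRrM mulfV ?gt_eqF// poweRe1. Qed.

Lemma le_poweR p x y : (0 < p)%R -> 0 <= x -> x <= y -> x `^ p <= y `^ p.
Proof.
move=> p0 x0 xy; apply: gt0_ler_poweR => //; first exact: ltW.
  by rewrite in_itv/= x0 leey.
by rewrite in_itv/= (le_trans x0 xy) leey.
Qed.

Lemma poweRV_leP p x y : (0 < p)%R -> 0 <= x -> 0 <= y -> (x `^ p^-1 <= y) = (x <= y `^ p).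
Proof.
move=> p0 x0 y0; apply/idP/idP => h.
  by rewrite -[x](poweRVK p0 x0) le_poweR// poweR_ge0.
by rewrite -[y](poweRKV p0 y0) le_poweR ?invr_gt0.
Qed.

End poweR_facts.

(** * Weighted Jensen inequality *)

Section weighted_jensen.
Context d (T : measurableType d) (R : realType).
Variable mu : {measure set T -> \bar R}.
Implicit Types (p : R).

Lemma measurable_fun_powR (D : set T) (f : T -> R) p : measurable_fun D f -> measurable_fun D (fun x => f x `^ p).
Proof. by move=> mf; exact: (measurableT_comp (measurable_powR p) mf). Qed.

Lemma le_powRD1 p (a : R) : 1 <= p -> 0 <= a -> a <= a `^ p + 1.
Proof.
move=> p1 a0; have [a1|a1] := leP a 1.
  by rewrite (le_trans a1)// lerDr powR_ge0.
rewrite (@le_trans _ _ (a `^ p))// ?lerDl//.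
by rewrite -[leLHS]powRr1// ler_powR// ltW.
Qed.

Lemma powR_1B p (t : R) : 0 < t -> t `^ (1 - p) = t / t `^ p.
Proof.
move=> t0; rewrite powRB ?powRr1 ?ltW//.
by apply/implyP => _; rewrite gt_eqF.
Qed.

Lemma powRVn p (t : R) : 0 < t -> t^-1 `^ p = (t `^ p)^-1.
Proof. by move=> t0; rewrite -[t^-1]powR_inv1 ?ltW// -powRrM mulN1r powRN. Qed.

(** The inequality a <= a^p + 1 at a = g / (t w), multiplied by t w. *)
Lemma le_weighted_young p (t g w : R) : 1 <= p -> 0 < t -> 0 <= g -> 0 < w ->
  g <= t `^ (1 - p) * (g `^ p * w `^ (1 - p)) + t * w.
Proof.
move=> p1 t0 g0 w0; have tw : 0 < t * w by rewrite mulr_gt0.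
have h := le_powRD1 p1 (divr_ge0 g0 (ltW tw)).
have -> : t `^ (1 - p) * (g `^ p * w `^ (1 - p)) = t * w * (g / (t * w)) `^ p.
  rewrite mulrCA -powRM ?(ltW t0) ?(ltW w0)// powR_1B// [(g / _) `^ p]powRM ?invr_ge0 ?(ltW tw)//.
  by rewrite (powRVn _ tw) mulrCA mulrA.
rewrite -[X in _ <= _ + X]mulr1 -mulrDr -ler_pdivrMl// mulrC.
exact: h.
Qed.

(** Integrating [le_weighted_young] and balancing its two terms through t takes the place of
    Hoelder's inequality, at the price of the factor 2^p. *)
Lemma weighted_jensen (D : set T) p (g w : T -> R) (j : R) : measurable D -> 1 < p ->
  measurable_fun D g -> measurable_fun D w ->
  (forall x, D x -> 0 <= g x) -> (forall x, D x -> 0 < w x) ->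
  0 < j -> (\int[mu]_(x in D) (w x)%:E <= j%:E)%E ->
  ((\int[mu]_(x in D) (g x)%:E) `^ p <=
    (2 `^ p * j `^ (p - 1))%:E * \int[mu]_(x in D) (g x `^ p * w x `^ (1 - p))%:E)%E.
Proof.
move=> mD p1 mg mw g0 w0 j0 wj.
have p0 : 0 < p by rewrite (lt_trans _ p1).
set I := (\int[mu]_(x in D) (g x `^ p * w x `^ (1 - p))%:E)%E.
have c0 : 0 < 2 `^ p * j `^ (p - 1) by rewrite mulr_gt0 ?powR_gt0.
have I0 : (0 <= I)%E by apply: integral_ge0 => x _; rewrite lee_fin mulr_ge0 ?powR_ge0.
have mI : measurable_fun D (fun x => g x `^ p * w x `^ (1 - p)).
  by apply: measurable_funM; apply: measurable_fun_powR.
(* A positive real bound [i] of I keeps t positive even if I is 0; I itself is reached by letting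
   [i] decrease to it. *)
have key (i : R) : 0 < i -> (I <= i%:E)%E ->
    ((\int[mu]_(x in D) (g x)%:E) `^ p <= (2 `^ p * j `^ (p - 1) * i)%:E)%E.
  (* Chosen so that the two terms of the integrated bound coincide: t^(1-p) i = t j. *)
  move=> i0 Ii; pose t := (i / j) `^ p^-1.
  have t0 : 0 < t by rewrite powR_gt0// divr_gt0.
  have tp : t `^ p = i / j by rewrite /t -powRrM mulVf ?gt_eqF// powRr1// divr_ge0// ltW.
  have h : (\int[mu]_(x in D) (g x)%:E <= (2 * t * j)%:E)%E.
    apply: (@le_trans _ _ (\int[mu]_(x in D) (t `^ (1 - p) * (g x `^ p * w x `^ (1 - p)) + t * w x)%:E)%E).
      apply: le_ge0_integral => x Dx; rewrite lee_fin; first exact: g0.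
      by apply: le_weighted_young (ltW p1) t0 (g0 _ Dx) (w0 _ Dx).
    under eq_integral do rewrite EFinD !EFinM.
    rewrite ge0_integralD//; last 4 first.
    - by move=> x Dx; rewrite -!EFinM lee_fin !mulr_ge0 ?powR_ge0.
    - apply/measurable_EFinP; apply: measurable_funM => //.
    - by move=> x Dx; rewrite -!EFinM lee_fin mulr_ge0 ?ltW// w0.
    - apply/measurable_EFinP; apply: measurable_funM => //.
    rewrite !ge0_integralZl_EFin ?powR_ge0 ?(ltW t0)//; last 4 first.
    - by move=> x Dx; rewrite lee_fin ltW// w0.
    - exact/measurable_EFinP.
    - by move=> x Dx; rewrite -EFinM lee_fin mulr_ge0 ?powR_ge0.
    - exact/measurable_EFinP.
    apply: (@le_trans _ _ ((t `^ (1 - p))%:E * i%:E + t%:E * j%:E)%E).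
      by apply: leeD; apply: lee_wpmul2l => //; rewrite lee_fin ?powR_ge0 ?ltW.
    rewrite -!EFinM -EFinD lee_fin.
    have -> : t `^ (1 - p) * i = t * j.
      rewrite powR_1B// tp; field; rewrite !gt_eqF//.
    by lra.
  apply: (@le_trans _ _ ((2 * t * j)%:E `^ p)%E).
    by apply: le_poweR => //; exact: integral_ge0.
  rewrite poweR_EFin lee_fin !powRM ?mulr_ge0 ?(ltW t0) ?(ltW j0)// tp.
  rewrite -(mulr_powRB1 (ltW j0) p0).
  rewrite le_eqVlt; apply/orP; left; apply/eqP; field.
  by rewrite gt_eqF.
have [->|Ioo] := eqVneq I +oo%E; first by rewrite gt0_muley ?leey// lte_fin.
have fI : I \is a fin_num by rewrite ge0_fin_numE// lt_neqAle Ioo leey.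
apply/lee_addgt0Pr => e e0.
have := key (fine I + e / (2 `^ p * j `^ (p - 1))).
have h1 : 0 < fine I + e / (2 `^ p * j `^ (p - 1)).
  by rewrite ltr_wpDl ?fine_ge0// divr_gt0.
rewrite EFinD fineK// => /(_ h1) /(_ _)/le_trans; apply.
  by rewrite leeDl// lee_fin divr_ge0 ?ltW.
rewrite -[in leRHS](fineK fI) -EFinM -EFinD lee_fin mulrDr.
by rewrite lerD2l mulrCA divff ?gt_eqF// mulr1.
Qed.

Lemma jensen_power (D : set T) p (g : T -> R) (j : R) : measurable D -> 1 < p ->
  measurable_fun D g -> (forall x, D x -> 0 <= g x) ->
  0 < j -> (mu D <= j%:E)%E ->
  ((\int[mu]_(x in D) (g x)%:E) `^ p <=
    (2 `^ p * j `^ (p - 1))%:E * \int[mu]_(x in D) (g x `^ p)%:E)%E.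
Proof.
move=> mD p1 mg g0 j0 Dj.
have := @weighted_jensen D p g (cst 1) j mD p1 mg (measurable_cst _) g0 (fun _ _ => ltr01) j0.
rewrite /= integral_cst// mul1e => /(_ Dj).
by move/le_trans; apply; rewrite le_eqVlt; apply/orP; left; apply/eqP; congr (_ * _)%E;
  apply: eq_integral => x _; by rewrite [1 `^ _]one_powR mulr1.
Qed.

End weighted_jensen.

(** * Telescoping chains with geometric weights *)

Section chains.
Context {R : realType}.

Lemma nneseries_term_le (u : nat -> \bar R) j : (forall k, 0 <= u k)%E ->
  (u j <= \sum_(0 <= k <oo) u k)%E.
Proof.
move=> u0; have h := @nneseries_lim_ge R u xpredT 0 j.+1 (fun k _ _ => u0 k).
by apply: le_trans h; rewrite big_nat_recr//= leeDr// sume_ge0.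
Qed.

Implicit Types (A : nat -> R) (p q : R).

Lemma geometric_chain A (l b q : R) : 0 <= b -> 0 < q < 1 ->
  (forall j, `|A j - A j.+1| <= b * q ^+ j) -> A k @[k --> \oo] --> l ->
  `|A 0%N - l| <= b / (1 - q).
Proof.
move=> b0 /andP[q0 q1] hA Al.
have hJ J : `|A 0%N - A J| <= b / (1 - q).
  apply: (@le_trans _ _ (b * (1 - q ^+ J) / (1 - q))); last first.
    rewrite ler_pM2r ?invr_gt0 ?subr_gt0//.
    by rewrite ler_piMr// lerBlDr lerDl exprn_ge0// ltW.
  elim: J => [|J IHJ]; first by rewrite subrr normr0 expr0 subrr mulr0 mul0r.
  have := ler_distD (A J) (A 0%N) (A J.+1) => /le_trans; apply.
  apply: le_trans (lerD IHJ (hA J)) _.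
  rewrite le_eqVlt; apply/orP; left; apply/eqP; rewrite exprS; field.
  by rewrite gt_eqF// subr_gt0.
have cv : `|A 0%N - A k| @[k --> \oo] --> `|A 0%N - l|.
  by apply: cvg_norm; apply: cvgB => //; exact: cvg_cst.
rewrite -(cvg_lim (@Rhausdorff R) cv); apply: limr_le; last by apply: nearW => k; exact: hJ.
by apply/cvg_ex; exists `|A 0%N - l|.
Qed.

(* The supremum of the weighted terms is bounded by their sum, so no Hoelder
   inequality for series is needed. *)
Lemma chain_power A (l p q : R) : 0 < p -> 0 < q < 1 -> A k @[k --> \oo] --> l ->
  ((`|A 0%N - l| `^ p)%:E <= (((1 - q `^ p^-1)^-1) `^ p)%:E *
     \sum_(0 <= j <oo) (q ^- j * `|A j - A j.+1| `^ p)%:E)%E.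
Proof.
move=> p0 /andP[q0 q1] Al.
set S := (\sum_(0 <= j <oo) _)%E.
have t0 j : (0 <= (q ^- j * `|A j - A j.+1| `^ p)%:E)%E.
  by rewrite lee_fin mulr_ge0 ?powR_ge0// invr_ge0 exprn_ge0// ltW.
have S0 : (0 <= S)%E by apply: nneseries_ge0 => j _ _; exact: t0.
(* Each single term of S bounds a difference by S^(1/p) r^j, so the differences are summed by a
   geometric series of ratio r. *)
pose r := q `^ p^-1.
have r0 : 0 < r by rewrite powR_gt0.
have rp : r `^ p = q by rewrite /r -powRrM mulVf ?gt_eqF// powRr1 ?ltW.
have r1 : r < 1.
  by rewrite -[ltRHS](one_powR p^-1); apply: gt0_ltr_powR; rewrite ?nnegrE ?invr_gt0 ?(ltW q0).
have c0 : 0 < (1 - r)^-1 `^ p by rewrite powR_gt0// invr_gt0 subr_gt0.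
have [->|Soo] := eqVneq S +oo%E; first by rewrite gt0_muley ?leey// lte_fin.
have fS : S \is a fin_num by rewrite ge0_fin_numE// lt_neqAle Soo leey.
have s0 : 0 <= fine S by rewrite fine_ge0.
have hj j : `|A j - A j.+1| <= fine S `^ p^-1 * r ^+ j.
  have : ((q ^- j * `|A j - A j.+1| `^ p)%:E <= S)%E.
    have := @nneseries_term_le (fun j => (q ^- j * `|A j - A j.+1| `^ p)%:E) j t0.
    exact.
  rewrite -[X in (_ <= X)%E](fineK fS) lee_fin mulrC ler_pdivrMr ?exprn_gt0// => h.
  rewrite -[leLHS](powRKV p0 (normr_ge0 _)) /=.
  have -> : fine S `^ p^-1 * r ^+ j = (fine S * q ^+ j) `^ p^-1.
    rewrite powRM ?exprn_ge0 ?(ltW q0)//; congr (_ * _).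
    by rewrite powR_exprn ?(ltW q0).
  by apply: ge0_ler_powR; rewrite ?nnegrE ?invr_ge0 ?(ltW p0) ?powR_ge0 ?mulr_ge0 ?exprn_ge0 ?(ltW q0).
have := geometric_chain (powR_ge0 _ _) _ hj Al; rewrite r0 r1 => /(_ isT) h.
rewrite -(fineK fS) -EFinM lee_fin.
apply: (@le_trans _ _ ((fine S `^ p^-1 / (1 - r)) `^ p)).
  by apply: ge0_ler_powR; rewrite ?nnegrE ?(ltW p0) ?mulr_ge0 ?powR_ge0 ?invr_ge0 ?subr_ge0 ?(ltW r1).
rewrite powRM ?powR_ge0 ?invr_ge0 ?subr_ge0 ?(ltW r1)// mulrC.
by rewrite -powRrM mulVf ?gt_eqF// powRr1.
Qed.

End chains.

(** * L_p norms as powers of integrals *)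

Section Lp_norms.
Context {R : realType} {n : nat}.
Local Notation V := 'rV[R]_n.
Local Notation X := (borelRn R n).
Implicit Types (mu : {measure set X -> \bar R}) (A : set V) (p : R) (u : V -> R).
Local Open Scope ereal_scope.

Lemma Lp_normE mu A p u : (0 < p)%R ->
  Lp_norm mu A p u = (\int[mu]_(x in A) (`|u x| `^ p)%:E) `^ p^-1.
Proof.
move=> p0; rewrite /Lp_norm unlock; congr (_ `^ _).
rewrite [RHS]integral_mkcond; apply: eq_integral => x _.
rewrite !patchE /= !patchE; case: ifP => _ //.
by rewrite normr0 powR0 ?gt_eqF.
Qed.

Lemma Lp_norm_ge0 mu A p u : 0 <= Lp_norm mu A p u.
Proof. exact: Lnorm_ge0. Qed.

Lemma Lp_norm_le mu A p u y : (0 < p)%R -> 0 <= y ->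
  (Lp_norm mu A p u <= y) = (\int[mu]_(x in A) (`|u x| `^ p)%:E <= y `^ p).
Proof.
move=> p0 y0; rewrite Lp_normE// poweRV_leP//.
by apply: integral_ge0 => x _; rewrite lee_fin powR_ge0.
Qed.

End Lp_norms.

Lemma measurable_inv_ge0 d (T : measurableType d) (R : realType) (D : set T) (f : T -> R) :
  (forall x, 0 <= f x) -> measurable_fun D f -> measurable_fun D (fun x => (f x)^-1).
Proof.
move=> f0 mf; have -> : (fun x => (f x)^-1) = (fun x => f x `^ (- 1)).
  by apply/funext => x; rewrite powR_inv1.
exact: measurable_fun_powR.
Qed.

(** * Finite covers and the subdivision of cubes *)

Section finite_cover.
Context d (T : measurableType d) (R : realType) (mu : {measure set T -> \bar R}).
Local Open Scope ereal_scope.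

Lemma le_integral_cover (I : finType) (D : set T) (F : I -> set T) (f : T -> \bar R) :
  measurable D -> (forall i, measurable (F i)) -> (forall x, D x -> exists i, F i x) ->
  measurable_fun D f -> (forall x, 0 <= f x) ->
  \int[mu]_(x in D) f x <= \sum_(i : I) \int[mu]_(x in D `&` F i) f x.
Proof.
move=> mD mF DF mf f0.
have mDF i := measurableI _ _ mD (mF i).
under eq_bigr do rewrite integral_mkcond.
rewrite integral_mkcond -ge0_integral_sum//; last 2 first.
- move=> i; apply/(measurable_restrictT _ (mDF i)).1.
  by apply: measurable_funS mf.
- by move=> i x _; apply: erestrict_ge0.
apply: le_ge0_integral => x _; first by apply: erestrict_ge0.
have S0 : 0 <= \sum_(i : I) (f \_ (D `&` F i)) x by apply: sume_ge0 => i _; apply: erestrict_ge0.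
rewrite [leLHS]patchE; case: ifPn => // /set_mem Dx.
have [i Fi] := DF x Dx.
rewrite (bigD1 i)//= [X in _ <= X + _]patchE mem_set//.
by rewrite leeDl// sume_ge0// => j _; apply: erestrict_ge0.
Qed.

Lemma le_measure_cover (I : finType) (D : set T) (F : I -> set T) :
  measurable D -> (forall i, measurable (F i)) -> (forall x, D x -> exists i, F i x) ->
  mu D <= \sum_(i : I) mu (D `&` F i).
Proof.
move=> mD mF DF.
have := @le_integral_cover I D F (cst 1) mD mF DF (measurable_cst _) (fun _ => lee01).
rewrite integral_cst// mul1e => /le_trans; apply; apply: lee_sum => i _.
by rewrite integral_cst ?mul1e//; exact: measurableI.
Qed.

End finite_cover.

Section subdivision.
Context {R : realType} {n : nat}.
Local Notation V := 'rV[R]_n.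
Local Notation X := (borelRn R n).
Local Notation L := (@lebesgueRn R n).
Implicit Types (c z x : V) (r : R) (m : nat).

Lemma interval_cell m (h y : R) : (0 < m)%N -> 0 <= y <= m%:R * h ->
  exists k : 'I_m, k%:R * h <= y <= k.+1%:R * h.
Proof.
elim: m => // -[|m] IHm _ /andP[y0 ym].
  by exists ord0; rewrite mul0r y0.
have [yh|yh] := leP y (m.+1%:R * h); last by exists ord_max; rewrite ltW.
have [|k hk] := IHm isT; first by rewrite y0.
by exists (widen_ord (leqnSn _) k).
Qed.

(** The centres of the m^n subcubes of radius r / m that tile [cube c r]. *)
Definition sub_center m c r (k : {ffun 'I_n -> 'I_m}) : V :=
  \row_j (c ord0 j - r + (k j)%:R * (2 * r / m%:R) + r / m%:R).

Lemma sub_center_cover m c r x : (0 < m)%N -> 0 < r -> cube c r x ->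
  exists k : {ffun 'I_n -> 'I_m}, cube (sub_center c r k) (r / m%:R) x.
Proof.
move=> m0 r0 xc.
have mr : 0 < m%:R :> R by rewrite ltr0n.
have /choice[k hk] : forall j, exists k : 'I_m,
    k%:R * (2 * r / m%:R) <= x ord0 j - c ord0 j + r <= k.+1%:R * (2 * r / m%:R).
  move=> j; apply: interval_cell => //.
  have : `|x ord0 j - c ord0 j| <= r.
    by apply: le_trans xc; have := rV_coord_le (x - c) j; rewrite subrvE.
  rewrite ler_norml => /andP[h1 h2].
  have -> : m%:R * (2 * r / m%:R) = 2 * r by field; rewrite gt_eqF.
  by apply/andP; split; lra.
exists [ffun j => k j]; apply/rV_norm_leP => [|j]; first by rewrite divr_ge0 ?ltW.
rewrite subrvE !mxE ffunE; have /andP[h1 h2] := hk j.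
move: h2; rewrite -natr1 mulrDl mul1r => h2.
have e : 2 * r / m%:R = r / m%:R + r / m%:R by rewrite -mulrDl; congr (_ / _); lra.
move: h1 h2; rewrite e => h1 h2.
by rewrite ler_norml; apply/andP; split; lra.
Qed.

End subdivision.

(** * The ball condition as porosity, and the decay of measure near a porous set *)

Section porosity.
Context {R : realType} {n : nat}.
Local Notation V := 'rV[R]_n.
Local Notation X := (borelRn R n).
Local Notation L := (@lebesgueRn R n).
Implicit Types (c z x : V) (r t : R) (m : nat) (E : set V).

Definition tube E t : set V := [set z | exists2 e, E e & `|z - e| < t].

Lemma open_tube E t : open (tube E t).
Proof.
rewrite (_ : tube E t = \bigcup_(e in E) ball e t).
  by apply: bigcup_open => e _; exact: ball_open.
apply/seteqP; split=> z [e Ee] h; exists e => //; move: h; rewrite -ball_normE /=.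
  by rewrite rV_distC.
by rewrite rV_distC.
Qed.

Lemma measurable_tube E t : @measurable _ X (tube E t).
Proof. by apply: open_measurableRn; exact: open_tube. Qed.

Lemma tube_le E s t : s <= t -> tube E s `<=` tube E t.
Proof. by move=> st z [e Ee h]; exists e => //; exact: lt_le_trans st. Qed.

Lemma norm_le_euclidean (v : V) : `|v| <= euclidean_norm v.
Proof.
apply/rV_norm_leP => [|j]; first exact: sqrtr_ge0.
rewrite -sqrtr_sqr; apply: ler_wsqrtr.
by rewrite (bigD1 j)//= lerDl sumr_ge0// => i _; exact: sqr_ge0.
Qed.

Lemma euclidean_le_norm (v : V) : euclidean_norm v <= n%:R * `|v|.
Proof.
have h0 : 0 <= n%:R * `|v| by rewrite mulr_ge0// rV_norm_ge0.
rewrite -(ger0_norm h0) -sqrtr_sqr; apply: ler_wsqrtr.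
apply: (@le_trans _ _ (\sum_(i < n) `|v| ^+ 2)).
  apply: ler_sum => i _; rewrite -[leLHS]real_normK ?num_real//.
  by rewrite ler_sqr ?nnegrE ?rV_norm_ge0// rV_coord_le.
rewrite sumr_const card_ord exprMn -[leLHS]mulr_natl; apply: ler_wpM2r; first exact: sqr_ge0.
by rewrite expr2 -natrM ler_nat; case: (n) => // k; rewrite leq_pmulr.
Qed.

(** Porosity on a grid and in the max norm. The exceptional subcube misses the neighbourhood of E of
    its own radius, not merely E, so that the property can be iterated for thin neighbourhoods. The
    bound 2 is where the ball condition, used with balls of radius r / 4, is available. *)
Definition has_holes m (E : set V) : Prop := forall c r, 0 < r <= 2 ->
  exists k : {ffun 'I_n -> 'I_m}, forall z, cube (sub_center c r k) (r / m%:R) z ->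
    ~ tube E (r / m%:R) z.

(** If E comes within r / 2 of c, the subcube containing the centre y of the hole works: a point of
    E near it would be within 3 r / m of y in the max norm, hence within 3 n r / m < s in the
    Euclidean norm, by r <= 4 beta s and 12 n beta < m. Otherwise the subcube containing c works, as
    3 r / m <= r / 2. *)
Lemma ball_condition_holes (beta : R) m E : 0 < beta -> (6 <= m)%N -> 12 * n%:R * beta < m%:R ->
  ball_condition beta E -> has_holes m E.
Proof.
move=> b0 m6 mb hE c r /andP[r0 r2].
have m0 : (0 < m)%N by exact: leq_trans m6.
have mr : 0 < m%:R :> R by rewrite ltr0n.
have mr6 : 6 <= m%:R :> R by rewrite ler_nat.
have rm6 : 6 * (r / m%:R) <= r by rewrite mulrA ler_pdivrMr// mulrC ler_wpM2l// ltW.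
have rm0 : 0 < r / m%:R by rewrite divr_gt0.
have [[e [Ee ec]]|ne] := pselect (exists e, E e /\ cube c (r / 2) e).
  have r40 : 0 < r / 4 by lra.
  have r41 : 2 * (r / 4) <= 1 by lra.
  have [y [s [s0 sb ys]]] := hE e (r / 4) Ee r40 r41.
  have ye : `|y - e| < r / 4.
    have : euclidean_ball y s y.
      rewrite /euclidean_ball /= subrr /euclidean_norm.
      by under eq_bigr do rewrite mxE expr0n/=; rewrite big1// sqrtr0.
    by move=> /ys[] /(le_lt_trans (norm_le_euclidean _)).
  have yc : cube c r y.
    by have := rV_distD e y c; rewrite /cube /= in ec * => ?; lra.
  have [k hk] := sub_center_cover m0 r0 yc.
  exists k => z hz [e' Ee' ze'].
  have ye' : `|e' - y| <= 3 * (r / m%:R).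
    have := rV_distD z e' y; have := rV_distD (sub_center c r k) z y.
    rewrite (rV_distC (sub_center c r k) y) (rV_distC e' z).
    by rewrite /cube /= in hk hz => ? ?; lra.
  have : euclidean_ball y s e'.
    rewrite /euclidean_ball /=; apply: le_lt_trans (euclidean_le_norm _) _.
    apply: le_lt_trans (_ : n%:R * (3 * (r / m%:R)) < s); first by rewrite ler_wpM2l.
    have qm : r / m%:R * m%:R = r by rewrite divfK// gt_eqF.
    have h1 : r / m%:R * (12 * n%:R * beta) < r by rewrite -[ltRHS]qm ltr_pM2l.
    rewrite -(ltr_pM2l (_ : 0 < 4 * beta)); last by lra.
    by apply: lt_le_trans (_ : r <= _); lra.
  by move=> /ys[].
have [k hk] : exists k : {ffun 'I_n -> 'I_m}, cube (sub_center c r k) (r / m%:R) c.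
  by apply: sub_center_cover => //; rewrite /cube /= subrr normr0 ltW.
exists k => z hz [e' Ee' ze']; apply: ne; exists e'; split=> //.
have := rV_distD z e' c; have := rV_distD (sub_center c r k) z c.
rewrite (rV_distC (sub_center c r k) c) (rV_distC e' z).
by rewrite /cube /= in hk hz * => ? ?; lra.
Qed.

(** Induction on the depth of subdivision: one subcube misses the tube, and the induction hypothesis
    applies to the m^n - 1 others. *)
Lemma measure_cube_tube m E j c r : (0 < m)%N -> has_holes m E -> 0 < r <= 2 ->
  (L (cube c r `&` tube E (r / m%:R ^+ j)) <= ((1 - (m%:R ^+ n)^-1) ^+ j * (r *+ 2) ^+ n)%:E)%E.
Proof.
move=> m0 hE; have mr : 0 < m%:R :> R by rewrite ltr0n.
have m1 : 1 <= m%:R :> R by rewrite ler1n.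
elim: j c r => [|j IHj] c r /andP[r0 r2].
  rewrite expr0 mul1r -(lebesgueRn_cube c r0); apply: le_measure; rewrite ?inE.
  - by apply: measurableI; [exact: measurable_cube|exact: measurable_tube].
  - exact: measurable_cube.
  - exact: subIsetl.
have mD : @measurable _ X (cube c r `&` tube E (r / m%:R ^+ j.+1)).
  by apply: measurableI; [exact: measurable_cube|exact: measurable_tube].
have mF (k : {ffun 'I_n -> 'I_m}) : @measurable _ X (cube (sub_center c r k) (r / m%:R)).
  exact: measurable_cube.
have rm0 : 0 < r / m%:R by rewrite divr_gt0.
have rmr : r / m%:R <= r by rewrite ler_pdivrMr// ler_peMr// ltW.
apply: le_trans (le_measure_cover L mD mF _) _.
  by move=> x [xc _]; exact: sub_center_cover.
have [k0 hk0] : exists k : {ffun 'I_n -> 'I_m}, forall z, cube (sub_center c r k) (r / m%:R) z ->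
    ~ tube E (r / m%:R) z by apply: hE; rewrite r0.
have e : r / m%:R ^+ j.+1 = r / m%:R / m%:R ^+ j by rewrite exprS invfM mulrA.
rewrite (bigD1 k0)//= [X in (X + _ <= _)%E](_ : _ = 0%E) ?add0e; last first.
  rewrite (_ : _ `&` _ = set0) ?measure0//; apply/seteqP; split=> // z [[_ zt] /hk0]; apply.
  apply: tube_le zt; rewrite e ler_pdivrMr ?exprn_gt0// ler_peMr ?(ltW rm0)//.
  by rewrite exprn_ege1.
apply: (@le_trans _ _ (\sum_(k | k != k0) ((1 - (m%:R ^+ n)^-1) ^+ j * ((r / m%:R) *+ 2) ^+ n)%:E)%E).
  apply: lee_sum => k _; apply: le_trans (IHj (sub_center c r k) (r / m%:R) _); last first.
    by rewrite rm0 (le_trans rmr).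
  apply: le_measure; rewrite ?inE.
  - by apply: measurableI.
  - by apply: measurableI; [exact: measurable_cube|exact: measurable_tube].
  - by move=> z [[_ zt] zk]; split=> //; rewrite -e.
rewrite sumEFin lee_fin sumr_const.
have -> : #|[pred k : {ffun 'I_n -> 'I_m} | k != k0]| = (m ^ n).-1.
  by rewrite cardC1 card_ffun !card_ord.
have mn1 : (0 < m ^ n)%N by rewrite expn_gt0 m0.
rewrite -[_ *+ (m ^ n).-1]mulr_natl -subn1 natrB// natrX exprS.
rewrite le_eqVlt; apply/orP; left; apply/eqP.
rewrite -mulrnAl exprMn exprVn.
have Mn0 : m%:R ^+ n != 0 :> R by rewrite expf_neq0// gt_eqF.
move: (m%:R ^+ n) Mn0 ((r *+ 2) ^+ n) => M Mn0 S; move: ((1 - M^-1) ^+ j) => T.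
by field.
Qed.

End porosity.

Section porous_null.
Context {R : realType} {n : nat}.
Local Notation V := 'rV[R]_n.
Local Notation X := (borelRn R n).
Local Notation L := (@lebesgueRn R n).

(** In a cube of radius 1 the set E lies in every tube, and the bounds of [measure_cube_tube] tend
    to 0; larger cubes are cut into cubes of radius 1. *)
Lemma porous_null m (E : set V) : (0 < n)%N -> (0 < m)%N -> closed E -> has_holes m E -> L E = 0%E.
Proof.
move=> n0 m0 cE hE; have mE : @measurable _ X E by exact: closed_measurableRn.
have mr : 0 < m%:R :> R by rewrite ltr0n.
have Ec (c : V) : L (E `&` cube c 1) = 0%E.
  have mEc : @measurable _ X (E `&` cube c 1) by apply: measurableI => //; exact: measurable_cube.
  have th j : (L (E `&` cube c 1) <= ((1 - (m%:R ^+ n)^-1) ^+ j * (1 *+ 2) ^+ n)%:E)%E.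
    have r1 : 0 < (1 : R) <= 2 by rewrite ltr01 ler1n.
    apply: le_trans (measure_cube_tube j c m0 hE r1).
    apply: le_measure; rewrite ?inE => //.
      by apply: measurableI; [exact: measurable_cube|exact: measurable_tube].
    by move=> z [Ez zc]; split=> //; exists z => //; rewrite subrr normr0 divr_gt0// exprn_gt0.
  apply/eqP; rewrite eq_le measure_ge0 andbT.
  have t01 : `|1 - (m%:R ^+ n)^-1| < 1 :> R.
    have mn : 1 <= m%:R ^+ n :> R by rewrite exprn_ege1// ler1n.
    have i0 : 0 < (m%:R ^+ n)^-1 :> R by rewrite invr_gt0 exprn_gt0.
    have i1 : (m%:R ^+ n)^-1 <= 1 :> R by rewrite invf_le1 ?exprn_gt0.
    by rewrite ltr_norml; apply/andP; split; lra.
  have cv : (1 - (m%:R ^+ n)^-1) ^+ j * (1 *+ 2) ^+ n @[j --> \oo] --> (0 : R).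
    rewrite -[X in _ --> X](mul0r ((1 *+ 2) ^+ n : R)).
    by apply: cvgM; [exact: cvg_expr|exact: cvg_cst].
  have cvE : ((1 - (m%:R ^+ n)^-1) ^+ j * (1 *+ 2) ^+ n)%:E @[j --> \oo] --> (0%:E : \bar R).
    by apply: cvg_EFin; [exact: nearW|exact: cv].
  suff : (L (E `&` cube c 1) <= limn (fun j => ((1 - (m%:R ^+ n)^-1) ^+ j * (1 *+ 2) ^+ n)%:E))%E.
    by rewrite (cvg_lim _ cvE).
  apply: lime_ge.
    by apply/cvg_ex; exists 0%:E.
  by apply: nearW => j; exact: th.
have Ek (k : nat) : L (E `&` cube (0 : V) k.+1%:R) = 0%E.
  have mK : @measurable _ X (E `&` cube (0 : V) k.+1%:R) by apply: measurableI => //; exact: measurable_cube.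
  apply/eqP; rewrite eq_le measure_ge0 andbT.
  have := @le_measure_cover _ _ R L {ffun 'I_n -> 'I_k.+1} _ (fun i => cube (sub_center (0 : V) k.+1%:R i) (k.+1%:R / k.+1%:R)) mK.
  have hx (x : X) : (E `&` cube (0 : V) k.+1%:R) x -> exists i : {ffun 'I_n -> 'I_k.+1},
      cube (sub_center (0 : V) k.+1%:R i) (k.+1%:R / k.+1%:R) x.
    by move=> [_ xc]; exact: sub_center_cover.
  move=> /(_ (fun i => measurable_cube _ _) hx) /le_trans; apply.
  rewrite big1// => i _; apply/eqP; rewrite eq_le measure_ge0 andbT -(Ec (sub_center (0 : V) k.+1%:R i)).
  rewrite divff ?pnatr_eq0//; apply: le_measure; rewrite ?inE.
  - by apply: measurableI => //; exact: measurable_cube.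
  - by apply: measurableI => //; exact: measurable_cube.
  - by move=> z [[Ez _] zc].
have -> : E = \bigcup_k (E `&` cube (0 : V) k.+1%:R).
  rewrite -setI_bigcupr (_ : \bigcup_k _ = setT) ?setIT//; apply/seteqP; split=> // x _.
  have : (\bigcup_k cube (0 : V) k%:R) x by rewrite cube_bigcup.
  move=> [k _ xk]; exists k => //; apply: le_trans xk _; by rewrite ler_nat.
apply/eqP; rewrite eq_le measure_ge0 andbT.
apply: le_trans (measure_sigma_subadditive _ _ _ (@subset_refl _ _)) _.
- by move=> k; apply: measurableI => //; exact: measurable_cube.
- apply: bigcup_measurable => k _; apply: measurableI => //; exact: measurable_cube.
by rewrite eseries0// => k _ _; exact: Ek.
Qed.

End porous_null.

(** * Integrals of inverse masses of cubes *)

Section covering_estimates.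
Context {R : realType} {n : nat}.
Local Notation V := 'rV[R]_n.
Local Notation X := (borelRn R n).
Implicit Types (x z : V) (r : R).
Variables (sigma : {measure set X -> \bar R}) (E : set V).
Hypothesis sfin : forall z r, (sigma (cube z r) < +oo)%E.
Hypothesis mE : @measurable _ X E.

Lemma sigma_finite_sigma : sigma_finite setT sigma.
Proof. exact: sigma_finite_cube. Qed.

Lemma measurable_sigma_cube r : measurable_fun [set: X] (fun x : X => sigma (cube (x : V) r)).
Proof.
have mA : measurable [set xy : X * X | `|(xy.1 : V) - xy.2| <= r].
  have := @measurable_dist R n measurableT `]-oo, r]%classic (measurable_itv _).
  rewrite setTI; congr (measurable _); apply/seteqP; split=> z /=; by rewrite in_itv.
have := measurable_measure_xsection sigma_finite_sigma mA.
congr (measurable_fun _ _); apply/funext => x; congr (sigma _).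
apply/seteqP; split=> y; rewrite /xsection /cube /= inE /=; by rewrite rV_distC.
Qed.

Lemma measurable_fine_sigma_cube r : measurable_fun [set: X] (fun x : X => fine (sigma (cube (x : V) r))).
Proof. exact: measurableT_comp (fine_measurable measurableT) (measurable_sigma_cube r). Qed.

Lemma fine_sigma_ge0 z r : 0 <= fine (sigma (cube z r)).
Proof. exact: fine_ge0. Qed.

Lemma fin_sigma z r : sigma (cube z r) \is a fin_num.
Proof. by rewrite ge0_fin_numE// sfin. Qed.

Lemma fine_sigma_le x y r s : cube x r `<=` cube y s -> fine (sigma (cube x r)) <= fine (sigma (cube y s)).
Proof.
move=> xy; rewrite fine_le ?fin_sigma//; apply: le_measure; rewrite ?inE//; exact: measurable_cube.
Qed.

Lemma cube_subset x y r s : `|x - y| + r <= s -> cube x r `<=` cube y s.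
Proof. by move=> h z; rewrite /cube /= => zx; have := rV_distD x z y => ?; lra. Qed.

(* Each subcube of radius [r / 2] is contained in the cube of radius [r]
   around any of its points and hence contributes at most [1]. *)
Lemma integral_inv_sigma_le z r N : 0 < r -> (0 < N)%N ->
  (\int[sigma]_(x in E `&` cube z (N%:R * r)) ((fine (sigma (cube x r)))^-1)%:E <=
    ((2 * N)%:R ^+ n)%:E)%E.
Proof.
move=> r0 N0; have N2 : (0 < 2 * N)%N by rewrite muln_gt0.
have Nr : 0 < N%:R * r by rewrite mulr_gt0 ?ltr0n.
have mD : @measurable _ X (E `&` cube z (N%:R * r)) by apply: measurableI => //; exact: measurable_cube.
pose F (k : {ffun 'I_n -> 'I_(2 * N)}) : set X := cube (sub_center z (N%:R * r) k) (N%:R * r / (2 * N)%:R).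
have eF : N%:R * r / (2 * N)%:R = r / 2.
  by rewrite natrM; field; rewrite pnatr_eq0 -lt0n.
have mF k : measurable (F k) by exact: measurable_cube.
have mf : measurable_fun (E `&` cube z (N%:R * r) : set X) (fun x : X => ((fine (sigma (cube (x : V) r)))^-1)%:E).
  apply: measurable_funTS; apply/measurable_EFinP.
  by apply: measurable_inv_ge0; [move=> x; exact: fine_sigma_ge0|exact: measurable_fine_sigma_cube].
apply: le_trans (le_integral_cover sigma mD mF _ mf _) _.
- by move=> x [_ xc]; exact: sub_center_cover.
- by move=> x; rewrite lee_fin invr_ge0 fine_sigma_ge0.
apply: (@le_trans _ _ (\sum_(k : {ffun 'I_n -> 'I_(2 * N)}) 1%:E)%E); last first.
  by rewrite sumEFin lee_fin sumr_const card_ffun !card_ord natrX.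
apply: lee_sum => k _.
have mDk : @measurable _ X (E `&` cube z (N%:R * r) `&` F k) by exact: measurableI.
have [F0|F0] := eqVneq (sigma (F k)) 0%E.
  have D0 : sigma (E `&` cube z (N%:R * r) `&` F k) = 0%E.
    by apply/eqP; rewrite eq_le measure_ge0 andbT -F0; apply: le_measure; rewrite ?inE//.
  by rewrite (null_set_integral mDk _ D0)//; exact: measurable_funS mD (@subIsetl _ _ _) mf.
have f0 : 0 < fine (sigma (F k)).
  by rewrite lt0r fine_sigma_ge0 andbT fine_eq0 ?fin_sigma.
apply: (@le_trans _ _ (\int[sigma]_(x in E `&` cube z (N%:R * r) `&` F k) ((fine (sigma (F k)))^-1)%:E)%E).
  apply: le_ge0_integral => x; first by rewrite lee_fin invr_ge0 fine_sigma_ge0.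
  move=> [_ Fx]; rewrite lee_fin.
  have h : fine (sigma (F k)) <= fine (sigma (cube x r)).
    apply: fine_sigma_le; apply: cube_subset; rewrite eF.
    by move: Fx; rewrite /F /cube /= eF rV_distC => ?; lra.
  by rewrite lef_pV2 ?posrE// (lt_le_trans f0).
rewrite integral_cst// -(fineK (fin_sigma _ _)).
apply: (@le_trans _ _ (((fine (sigma (F k)))^-1)%:E * sigma (F k))%E).
  by apply: lee_wpmul2l; [rewrite lee_fin invr_ge0 ltW|apply: le_measure; rewrite ?inE//].
by rewrite -[X in (_ * X)%E](fineK (fin_sigma _ _)) -EFinM lee_fin mulVf// gt_eqF.
Qed.

End covering_estimates.

Lemma poweR_EFinM (R : realType) (r c : R) (x : \bar R) : 0 <= c -> (0 <= x)%E ->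
  ((c%:E * x) `^ r = (c `^ r)%:E * x `^ r)%E.
Proof.
move=> c0 x0; have c0' : (0 <= c%:E)%E by rewrite lee_fin.
by rewrite (poweRM r c0' x0).
Qed.

(** * Pointwise bounds for differences and values of a Sobolev function *)

Section pointwise_oscillation.
Context {R : realType} {n : nat}.
Local Notation V := 'rV[R]_n.
Local Notation X := (borelRn R n).
Local Notation L := (@lebesgueRn R n).
Local Notation mass := (@box_mass R n).
Variables (p M : R) (m : nat).
Hypotheses (n0 : (0 < n)%N) (pn : n%:R < p) (m6 : (6 <= m)%N).
Hypotheses (M0 : 0 < M) (hM : forall t : R, dstep t <= M).
Implicit Types (F : V -> R) (G : V -> V) (x y : V).

Definition scale (j : nat) : R := m%:R ^- j.

(** The square root of m^(n-p), see [ratio_sqr]. Its inverse powers weight the chain of means in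
    [osc], and a factor [ratio ^+ j] is still left when the scales are summed, see [scale_ratio]. *)
Definition ratio : R := m%:R `^ (- ((p - n%:R) / 2)).

Definition grad_mass G x (j : nat) : \bar R := (\int[L]_(z in cube x (2 * scale j)) `|G z|%:E)%E.

(** Up to a constant and the weight, the j-th summand bounds the p-th power of the step from scale k
    + j to scale k + j + 1 in the chain of means at x. *)
Definition osc G (k : nat) x : \bar R :=
  (\sum_(0 <= j <oo) ((ratio ^- j)%:E * ((scale (k + j) ^- n.-1)%:E * grad_mass G x (k + j)) `^ p))%E.

Let mr6 : 6 <= m%:R :> R. Proof. by rewrite ler_nat. Qed.
Let mr0 : 0 < m%:R :> R. Proof. by rewrite (lt_le_trans _ mr6). Qed.
Let p0 : 0 < p. Proof. by rewrite (le_lt_trans _ pn). Qed.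
Let p1 : 1 < p. Proof. by rewrite (le_lt_trans _ pn)// ler1n. Qed.

Lemma scale_gt0 j : 0 < scale j.
Proof. by rewrite invr_gt0 exprn_gt0. Qed.

Lemma scaleS j : scale j.+1 = scale j / m%:R.
Proof. by rewrite /scale exprSr invfM. Qed.

Lemma scale_add i d : scale i = m%:R ^+ d * scale (i + d).
Proof. by rewrite /scale addnC exprD invfM mulrA divff ?mul1r// expf_neq0// gt_eqF. Qed.

Lemma scale_le1 j : scale j <= 1.
Proof. by rewrite invf_le1 ?exprn_gt0// exprn_ege1// (le_trans _ mr6)// ler1n. Qed.

Lemma scaleS_le j : 6 * scale j.+1 <= scale j.
Proof. by rewrite scaleS mulrA ler_pdivrMr// mulrC ler_wpM2l// ltW// scale_gt0. Qed.

Lemma scaleS_lt j : scale j.+1 < scale j.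
Proof. by have := scaleS_le j; have := scale_gt0 j.+1 => ? ?; lra. Qed.

Lemma scale_cvg0 : scale j @[j --> \oo] --> (0 : R).
Proof.
rewrite /scale; under eq_fun do rewrite -exprVn; apply: cvg_expr.
rewrite gtr0_norm ?invr_gt0// invf_lt1// (lt_le_trans _ mr6)//; lra.
Qed.

Lemma ratio01 : 0 < ratio < 1.
Proof.
rewrite /ratio powR_gt0//= powRN invf_lt1 ?powR_gt0// -[ltLHS](one_powR ((p - n%:R) / 2)).
apply: gt0_ltr_powR; rewrite ?nnegrE ?(ltW mr0)//; last by rewrite (lt_le_trans _ mr6)//; lra.
by rewrite divr_gt0// subr_gt0.
Qed.

Lemma ratio_sqr : ratio * ratio = m%:R `^ (n%:R - p).
Proof. by rewrite -powRD; [congr (_ `^ _); lra|rewrite (gt_eqF mr0) implybT]. Qed.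

Lemma grad_mass_ge0 G x j : (0 <= grad_mass G x j)%E.
Proof. by apply: integral_ge0 => z _; rewrite lee_fin. Qed.

Lemma osc_term_ge0 G k x j :
  (0 <= (ratio ^- j)%:E * ((scale (k + j) ^- n.-1)%:E * grad_mass G x (k + j)) `^ p)%E.
Proof.
have /andP[q0 _] := ratio01.
by rewrite mule_ge0 ?poweR_ge0// lee_fin invr_ge0 exprn_ge0// ltW.
Qed.

Lemma osc_ge0 G k x : (0 <= osc G k x)%E.
Proof. by apply: nneseries_ge0 => j _ _; exact: osc_term_ge0. Qed.

Lemma le_osc0 G k x : (((scale k ^- n.-1)%:E * grad_mass G x k) `^ p <= osc G k x)%E.
Proof.
have := @nneseries_term_le R _ 0 (osc_term_ge0 G k x).
by rewrite /= expr0 invr1 mul1e addn0.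
Qed.

Lemma box_mean_cvg F x k : continuous F -> (forall z r, L.-integrable (cube z r) (EFin \o (F : X -> R))) ->
  box_mean F x (scale (k + j)) @[j --> \oo] --> mass * F x.
Proof.
move=> cF iF; apply/cvgrPdist_le => e e0.
have c0 := @box_mass_gt0 R n.
have e1 : 0 < e / mass by rewrite divr_gt0.
have : \forall z \near x, `|F x - F z| < e / mass.
  have /(_ [set t | `|F x - t| < e / mass]) := cF x; apply.
  exact: (nbhsx_ballx (F x) _ e1).
move=> /nbhs_ballP[d /= d0 hd].
have hs : \forall j \near \oo, scale j < d.
  have /cvgrPdist_lt/(_ _ d0) := scale_cvg0.
  by apply: filterS => j; rewrite sub0r normrN gtr0_norm ?scale_gt0.
near=> j; rewrite distrC.
have -> : e = mass * (e / mass) by rewrite mulrCA divff ?mulr1// gt_eqF.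
apply: box_mean_near => //; first exact: scale_gt0.
move=> z zx; rewrite distrC ltW//; apply: hd; rewrite -ball_normE /= rV_distC.
apply: le_lt_trans zx _.
apply: (@le_lt_trans _ _ (scale j)).
  by rewrite /scale lef_pV2 ?posrE ?exprn_gt0// ler_eXn2l ?leq_addl// (lt_le_trans _ mr6)//; lra.
by near: j; exact: hs.
Unshelve. all: end_near. Qed.

(** The factor n (M / t)^(n-1) of [box_mean_dist] for t = scale k / m, with the power of [scale k]
    taken out. *)
Definition step_const : R := n%:R * (M * m%:R) ^+ n.-1.

Lemma step_const_ge0 : 0 <= step_const.
Proof. by rewrite mulr_ge0// exprn_ge0// mulr_ge0// ltW. Qed.

(** The two values of l serve two purposes: l = k.+1 is a step of the chain at a fixed centre, l = k
    the passage from x to y at a fixed scale. *)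
Lemma box_mean_scale F G x y k l : weak_gradient setT F G -> `|x - y| <= scale k ->
  (k <= l <= k.+1)%N ->
  (`|box_mean F x (scale k) - box_mean F y (scale l)|%:E <=
    step_const%:E * ((scale k ^- n.-1)%:E * grad_mass G x k))%E.
Proof.
move=> wG xy /andP[kl lk]; have sk := scale_gt0 k.
have sl : scale l <= scale k by rewrite lef_pV2 ?posrE ?exprn_gt0// ler_eXn2l// (lt_le_trans _ mr6)//; lra.
have ls : scale k.+1 <= scale l by rewrite lef_pV2 ?posrE ?exprn_gt0// ler_eXn2l// (lt_le_trans _ mr6)//; lra.
have := @box_mean_dist R n M setT F G x (scale k) y (scale l) (scale k.+1) x (2 * scale k) n0 M0 hM openT wG
  (@subsetT _ _).
rewrite subrr normr0 add0r (rV_distC y x).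
have h1 : scale k <= 2 * scale k by lra.
have h2 : `|x - y| + scale l <= 2 * scale k by lra.
have h3 := ltW (scaleS_lt k).
move=> /(_ h1 h2 (scale_gt0 _) h3 ls) /le_trans; apply.
rewrite muleA -EFinM lee_wpmul2r ?grad_mass_ge0// lee_fin /step_const scaleS.
by rewrite -[leRHS]mulrA ler_wpM2l// invf_div mulrA exprMn exprMn exprVn.
Qed.

Lemma le3_powR (a b c : R) : 0 <= a -> 0 <= b -> 0 <= c ->
  (a + b + c) `^ p <= 3 `^ p * (a `^ p + b `^ p + c `^ p).
Proof.
move=> a0 b0 c0; wlog : / True by apply. move=> _.
pose t := Num.max a (Num.max b c).
have ta : a <= t by rewrite le_max lexx.
have tb : b <= t by rewrite !le_max lexx orbT.
have tc : c <= t by rewrite !le_max lexx !orbT.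
have t0 : 0 <= t by exact: le_trans ta.
apply: (@le_trans _ _ ((3 * t) `^ p)).
  apply: ge0_ler_powR; rewrite ?nnegrE ?(ltW p0) ?addr_ge0 ?mulr_ge0//; lra.
rewrite powRM// ler_wpM2l ?powR_ge0//.
have := powR_ge0 a p; have := powR_ge0 b p; have := powR_ge0 c p => h1 h2 h3.
rewrite /t; case: (leP b c) => bc; rewrite ?(max_r bc) ?(max_l (ltW bc)).
  by case: (leP a c) => ac; rewrite ?(max_r ac) ?(max_l (ltW ac)); lra.
by case: (leP a b) => ab; rewrite ?(max_r ab) ?(max_l (ltW ab)); lra.
Qed.

Lemma box_mean_osc F G x k : continuous F -> weak_gradient setT F G ->
  ((`|box_mean F x (scale k) - mass * F x| `^ p)%:E <=
    (((1 - ratio `^ p^-1)^-1 `^ p) * step_const `^ p)%:E * osc G k x)%E.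
Proof.
move=> cF wG.
have iF z r : L.-integrable (cube z r) (EFin \o (F : X -> R)).
  by apply: (locally_integrable_cube openT wG.1).
have := chain_power p0 ratio01 (box_mean_cvg (x := x) k cF iF); rewrite addn0.
move=> /le_trans; apply; rewrite EFinM -muleA lee_wpmul2l ?lee_fin ?powR_ge0//.
have /andP[q0 _] := ratio01.
rewrite /osc -nneseriesZl; last by move=> j _; exact: osc_term_ge0.
apply: lee_nneseries => [j _|j _]; first by rewrite lee_fin mulr_ge0 ?powR_ge0// invr_ge0 exprn_ge0// ltW.
rewrite EFinM muleCA lee_wpmul2l ?lee_fin ?invr_ge0 ?exprn_ge0 ?(ltW q0)//.
rewrite -!poweR_EFin -poweRM ?lee_fin ?step_const_ge0//; last first.
  by rewrite mule_ge0 ?grad_mass_ge0// lee_fin invr_ge0 exprn_ge0// ltW// scale_gt0.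
apply: le_poweR => //; rewrite addnS; apply: box_mean_scale => //.
  by rewrite subrr normr0 ltW// scale_gt0.
by rewrite leqnSn leqnn.
Qed.

Definition mean_const : R := ((1 - ratio `^ p^-1)^-1 `^ p) * step_const `^ p.

Lemma mean_const_ge0 : 0 <= mean_const.
Proof. by rewrite mulr_ge0 ?powR_ge0. Qed.

Definition pointwise_const : R := mass^-1 `^ p * (3 `^ p * (mean_const + step_const `^ p)).

Lemma pointwise_const_ge0 : 0 <= pointwise_const.
Proof. by rewrite mulr_ge0 ?powR_ge0// mulr_ge0 ?addr_ge0 ?powR_ge0 ?mean_const_ge0. Qed.

Let combine3 (k l s t A B C : R) (u v : \bar R) : 0 <= k -> 0 <= l -> 0 <= s -> 0 <= t ->
  (0 <= u)%E -> (0 <= v)%E -> (A%:E <= s%:E * u -> B%:E <= t%:E * u -> C%:E <= s%:E * v ->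
  (k * (l * (A + B + C)))%:E <= (k * (l * (s + t)))%:E * (u + v))%E.
Proof.
move=> k0 l0 s0 t0 u0 v0 hA hB hC; rewrite mulrA [in leRHS]mulrA EFinM [in leRHS]EFinM -muleA.
apply: lee_wpmul2l; first by rewrite lee_fin mulr_ge0.
rewrite !EFinD ge0_muleDl ?lee_fin// ge0_muleDr// ge0_muleDr//.
rewrite addeACA; apply: leeD; first exact: leeD.
by apply: le_trans hC _; rewrite leeDl// mule_ge0.
Qed.

Let combine2 (k l s t A B : R) (u v : \bar R) : 0 <= k -> 0 <= l -> 0 <= s -> 0 <= t ->
  (0 <= u)%E -> (0 <= v)%E -> (A%:E <= s%:E * u -> B%:E <= t%:E * v ->
  (k * (l * (A + B)))%:E <= (k * (l * (s + t)))%:E * (u + v))%E.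
Proof.
move=> k0 l0 s0 t0 u0 v0 hA hB; rewrite mulrA [in leRHS]mulrA EFinM [in leRHS]EFinM -muleA.
apply: lee_wpmul2l; first by rewrite lee_fin mulr_ge0.
rewrite !EFinD ge0_muleDl ?lee_fin// ge0_muleDr// ge0_muleDr//; apply: leeD.
  by apply: le_trans hA _; rewrite leeDl// mule_ge0.
by apply: le_trans hB _; rewrite leeDr// mule_ge0.
Qed.

Let normB3 (a b c d : R) : `|a - d| <= `|b - a| + `|b - c| + `|c - d|.
Proof. by rewrite (distrC b a) -addrA (le_trans (ler_distD b _ _))// lerD2l ler_distD. Qed.

Let norm2 (a b : R) : `|a| <= `|b - a| + `|b|.
Proof. by rewrite (distrC b a) -[X in `|X| <= _](subrK b a) ler_normD. Qed.

(** F x is compared with its mean at scale k, that mean with the one at y, and the latter with F y.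
    The middle difference is controlled by the first summand of [osc] alone. *)
Lemma pointwise_osc F G x y k : continuous F -> weak_gradient setT F G -> `|x - y| <= scale k ->
  ((`|F x - F y| `^ p)%:E <= pointwise_const%:E * (osc G k x + osc G k y))%E.
Proof.
move=> cF wG xy; have c0 := @box_mass_gt0 R n.
have ox := box_mean_osc x k cF wG; have oy := box_mean_osc y k cF wG.
have ob : ((`|box_mean F x (scale k) - box_mean F y (scale k)| `^ p)%:E <= (step_const `^ p)%:E * osc G k x)%E.
  have kk : (k <= k <= k.+1)%N by rewrite leqnn leqnSn.
  have h := box_mean_scale wG xy kk.
  have : (0 <= `|box_mean F x (scale k) - box_mean F y (scale k)|%:E)%E by rewrite lee_fin.
  move=> /(le_poweR p0) /(_ h); rewrite poweR_EFin => /le_trans; apply.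
  have t0 : (0 <= (scale k ^- n.-1)%:E * grad_mass G x k)%E.
    by rewrite mule_ge0 ?grad_mass_ge0// lee_fin invr_ge0 exprn_ge0// ltW// scale_gt0.
  rewrite (poweR_EFinM _ step_const_ge0 t0).
  by apply: lee_wpmul2l; [rewrite lee_fin powR_ge0|exact: le_osc0].
set a := `|box_mean F x (scale k) - mass * F x| in ox.
set c := `|box_mean F y (scale k) - mass * F y| in oy.
set b := `|_| in ob.
have h1 : `|F x - F y| `^ p <= mass^-1 `^ p * (3 `^ p * (a `^ p + b `^ p + c `^ p)).
  apply: (@le_trans _ _ ((mass^-1 * (a + b + c)) `^ p)).
    apply: ge0_ler_powR; rewrite ?nnegrE ?(ltW p0)//.
      by rewrite mulr_ge0 ?invr_ge0 ?(ltW c0)// !addr_ge0 /a /b /c.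
    rewrite ler_pdivlMl// -[mass in leLHS]gtr0_norm// -normrM mulrBr.
    exact: normB3.
  rewrite powRM ?invr_ge0 ?(ltW c0) ?addr_ge0 /a /b /c//.
  by rewrite ler_wpM2l ?powR_ge0// le3_powR.
apply: le_trans (_ : (mass^-1 `^ p * (3 `^ p * (a `^ p + b `^ p + c `^ p)))%:E <= _)%E.
  by rewrite lee_fin.
exact: (combine3 (powR_ge0 _ _) (powR_ge0 _ _) mean_const_ge0 (powR_ge0 _ _) (osc_ge0 _ _ _) (osc_ge0 _ _ _) ox ob oy).
Qed.

Lemma box_mean0_le F x : L.-integrable (cube x 1) (EFin \o (F : X -> R)) ->
  ((`|box_mean F x (scale 0)| `^ p)%:E <=
    ((M ^+ n) `^ p * (2 `^ p * (2 ^+ n) `^ (p - 1)))%:E * \int[L]_(z in cube x 1) (`|F z| `^ p)%:E)%E.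
Proof.
move=> iF; have s0 : scale 0 = 1 by rewrite /scale expr0 invr1.
rewrite s0; have mK := @measurable_cube R n x 1.
have mF : measurable_fun (cube x 1 : set X) (fun z : X => `|F z|).
  have /measurable_EFinP mF := measurable_int _ iF.
  exact: measurableT_comp (@normr_measurable R setT) mF.
have h1 : (`|box_mean F x 1|%:E <= (M ^+ n)%:E * \int[L]_(z in cube x 1) `|F z|%:E)%E.
  rewrite -ge0_integralZl_EFin ?exprn_ge0 ?(ltW M0)//; last exact/measurable_EFinP.
  have ik := integrable_cubeM iF (@continuous_box_bump R n x 1).
  apply: le_trans (_ : \int[L]_(z in cube x 1) `|F z * box_bump x 1 z|%:E <= _)%E.
    rewrite /box_mean EFin_normr_Rintegral//.
    by apply: (le_abse_integral L mK); exact: measurable_int ik.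
  apply: le_ge0_integral => z _ //; rewrite lee_fin normrM mulrC; apply: ler_pM => //.
  rewrite ger0_norm ?box_bump_ge0// -[X in M ^+ X]card_ord -prodr_const.
  apply: ler_prod => j _; rewrite box_factor_ge0//=.
  by rewrite -[M]divr1; exact: box_factor_le.
have : (0 <= `|box_mean F x 1|%:E)%E by rewrite lee_fin.
move=> /(le_poweR p0) /(_ h1); rewrite poweR_EFin => /le_trans; apply.
have t0 : (0 <= \int[L]_(z in cube x 1) `|F z|%:E)%E by apply: integral_ge0 => z _; rewrite lee_fin.
rewrite (poweR_EFinM _ (exprn_ge0 n (ltW M0)) t0) EFinM -muleA.
apply: lee_wpmul2l; first by rewrite lee_fin powR_ge0.
apply: (@jensen_power _ _ _ L (cube x 1) p (fun z => `|F z|) (2 ^+ n) mK p1 mF) => //.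
by rewrite lebesgueRn_cube// lee_fin.
Qed.

Definition value_const : R :=
  mass^-1 `^ p * (3 `^ p * (mean_const + (M ^+ n) `^ p * (2 `^ p * (2 ^+ n) `^ (p - 1)))).

Lemma value_const_ge0 : 0 <= value_const.
Proof.
apply: mulr_ge0; first exact: powR_ge0.
by apply: mulr_ge0; [exact: powR_ge0|rewrite addr_ge0 ?mean_const_ge0// !mulr_ge0 ?powR_ge0].
Qed.

(** As in [pointwise_osc], but the path stops at the mean of scale 0, which Jensen's inequality
    bounds by the L_p norm of F on a unit cube. *)
Lemma pointwise_value F G x : continuous F -> weak_gradient setT F G ->
  ((`|F x| `^ p)%:E <= value_const%:E * (osc G 0 x + \int[L]_(z in cube x 1) (`|F z| `^ p)%:E))%E.
Proof.
move=> cF wG; have c0 := @box_mass_gt0 R n.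
have ox := box_mean_osc x 0 cF wG.
have iF : L.-integrable (cube x 1) (EFin \o (F : X -> R)) by apply: (locally_integrable_cube openT wG.1).
have ob := box_mean0_le iF.
set I := (\int[L]_(z in cube x 1) _)%E in ob *.
have I0 : (0 <= I)%E by apply: integral_ge0 => z _; rewrite lee_fin powR_ge0.
set a := `|box_mean F x (scale 0) - mass * F x| in ox.
set b := `|_| in ob.
set C := (M ^+ n) `^ p * _ in ob *.
have C0 : 0 <= C by rewrite /C !mulr_ge0 ?powR_ge0.
have h1 : `|F x| `^ p <= mass^-1 `^ p * (3 `^ p * (a `^ p + b `^ p)).
  apply: (@le_trans _ _ ((mass^-1 * (a + b + 0)) `^ p)).
    apply: ge0_ler_powR; rewrite ?nnegrE ?(ltW p0)//.
      by rewrite mulr_ge0 ?invr_ge0 ?(ltW c0)// !addr_ge0 /a /b.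
    rewrite ler_pdivlMl// -[mass in leLHS]gtr0_norm// -normrM addr0.
    exact: norm2.
  rewrite powRM ?invr_ge0 ?(ltW c0) ?addr_ge0 /a /b//.
  rewrite ler_wpM2l ?powR_ge0//.
  by apply: le_trans (le3_powR _ _ _) _ => //; rewrite powR0 ?gt_eqF// addr0.
apply: le_trans (_ : (mass^-1 `^ p * (3 `^ p * (a `^ p + b `^ p)))%:E <= _)%E.
  by rewrite lee_fin.
exact: (combine2 (powR_ge0 _ _) (powR_ge0 _ _) mean_const_ge0 C0 (osc_ge0 _ _ _) I0 ox ob).
Qed.

End pointwise_oscillation.

(** * Geometric sums *)

Section geometric_sums.
Context {R : realType}.
Implicit Types (t q : R).

Lemma sum_geometric_gt1 t J : 1 < t -> \sum_(i < J) t ^+ i <= t ^+ J / (t - 1).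
Proof.
move=> t1; have t10 : 0 < t - 1 by rewrite subr_gt0.
elim: J => [|J IHJ]; first by rewrite big_ord0 expr0 divr_ge0// ltW.
rewrite big_ord_recr/=; apply: le_trans (_ : t ^+ J / (t - 1) + t ^+ J <= _); first by rewrite lerD2r.
by rewrite exprS le_eqVlt; apply/orP; left; apply/eqP; field; rewrite gt_eqF.
Qed.

Lemma sum_geometric_lt1 q J : 0 <= q < 1 -> \sum_(i < J) q ^+ i <= (1 - q)^-1.
Proof.
move=> /andP[q0 q1]; have h : 0 < 1 - q by rewrite subr_gt0.
suff -> : \sum_(i < J) q ^+ i = (1 - q ^+ J) / (1 - q).
  by rewrite ler_pdivrMr// mulVf ?gt_eqF// gerBl exprn_ge0.
elim: J => [|J IHJ]; first by rewrite big_ord0 expr0 subrr mul0r.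
by rewrite big_ord_recr/= IHJ exprS; field; rewrite gt_eqF.
Qed.

(** The terms grow like t^l up to l = i.+1, where the truncated subtraction makes the power of [th]
    trivial, and decay geometrically beyond, as t th < 1. The sum is therefore of the order of its
    term at l = i. *)
Lemma sum_porous_le (t th : R) i J : 1 < t -> 0 <= th -> t * th < 1 ->
  \sum_(l < J) t ^+ l * th ^+ (l - i.+1) <= (1 + t / (1 - t * th) + (t - 1)^-1) * t ^+ i.
Proof.
move=> t1 th0 tth; have t0 : 0 < t by rewrite (lt_trans _ t1).
have t10 : 0 < t - 1 by rewrite subr_gt0.
have tt0 : 0 < 1 - t * th by rewrite subr_gt0.
set K := _ + _; have h0 : 0 <= (t - 1)^-1 by rewrite invr_ge0 ltW.
(* The induction on i reproduces this stronger bound, lowered by 1 / (t - 1). *)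
suff : \sum_(l < J) t ^+ l * th ^+ (l - i.+1) <= K * t ^+ i - (t - 1)^-1 by move=> ?; lra.
elim: i J => [|i IHi] [|J].
- by rewrite big_ord0 expr0 mulr1 addrK addr_ge0// divr_ge0// ltW.
- rewrite big_ord_recl expr0 mul1r expr0 mulr1 addrK lerD2l.
  under eq_bigr => l _ do rewrite lift0 subn1 /= exprS -mulrA -exprMn.
  rewrite -mulr_sumr ler_wpM2l ?(ltW t0)//; apply: sum_geometric_lt1.
  by rewrite mulr_ge0 ?(ltW t0).
- rewrite big_ord0 subr_ge0; apply: le_trans (_ : K <= _); first by rewrite lerDr addr_ge0// divr_ge0// ltW.
  by rewrite ler_peMr ?exprn_ege1 ?(ltW t1)// addr_ge0// addr_ge0// divr_ge0// ltW.
- rewrite big_ord_recl expr0 mul1r expr0.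
  under eq_bigr => l _ do rewrite lift0 subSS exprS -mulrA.
  rewrite -mulr_sumr; have h := IHi J.
  apply: le_trans (_ : 1 + t * (K * t ^+ i - (t - 1)^-1) <= _); first by rewrite lerD2l ler_wpM2l// ltW.
  rewrite exprS le_eqVlt; apply/orP; left; apply/eqP; field; by rewrite gt_eqF.
Qed.

(** Both sums are comparable to their largest active term, so a power can be moved across the sum
    for any set of active indices. When the last index is active, the full geometric sum bounds the
    left side and the last term alone bounds the right side from below. *)
Lemma sum_indicator_power (t q : R) (s : nat -> bool) J : 1 < t -> 0 < q ->
  \sum_(i < J) (t ^+ i) `^ q * (s i)%:R <=
    t `^ q / (t `^ q - 1) * (\sum_(i < J) t ^+ i * (s i)%:R) `^ q.
Proof.
move=> t1 q0; have t0 : 0 < t by rewrite (lt_trans _ t1).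
have tq : 1 < t `^ q.
  by rewrite -[ltLHS](one_powR q); apply: gt0_ltr_powR; rewrite ?nnegrE ?(ltW t0).
have c0 : 0 <= t `^ q / (t `^ q - 1) by rewrite divr_ge0 ?powR_ge0// subr_ge0 ltW.
elim: J => [|J IHJ]; first by rewrite !big_ord0 mulr_ge0 ?powR_ge0.
rewrite ![\sum_(i < J.+1) _]big_ord_recr/=; case: (s J); last by rewrite !mulr0 !addr0.
rewrite !mulr1.
have W0 : 0 <= \sum_(i < J) t ^+ i * (s i)%:R by apply: sumr_ge0 => i _; rewrite mulr_ge0// exprn_ge0// ltW.
apply: le_trans (_ : \sum_(i < J.+1) (t `^ q) ^+ i <= _).
  rewrite big_ord_recr/= -(powR_exprn q J (ltW t0)) lerD2r; apply: ler_sum => i _.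
  rewrite -(powR_exprn q i (ltW t0)); case: (s i); first by rewrite mulr1.
  by rewrite mulr0 powR_ge0.
apply: le_trans (sum_geometric_gt1 _ tq) _.
rewrite exprSr -mulrA mulrC ler_wpM2l// -(powR_exprn q J (ltW t0)).
by apply: ge0_ler_powR; rewrite ?nnegrE ?(ltW q0)// ?addr_ge0 ?exprn_ge0 ?(ltW t0)// lerDr.
Qed.

End geometric_sums.

(** * Tonelli's theorem for pairs of points at bounded distance *)

Section tonelli_cube.
Context {R : realType} {n : nat}.
Local Notation V := 'rV[R]_n.
Local Notation X := (borelRn R n).
Local Open Scope ereal_scope.

Lemma measurable_dist_le (r : R) : measurable [set xy : X * X | (`|(xy.1 : V) - xy.2| <= r)%R].
Proof.
have := @measurable_dist R n measurableT `]-oo, r]%classic (measurable_itv _).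
by rewrite setTI; congr (measurable _); apply/seteqP; split=> z /=; rewrite in_itv.
Qed.

Lemma tonelli_cube (mu nu : {measure set X -> \bar R}) (A B : set X) (r : R) (f : X * X -> \bar R) :
  sigma_finite setT mu -> sigma_finite setT nu -> measurable A -> measurable B ->
  measurable_fun setT f -> (forall z, 0 <= f z) ->
  \int[mu]_(x in A) \int[nu]_(y in B `&` cube (x : V) r) f (x, y) =
  \int[nu]_(y in B) \int[mu]_(x in A `&` cube (y : V) r) f (x, y).
Proof.
move=> smu snu mA mB mf f0.
pose D : set (X * X) := (A `*` B) `&` [set xy : X * X | (`|(xy.1 : V) - xy.2| <= r)%R].
have mD : measurable D by apply: measurableI; [exact: measurableX|exact: measurable_dist_le].
have mfD : measurable_fun setT (f \_ D).
  by have [h _] := measurable_restrictT f mD; apply: h; exact: measurable_funTS.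
have fD0 z : 0 <= (f \_ D) z by apply: erestrict_ge0.
have DE x y : ((x, y) \in D) = (x \in A) && (y \in B) && (`|(x : V) - y| <= r)%R.
  apply/idP/idP => [/set_mem[[Ax By] h]|/andP[/andP[/set_mem Ax /set_mem By] h]].
    by rewrite (mem_set (Ax : A x)) (mem_set (By : B y)).
  exact: mem_set.
have CE (x y : V) : (y \in cube x r) = (`|x - y| <= r)%R.
  by rewrite rV_distC; apply/idP/idP => [/set_mem//|h]; exact: mem_set.
transitivity (\int[mu]_x \int[nu]_y (f \_ D) (x, y)).
  rewrite integral_mkcond; apply: eq_integral => x _.
  rewrite patchE; case: ifPn => xA; last first.
    by rewrite integral0_eq// => y _; rewrite patchE DE (negbTE xA).
  rewrite integral_mkcond; apply: eq_integral => y _; rewrite !patchE DE xA /=.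
  by rewrite in_setI CE.
rewrite (tonelli smu snu mfD fD0) [RHS]integral_mkcond; apply: eq_integral => y _.
rewrite patchE; case: ifPn => yB; last first.
  by rewrite integral0_eq// => x _; rewrite patchE DE (negbTE yB) andbF.
rewrite [RHS]integral_mkcond; apply: eq_integral => x _; rewrite !patchE DE yB andbT.
by rewrite in_setI CE rV_distC.
Qed.

Lemma measurable_integral_cube (mu : {measure set X -> \bar R}) (A : set X) (r : R) (g : X -> \bar R) :
  sigma_finite setT mu -> measurable A -> measurable_fun setT g -> (forall x, 0 <= g x) ->
  measurable_fun [set: X] (fun y : X => \int[mu]_(x in A `&` cube (y : V) r) g x).
Proof.
move=> smu mA mg g0.
pose D : set (X * X) := (setT `*` A) `&` [set xy : X * X | (`|(xy.1 : V) - xy.2| <= r)%R].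
have mD : measurable D by apply: measurableI; [exact: measurableX|exact: measurable_dist_le].
pose f (w : X * X) := g w.2.
have mf : measurable_fun setT (f \_ D).
  have [h _] := measurable_restrictT f mD; apply: h; apply: measurable_funTS.
  exact: (measurableT_comp mg measurable_snd).
have f0 w : 0 <= (f \_ D) w by apply: erestrict_ge0 => z _; exact: g0.
have := measurable_integral2 smu mf f0; congr (measurable_fun _ _); apply/funext => y.
rewrite [RHS]integral_mkcond; apply: eq_integral => x _; rewrite !patchE; congr (if _ then _ else _).
apply/idP/idP => [/set_mem[[_ Ax] /= h]|/set_mem[Ax h]]; apply: mem_set.
  by split=> //; rewrite /cube /= rV_distC.
by split=> //=; rewrite rV_distC.
Qed.

Lemma tonelli_cube_prod (mu nu : {measure set X -> \bar R}) (A B : set X) (r : R) (g h : X -> \bar R) :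
  sigma_finite setT mu -> sigma_finite setT nu -> measurable A -> measurable B ->
  measurable_fun setT g -> measurable_fun setT h -> (forall x, 0 <= g x) -> (forall x, 0 <= h x) ->
  \int[mu]_(x in A) (g x * \int[nu]_(y in B `&` cube (x : V) r) h y) =
  \int[nu]_(y in B) (h y * \int[mu]_(x in A `&` cube (y : V) r) g x).
Proof.
move=> smu snu mA mB mg mh g0 h0.
pose f (w : X * X) := g w.1 * h w.2.
have mf : measurable_fun setT f.
  apply: emeasurable_funM.
    exact: (measurableT_comp mg measurable_fst).
  exact: (measurableT_comp mh measurable_snd).
have f0 w : 0 <= f w by rewrite mule_ge0.
have mK (C : set X) (z : X) : measurable C -> measurable (C `&` cube (z : V) r).
  by move=> mC; apply: measurableI => //; exact: measurable_cube.
transitivity (\int[mu]_(x in A) \int[nu]_(y in B `&` cube (x : V) r) f (x, y)).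
  apply: eq_integral => x _; rewrite -ge0_integralZl//; first exact: mK.
  exact: measurable_funTS.
rewrite tonelli_cube//; apply: eq_integral => y _; rewrite -ge0_integralZl//.
- by apply: eq_integral => x _; rewrite /f/= muleC.
- exact: mK.
- exact: measurable_funTS.
Qed.

End tonelli_cube.

(** * Summing the scales of a gradient near a porous set *)

Section trace_sums.
Context {R : realType} {n : nat}.
Local Notation V := 'rV[R]_n.
Local Notation X := (borelRn R n).
Local Notation L := (@lebesgueRn R n).
Variables (p : R) (m : nat).
Hypotheses (n0 : (0 < n)%N) (pn : n%:R < p) (m6 : (6 <= m)%N).
Variables (sigma : {measure set X -> \bar R}) (E : set V).
Hypothesis sfin : forall z r, (sigma (cube z r) < +oo)%E.
Hypotheses (cE : closed E) (hE : has_holes m E).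
Local Notation scale := (@scale R m).
Local Notation grad_mass := (@grad_mass R n m).
Implicit Types (G : V -> V) (x z : V).

Let mE : @measurable _ X E. Proof. exact: closed_measurableRn. Qed.
Let p1 : 1 < p. Proof. by rewrite (le_lt_trans _ pn)// ler1n. Qed.
Let p0 : 0 < p. Proof. by rewrite (lt_trans _ p1). Qed.
Let m0 : (0 < m)%N. Proof. exact: leq_trans m6. Qed.
Let mr6 : 6 <= m%:R :> R. Proof. by rewrite ler_nat. Qed.

(* [porosity_loss] is the fraction of the volume surviving one subdivision;
   [growth] is chosen strictly between 1 and its inverse. *)
Definition porosity_loss : R := 1 - (m%:R ^+ n)^-1.
Definition growth : R := 2 / (1 + porosity_loss).

Lemma porosity_loss01 : 0 <= porosity_loss < 1.
Proof.
have mn : 1 <= m%:R ^+ n :> R by rewrite exprn_ege1// (le_trans _ mr6)// ler1n.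
have i0 : 0 < (m%:R ^+ n)^-1 :> R by rewrite invr_gt0 (lt_le_trans ltr01).
have i1 : (m%:R ^+ n)^-1 <= 1 :> R by rewrite invf_le1 ?(lt_le_trans ltr01).
by rewrite /porosity_loss; apply/andP; split; lra.
Qed.

Lemma growth_gt1 : 1 < growth.
Proof.
have /andP[t0 t1] := porosity_loss01.
by rewrite /growth ltr_pdivlMr ?mul1r; lra.
Qed.

Lemma growth_loss_lt1 : growth * porosity_loss < 1.
Proof.
have /andP[t0 t1] := porosity_loss01.
by rewrite /growth mulrAC ltr_pdivrMr ?mul1r; lra.
Qed.

(** Of the order of [growth ^+ i] for the largest i < J whose neighbourhood contains z. The bound J
    keeps the weight finite on E; the estimates are uniform in J. *)
Definition tube_weight J z : R := \sum_(i < J) growth ^+ i * (z \in tube E (3 * scale i))%:R.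

Lemma tube_weight_ge0 J z : 0 <= tube_weight J z.
Proof. by apply: sumr_ge0 => i _; rewrite mulr_ge0// exprn_ge0// (le_trans ler01)// ltW// growth_gt1. Qed.

Lemma tube_weight_gt0 J x z i : (i < J)%N -> E x -> cube x (2 * scale i) z -> 0 < tube_weight J z.
Proof.
move=> iJ Ex xz; have g0 : 0 < growth by rewrite (lt_trans _ growth_gt1).
have si : 0 < scale i := scale_gt0 m6 i.
have zt : tube E (3 * scale i) z by exists x => //; apply: le_lt_trans xz _; lra.
rewrite /tube_weight (bigD1 (Ordinal iJ))//= mem_set// mulr1.
by rewrite ltr_wpDr ?exprn_gt0// sumr_ge0// => j _; rewrite mulr_ge0// exprn_ge0// ltW.
Qed.

Lemma measurable_tube_weight J : measurable_fun [set: X] (tube_weight J : X -> R).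
Proof.
rewrite /tube_weight; apply: measurable_sum => i; apply: measurable_funM => //.
exact: measurable_indic (measurable_tube _ _).
Qed.

Definition weight_const : R :=
  (1 + growth / (1 - growth * porosity_loss) + (growth - 1)^-1) * 4 ^+ n.

Lemma weight_const_gt0 : 0 < weight_const.
Proof.
have g1 := growth_gt1; have g2 := growth_loss_lt1.
rewrite mulr_gt0 ?exprn_gt0// ltr_pwDl ?invr_ge0 ?subr_ge0 ?(ltW g1)//.
by rewrite ltr_pwDl// divr_ge0 ?subr_ge0 ?ltW// (lt_trans _ g1).
Qed.

(** One generation is given up so that the radius 3 scale l fits below 2 scale i / m^(l-i-1) = 2 m
    scale l. *)
Lemma measure_cube_tube_scale x i l :
  (L (cube x (2 * scale i) `&` tube E (3 * scale l)) <=
    (porosity_loss ^+ (l - i.+1) * (4 ^+ n * scale i ^+ n))%:E)%E.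
Proof.
have si : 0 < scale i := scale_gt0 m6 i; have s1 : scale i <= 1 := scale_le1 m6 i.
have r2 : 0 < 2 * scale i <= 2 by apply/andP; split; lra.
have mr : 0 < m%:R :> R by rewrite (lt_le_trans _ mr6).
have h4 : 4 ^+ n * scale i ^+ n = ((2 * scale i) *+ 2) ^+ n.
  by rewrite -exprMn; congr (_ ^+ n); lra.
case: (ltnP i l) => il; last first.
  have /eqP -> : (l - i.+1 == 0)%N by rewrite subn_eq0 leqW.
  rewrite expr0 mul1r h4 -(lebesgueRn_cube x (andP r2).1); apply: le_measure; rewrite ?inE.
  - by apply: measurableI; [exact: measurable_cube|exact: measurable_tube].
  - exact: measurable_cube.
  - exact: subIsetl.
rewrite h4; apply: le_trans _ (measure_cube_tube (l - i.+1) x m0 hE r2).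
apply: le_measure; rewrite ?inE.
- by apply: measurableI; [exact: measurable_cube|exact: measurable_tube].
- by apply: measurableI; [exact: measurable_cube|exact: measurable_tube].
move=> z [zc zt]; split=> //; apply: tube_le zt.
have e : scale i = m%:R ^+ (l - i) * scale l by rewrite (scale_add m6 i (l - i)) subnKC// ltnW.
have -> : 2 * scale i / m%:R ^+ (l - i.+1) = 2 * (m%:R * scale l).
  rewrite e -(subnSK il) exprS; field; by rewrite expf_neq0// gt_eqF.
have sl : 0 < scale l := scale_gt0 m6 l.
by rewrite mulrA ler_wpM2r ?(ltW sl)//; have := mr6 => ?; lra.
Qed.

(** Finer neighbourhoods weigh more, but fill only a fraction [porosity_loss ^+ (l - i.+1)] of the
    cube, and [growth * porosity_loss < 1]. The weight thus integrates, up to a constant, like the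
    constant function [growth ^+ i]. *)
Lemma integral_tube_weight J x i :
  (\int[L]_(z in cube x (2 * scale i)) (tube_weight J z)%:E <= (weight_const * (growth ^+ i * scale i ^+ n))%:E)%E.
Proof.
have mK := @measurable_cube R n x (2 * scale i); have g1 := growth_gt1.
have g0 : 0 < growth by rewrite (lt_trans _ g1).
have mt l : measurable_fun [set: X] (fun z : X => (growth ^+ l * (z \in tube E (3 * scale l))%:R)).
  by apply: measurable_funM => //; exact: measurable_indic (measurable_tube _ _).
under eq_integral => z _ do rewrite /tube_weight -sumEFin.
rewrite ge0_integral_sum//; last 2 first.
- by move=> l; apply: measurable_funTS; apply/measurable_EFinP; exact: mt.
- by move=> l z _; rewrite lee_fin mulr_ge0// exprn_ge0// ltW.
apply: (@le_trans _ _ (\sum_(l < J) (growth ^+ l * (porosity_loss ^+ (l - i.+1) * (4 ^+ n * scale i ^+ n)))%:E)%E).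
  apply: lee_sum => l _; under eq_integral do rewrite EFinM.
  rewrite ge0_integralZl_EFin ?exprn_ge0 ?(ltW g0)//; last first.
    by apply: measurable_funTS; apply/measurable_EFinP; exact: measurable_indic (measurable_tube _ _).
  rewrite [in leRHS]EFinM lee_wpmul2l ?lee_fin ?exprn_ge0 ?(ltW g0)//.
  have := @integral_indic _ _ _ L _ mK _ (measurable_tube E (3 * scale l)) => /= h.
  by rewrite h setIC measure_cube_tube_scale.
rewrite sumEFin lee_fin; under eq_bigr do rewrite mulrA.
rewrite -mulr_suml /weight_const [leRHS](_ : _ =
  (1 + growth / (1 - growth * porosity_loss) + (growth - 1)^-1) * growth ^+ i * (4 ^+ n * scale i ^+ n)); last by ring.
apply: ler_wpM2r; first by rewrite mulr_ge0 ?exprn_ge0// ltW// scale_gt0.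
by have /andP[? _] := porosity_loss01; apply: sum_porous_le => //; exact: growth_loss_lt1.
Qed.

(** Up to a constant, the p-th power of the mean of the gradient over a cube at x, times the ratio
    of Lebesgue mass to sigma mass at that scale. *)
Definition trace_term G i x : \bar R :=
  ((scale i ^+ n / fine (sigma (cube x (scale i))))%:E * ((scale i ^- n)%:E * grad_mass G x i) `^ p)%E.

Lemma trace_term_ge0 G i x : (0 <= trace_term G i x)%E.
Proof.
by rewrite mule_ge0 ?poweR_ge0// lee_fin divr_ge0 ?fine_sigma_ge0// exprn_ge0// ltW// scale_gt0.
Qed.

Let powR_cancel (S : R) : 0 < S -> S * S^-1 `^ p * S `^ (p - 1) = 1.
Proof.
move=> S0; rewrite powRVn// -opprB powRN powR_1B// invf_div.
have Sp := lt0r_neq0 (powR_gt0 p S0); have S1 := lt0r_neq0 S0.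
by rewrite mulrA divfK// divff.
Qed.

Definition jensen_const : R := 2 `^ p * weight_const `^ (p - 1).

Lemma trace_term_le J i x G : (i < J)%N -> E x -> measurable_fun [set: X] (fun z : X => `|G z|) ->
  (trace_term G i x <= ((fine (sigma (cube x (scale i))))^-1)%:E *
    ((jensen_const * (growth ^+ i) `^ (p - 1))%:E *
     \int[L]_(z in cube x (2 * scale i)) (`|G z| `^ p * tube_weight J z `^ (1 - p))%:E))%E.
Proof.
move=> iJ Ex mG; have g0 : 0 < growth by rewrite (lt_trans _ growth_gt1).
have si : 0 < scale i := scale_gt0 m6 i.
have S0 : 0 < scale i ^+ n by rewrite exprn_gt0.
have T0 : 0 < growth ^+ i by rewrite exprn_gt0.
have wc := weight_const_gt0.
have := @weighted_jensen _ _ R L (cube x (2 * scale i)) p (fun z => `|G z|) (tube_weight J)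
  (weight_const * (growth ^+ i * scale i ^+ n)) (@measurable_cube R n x _) p1
  (measurable_funTS mG) (measurable_funTS (measurable_tube_weight J)) (fun z _ => rV_norm_ge0 (G z))
  (fun z xz => tube_weight_gt0 iJ Ex xz).
have j0 : 0 < weight_const * (growth ^+ i * scale i ^+ n) := mulr_gt0 wc (mulr_gt0 T0 S0).
move=> /(_ j0 (integral_tube_weight _ _ _)); set H := (X in (_ <= _ * X)%E) => hJ.
have H0 : (0 <= H)%E.
  by apply: integral_ge0 => z _; rewrite lee_fin mulr_ge0 ?powR_ge0.
have sg : 0 <= (fine (sigma (cube x (scale i))))^-1 by rewrite invr_ge0 fine_sigma_ge0.
rewrite /trace_term; have Si0 : 0 <= scale i ^- n by rewrite invr_ge0 ltW.
rewrite (poweR_EFinM p Si0 (grad_mass_ge0 _ _ _ _)) muleA -EFinM.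
apply: (@le_trans _ _ ((scale i ^+ n / fine (sigma (cube x (scale i))) * (scale i ^- n) `^ p)%:E *
   ((2 `^ p * (weight_const * (growth ^+ i * scale i ^+ n)) `^ (p - 1))%:E * H))%E).
  apply: lee_wpmul2l => //; rewrite lee_fin mulr_ge0 ?powR_ge0// mulr_ge0// ltW//.
rewrite !muleA -!EFinM; apply: lee_wpmul2r => //; rewrite lee_fin.
rewrite (powRM _ (ltW wc) (mulr_ge0 (ltW T0) (ltW S0))) (powRM _ (ltW T0) (ltW S0)).
rewrite /jensen_const; have := powR_cancel S0.
move: ((scale i ^+ n)^-1 `^ p) ((scale i ^+ n) `^ (p - 1)) ((growth ^+ i) `^ (p - 1)) => A B T AB.
rewrite le_eqVlt; apply/orP; left; apply/eqP.
move: (2 `^ p) (weight_const `^ (p - 1)) ((fine (sigma (cube x (scale i))))^-1) => a b c.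
by rewrite -[in RHS](mulr1 (c * _)) -AB; ring.
Qed.

Definition trace_const : R := jensen_const * 4 ^+ n * (growth `^ (p - 1) / (growth `^ (p - 1) - 1)).

Let inv_sigma i x : R := (fine (sigma (cube x (scale i))))^-1.

Let inv_sigma_ge0 i x : 0 <= inv_sigma i x.
Proof. by rewrite invr_ge0 fine_sigma_ge0. Qed.

Let measurable_inv_sigma i : measurable_fun [set: X] (inv_sigma i : X -> R).
Proof.
apply: measurable_inv_ge0; first by move=> x; exact: fine_sigma_ge0.
exact: measurable_fine_sigma_cube.
Qed.

Let ssig : sigma_finite setT sigma. Proof. exact: sigma_finite_sigma. Qed.
Let sleb : sigma_finite setT L. Proof. exact: sigma_finite_lebesgueRn. Qed.

(** After Jensen and Tonelli the inner integral is that of inverse masses over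
    [cube z (2 * scale i)]: it is at most 4^n, and 0 unless z lies in the i-th neighbourhood of
    E. *)
Lemma integral_trace_term J i G : (i < J)%N -> measurable_fun [set: X] (fun z : X => `|G z|) ->
  (\int[sigma]_(x in E) trace_term G i x <=
   \int[L]_z (jensen_const * 4 ^+ n * (`|G z| `^ p * tube_weight J z `^ (1 - p)) *
     ((growth ^+ i) `^ (p - 1) * (z \in tube E (3 * scale i))%:R))%:E)%E.
Proof.
move=> iJ mG; have si : 0 < scale i := scale_gt0 m6 i.
pose C : R := jensen_const * (growth ^+ i) `^ (p - 1).
have C0 : 0 <= C by rewrite mulr_ge0 ?powR_ge0// mulr_ge0 ?powR_ge0.
pose h (z : V) : R := `|G z| `^ p * tube_weight J z `^ (1 - p).
have h0 z : 0 <= h z by rewrite mulr_ge0 ?powR_ge0.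
have mh : measurable_fun [set: X] (h : X -> R).
  apply: measurable_funM; apply: measurable_fun_powR => //.
  exact: measurable_tube_weight.
have mhE : measurable_fun [set: X] (EFin \o (h : X -> R)) by apply/measurable_EFinP.
have hE0 z : (0 <= (h z)%:E)%E by rewrite lee_fin.
have miE : measurable_fun [set: X] (EFin \o (inv_sigma i : X -> R)) by apply/measurable_EFinP.
have iE0 z : (0 <= (inv_sigma i z)%:E)%E by rewrite lee_fin.
have mhx x r : measurable_fun (cube (x : V) r : set X) (fun z => (h z)%:E).
  by apply: measurable_funTS; apply/measurable_EFinP.
apply: (@le_trans _ _ (C%:E * \int[sigma]_(x in E) ((inv_sigma i x)%:E * \int[L]_(z in setT `&` cube (x : V) (2 * scale i)) (h z)%:E))%E).
  have mi : measurable_fun [set: X] (fun x : X => ((inv_sigma i x)%:E * \int[L]_(z in setT `&` cube (x : V) (2 * scale i)) (h z)%:E)%E).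
    apply: emeasurable_funM; first exact/measurable_EFinP.
    exact: (measurable_integral_cube _ sleb measurableT mhE hE0).
  rewrite -ge0_integralZl_EFin//; last 2 first.
  - move=> x _; rewrite mule_ge0 ?lee_fin//; by apply: integral_ge0 => z _; rewrite lee_fin.
  - exact: measurable_funTS.
  apply: le_ge0_integral => x Ex; first exact: trace_term_ge0.
  by apply: le_trans (trace_term_le iJ Ex mG) _; rewrite setTI muleCA.
rewrite (tonelli_cube_prod _ ssig sleb mE measurableT miE mhE iE0 hE0).
have mi : measurable_fun [set: X] (fun z : X => ((h z)%:E * \int[sigma]_(x in E `&` cube (z : V) (2 * scale i)) (inv_sigma i x)%:E)%E).
  apply: emeasurable_funM; first exact/measurable_EFinP.
  exact: (measurable_integral_cube _ ssig mE miE iE0).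
rewrite -ge0_integralZl_EFin//; last first.
  by move=> z _; rewrite mule_ge0 ?lee_fin//; apply: integral_ge0 => x _; rewrite lee_fin.
apply: le_ge0_integral => z _.
  by rewrite mule_ge0 ?lee_fin// mule_ge0 ?lee_fin//; apply: integral_ge0 => x _; rewrite lee_fin.
rewrite muleA -EFinM.
have [zt|zt] := boolP ((z : V) \in tube E (3 * scale i)).
  apply: (@le_trans _ _ ((C * h z)%:E * ((2 * 2)%:R ^+ n)%:E)%E).
    apply: lee_wpmul2l; first by rewrite lee_fin; exact: mulr_ge0 C0 (h0 z).
    exact: (integral_inv_sigma_le sfin mE (z : V) si (isT : 0 < 2)%N).
  rewrite -EFinM lee_fin mulr1 /C -/(h z) (_ : (2 * 2)%N = 4%N)// le_eqVlt; apply/orP; left; apply/eqP.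
  by move: (h z) ((growth ^+ i) `^ (p - 1)) (4 ^+ n) jensen_const => a b c d; ring.
rewrite (_ : E `&` cube (z : V) (2 * scale i) = set0); last first.
  apply/seteqP; split=> // x [Ex xz]; move/negP : zt; apply; apply: mem_set; exists x => //.
  by move: xz; rewrite /cube /= rV_distC => ?; lra.
by rewrite integral_set0 mule0 !mulr0.
Qed.

Lemma trace_const_ge0 : 0 <= trace_const.
Proof.
have g0 : 0 < growth by rewrite (lt_trans _ growth_gt1).
have gq : 1 < growth `^ (p - 1).
  rewrite -[ltLHS](one_powR (p - 1)); apply: gt0_ltr_powR; rewrite ?nnegrE ?(ltW g0)// ?growth_gt1//.
  by rewrite subr_gt0.
apply: mulr_ge0; last by rewrite divr_ge0 ?powR_ge0// subr_ge0 ltW.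
by apply: mulr_ge0; rewrite ?exprn_ge0// mulr_ge0 ?powR_ge0.
Qed.

(** Over the neighbourhoods that contain z, the (p-1)-st powers of [growth ^+ i] add up to at most a
    multiple of the (p-1)-st power of [tube_weight], by [sum_indicator_power]. This cancels the
    weight left by Jensen's inequality, and the bound is uniform in J. *)
Lemma sum_trace_term J G : measurable_fun [set: X] (fun z : X => `|G z|) ->
  (\sum_(i < J) \int[sigma]_(x in E) trace_term G i x <= trace_const%:E * \int[L]_z (`|G z| `^ p)%:E)%E.
Proof.
move=> mG; have g0 : 0 < growth by rewrite (lt_trans _ growth_gt1).
have q0 : 0 < p - 1 by rewrite subr_gt0.
have jc : 0 <= jensen_const * 4 ^+ n by rewrite mulr_ge0 ?exprn_ge0// mulr_ge0 ?powR_ge0.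
have gq : 1 < growth `^ (p - 1).
  by rewrite -[ltLHS](one_powR (p - 1)); apply: gt0_ltr_powR; rewrite ?nnegrE ?(ltW g0)// growth_gt1.
have c0 : 0 <= growth `^ (p - 1) / (growth `^ (p - 1) - 1) by rewrite divr_ge0 ?powR_ge0// subr_ge0 ltW.
apply: le_trans (lee_sum _ (fun (i : 'I_J) _ => integral_trace_term (ltn_ord i) mG)) _.
have mGp : measurable_fun [set: X] (fun z : X => `|G z| `^ p) by exact: measurable_fun_powR.
have tc := trace_const_ge0.
rewrite -(ge0_integralZl_EFin _ _ _ _ tc)//; last exact/measurable_EFinP.
have t0 (i : nat) z : 0 <= jensen_const * 4 ^+ n * (`|G z| `^ p * tube_weight J z `^ (1 - p)) *
    ((growth ^+ i) `^ (p - 1) * (z \in tube E (3 * scale i))%:R).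
  by apply: mulr_ge0; [apply: mulr_ge0 => //; exact: mulr_ge0 (powR_ge0 _ _) (powR_ge0 _ _)|rewrite mulr_ge0 ?powR_ge0].
rewrite -ge0_integral_sum//; last 2 first.
- move=> i; apply/measurable_EFinP; apply: measurable_funM; apply: measurable_funM => //.
    apply: measurable_funM => //; apply: measurable_fun_powR; exact: measurable_tube_weight.
  exact: measurable_indic (measurable_tube _ _).
- by move=> i z _; rewrite lee_fin; exact: t0.
apply: le_ge0_integral => z _; first by apply: sume_ge0 => i _; rewrite lee_fin; exact: t0.
rewrite sumEFin -EFinM lee_fin -mulr_sumr /trace_const.
have h := sum_indicator_power (fun i => z \in tube E (3 * scale i)) J growth_gt1 q0.
have W0 := tube_weight_ge0 J z; rewrite -/(tube_weight J z) in h.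
have hW : tube_weight J z `^ (1 - p) * (\sum_(i < J) (growth ^+ i) `^ (p - 1) * (z \in tube E (3 * scale i))%:R) <=
    growth `^ (p - 1) / (growth `^ (p - 1) - 1).
  (* Where the weight is 0, its power of exponent 1 - p is 0 by convention, the exponent being
     nonzero. *)
  move: W0 h; rewrite le_eqVlt => /predU1P[<- _|W0 h].
    by rewrite powR0 ?mul0r// lt_eqF// subr_lt0.
  apply: le_trans (ler_wpM2l (powR_ge0 _ _) h) _.
  by rewrite mulrCA -[1 - p]opprB powRN mulVf ?mulr1// gt_eqF// powR_gt0.
rewrite -(mulrA (jensen_const * 4 ^+ n)) -[leRHS]mulrA; apply: ler_wpM2l => //.
by rewrite -mulrA [leRHS]mulrC; apply: ler_wpM2l; first exact: powR_ge0.
Qed.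

End trace_sums.

Lemma nneseries_le_bound (R : realType) (u : nat -> \bar R) (B : \bar R) :
  (forall k, 0 <= u k)%E -> (forall J, \sum_(i < J) u i <= B)%E -> (\sum_(0 <= i <oo) u i <= B)%E.
Proof.
move=> u0 uB; apply: lime_le; first exact: is_cvg_nneseries.
by apply: nearW => J; rewrite big_mkord.
Qed.

(** * Trace inequalities for the Besov and L_p terms *)

Section trace_bounds.
Context {R : realType} {n : nat}.
Local Notation V := 'rV[R]_n.
Local Notation X := (borelRn R n).
Local Notation L := (@lebesgueRn R n).
Variables (p M : R) (m : nat).
Hypotheses (n0 : (0 < n)%N) (pn : n%:R < p) (m6 : (6 <= m)%N).
Hypotheses (M0 : 0 < M) (hM : forall t : R, dstep t <= M).
Variables (sigma : {measure set X -> \bar R}) (E : set V).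
Hypothesis sfin : forall z r, (sigma (cube z r) < +oo)%E.
Hypotheses (cE : closed E) (hE : has_holes m E).
Variables (Cs C1 C2 : R).
Hypotheses (Cs0 : 0 < Cs) (C10 : 0 < C1) (C20 : 0 < C2).
Hypothesis spos : forall x r, E x -> 0 < r -> (0 < sigma (cube x r))%E.
Hypothesis sdbl : forall (x : V) (r k : R), E x -> 0 < r <= 1 -> 1 <= k <= r^-1 ->
  (sigma (cube x (k * r)) <= (Cs * k ^+ n)%:E * sigma (cube x r))%E.
Hypothesis sone : forall x : V, E x -> (C1%:E <= sigma (cube x 1) <= C2%:E)%E.
Local Notation scale := (@scale R m).
Local Notation ratio := (@ratio R n p m).
Local Notation trace_const := (@trace_const R n p m).
Local Notation pointwise_const := (@pointwise_const R n p M m).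
Local Notation value_const := (@value_const R n p M m).
Local Notation osc := (@osc R n p m).
Local Notation trace_term := (@trace_term R n p m sigma).
Implicit Types (F : V -> R) (G : V -> V) (x y z : V).

Let mE : @measurable _ X E. Proof. exact: closed_measurableRn. Qed.
Let p1 : 1 < p. Proof. by rewrite (le_lt_trans _ pn)// ler1n. Qed.
Let p0 : 0 < p. Proof. by rewrite (lt_trans _ p1). Qed.
Let m0 : (0 < m)%N. Proof. exact: leq_trans m6. Qed.
Let mr0 : 0 < m%:R :> R. Proof. by rewrite ltr0n. Qed.
Let ssig : sigma_finite setT sigma. Proof. exact: sigma_finite_sigma. Qed.
Let sleb : sigma_finite setT L. Proof. exact: sigma_finite_lebesgueRn. Qed.

Lemma fine_sigma_gt0 x r : E x -> 0 < r -> 0 < fine (sigma (cube x r)).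
Proof. by move=> Ex r0; rewrite fine_gt0// spos//= sfin. Qed.

Let sg k x : R := fine (sigma (cube x (scale k))).

Let sg0 k x : E x -> 0 < sg k x.
Proof. by move=> Ex; rewrite fine_sigma_gt0// scale_gt0. Qed.

(** The bound [osc] for differences at scale k, divided as in the Besov kernel by the power p - n of
    the scale and by one of the two masses; the other mass enters in [osc_kernel]. *)
Definition weighted_osc G k x : \bar R :=
  ((scale k `^ (n%:R - p) / fine (sigma (cube x (scale k))))%:E * osc G k x)%E.

Lemma weighted_osc_ge0 G k x : (0 <= weighted_osc G k x)%E.
Proof.
by rewrite mule_ge0 ?osc_ge0// lee_fin mulr_ge0 ?powR_ge0// invr_ge0 fine_sigma_ge0.
Qed.

(** By [ratio_sqr], passing from scale k to scale k + j in the power n - p yields [ratio] twice to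
    the power j: one factor cancels the weight of the chain, the other survives and makes the sum
    over j converge. *)
Let scale_ratio k j :
  scale k `^ (n%:R - p) * (ratio ^- j * scale (k + j) `^ p) = ratio ^+ j * scale (k + j) ^+ n.
Proof.
have sk : 0 < scale (k + j) := scale_gt0 m6 (k + j).
have /andP[q0 _] := ratio01 pn m6.
rewrite (scale_add m6 k j) powRM ?exprn_ge0 ?(ltW mr0) ?(ltW sk)//.
rewrite (powR_exprn _ _ (ltW mr0)) -(ratio_sqr p m6) exprMn.
have -> : scale (k + j) ^+ n = scale (k + j) `^ (n%:R - p) * scale (k + j) `^ p.
  by rewrite -powRD ?subrK ?powR_mulrn ?(ltW sk)// (gt_eqF sk) implybT.
have qj : ratio ^+ j != 0 by rewrite expf_neq0// gt_eqF.
move: (ratio ^+ j) qj (scale (k + j) `^ (n%:R - p)) (scale (k + j) `^ p) => q q00 a b.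
by field.
Qed.

Lemma weighted_osc_le G k x : E x ->
  (weighted_osc G k x <= \sum_(0 <= j <oo) (ratio ^+ j)%:E * trace_term G (k + j) x)%E.
Proof.
move=> Ex; have /andP[q0 _] := ratio01 pn m6.
have sk : 0 < scale k := scale_gt0 m6 k.
rewrite /weighted_osc /osc -nneseriesZl; last by move=> j _; exact: osc_term_ge0.
apply: lee_nneseries => [j _|j _].
  rewrite mule_ge0 ?osc_term_ge0// lee_fin mulr_ge0 ?powR_ge0// invr_ge0 fine_sigma_ge0//.
have skj : 0 < scale (k + j) := scale_gt0 m6 (k + j).
have -> : ((scale (k + j) ^- n.-1)%:E * grad_mass m G x (k + j) =
           (scale (k + j))%:E * ((scale (k + j) ^- n)%:E * grad_mass m G x (k + j)))%E.
  rewrite muleA -EFinM; congr (_%:E * _)%E; rewrite -[in RHS](prednK n0) exprS invfM mulrA.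
  by rewrite divff ?mul1r// gt_eqF.
set T := ((scale (k + j) ^- n)%:E * _)%E.
have T0 : (0 <= T)%E by rewrite mule_ge0 ?grad_mass_ge0// lee_fin invr_ge0 exprn_ge0// ltW.
rewrite (poweR_EFinM _ (ltW skj) T0) /trace_term -/T !muleA -!EFinM.
apply: lee_wpmul2r; first exact: poweR_ge0.
rewrite lee_fin -mulrA mulrAC scale_ratio mulrA; apply: ler_wpM2l.
  by rewrite mulr_ge0 ?exprn_ge0// ltW.
rewrite lef_pV2 ?posrE ?sg0//; apply: fine_sigma_le => //; apply: cube_subset.
rewrite subrr normr0 add0r (scale_add m6 k j) ler_peMl ?(ltW skj)// exprn_ege1// ler1n//.
Qed.

Lemma measurable_grad_mass G i : measurable_fun [set: X] (fun z : X => `|G z|) ->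
  measurable_fun [set: X] (fun x : X => grad_mass m G x i).
Proof.
move=> mG; have mG' : measurable_fun [set: X] (fun z : X => `|G z|%:E) by apply/measurable_EFinP.
have G0 (z : X) : (0 <= `|G z|%:E)%E by rewrite lee_fin rV_norm_ge0.
have := measurable_integral_cube (2 * scale i) sleb measurableT mG' G0.
by congr (measurable_fun _ _); apply/funext => x; rewrite setTI.
Qed.

Let measurable_sg k : measurable_fun [set: X] (fun x : X => sg k (x : V)).
Proof. exact: measurable_fine_sigma_cube. Qed.

Let measurable_inv_sg k : measurable_fun [set: X] (fun x : X => ((sg k (x : V))^-1)%:E).
Proof.
apply/measurable_EFinP; apply: measurable_inv_ge0 => //.
by move=> x; exact: fine_sigma_ge0.
Qed.

Let inv_sg0 k x : (0 <= ((sg k x)^-1)%:E)%E.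
Proof. by rewrite lee_fin invr_ge0 fine_sigma_ge0. Qed.

Lemma measurable_trace_term G i : measurable_fun [set: X] (fun z : X => `|G z|) ->
  measurable_fun [set: X] (trace_term G i : X -> \bar R).
Proof.
move=> mG; apply: emeasurable_funM.
  apply/measurable_EFinP; apply: measurable_funM => //.
  by have /measurable_EFinP := measurable_inv_sg i.
apply: (measurableT_comp (measurable_poweR p)); apply: measurable_funeM.
exact: measurable_grad_mass.
Qed.

Lemma measurable_weighted_osc G k : measurable_fun [set: X] (fun z : X => `|G z|) ->
  measurable_fun [set: X] (weighted_osc G k : X -> \bar R).
Proof.
move=> mG; apply: emeasurable_funM.
  apply/measurable_EFinP; apply: measurable_funM => //.
  by have /measurable_EFinP := measurable_inv_sg k.
apply: ge0_emeasurable_sum => [j x _ _|j _]; first exact: osc_term_ge0.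
apply: measurable_funeM; apply: (measurableT_comp (measurable_poweR p)); apply: measurable_funeM.
exact: measurable_grad_mass.
Qed.

(** For fixed j the sum over k is a tail of the sum of all trace terms. Exchanging the two sums
    therefore costs only the geometric series in [ratio]. *)
Lemma sum_weighted_osc G : measurable_fun [set: X] (fun z : X => `|G z|) ->
  (\sum_(0 <= k <oo) \int[sigma]_(x in E) weighted_osc G k x <=
   ((1 - ratio)^-1 * trace_const)%:E * \int[L]_z (`|G z| `^ p)%:E)%E.
Proof.
move=> mG; have /andP[q0 q1] := ratio01 pn m6.
pose T i : \bar R := (\int[sigma]_(x in E) trace_term G i x)%E.
have T0 i : (0 <= T i)%E by apply: integral_ge0 => x _; exact: trace_term_ge0.
set B := (\int[L]_z _)%E; have B0 : (0 <= B)%E by apply: integral_ge0 => z _; rewrite lee_fin powR_ge0.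
have TB J : (\sum_(i < J) T i <= (trace_const)%:E * B)%E by exact: sum_trace_term.
have h1 k : (\int[sigma]_(x in E) weighted_osc G k x <= \sum_(0 <= j <oo) (ratio ^+ j)%:E * T (k + j)%N)%E.
  apply: (@le_trans _ _ (\int[sigma]_(x in E) (\sum_(0 <= j <oo) (ratio ^+ j)%:E * trace_term G (k + j) x))%E).
    by apply: le_ge0_integral => x Ex; [exact: weighted_osc_ge0|exact: weighted_osc_le].
  rewrite integral_nneseries//; last 2 first.
  - by move=> j; apply: measurable_funTS; apply: measurable_funeM; exact: measurable_trace_term.
  - by move=> j x _; rewrite mule_ge0 ?trace_term_ge0// lee_fin exprn_ge0// ltW.
  apply: lee_nneseries => [j _ _|j _].
    by apply: integral_ge0 => x _; rewrite mule_ge0 ?trace_term_ge0// lee_fin exprn_ge0// ltW.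
  rewrite ge0_integralZl_EFin ?exprn_ge0 ?(ltW q0)//.
  - by move=> x _; exact: trace_term_ge0.
  - by apply: measurable_funTS; exact: measurable_trace_term.
apply: (@le_trans _ _ (\sum_(0 <= k <oo) \sum_(0 <= j <oo) (ratio ^+ j)%:E * T (k + j)%N)%E).
  by apply: lee_nneseries => [k _ _|k _]; [apply: integral_ge0 => x _; exact: weighted_osc_ge0|exact: h1].
have t0 k j : (0 <= (ratio ^+ j)%:E * T (k + j)%N)%E by rewrite mule_ge0// lee_fin exprn_ge0// ltW.
rewrite nneseries_interchange//; apply: nneseries_le_bound.
  by move=> j; apply: nneseries_ge0 => k _ _; exact: t0.
move=> J; apply: (@le_trans _ _ (\sum_(j < J) (ratio ^+ j)%:E * ((trace_const)%:E * B))%E).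
  apply: lee_sum => j _; rewrite nneseriesZl//; apply: lee_wpmul2l; first by rewrite lee_fin exprn_ge0// ltW.
  apply: nneseries_le_bound => // K; apply: le_trans (TB (j + K)%N).
  rewrite big_split_ord/= -[leLHS]add0e; apply: leeD; first exact: sume_ge0.
  by apply: lee_sum => k _; rewrite addnC.
rewrite -ge0_sume_distrl; last by move=> j _; rewrite lee_fin exprn_ge0// ltW.
rewrite sumEFin [X in (_ <= X * _)%E]EFinM -[X in (_ <= X)%E]muleA; apply: lee_wpmul2r.
  by apply: le_trans (TB 0%N); rewrite big_ord0.
by rewrite lee_fin sum_geometric_lt1// (ltW q0).
Qed.

(** Doubling compares the masses at nearby centres for k > 0. At k = 0 the doubled cube leaves the
    range of the doubling condition, and the two-sided bounds at radius 1 give the quotient C2 /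
    C1. *)
Definition comparison_const : R := Cs * 2 ^+ n + C2 / C1.

Lemma comparison_const_gt0 : 0 < comparison_const.
Proof. by rewrite addr_gt0 ?divr_gt0// mulr_gt0// exprn_gt0. Qed.

Lemma sigma_cube1_le x : E x -> fine (sigma (cube x 1)) <= C2.
Proof. by move=> Ex; have /andP[_ h] := sone Ex; rewrite -lee_fin fineK// fin_sigma. Qed.

Lemma sigma_cube1_ge x : E x -> C1 <= fine (sigma (cube x 1)).
Proof. by move=> Ex; have /andP[h _] := sone Ex; rewrite -lee_fin fineK// fin_sigma. Qed.

Lemma sigma_double x (r k : R) : E x -> 0 < r <= 1 -> 1 <= k <= r^-1 ->
  fine (sigma (cube x (k * r))) <= Cs * k ^+ n * fine (sigma (cube x r)).
Proof.
move=> Ex hr hk; have := sdbl Ex hr hk.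
by rewrite -[sigma (cube x (k * r))]fineK ?fin_sigma// -[sigma (cube x r)]fineK ?fin_sigma// -EFinM lee_fin.
Qed.

Let sg_compare k x y : E x -> E y -> `|x - y| <= scale k -> sg k y <= comparison_const * sg k x.
Proof.
move=> Ex Ey xy; have gx := sg0 k Ex; have gy := sg0 k Ey.
have Cn : 0 <= Cs * 2 ^+ n by rewrite mulr_ge0 ?exprn_ge0// ltW.
have C21 : 0 <= C2 / C1 by rewrite divr_ge0 ?ltW.
rewrite /comparison_const mulrDl; case: k => [|k] in xy gx gy *.
  apply: (@le_trans _ _ (C2 / C1 * sg 0 x)); last by rewrite lerDr mulr_ge0// ltW.
  have s0 : scale 0 = 1 by rewrite /scale expr0 invr1.
  rewrite /sg s0; apply: le_trans (sigma_cube1_le Ey) _.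
  by rewrite mulrAC ler_pdivlMr// ler_wpM2l ?(ltW C20)// sigma_cube1_ge.
have sk : 0 < scale k.+1 := scale_gt0 m6 k.+1.
have s1 : scale k.+1 <= 1 := scale_le1 m6 k.+1.
apply: (@le_trans _ _ (Cs * 2 ^+ n * sg k.+1 x)); last by rewrite lerDl mulr_ge0// ltW.
apply: le_trans (sigma_double Ex (r := scale k.+1) (k := 2) _ _); last 2 first.
- by rewrite sk.
- apply/andP; split; first by lra.
  have s6 : 6 * scale k.+1 <= scale k := scaleS_le m6 k.
  have s61 : scale k <= 1 := scale_le1 m6 k.
  by rewrite -(ler_pM2r sk) mulVf ?gt_eqF//; lra.
apply: fine_sigma_le => //; apply: cube_subset.
by rewrite rV_distC; lra.
Qed.

(* The annuli [scale k.+1 <= |x - y| < scale k] exhaust [0 < |x - y| < 1]; on each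
   the kernel is comparable to the one at scale [k]. *)
Definition besov_kernel F x y : R :=
  `|F x - F y| `^ p / (`|x - y| `^ (p - n%:R) * fine (sigma (cube x `|x - y|)) ^+ 2).

(** Each oscillation is paired with the inverse mass at the opposite point, so that in either term
    the dependence on x and y separates. *)
Definition osc_kernel G k x y : \bar R :=
  (weighted_osc G k x * ((sg k y)^-1)%:E + weighted_osc G k y * ((sg k x)^-1)%:E)%E.

Lemma osc_kernel_ge0 G k x y : (0 <= osc_kernel G k x y)%E.
Proof. by rewrite adde_ge0// mule_ge0 ?weighted_osc_ge0. Qed.

Lemma exists_scale (d : R) : 0 < d < 1 -> exists k, scale k.+1 <= d <= scale k.
Proof.
move=> /andP[d0 d1].
have : exists j, scale j <= d.
  have /cvgrPdist_lt/(_ _ d0) := @scale_cvg0 R m m6.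
  move=> [j _ hj]; exists j; have := hj j (leqnn j).
  by rewrite /= sub0r normrN gtr0_norm ?scale_gt0// => /ltW.
move=> ex; case: (ex_minnP ex) => -[|k] hk hmin.
  by move: hk; rewrite /scale expr0 invr1 leNgt d1.
exists k; rewrite hk ltW// ltNge; apply/negP => /hmin; by rewrite ltnn.
Qed.

Definition kernel_const : R :=
  m%:R `^ (p - n%:R) * (Cs * m%:R ^+ n) ^+ 2 * pointwise_const * comparison_const.

Let combine (P W Q a b a' b' : R) (u v : \bar R) : 0 <= P -> 0 <= Q -> 0 <= a -> 0 <= a' ->
  0 <= b -> 0 <= b' -> 0 <= W -> (0 <= u)%E -> (0 <= v)%E ->
  P * W <= Q * (a * b) -> P * W <= Q * (a' * b') ->
  (P%:E * (u + v) * W%:E <= Q%:E * ((a%:E * u) * b%:E + (a'%:E * v) * b'%:E))%E.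
Proof.
move=> P0 Q0 a0 a'0 b0 b'0 W0 u0 v0 h1 h2.
rewrite muleAC -EFinM ge0_muleDr// ge0_muleDr ?mule_ge0 ?lee_fin//.
rewrite (muleAC a%:E u) (muleAC a'%:E v) -!EFinM !muleA -!EFinM.
by apply: leeD; apply: lee_wpmul2r => //; rewrite lee_fin.
Qed.

Let rearrange (A P K w g h : R) : 0 <= A -> 0 <= P -> 0 <= w -> 0 < g -> 0 < h -> h <= K * g ->
  P * (A * (w / g ^+ 2)) <= A * P * K * (w * (g^-1 * h^-1)).
Proof.
move=> A0 P0 w0 g0 h0 hK.
have -> : P * (A * (w / g ^+ 2)) = (A * P * w) * (g ^+ 2)^-1 by ring.
have -> : A * P * K * (w * (g^-1 * h^-1)) = (A * P * w) * (K * (g^-1 * h^-1)) by ring.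
apply: ler_wpM2l; first by rewrite !mulr_ge0.
rewrite expr2 invfM mulrCA; apply: ler_wpM2l; first by rewrite invr_ge0 ltW.
by rewrite ler_pdivlMr// mulrC ler_pdivrMr.
Qed.

(** On the annulus of scale k, doubling from scale k.+1 replaces the distance and the mass in the
    kernel by those of scale k. One of the two masses is then moved from x to y by [sg_compare]. *)
Lemma besov_kernel_le F G x y : continuous F -> weak_gradient setT F G -> E x -> E y ->
  0 < `|x - y| < 1 -> exists2 k, cube y (scale k) x & ((besov_kernel F x y)%:E <= kernel_const%:E * osc_kernel G k x y)%E.
Proof.
move=> cF wG Ex Ey xy; have [k /andP[kd dk]] := exists_scale xy.
exists k => //; have /andP[d0 d1] := xy.
have sk : 0 < scale k := scale_gt0 m6 k.
have sk1 : 0 < scale k.+1 := scale_gt0 m6 k.+1.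
have s11 : scale k.+1 <= 1 := scale_le1 m6 k.+1.
have e : scale k = m%:R * scale k.+1 by rewrite (scale_add m6 k 1) addn1.
have gx := sg0 k Ex; have gy := sg0 k Ey; have g1 := sg0 k.+1 Ex.
have gg : 0 < fine (sigma (cube x `|x - y|)) by exact: fine_sigma_gt0.
have h1 : sg k x <= Cs * m%:R ^+ n * fine (sigma (cube x `|x - y|)).
  apply: (@le_trans _ _ (Cs * m%:R ^+ n * sg k.+1 x)).
    rewrite {1}/sg e; apply: (sigma_double Ex); first by rewrite sk1.
    apply/andP; split; first by rewrite ler1n.
    by rewrite -(ler_pM2r sk1) mulVf ?gt_eqF// -e; exact: (scale_le1 m6 k).
  apply: ler_wpM2l; first by rewrite mulr_ge0 ?exprn_ge0// ltW.
  by apply: fine_sigma_le => //; apply: cube_subset; rewrite subrr normr0 add0r.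
have pn0 : 0 <= p - n%:R by rewrite subr_ge0 ltW.
have h2 : m%:R `^ (p - n%:R) * `|x - y| `^ (p - n%:R) >= scale k `^ (p - n%:R).
  rewrite -powRM ?(ltW mr0)//; apply: ge0_ler_powR; rewrite ?nnegrE ?(ltW sk)//.
  by rewrite e ler_wpM2l// ltW.
have h3 : besov_kernel F x y <= `|F x - F y| `^ p *
    (m%:R `^ (p - n%:R) * (Cs * m%:R ^+ n) ^+ 2 * (scale k `^ (n%:R - p) / sg k x ^+ 2)).
  apply: ler_wpM2l; first exact: powR_ge0.
  have -> : scale k `^ (n%:R - p) = (scale k `^ (p - n%:R))^-1 by rewrite -powRN opprB.
  rewrite -invfM ler_pdivlMr ?mulr_gt0 ?exprn_gt0 ?powR_gt0// mulrC ler_pdivrMr ?mulr_gt0 ?exprn_gt0 ?powR_gt0//.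
  rewrite [leRHS]mulrACA -exprMn; apply: ler_pM => //.
  - exact: powR_ge0.
  - by rewrite exprn_ge0// ltW.
  - by rewrite ler_sqr ?nnegrE ?mulr_ge0 ?exprn_ge0 ?(ltW mr0) ?(ltW Cs0) ?(ltW gx) ?(ltW gg).
apply: (@le_trans _ _ ((`|F x - F y| `^ p)%:E * (m%:R `^ (p - n%:R) * (Cs * m%:R ^+ n) ^+ 2 * (scale k `^ (n%:R - p) / sg k x ^+ 2))%:E)%E).
  by rewrite -EFinM lee_fin.
have c0 : 0 <= m%:R `^ (p - n%:R) * (Cs * m%:R ^+ n) ^+ 2.
  by rewrite mulr_ge0 ?powR_ge0// sqr_ge0.
have pc : 0 <= pointwise_const by apply: pointwise_const_ge0.
have w0 : 0 <= scale k `^ (n%:R - p) / sg k x ^+ 2 by rewrite divr_ge0 ?powR_ge0// sqr_ge0.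
have pw := pointwise_osc n0 pn m6 M0 hM cF wG dk.
apply: le_trans (lee_wpmul2r _ pw) _; first by rewrite lee_fin mulr_ge0.
have Cc := comparison_const_gt0.
have hc : pointwise_const * (m%:R `^ (p - n%:R) * (Cs * m%:R ^+ n) ^+ 2 * (scale k `^ (n%:R - p) / sg k x ^+ 2)) <=
    kernel_const * (scale k `^ (n%:R - p) * ((sg k x)^-1 * (sg k y)^-1)).
  exact: (rearrange c0 pc (powR_ge0 _ _) gx gy (sg_compare Ex Ey dk)).
have pc0 : 0 <= kernel_const.
  by apply: mulr_ge0 (ltW Cc); apply: mulr_ge0.
have igx : 0 <= (sg k x)^-1 by rewrite invr_ge0 ltW.
have igy : 0 <= (sg k y)^-1 by rewrite invr_ge0 ltW.
have sp0 : 0 <= scale k `^ (n%:R - p) by exact: powR_ge0.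
apply: (combine pc pc0 (mulr_ge0 sp0 igx) (mulr_ge0 sp0 igy) igy igx (mulr_ge0 c0 w0)).
- exact: (osc_ge0 pn m6 G k x).
- exact: (osc_ge0 pn m6 G k y).
- by rewrite -(mulrA (scale k `^ _) (sg k x)^-1).
- by rewrite -(mulrA (scale k `^ _) (sg k y)^-1) (mulrC (sg k y)^-1).
Qed.

Lemma integral_inv_sg z k : (\int[sigma]_(x in E `&` cube z (scale k)) ((sg k x)^-1)%:E <= (2 ^+ n)%:E)%E.
Proof.
have sk : 0 < scale k := scale_gt0 m6 k.
by have := integral_inv_sigma_le sfin mE z sk (isT : 0 < 1)%N; rewrite mul1r muln1.
Qed.

Definition besov_const : R := kernel_const * (2 * 2 ^+ n) * ((1 - ratio)^-1 * trace_const).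

(** Annuli are enlarged to whole cubes and summed over k. Tonelli shows that both halves of
    [osc_kernel] have the same integral, and integrating the free inverse mass costs 2^n. *)
Lemma besov_trace F G : continuous F -> weak_gradient setT F G ->
  measurable_fun [set: X] (fun z : X => `|G z|) ->
  (\int[sigma]_(y in E) \int[sigma]_(x in E `&` [set x : V | (0 < `|x - y| < 1)%R]) (besov_kernel F x y)%:E
   <= besov_const%:E * \int[L]_z (`|G z| `^ p)%:E)%E.
Proof.
move=> cF wG mG; set B := (\int[L]_z _)%E.
pose A k : X -> \bar R := weighted_osc G k.
pose b k (x : X) : \bar R := ((sg k x)^-1)%:E.
have A0 k x : (0 <= A k x)%E by exact: weighted_osc_ge0.
have b0 k x : (0 <= b k x)%E by exact: inv_sg0.
have mA k : measurable_fun [set: X] (A k) by exact: measurable_weighted_osc.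
have mb k : measurable_fun [set: X] (b k) by exact: measurable_inv_sg.
have kc0 : 0 <= kernel_const.
  apply: mulr_ge0 (ltW comparison_const_gt0); apply: mulr_ge0.
    by rewrite mulr_ge0 ?powR_ge0// sqr_ge0.
  by apply: pointwise_const_ge0.
have mK k (y : X) : @measurable _ X (E `&` cube (y : V) (scale k)).
  by apply: measurableI => //; exact: measurable_cube.
pose I k (y : X) : \bar R := (b k y * \int[sigma]_(x in E `&` cube (y : V) (scale k)) A k x +
   A k y * \int[sigma]_(x in E `&` cube (y : V) (scale k)) b k x)%E.
have iA0 k (y : X) : (0 <= \int[sigma]_(x in E `&` cube (y : V) (scale k)) A k x)%E by exact: integral_ge0.
have ib0 k (y : X) : (0 <= \int[sigma]_(x in E `&` cube (y : V) (scale k)) b k x)%E by exact: integral_ge0.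
have I0 k y : (0 <= I k y)%E by rewrite adde_ge0// mule_ge0.
have mo k (y : X) : measurable_fun [set: X] (fun x : X => osc_kernel G k (x : V) y).
  apply: emeasurable_funD.
    by under eq_fun do rewrite muleC; apply: measurable_funeM; exact: mA.
  by apply: measurable_funeM; exact: mb.
have hI k (y : X) : (\int[sigma]_(x in E `&` cube (y : V) (scale k)) osc_kernel G k x y = I k y)%E.
  rewrite /osc_kernel ge0_integralD//; last 4 first.
  - by move=> x _; rewrite mule_ge0 ?A0.
  - by apply: measurable_funTS; under eq_fun do rewrite muleC; apply: measurable_funeM; exact: mA.
  - by move=> x _; rewrite mule_ge0 ?A0.
  - by apply: measurable_funTS; apply: measurable_funeM; exact: mb.
  under eq_integral do rewrite muleC.
  rewrite ge0_integralZl//; last exact: measurable_funTS.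
  by rewrite ge0_integralZl//; exact: measurable_funTS.
have inner (y : X) : E y ->
  (\int[sigma]_(x in E `&` [set x : V | (0 < `|x - y| < 1)%R]) (besov_kernel F x y)%:E <=
    \sum_(0 <= k <oo) kernel_const%:E * I k y)%E.
  (* The scale given by [besov_kernel_le] depends on x; dominating by the sum over all scales avoids
     a measurable choice. *)
  move=> Ey; pose f k := (fun x : X => kernel_const%:E * osc_kernel G k (x : V) y)%E \_ (cube (y : V) (scale k)).
  have f0 k x : (0 <= f k x)%E.
    by apply: erestrict_ge0 => z _; rewrite mule_ge0 ?osc_kernel_ge0// lee_fin.
  have -> : (\sum_(0 <= k <oo) kernel_const%:E * I k y = \int[sigma]_(x in E) \sum_(0 <= k <oo) f k x)%E.
    rewrite integral_nneseries//; last first.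
      move=> k; apply: measurable_funTS.
      have [h _] := measurable_restrictT (fun x : X => kernel_const%:E * osc_kernel G k (x : V) y)%E (@measurable_cube R n y (scale k)).
      by apply: h; apply: measurable_funTS; apply: measurable_funeM.
    apply: eq_eseriesr => k _; rewrite -integral_mkcondr.
    rewrite ge0_integralZl//; last 2 first.
    - by apply: measurable_funTS.
    - by move=> x _; exact: osc_kernel_ge0.
    by rewrite hI.
  apply: (@le_trans _ _ (\int[sigma]_(x in E `&` [set x : V | (0 < `|x - y| < 1)%R]) \sum_(0 <= k <oo) f k x)%E).
    apply: le_ge0_integral => x [Ex xy]; first by rewrite lee_fin divr_ge0 ?powR_ge0// mulr_ge0 ?powR_ge0 ?sqr_ge0.
    have [k xk hk] := besov_kernel_le cF wG Ex Ey xy.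
    apply: le_trans hk _; apply: le_trans (nneseries_term_le k (fun k => f0 k x)).
    by rewrite /f patchE mem_set.
  by apply: le_ge0_integral_subset => [x []//|x _]; exact: nneseries_ge0.
have c2 : 0 <= kernel_const * (2 * 2 ^+ n) by rewrite mulr_ge0// mulr_ge0// exprn_ge0.
apply: (@le_trans _ _ (\int[sigma]_(y in E) \sum_(0 <= k <oo) kernel_const%:E * I k y)%E).
  apply: le_ge0_integral => y Ey; last exact: inner.
  by apply: integral_ge0 => x _; rewrite lee_fin divr_ge0 ?powR_ge0// mulr_ge0 ?powR_ge0 ?sqr_ge0.
have mi1 k : measurable_fun [set: X] (fun y : X => b k y * \int[sigma]_(x in E `&` cube (y : V) (scale k)) A k x)%E.
  by apply: emeasurable_funM => //; exact: measurable_integral_cube.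
have mi2 k : measurable_fun [set: X] (fun y : X => A k y * \int[sigma]_(x in E `&` cube (y : V) (scale k)) b k x)%E.
  by apply: emeasurable_funM => //; exact: measurable_integral_cube.
have mI k : measurable_fun [set: X] (I k) by exact: emeasurable_funD.
rewrite integral_nneseries//; last 2 first.
- by move=> k; apply: measurable_funTS; exact: measurable_funeM.
- by move=> k x _; rewrite mule_ge0// lee_fin.
have sA0 k : (0 <= \int[sigma]_(x in E) weighted_osc G k x)%E by exact: integral_ge0.
apply: (@le_trans _ _ (\sum_(0 <= k <oo) (kernel_const * (2 * 2 ^+ n))%:E * \int[sigma]_(x in E) weighted_osc G k x)%E).
  apply: lee_nneseries => [k _ _|k _].
    by apply: integral_ge0 => x _; rewrite mule_ge0// lee_fin.
  rewrite ge0_integralZl//; last exact: measurable_funTS.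
  rewrite (EFinM kernel_const) -[leRHS]muleA; apply: lee_wpmul2l; first by rewrite lee_fin.
  rewrite ge0_integralD//; last 4 first.
  - by move=> x _; rewrite mule_ge0.
  - exact: measurable_funTS.
  - by move=> x _; rewrite mule_ge0.
  - exact: measurable_funTS.
  rewrite (tonelli_cube_prod _ ssig ssig mE mE (mb k) (mA k) (b0 k) (A0 k)).
  have D : (\int[sigma]_(y in E) (A k y * \int[sigma]_(x in E `&` cube (y : V) (scale k)) b k x) <=
      (2 ^+ n)%:E * \int[sigma]_(x in E) weighted_osc G k x)%E.
    rewrite -ge0_integralZl//; last exact: measurable_funTS (mA k).
    apply: le_ge0_integral => y Ey; first by rewrite mule_ge0.
    by rewrite muleC; apply: lee_wpmul2r => //; exact: integral_inv_sg.
  apply: le_trans (leeD D D) _; rewrite -ge0_muleDl ?lee_fin ?exprn_ge0// -EFinD.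
  by rewrite (_ : 2 ^+ n + 2 ^+ n = 2 * 2 ^+ n)//; lra.
rewrite nneseriesZl// /besov_const (EFinM (kernel_const * _)) -[leRHS]muleA; apply: lee_wpmul2l; first by rewrite lee_fin.
exact: sum_weighted_osc.
Qed.

(** The masses of unit cubes are bounded by hypothesis for centres in E. For an arbitrary centre the
    bound comes from the integral of inverse masses over the part of E in the cube. *)
Lemma measure_cube1_le z : (sigma (E `&` cube z 1) <= (C2 * 2 ^+ n)%:E)%E.
Proof.
have mK : @measurable _ X (E `&` cube z 1) by apply: measurableI => //; exact: measurable_cube.
have h := integral_inv_sg z 0; have s0 : scale 0 = 1 by rewrite /scale expr0 invr1.
rewrite s0 in h; rewrite (EFinM C2) -[leLHS]mul1e.
apply: (@le_trans _ _ (C2%:E * \int[sigma]_(x in E `&` cube z 1) ((sg 0 x)^-1)%:E)%E); last first.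
  by apply: lee_wpmul2l => //; rewrite lee_fin ltW.
rewrite -ge0_integralZl//; last 2 first.
- by apply: measurable_funTS.
- exact: ltW.
rewrite -integral_cst//; apply: le_ge0_integral => x [Ex _]; first by rewrite lee_fin.
rewrite -EFinM lee_fin ler_pdivlMr ?sg0// mul1r /sg s0; exact: sigma_cube1_le.
Qed.

Definition trace_Lp_const : R := value_const * (C2 * ((1 - ratio)^-1 * trace_const) + C2 * 2 ^+ n).

Lemma trace_Lp F G : continuous F -> weak_gradient setT F G ->
  measurable_fun [set: X] (fun z : X => `|G z|) ->
  (\int[sigma]_(x in E) (`|F x| `^ p)%:E
   <= trace_Lp_const%:E * (\int[L]_z (`|G z| `^ p)%:E + \int[L]_z (`|F z| `^ p)%:E))%E.
Proof.
move=> cF wG mG; set B := (\int[L]_z (`|G z| `^ p)%:E)%E; set B' := (\int[L]_z _)%E.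
have [q0 q1] := andP (ratio01 pn m6).
have vc0 : 0 <= value_const by by apply: value_const_ge0.
have B0 : (0 <= B)%E by apply: integral_ge0 => z _; rewrite lee_fin powR_ge0.
have B'0 : (0 <= B')%E by apply: integral_ge0 => z _; rewrite lee_fin powR_ge0.
have mF : measurable_fun [set: X] (fun z : X => (`|F z| `^ p)%:E).
  apply/measurable_EFinP; apply: measurable_fun_powR.
  exact: measurableT_comp (@normr_measurable R setT) (continuous_measurableRn cF).
have F0 (z : X) : (0 <= (`|F z| `^ p)%:E)%E by rewrite lee_fin powR_ge0.
pose I (x : X) : \bar R := (\int[L]_(z in setT `&` cube (x : V) 1) (`|F z| `^ p)%:E)%E.
have I0 x : (0 <= I x)%E by apply: integral_ge0 => z _; exact: F0.
have mI : measurable_fun [set: X] I by exact: measurable_integral_cube.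
have mW : measurable_fun [set: X] (weighted_osc G 0 : X -> \bar R) by exact: measurable_weighted_osc.
have W0 (x : X) : (0 <= weighted_osc G 0 x)%E by exact: weighted_osc_ge0.
have s0 : scale 0 = 1 by rewrite /scale expr0 invr1.
have hF x : E x -> ((`|F x| `^ p)%:E <= value_const%:E * (C2%:E * weighted_osc G 0 x + I x))%E.
  move=> Ex; apply: le_trans (pointwise_value n0 pn m6 M0 hM x cF wG) _.
  apply: lee_wpmul2l; first by rewrite lee_fin.
  rewrite /I setTI; apply: leeD => //; rewrite /weighted_osc s0 one_powR div1r muleA -EFinM.
  rewrite -[leLHS]mul1e; apply: lee_wpmul2r; first exact: osc_ge0.
  have := sg0 0 Ex; rewrite /sg s0 => g0.
  by rewrite lee_fin ler_pdivlMr// mul1r sigma_cube1_le.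
apply: (@le_trans _ _ (\int[sigma]_(x in E) (value_const%:E * (C2%:E * weighted_osc G 0 x + I x)))%E).
  by apply: le_ge0_integral => x Ex; [exact: F0|exact: hF].
have mC : measurable_fun [set: X] (fun x : X => C2%:E * weighted_osc G 0 (x : V))%E by exact: measurable_funeM.
have C0 (x : X) : (0 <= C2%:E * weighted_osc G 0 x)%E by rewrite mule_ge0// lee_fin ltW.
rewrite ge0_integralZl//; last 2 first.
- by apply: measurable_funTS; exact: emeasurable_funD.
- by move=> x _; rewrite adde_ge0.
rewrite /trace_Lp_const (EFinM value_const) -[leRHS]muleA; apply: lee_wpmul2l; first by rewrite lee_fin.
rewrite ge0_integralD//; last 2 first.
- exact: measurable_funTS.
- exact: measurable_funTS.
have c1 : (0 <= (C2 * ((1 - ratio)^-1 * trace_const))%:E)%E.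
  have t0 : 0 <= trace_const by by apply: trace_const_ge0.
  by rewrite lee_fin mulr_ge0 ?(ltW C20)// mulr_ge0// invr_ge0 subr_ge0 ltW.
have c2 : (0 <= (C2 * 2 ^+ n)%:E)%E by rewrite lee_fin mulr_ge0 ?exprn_ge0// ltW.
rewrite EFinD ge0_muleDl//; apply: leeD.
  rewrite ge0_integralZl//; last 2 first.
  - exact: measurable_funTS.
  - exact: ltW.
  rewrite (EFinM C2) -[leRHS]muleA; apply: lee_wpmul2l; first by rewrite lee_fin ltW.
  apply: (@le_trans _ _ (((1 - ratio)^-1 * trace_const)%:E * B)%E).
    apply: le_trans (sum_weighted_osc mG).
    by apply: (nneseries_term_le 0 (u := fun k => (\int[sigma]_(x in E) weighted_osc G k x)%E)) => k; apply: integral_ge0 => x _; exact: weighted_osc_ge0.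
  have t0 : 0 <= trace_const by apply: trace_const_ge0.
  apply: lee_wpmul2l; last exact: leeDl.
  by rewrite lee_fin mulr_ge0// invr_ge0 subr_ge0 ltW.
have one0 (x : X) : (0 <= (fun=> 1%:E) x :> \bar R)%E by rewrite lee_fin.
have tI : (\int[sigma]_(x in E) I x =
    \int[L]_y ((`|F y| `^ p)%:E * \int[sigma]_(x in E `&` cube (y : V) 1) (fun=> 1%:E) x))%E.
  rewrite -(tonelli_cube_prod 1 ssig sleb mE measurableT (measurable_cst 1%:E) mF one0 F0).
  by apply: eq_integral => x _; rewrite mul1e.
rewrite tI; apply: (@le_trans _ _ ((C2 * 2 ^+ n)%:E * B')%E); last first.
  by apply: lee_wpmul2l => //; exact: leeDr.
rewrite -ge0_integralZl//; apply: le_ge0_integral => z _.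
  by rewrite mule_ge0// integral_ge0.
rewrite muleC; apply: lee_wpmul2r => //; rewrite integral_cst ?mul1e; first exact: measure_cube1_le.
by apply: measurableI => //; exact: measurable_cube.
Qed.

End trace_bounds.

(** * Scaled plateaus and mollified cutoffs *)

Section bumps.
Context {R : realType} {n : nat}.
Local Notation V := 'rV[R]_n.
Local Notation X := (borelRn R n).
Local Notation L := (@lebesgueRn R n).
Local Notation e_ i := (delta_mx ord0 i : V).
Implicit Types (r eps : R) (z e : V) (A : set V).

(** The summand 0 gives the argument the affine form required by [Ck_affine] and
    [is_derive_affine]. *)
Definition bump r (z : V) : R := plateau (r^-1 *: z + 0).

Lemma Ck_bump N r : Ck N (bump r).
Proof. by apply: Ck_affine; exact: Ck_plateau. Qed.

Lemma bump_ge0 r z : 0 <= bump r z.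
Proof. exact: plateau_ge0. Qed.

Lemma bump_le1 r z : bump r z <= 1.
Proof. exact: plateau_le1. Qed.

Let normZV r z : 0 < r -> `|r^-1 *: z + 0| = `|z| / r.
Proof. by move=> r0; rewrite addr0 rV_normZ gtr0_norm ?invr_gt0// mulrC. Qed.

Lemma bump_eq1 r z : 0 < r -> `|z| <= r / 2 -> bump r z = 1.
Proof. by move=> r0 h; apply: plateau_eq1; rewrite normZV// ler_pdivrMr// mulrC. Qed.

Lemma bump_eq0 r z : 0 < r -> r <= `|z| -> bump r z = 0.
Proof. by move=> r0 h; apply: plateau_eq0; rewrite normZV// ler_pdivlMr// mul1r. Qed.

Lemma vanish_off_bump r : 0 < r -> vanish_off r (bump r).
Proof. by move=> r0 z /ltW; exact: bump_eq0. Qed.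

Lemma partial_plateau_bounded : exists K : R, 0 < K /\ forall (i : 'I_n) z, `|partial i plateau z| <= K.
Proof.
have /choice[K hK] : forall i : 'I_n, exists K : R, 0 < K /\ forall z, `|partial i plateau z| <= K.
  move=> i; apply: (@vanish_off_bounded R n 1).
    exact: Ck_continuous (Ck_partial i (Ck_plateau 1)).
  by apply: vanish_off_partial => z /ltW; exact: plateau_eq0.
exists (1 + \sum_i K i); have K0 i : 0 <= K i by exact: ltW (hK i).1.
split=> [|i z]; first by rewrite ltr_pwDl// sumr_ge0.
apply: le_trans ((hK i).2 z) _; rewrite (bigD1 i)//= addrCA lerDl addr_ge0// sumr_ge0//.
Qed.

Section cutoff.
Variable K : R.
Hypotheses (K0 : 0 < K) (hK : forall (i : 'I_n) (z : V), `|partial i plateau z| <= K).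

Lemma partial_bump_le i r z : 0 < r -> `|partial i (bump r) z| <= K / r.
Proof.
move=> r0; have du : derivable plateau (r^-1 *: z + 0) (e_ i) := Ck_derivable (Ck_plateau 1).
have [_ ->] := is_derive_partialE (is_derive_affine du).
by rewrite normrM gtr0_norm ?invr_gt0// mulrC ler_wpM2r// invr_ge0 ltW.
Qed.

Definition bump_mass r : R := \int[L]_(x in cube (0 : V) r) bump r x.

Lemma integral_bump r z : 0 < r ->
  (\int[L]_(x in cube z r) (bump r ((x : V) - z))%:E = (bump_mass r)%:E)%E.
Proof.
move=> r0; have cb := Ck_continuous (Ck_bump 0 r).
have h0 (x : V) : r < `|x - 0| -> bump r x = 0 by rewrite subr0 => /ltW; exact: bump_eq0.
have hz (x : V) : r < `|x - z| -> bump r (x - z) = 0 by move=> /ltW; exact: bump_eq0.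
rewrite -(integral_eq_cube L (@subsetT _ _) hz).
have mb := continuous_measurableRn cb.
have := @integral_transl R n (- z) (bump r) mb; rewrite /transl => ->.
rewrite (integral_eq_cube L (@subsetT _ _) h0) /bump_mass /Rintegral fineK//.
apply: integrable_fin_num; first exact: measurable_cube.
apply: integrableS (integrable_vanish_off (lebesgueRn_cube_lty 0) cb (vanish_off_bump r0)) => //.
exact: measurable_cube.
Qed.

Lemma bump_mass_ge r : 0 < r -> r ^+ n <= bump_mass r.
Proof.
move=> r0; have r20 : 0 < r / 2 by rewrite divr_gt0.
have rr : (r / 2) *+ 2 = r by lra.
rewrite -lee_fin -(integral_bump 0 r0) -[X in (X ^+ n)%:E]rr -(lebesgueRn_cube (0 : V) r20).
rewrite -[leLHS]mul1e -integral_cst; last exact: measurable_cube.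
apply: (@le_trans _ _ (\int[L]_(x in cube (0 : V) (r / 2)) (bump r ((x : V) - 0))%:E)%E).
  by apply: le_ge0_integral => x xr //; rewrite lee_fin bump_eq1.
apply: le_ge0_integral_subset => x; last by rewrite lee_fin bump_ge0.
by rewrite /cube /= => h; apply: le_trans h _; lra.
Qed.

Lemma bump_mass_gt0 r : 0 < r -> 0 < bump_mass r.
Proof. by move=> r0; apply: lt_le_trans (bump_mass_ge r0); rewrite exprn_gt0. Qed.

(* A mollified indicator of [tube A (2 * eps)]. *)
Definition cutoff A eps z : R := (bump_mass eps)^-1 * conv L (tube A (2 * eps)) (cst 1) (bump eps) z.

Let ib A eps r : L.-integrable ((tube A (2 * eps) : set X) `&` cube (0 : V) r) (EFin \o (cst 1 : X -> R)).
Proof.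
have ic : L.-integrable (cube (0 : V) r) (EFin \o (cst 1 : X -> R)).
  apply: measurable_bounded_integrable; [exact: measurable_cube|exact: lebesgueRn_cube_lty|exact: measurable_cst|].
  by exists 1; split; [exact: num_real|move=> y y1 z _ /=; rewrite normr1 ltW].
have mI := measurableI _ _ (measurable_tube A (2 * eps)) (measurable_cube (0 : V) r).
exact: (integrableS (measurable_cube _ _) mI (@subIsetr _ _ _) ic).
Qed.

Lemma Ck_cutoff N A eps : 0 < eps -> Ck N (cutoff A eps).
Proof.
move=> e0; apply: CkZ.
exact: (Ck_conv (measurable_tube _ _) (ib A eps) (Ck_bump N eps) (vanish_off_bump e0)).
Qed.

Lemma partial_cutoff i A eps z : 0 < eps ->
  partial i (cutoff A eps) z = - ((bump_mass eps)^-1 * conv L (tube A (2 * eps)) (cst 1) (partial i (bump eps)) z).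
Proof.
move=> e0; have := is_derive_conv (measurable_tube A (2 * eps)) (ib A eps) i z (Ck_bump 1 eps) (vanish_off_bump e0).
move=> /is_derive_partialE[d e]; rewrite /cutoff partialZ// e; by rewrite mulrN.
Qed.

Lemma cutoff_eq1 A eps z : 0 < eps -> tube A eps z -> cutoff A eps z = 1.
Proof.
move=> e0 [a Aa za]; have bm := bump_mass_gt0 e0.
have sub : cube z eps `<=` tube A (2 * eps).
  move=> x xz; exists a => //; have := rV_distD z x a; rewrite /cube /= in xz.
  by move=> ?; lra.
have hz (x : V) : eps < `|x - z| -> cst 1 x * bump eps (x - z) = 0 by move=> /ltW h; rewrite bump_eq0 ?mulr0.
rewrite /cutoff /conv /Rintegral (integral_eq_cube L sub hz).
under eq_integral do rewrite mul1r.
by rewrite integral_bump//= mulVf// gt_eqF.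
Qed.

Let off_tube A eps z x : ~ tube A (3 * eps) z -> tube A (2 * eps) x -> eps < `|x - z|.
Proof.
move=> zt [a Aa xa]; rewrite ltNge; apply/negP => xz; apply: zt; exists a => //.
by have := rV_distD x z a; rewrite (rV_distC z x) => ?; lra.
Qed.

Let conv_eq0 A eps zeta z : vanish_off eps zeta -> ~ tube A (3 * eps) z ->
  conv L (tube A (2 * eps)) (cst 1) zeta z = 0.
Proof.
move=> hz zt; rewrite /conv /Rintegral integral0_eq// => x xt.
by rewrite hz ?mulr0//; exact: off_tube xt.
Qed.

Lemma cutoff_eq0 A eps z : 0 < eps -> ~ tube A (3 * eps) z -> cutoff A eps z = 0.
Proof. by move=> e0 zt; rewrite /cutoff conv_eq0 ?mulr0//; exact: vanish_off_bump. Qed.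

Lemma partial_cutoff_eq0_far i A eps z : 0 < eps -> ~ tube A (3 * eps) z -> partial i (cutoff A eps) z = 0.
Proof.
move=> e0 zt; rewrite partial_cutoff// conv_eq0 ?mulr0 ?oppr0//.
exact: vanish_off_partial (vanish_off_bump e0).
Qed.

Lemma partial_cutoff_eq0_near i A eps z : 0 < eps -> tube A eps z -> partial i (cutoff A eps) z = 0.
Proof.
move=> e0 zt; rewrite (@near_eq_partial _ _ i _ (cst 1)) ?partial_cst//.
have : nbhs z (tube A eps) by apply: open_nbhs_nbhs; split; [exact: open_tube|].
by apply: filterS => y; exact: cutoff_eq1.
Qed.

Let conv_cube_le A eps zeta B z : 0 < eps -> continuous zeta -> vanish_off eps zeta -> 0 <= B ->
  (forall x, `|zeta x| <= B) ->
  `|conv L (tube A (2 * eps)) (cst 1) zeta z| <= B * (2 * eps) ^+ n.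
Proof.
move=> e0 cz hz B0 zB; have mt : @measurable _ X (tube A (2 * eps)) by exact: measurable_tube.
have sB : exists M, forall z, `|zeta z| <= M by exists B.
rewrite (conv_cubeE _ _ _ hz (lexx (eps + `|z|))).
have iz := integrable_conv mt (ib A eps) z (eps + `|z|) cz sB.
have mI : @measurable _ X (tube A (2 * eps) `&` cube (0 : V) (eps + `|z|)).
  by apply: measurableI => //; exact: measurable_cube.
rewrite -lee_fin EFin_normr_Rintegral//.
apply: le_trans (le_abse_integral L mI (measurable_int _ iz)) _.
apply: (@le_trans _ _ (\int[L]_(x in setT) ((fun=> B%:E) \_ (cube z eps)) x)%E).
  apply: (@le_trans _ _ (\int[L]_(x in tube A (2 * eps) `&` cube (0 : V) (eps + `|z|)) ((fun=> B%:E) \_ (cube z eps)) x)%E).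
    apply: le_ge0_integral => x _ //=; rewrite patchE; case: ifPn => [_|/negP xz].
      by rewrite lee_fin mul1r.
    rewrite hz ?mulr0 ?normr0// ltNge; apply/negP => xz'; apply: xz; exact: mem_set.
  by apply: le_ge0_integral_subset => // x _; apply: erestrict_ge0 => y _; rewrite lee_fin.
rewrite -integral_mkcond integral_cst; last exact: measurable_cube.
by rewrite lebesgueRn_cube// -EFinM lee_fin (_ : eps *+ 2 = 2 * eps)// mulr_natl.
Qed.

Lemma cutoff_ge0 A eps z : 0 < eps -> 0 <= cutoff A eps z.
Proof.
move=> e0; rewrite mulr_ge0 ?invr_ge0 ?(ltW (bump_mass_gt0 e0))//.
by apply: Rintegral_ge0 => x _; rewrite mul1r bump_ge0.
Qed.

Lemma cutoff_le1 A eps z : 0 < eps -> cutoff A eps z <= 1.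
Proof.
move=> e0; have bm := bump_mass_gt0 e0; rewrite ler_pdivrMl// mulr1.
rewrite -lee_fin -(integral_bump z e0) /conv /Rintegral.
have hz (x : V) : eps < `|x - z| -> bump eps (x - z) = 0 by move=> /ltW; exact: bump_eq0.
have h : (\int[L]_(x in tube A (2 * eps)) (cst 1 x * bump eps ((x : V) - z))%:E <=
    \int[L]_(x in cube z eps) (bump eps ((x : V) - z))%:E)%E.
  rewrite -(integral_eq_cube L (@subsetT _ _) hz).
  under eq_integral do rewrite mul1r.
  by apply: le_ge0_integral_subset => // x _; rewrite lee_fin bump_ge0.
rewrite fineK// ge0_fin_numE; last first.
  by apply: integral_ge0 => x _; rewrite lee_fin mul1r bump_ge0.
by apply: le_lt_trans h _; rewrite integral_bump// ltry.
Qed.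

(** The derivative falls on the bump: it is at most K / eps on a cube of volume (2 eps)^n, against a
    normalisation [bump_mass eps] of at least eps^n. *)
Lemma partial_cutoff_le i A eps z : 0 < eps -> `|partial i (cutoff A eps) z| <= 2 ^+ n * K / eps.
Proof.
move=> e0; have bm := bump_mass_gt0 e0; have bg := bump_mass_ge e0.
rewrite partial_cutoff// normrN normrM gtr0_norm ?invr_gt0// ler_pdivrMl//.
have cp := Ck_continuous (Ck_partial i (Ck_bump 1 eps)).
have Ke : 0 <= K / eps by rewrite divr_ge0 ?ltW.
have := conv_cube_le A z e0 cp (vanish_off_partial i (vanish_off_bump e0)) Ke (fun x => partial_bump_le i x e0).
move=> /le_trans; apply; rewrite exprMn mulrCA mulrA mulrC [leRHS](_ : _ = bump_mass eps * (2 ^+ n * K / eps))//.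
rewrite -mulrA; apply: ler_wpM2r => //.
by rewrite mulr_ge0// exprn_ge0.
Qed.

End cutoff.
End bumps.

(** * Size of a Sobolev function near a zero on the boundary of its domain *)

Section touching.
Context {R : realType} {n : nat}.
Local Notation V := 'rV[R]_n.
Local Notation X := (borelRn R n).
Local Notation L := (@lebesgueRn R n).
Local Notation mass := (@box_mass R n).
Variables (p M : R).
Hypotheses (n0 : (0 < n)%N) (pn : n%:R < p).
Hypotheses (M0 : 0 < M) (hM : forall t : R, dstep t <= M).
Implicit Types (W : set V) (u : V -> R) (G : V -> V) (z w y : V) (d B : R).

Let p1 : 1 < p. Proof. by rewrite (le_lt_trans _ pn)// ler1n. Qed.
Let p0 : 0 < p. Proof. by rewrite (lt_trans _ p1). Qed.

(** The count of exponents: the flux loses (n - 1) p, Jensen's inequality gains n (p - 1), and p - n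
    remains. *)
Let pow_scale (s : R) : 0 < s -> (s ^- n.-1) `^ p * (s ^+ n) `^ (p - 1) = s `^ (p - n%:R).
Proof.
move=> s0; have S0 : 0 < s ^+ n by rewrite exprn_gt0.
have -> : s ^- n.-1 = (s ^+ n)^-1 * s.
  by rewrite -[in RHS](prednK n0) exprSr invfM -mulrA mulVf ?mulr1// gt_eqF.
rewrite powRM ?invr_ge0 ?(ltW S0) ?(ltW s0)// powRVn// -[p - 1]opprB powRN powR_1B// invf_div.
rewrite powRD ?(gt_eqF s0) ?implybT// powRN powR_mulrn ?(ltW s0)//.
have := lt0r_neq0 (powR_gt0 p S0); move: ((s ^+ n) `^ p) => T T0.
by rewrite mulrACA mulVf// mul1r.
Qed.

(** The factor by which the bound on a step of the chain, of order s^((p-n)/p), contracts when the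
    radius s is halved. *)
Definition touch_ratio : R := 2^-1 `^ ((p - n%:R) / p).

Lemma touch_ratio01 : 0 < touch_ratio < 1.
Proof.
have e0 : 0 < (p - n%:R) / p by rewrite divr_gt0// subr_gt0.
rewrite powR_gt0 ?invr_gt0//= -[ltRHS](one_powR ((p - n%:R) / p)).
by apply: gt0_ltr_powR; rewrite ?nnegrE// invf_lt1// ltr1n.
Qed.

Definition touch_const : R :=
  ((n%:R * (4 * M) ^+ n.-1) `^ p * (2 `^ p * (2 ^+ n) `^ (p - 1))) `^ p^-1.

Let step_identity (s B : R) : 0 < s -> 0 <= B ->
  (n%:R * (M / (s / 4)) ^+ n.-1) `^ p * (2 `^ p * (((2 * s) ^+ n) `^ (p - 1) * B)) =
  touch_const `^ p * (s `^ (p - n%:R) * B).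
Proof.
move=> s0 B0; have M4 : 0 <= 4 * M by rewrite mulr_ge0// ltW.
have i0 : 0 <= s ^- n.-1 by rewrite invr_ge0 exprn_ge0// ltW.
have -> : M / (s / 4) = 4 * M * s^-1 by field; rewrite gt_eqF.
have e1 : n%:R * (4 * M * s^-1) ^+ n.-1 = (n%:R * (4 * M) ^+ n.-1) * s ^- n.-1.
  by rewrite exprMn exprVn mulrA.
have c1 : 0 <= n%:R * (4 * M) ^+ n.-1 by rewrite mulr_ge0// exprn_ge0.
have c2 : 0 <= 2 ^+ n :> R by rewrite exprn_ge0.
have c3 : 0 <= s ^+ n by rewrite exprn_ge0// ltW.
rewrite e1 (powRM _ c1 i0) (exprMn _ 2 s) (powRM _ c2 c3) -(pow_scale s0).
rewrite /touch_const powRVK//; last by rewrite mulr_ge0 ?powR_ge0// mulr_ge0 ?powR_ge0.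
move: ((s ^- n.-1) `^ p) ((s ^+ n) `^ (p - 1)) ((2 ^+ n) `^ (p - 1)) (2 `^ p) => a b c e.
by move: ((n%:R * (4 * M) ^+ n.-1) `^ p) => f; ring.
Qed.

(** The cubes shrink linearly from z towards w while staying in the open cube of radius d about z,
    hence in W even if w lies on its boundary. Steps decrease like powers of [touch_ratio], and the
    means tend to [mass * u w]. *)
Lemma box_mean_touch W u G z w d B : open W -> continuous u -> weak_gradient W u G ->
  0 < d -> (forall v, `|v - z| < d -> W v) -> `|z - w| <= d -> 0 <= B ->
  (\int[L]_(v in W `&` cube z d) (`|G v| `^ p)%:E <= B%:E)%E ->
  `|box_mean u z (d / 2) - mass * u w| <=
    touch_const * (d `^ (p - n%:R) * B) `^ p^-1 / (1 - touch_ratio).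
Proof.
move=> oW cu wG d0 dW zw B0 hB; have /andP[q0 q1] := touch_ratio01.
pose s (j : nat) : R := 2^-1 ^+ j * d.
pose a (j : nat) : V := w + 2^-1 ^+ j *: (z - w).
have h0 j : 0 < 2^-1 ^+ j :> R by rewrite exprn_gt0// invr_gt0.
have s0 j : 0 < s j by rewrite mulr_gt0.
have sS j : s j.+1 = s j / 2 by rewrite /s exprS -mulrA mulrC.
have az j : `|a j - z| + s j <= d.
  have -> : a j - z = (1 - 2^-1 ^+ j) *: (w - z).
    by apply/rowP => i; rewrite /a !mxE; ring.
  have h1 : 2^-1 ^+ j <= 1 :> R by rewrite exprn_ile1// invf_le1// ler1n.
  rewrite rV_normZ ger0_norm ?subr_ge0// (rV_distC w z) /s.
  apply: (@le_trans _ _ ((1 - 2^-1 ^+ j) * d + 2^-1 ^+ j * d)); last by rewrite mulrBl mul1r subrK.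
  by rewrite lerD2r ler_wpM2l// subr_ge0.
have aw j : `|a j - w| <= s j.
  by rewrite /a addrAC subrr add0r rV_normZ ger0_norm ?(ltW (h0 j))// ler_wpM2l// ltW.
have aa j : `|a j.+1 - a j| <= s j / 2.
  have -> : a j.+1 - a j = - (2^-1 ^+ j.+1) *: (z - w).
    by apply/rowP => i; rewrite /a !mxE exprS; lra.
  by rewrite rV_normZ normrN ger0_norm ?(ltW (h0 _))// -sS ler_wpM2l// ltW.
(* Radius 3/4 s_j holds the bump of radius s_j / 2 at a_j and the one of radius s_j / 4 at a_(j+1),
   at distance at most s_j / 2; being below s_j, it keeps the cube strictly inside. *)
have KW j : cube (a j) (3 / 4 * s j) `<=` W.
  move=> v va; apply: dW; have := rV_distD (a j) v z; rewrite /cube /= in va.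
  by have := az j; have := s0 j => ? ? ?; lra.
have KB j : cube (a j) (3 / 4 * s j) `<=` W `&` cube z d.
  move=> v va; split; first exact: KW va.
  have := rV_distD (a j) v z; rewrite /cube /= in va *.
  by have := az j; have := s0 j => ? ? ?; lra.
have mG : measurable_fun (W : set X) (fun v => `|G v| : R).
  by apply: measurable_rV_norm => i; have [_ /(_ i)[[mGi _] _]] := wG.
have -> : box_mean u z (d / 2) = box_mean u (a 0) (s 0 / 2).
  by rewrite /a /s expr0 scale1r mul1r [w + _]addrC subrK.
apply: (geometric_chain (A := fun j => box_mean u (a j) (s j / 2))).
- by rewrite mulr_ge0 ?powR_ge0.
- by rewrite q0.
- move=> j; have sj := s0 j.
  have := @box_mean_dist R n M W u G (a j) (s j / 2) (a j.+1) (s j.+1 / 2) (s j / 4) (a j) (3 / 4 * s j) n0 M0 hM oW wG (KW j).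
  rewrite subrr normr0 add0r sS.
  have e1 : s j / 2 <= 3 / 4 * s j by lra.
  have e2 : `|a j.+1 - a j| + s j / 2 / 2 <= 3 / 4 * s j by have := aa j => ?; lra.
  have e3 : 0 < s j / 4 by lra.
  have e4 : s j / 4 <= s j / 2 by lra.
  have e5 : s j / 4 <= s j / 2 / 2 by lra.
  move=> /(_ e1 e2 e3 e4 e5); set I := (\int[L]_(x in _) _)%E => hI.
  have I0 : (0 <= I)%E by apply: integral_ge0 => v _; rewrite lee_fin.
  have J : (I `^ p <= (2 `^ p * (((2 * s j) ^+ n) `^ (p - 1) * B))%:E)%E.
    have mGj := measurable_funS (open_measurableRn oW) (KW j) mG.
    have jj : 0 < (2 * s j) ^+ n by rewrite exprn_gt0// mulr_gt0.
    have Lj : (L (cube (a j) (3 / 4 * s j)) <= ((2 * s j) ^+ n)%:E)%E.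
      have s34 : 0 < 3 / 4 * s j by lra.
      rewrite lebesgueRn_cube// lee_fin; apply: lerXn2r; rewrite ?nnegrE; lra.
    apply: le_trans (jensen_power (measurable_cube _ _) p1 mGj (fun v _ => rV_norm_ge0 (G v)) jj Lj) _.
    rewrite mulrA [leRHS]EFinM; apply: lee_wpmul2l; first by rewrite lee_fin mulr_ge0 ?powR_ge0.
    apply: le_trans hB; apply: le_ge0_integral_subset; first exact: KB.
    by move=> v _; rewrite lee_fin powR_ge0.
  have c0 : 0 <= n%:R * (M / (s j / 4)) ^+ n.-1.
    by rewrite mulr_ge0// exprn_ge0// divr_ge0 ?ltW.
  set D := `|_| in hI *; have D0 : 0 <= D by rewrite /D.
  set b := _ * _ `^ _; have b0 : 0 <= b by rewrite mulr_ge0 ?powR_ge0.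
  rewrite -(powRKV p0 D0) -(powRKV p0 (mulr_ge0 b0 (exprn_ge0 j (ltW q0)))).
  apply: ge0_ler_powR; rewrite ?nnegrE ?powR_ge0 ?invr_ge0 ?(ltW p0)//.
  have : (D%:E `^ p <= ((n%:R * (M / (s j / 4)) ^+ n.-1)%:E * I) `^ p)%E.
    by apply: le_poweR => //; rewrite lee_fin.
  rewrite (poweR_EFinM _ c0 I0) => h.
  have {h} : (D%:E `^ p <= ((n%:R * (M / (s j / 4)) ^+ n.-1) `^ p * (2 `^ p * (((2 * s j) ^+ n) `^ (p - 1) * B)))%:E)%E.
    by apply: le_trans h _; rewrite [leRHS]EFinM; apply: lee_wpmul2l => //; rewrite lee_fin powR_ge0.
  rewrite poweR_EFin lee_fin (step_identity sj B0) => /le_trans; apply.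
  have dB : 0 <= d `^ (p - n%:R) * B by rewrite mulr_ge0 ?powR_ge0.
  rewrite (powRM _ b0 (exprn_ge0 j (ltW q0))) /b (powRM _ (powR_ge0 _ _) (powR_ge0 _ _)) (powRVK p0 dB).
  rewrite -[leRHS]mulrA; apply: ler_wpM2l; first exact: powR_ge0.
  rewrite /s (powRM _ (ltW (h0 j)) (ltW d0)) (powR_exprn _ _ (ltW q0)) /touch_ratio -powRrM.
  rewrite mulfVK ?gt_eqF// powR_exprn ?invr_ge0//.
  by move: ((2^-1 `^ (p - n%:R)) ^+ j) (d `^ (p - n%:R)) => x y; rewrite le_eqVlt; apply/orP; left; apply/eqP; ring.
- apply/cvgrPdist_le => e e0; have c0 := @box_mass_gt0 R n.
  have e1 : 0 < e / mass by rewrite divr_gt0.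
  have : \forall v \near w, `|u w - u v| < e / mass.
    have /(_ [set t | `|u w - t| < e / mass]) := cu w; apply.
    exact: (nbhsx_ballx (u w) _ e1).
  move=> /nbhs_ballP[r /= r0 hr].
  have hs : \forall j \near \oo, 2 * s j < r.
    have : 2 * s j @[j --> \oo] --> 2 * (0 * d : R).
      apply: cvgM; first exact: cvg_cst.
      apply: cvgM; last exact: cvg_cst.
      by apply: cvg_expr; rewrite ger0_norm ?invr_ge0// invf_lt1// ltr1n.
    rewrite mul0r mulr0 => /cvgrPdist_lt/(_ _ r0); apply: filterS => j.
    by rewrite sub0r normrN gtr0_norm// mulr_gt0.
  near=> j; rewrite distrC; have sj := s0 j.
  have -> : e = mass * (e / mass) by rewrite mulrCA divff ?mulr1// gt_eqF.
  have sj2 : 0 < s j / 2 by lra.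
  apply: box_mean_near => //.
    apply: (locally_integrable_cube oW wG.1) => v va; apply: (KW j).
    by move: va; rewrite /cube /= => ?; lra.
  move=> v va; rewrite distrC ltW//; apply: hr; rewrite -ball_normE /= rV_distC.
  have : 2 * s j < r by near: j; exact: hs.
  have := rV_distD (a j) v w; have := aw j; rewrite /cube /= in va => ? ? ?; lra.
Unshelve. all: end_near. Qed.

Definition touch_value_const : R := (mass^-1 * (2 * (touch_const / (1 - touch_ratio)))) `^ p.

(** The chains towards w = z and towards w = y start from the same mean, so u z is compared with u
    y, which is 0. *)
Lemma touch_value W u G z y : open W -> continuous u -> weak_gradient W u G ->
  (forall v, `|v - z| < `|z - y| -> W v) -> z != y -> u y = 0 ->
  ((`|u z| `^ p)%:E <= (touch_value_const * `|z - y| `^ (p - n%:R))%:E *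
    \int[L]_(v in W `&` cube z (`|z - y|)%R) (`|G v| `^ p)%:E)%E.
Proof.
move=> oW cu wG dW zy uy; set I := (\int[L]_(v in _) _)%E; set d := `|z - y| in dW I *.
have I0 : (0 <= I)%E by apply: integral_ge0 => v _; rewrite lee_fin powR_ge0.
have d0 : 0 < d by rewrite normr_gt0 subr_eq0.
have c0 := @box_mass_gt0 R n; have /andP[q0 q1] := touch_ratio01.
have T0 : 0 < touch_const.
  rewrite powR_gt0// mulr_gt0// ?mulr_gt0// powR_gt0// ?exprn_gt0//.
  by rewrite mulr_gt0 ?ltr0n// exprn_gt0// mulr_gt0.
have tv0 : 0 < touch_value_const.
  by rewrite powR_gt0// mulr_gt0 ?invr_gt0// mulr_gt0// divr_gt0// subr_gt0.
have [I1|] := ltP I +oo%E; last first.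
  rewrite leye_eq => /eqP ->; rewrite gt0_muley ?leey// lte_fin mulr_gt0// powR_gt0//.
have If : I \is a fin_num by rewrite ge0_fin_numE.
have B0 : 0 <= fine I by rewrite fine_ge0.
have hB : (I <= (fine I)%:E)%E by rewrite fineK.
have hzz : `|z - z| <= d by rewrite subrr normr0 ltW.
have h1 := box_mean_touch oW cu wG d0 dW hzz B0 hB.
have h2 := box_mean_touch oW cu wG d0 dW (lexx d) B0 hB.
rewrite uy mulr0 subr0 in h2; rewrite -(fineK If) -EFinM lee_fin.
set b := (_ * _) `^ _ in h1 h2; have b0 : 0 <= b by exact: powR_ge0.
have h3 : `|u z| <= mass^-1 * (2 * (touch_const / (1 - touch_ratio))) * b.
  rewrite -mulrA ler_pdivlMl// -[X in X * _](gtr0_norm c0) -normrM.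
  move: (mass * u z) (box_mean u z (d / 2)) h1 h2 => A C h1 h2.
  have := ler_distD C A 0; rewrite !subr0 (distrC A C) => h.
  apply: le_trans h _; apply: le_trans (lerD h1 h2) _.
  by rewrite le_eqVlt; apply/orP; left; apply/eqP; ring.
have bp : b `^ p = d `^ (p - n%:R) * fine I by rewrite powRVK// mulr_ge0 ?powR_ge0.
rewrite -mulrA -bp /touch_value_const -powRM//; last first.
  by rewrite mulr_ge0 ?invr_ge0 ?(ltW c0)// mulr_ge0// divr_ge0 ?(ltW T0)// subr_ge0 ltW.
apply: ge0_ler_powR; rewrite ?nnegrE ?(ltW p0)//.
by apply: le_trans h3.
Qed.

(** A nearest point of the complement in the max norm, obtained by minimising the distance over a
    compact piece of it. *)
Lemma exists_touching W z y0 : open W -> W z -> ~ W y0 ->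
  exists y, [/\ ~ W y, `|z - y| <= `|z - y0| & forall v, `|v - z| < `|z - y| -> W v].
Proof.
move=> oW Wz Wy0; pose A : set V := ~` W `&` cube z `|z - y0|.
have cA : compact A.
  apply: (subclosed_compact _ (@compact_cube R n z `|z - y0|)); last exact: subIsetr.
  by apply: closedI; [exact: open_closedC|exact: closed_cube].
have A0 : A !=set0 by exists y0; split=> //; rewrite /cube /= rV_distC.
have cf : {within A, continuous (fun y : V => `|z - y|)}.
  apply: continuous_subspaceT => x.
  apply: (proj2 (@cvgrPdist_lt _ _ _ (nbhs x) (nbhs_filter x) (fun y : V => `|z - y|) (`|z - x|))) => e e0; apply: filterS (near_dist x e0) => y yx.
  have := rV_distD x z y; have := rV_distD y z x; rewrite (rV_distC x y) => h1 h2.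
  by rewrite ltr_norml; apply/andP; split; lra.
have [y /set_mem[Wy zy] hy] := EVT_min_rV A0 cA cf.
exists y; split=> //; first by rewrite rV_distC.
have Ay0 : A y0 by split=> //; rewrite /cube /= rV_distC.
have h0 : `|z - y| <= `|z - y0| := hy y0 (mem_set Ay0).
move=> v vz; apply: contrapT => Wv.
have Av : A v by split=> //; rewrite /cube /=; exact: le_trans (ltW vz) h0.
have : `|z - y| <= `|z - v| := hy v (mem_set Av).
by rewrite (rV_distC z v) leNgt vz.
Qed.

End touching.

Lemma RintegralDBD d (T : measurableType d) (R : realType) (mu : {measure set T -> \bar R})
    (D : set T) (a b c e : T -> R) : measurable D ->
  mu.-integrable D (EFin \o a) -> mu.-integrable D (EFin \o b) ->
  mu.-integrable D (EFin \o c) -> mu.-integrable D (EFin \o e) ->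
  \int[mu]_(x in D) (a x + b x - (c x + e x)) =
  \int[mu]_(x in D) a x + \int[mu]_(x in D) b x - (\int[mu]_(x in D) c x + \int[mu]_(x in D) e x).
Proof.
move=> mD ia ib ic ie; rewrite RintegralB ?RintegralD//.
- by apply: eq_integrable (integrableD mD ia ib).
- by apply: eq_integrable (integrableD mD ic ie).
Qed.

(** * Extension by zero of a function vanishing off an open set *)

Section zero_extension.
Context {R : realType} {n : nat}.
Local Notation V := 'rV[R]_n.
Local Notation X := (borelRn R n).
Local Notation L := (@lebesgueRn R n).
Variables (p M : R).
Local Notation touch_value_const := (@touch_value_const R n p M).
Hypotheses (n0 : (0 < n)%N) (pn : n%:R < p).
Hypotheses (M0 : 0 < M) (hM : forall t : R, dstep t <= M).
Variable K : R.
Hypotheses (K0 : 0 < K) (hK : forall (i : 'I_n) (z : V), `|partial i plateau z| <= K).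
Variables (W : set V) (u : V -> R) (G : V -> V).
Hypotheses (oW : open W) (cu : continuous u) (uW : forall z, ~ W z -> u z = 0).
Hypotheses (wG : weak_gradient W u G) (Gp : (\int[L]_(z in W) (`|G z| `^ p)%:E < +oo)%E).
Implicit Types (z y v : V) (eps : R).

Let p1 : 1 < p. Proof. by rewrite (le_lt_trans _ pn)// ler1n. Qed.
Let p0 : 0 < p. Proof. by rewrite (lt_trans _ p1). Qed.
Let mW : @measurable _ X W. Proof. exact: open_measurableRn. Qed.
Let sleb : sigma_finite setT L. Proof. exact: sigma_finite_lebesgueRn. Qed.

Let mG : measurable_fun (W : set X) (fun v => `|G v| : R).
Proof. by apply: measurable_rV_norm => i; have [_ /(_ i)[[mGi _] _]] := wG. Qed.

Let h : X -> \bar R := (fun v : X => (`|G v| `^ p)%:E) \_ W.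

Let h0 z : (0 <= h z)%E. Proof. by apply: erestrict_ge0 => y _; rewrite lee_fin powR_ge0. Qed.

Let mh : measurable_fun [set: X] h.
Proof.
have [hm _] := measurable_restrictT (fun v : X => (`|G v| `^ p)%:E) mW; apply: hm.
by apply/measurable_EFinP; exact: measurable_fun_powR.
Qed.

Let layer eps : set X := W `&` tube (~` W) eps.

Let mlayer eps : measurable (layer eps).
Proof. by apply: measurableI => //; exact: measurable_tube. Qed.

(** W being open, each of its points leaves the layers as they get thinner, and dominated
    convergence applies to the integrable function h. *)
Let layer_small (eta : R) : 0 < eta -> exists2 eps : R, 0 < eps <= 1 & (\int[L]_(z in layer (6 * eps)) h z <= eta%:E)%E.
Proof.
move=> eta0; pose f (k : nat) : X -> \bar R := h \_ (tube (~` W) (6 * k.+1%:R^-1)).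
have mf k : measurable_fun (W : set X) (f k).
  apply: measurable_funTS; have [hm _] := measurable_restrictT h (measurable_tube (~` W) (6 * k.+1%:R^-1)).
  by apply: hm; exact: measurable_funTS.
have fcvg (x : X) : W x -> f ^~ x @ \oo --> (0%:E : \bar R).
  move=> Wx; have /nbhs_ballP[r /= r0 hr] : nbhs (x : V) W by exact: open_nbhs_nbhs.
  apply: cvg_near_cst; have r60 : 0 < r / 6 by rewrite divr_gt0.
  have := near_infty_natSinv_lt (PosNum r60); apply: filterS => k /= kr.
  rewrite /f patchE; case: ifPn => // /set_mem[y Wy xy]; exfalso; apply: Wy; apply: hr.
  rewrite -ball_normE /=; apply: lt_trans xy _.
  by rewrite mulrC -ltr_pdivlMr.
have ih : L.-integrable (W : set X) h.
  apply/integrableP; split; first exact: measurable_funTS.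
  under eq_integral do rewrite gee0_abs//.
  by rewrite /h -integral_mkcondr setIid.
have ff : {ae L, forall x, W x -> f ^~ x @ \oo --> (cst 0%:E : X -> \bar R) x}.
  by apply: aeW => x; exact: fcvg.
have fh : {ae L, forall x k, W x -> (`|f k x| <= h x)%E}.
  apply: aeW => x k _; rewrite /f patchE; case: ifP => _; first by rewrite gee0_abs.
  by rewrite abse0.
have [_ _] := dominated_convergence mW mf (measurable_cst _) ff ih fh.
rewrite integral0 => cf.
have : \forall k \near \oo, (\int[L]_(x in W) f k x < eta%:E)%E.
  have /fine_cvgP[ff' cf'] : (\int[L]_(x in W) f k x)%E @[k --> \oo] --> (0%:E : \bar R) by exact: cf.
  have /cvgrPdist_lt/(_ _ eta0) := cf'; apply: filterS2 ff' => k fk.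
  rewrite sub0r normrN => hk; rewrite -(fineK fk) lte_fin; exact: le_lt_trans (ler_norm _) hk.
move=> [k _ /(_ k (leqnn k))] /= hk; exists k.+1%:R^-1.
  by rewrite invr_gt0 ltr0n /= invf_le1 ?ltr0n// ler1n.
by rewrite /layer integral_mkcondr ltW.
Qed.

(** [touch_value] at a nearest point of the complement, integrated by Tonelli over the layer. The
    resulting factor is of order eps^p, which is exactly what the gradient of the cutoff costs. *)
Let layer_u eps : 0 < eps ->
  (\int[L]_(z in layer (3 * eps)) (`|u z| `^ p)%:E <=
   (touch_value_const * ((3 * eps) `^ (p - n%:R) * (6 * eps) ^+ n))%:E * \int[L]_(z in layer (6 * eps)) h z)%E.
Proof.
move=> e0; have e3 : 0 < 3 * eps by rewrite mulr_gt0.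
have e66 : 6 * eps = 3 * eps + 3 * eps by lra.
have tv0 : 0 <= touch_value_const by exact: powR_ge0.
set c := touch_value_const; have c0 : 0 <= c * (3 * eps) `^ (p - n%:R) by rewrite mulr_ge0 ?powR_ge0.
have one0 (x : X) : (0 <= (fun=> 1%:E) x :> \bar R)%E by rewrite lee_fin.
have mI := measurable_integral_cube (3 * eps) sleb (mlayer (6 * eps)) mh h0.
apply: (@le_trans _ _ (\int[L]_z ((c * (3 * eps) `^ (p - n%:R))%:E * \int[L]_(v in layer (6 * eps) `&` cube (z : V) (3 * eps)) h v))%E).
  apply: (@le_trans _ _ (\int[L]_(z in layer (3 * eps)) ((c * (3 * eps) `^ (p - n%:R))%:E * \int[L]_(v in layer (6 * eps) `&` cube (z : V) (3 * eps)) h v))%E); last first.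
    apply: le_ge0_integral_subset => // z _; rewrite mule_ge0 ?lee_fin//; exact: integral_ge0.
  apply: le_ge0_integral => z [Wz [y0 Wy0 zy0]]; first by rewrite lee_fin powR_ge0.
  have [y [Wy zy dW]] := exists_touching oW Wz Wy0.
  have zny : z != y by apply/eqP => e; apply: Wy; rewrite -e.
  apply: le_trans (touch_value n0 pn M0 hM oW cu wG dW zny (uW Wy)) _.
  have zy3 : `|z - y| <= 3 * eps by exact: le_trans zy (ltW zy0).
  apply: lee_pmul; rewrite ?lee_fin ?mulr_ge0 ?powR_ge0//.
  - by apply: integral_ge0 => v _; rewrite lee_fin powR_ge0.
  - apply: ler_wpM2l => //; apply: ge0_ler_powR; rewrite ?nnegrE ?subr_ge0 ?(ltW pn) ?(ltW e3)//.
  - rewrite integral_mkcond [leRHS]integral_mkcond; apply: le_ge0_integral => v _.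
      by apply: erestrict_ge0 => ? _; rewrite lee_fin powR_ge0.
    rewrite !patchE; case: ifPn => [/set_mem[Wv vz]|_]; last first.
      by case: ifP => // _; exact: h0.
    rewrite mem_set; first by rewrite /h patchE mem_set.
    rewrite /cube /= in vz; split; last by rewrite /cube /=; exact: le_trans zy3.
    split=> //; exists y => //; rewrite e66.
    apply: le_lt_trans (rV_distD (z : V) v y) _.
    by apply: ler_ltD; [exact: le_trans vz zy3|exact: le_lt_trans zy zy0].
rewrite ge0_integralZl//; last by move=> z _; exact: integral_ge0.
have tI : (\int[L]_z \int[L]_(v in layer (6 * eps) `&` cube (z : V) (3 * eps)) h v =
   \int[L]_(v in layer (6 * eps)) (h v * ((6 * eps) ^+ n)%:E))%E.
  transitivity (\int[L]_(z in setT) ((fun=> 1%:E) z * \int[L]_(v in layer (6 * eps) `&` cube (z : V) (3 * eps)) h v))%E.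
    by apply: eq_integral => z _; rewrite mul1e.
  rewrite (tonelli_cube_prod (3 * eps) sleb sleb measurableT (mlayer (6 * eps)) (measurable_cst 1%:E) mh one0 h0).
  apply: eq_integral => v _; rewrite setTI integral_cst; last exact: measurable_cube.
  by rewrite mul1e lebesgueRn_cube// (_ : (3 * eps) *+ 2 = 6 * eps)//; lra.
rewrite tI ge0_integralZr//; last 2 first.
- exact: measurable_funTS.
- by rewrite lee_fin exprn_ge0// mulr_ge0// ltW.
by rewrite muleCA muleC -!muleA muleA -EFinM mulrA [in leRHS]EFinM.
Qed.

Definition zero_ext (z : V) : V := if z \in W then G z else 0.

Let H i (z : V) : R := zero_ext z ord0 i.

Let HE i z : H i z = if z \in W then G z ord0 i else 0.
Proof. by rewrite /H /zero_ext; case: ifP => // _; rewrite mxE. Qed.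

Let mH i : measurable_fun [set: X] (H i : X -> R).
Proof.
have [_ /(_ i)[[mGi _] _]] := wG.
have [hm _] := measurable_restrictT (fun z : X => (G z ord0 i)%:E) mW.
have := measurableT_comp (fine_measurable measurableT) (hm ((measurable_EFinP _ _).2 mGi)).
by congr (measurable_fun _ _); apply/funext => z; rewrite /= patchE HE; case: ifP.
Qed.

Let Hh i z : (`|H i z|%:E <= h z + 1%:E)%E.
Proof.
rewrite HE /h patchE; case: ifP => _; last by rewrite normr0 add0e lee_fin.
rewrite -EFinD lee_fin; apply: le_trans (rV_coord_le (G z) i) _.
by apply: le_powRD1; [exact: ltW|exact: rV_norm_ge0].
Qed.

Let integral_h : (\int[L]_z h z < +oo)%E.
Proof. by rewrite /h -integral_mkcond. Qed.

Let iH i r : L.-integrable (cube (0 : V) r) (EFin \o (H i : X -> R)).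
Proof.
have mC := @measurable_cube R n 0 r.
apply/integrableP; split; first by apply: measurable_funTS; apply/measurable_EFinP.
apply: (@le_lt_trans _ _ (\int[L]_(z in cube (0 : V) r) (h z + 1%:E))%E).
  by apply: le_ge0_integral => z _ //=; exact: Hh.
rewrite ge0_integralD//; last exact: measurable_funTS.
rewrite lte_add_pinfty//.
  by apply: le_lt_trans integral_h; apply: le_ge0_integral_subset.
by rewrite integral_cst// mul1e lebesgueRn_cube_lty.
Qed.

Let locally_integrable_ext i : locally_integrableRn setT (H i).
Proof.
split=> [|C cC _]; first exact: mH.
have [B [Br hB]] := compact_bounded cC.
have sub : C `<=` cube (0 : V) (`|B| + 1).
  by move=> z Cz; rewrite /cube /= subr0; apply: (hB (`|B| + 1)) => //; rewrite (le_lt_trans (ler_norm _))// ltrDl.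
have /integrableP[_ fin] := iH i (`|B| + 1).
by apply: le_lt_trans fin; apply: le_ge0_integral_subset => //= z _; rewrite lee_fin.
Qed.

Let young_const (eta : R) : R := eta * eta^-1 `^ p.

(** Trades a first power for an arbitrarily small constant, to be integrated over a fixed cube, and
    a p-th power, which [layer_u] and [layer_small] control. *)
Let young (eta a : R) : 0 < eta -> 0 <= a -> a <= eta + young_const eta * a `^ p.
Proof.
move=> e0 a0; have ae : 0 <= a / eta by rewrite divr_ge0// ltW.
have := le_powRD1 (ltW p1) ae; rewrite powRM ?invr_ge0 ?(ltW e0)// ler_pdivrMr// => /le_trans; apply.
by rewrite /young_const le_eqVlt; apply/orP; left; apply/eqP; ring.
Qed.

Lemma test_function_cutoff phi eps : 0 < eps -> test_function setT phi ->
  test_function W (fun z => (1 - cutoff (~` W) eps z) * phi z).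
Proof.
move=> e0 [sp cp _]; set psi := fun z => _.
have cl : closure [set z | psi z != 0] `<=` closure [set z | phi z != 0] `&` ~` tube (~` W) eps.
  rewrite subsetI; split.
    by apply: closure_subset => z /=; apply: contra_neq => e; rewrite /psi e mulr0.
  rewrite (closure_id (~` tube (~` W) eps)).1; last by apply: open_closedC; exact: open_tube.
  apply: closure_subset => z /=; rewrite /psi => pz zt; move: pz.
  by rewrite cutoff_eq1// subrr mul0r eqxx.
split.
- apply/smoothP => N; apply: CkM; last exact: (smoothP _).1.
  by apply: CkB; [exact: Ck_cst|exact: Ck_cutoff].
- by apply: (subclosed_compact _ cp); [exact: closed_closure|move=> z /cl[]].
- by move=> z /cl[_ zt]; apply: contrapT => Wz; apply: zt; exists z => //; rewrite subrr normr0.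
Qed.

Let cutoff_product (C A e a x dx f df b g : R) : 0 < C -> 0 <= A -> 0 < e -> e <= 1 ->
  `|x| <= 1 -> `|df| <= C -> `|f| <= C -> `|dx| <= A / e -> `|b| <= g ->
  `|a * (x * df + f * dx) + b * (x * f)| <= C * (1 + A) * (`|a| / e + g).
Proof.
move=> C0 A0 e0 e1 x1 df1 f1 dx1 bg.
have h1 : `|x| * `|df| <= 1 * C by exact: ler_pM.
have h2 : `|f| * `|dx| <= C * (A / e) by exact: ler_pM.
have h3 : `|x| * `|f| <= 1 * C by exact: ler_pM.
have CA : C <= C * (1 + A) by rewrite ler_peMr ?(ltW C0)// lerDl.
apply: le_trans (ler_normD _ _) _; rewrite [leRHS]mulrDr; apply: lerD.
  have -> : C * (1 + A) * (`|a| / e) = `|a| * (C * e^-1 + C * (A / e)) by field; rewrite gt_eqF.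
  rewrite normrM; apply: ler_wpM2l => //; apply: le_trans (ler_normD _ _) _; rewrite !normrM; apply: lerD => //.
  by apply: le_trans h1 _; rewrite mul1r ler_peMr ?(ltW C0)// invf_ge1.
rewrite normrM mulrC; apply: ler_pM => //; rewrite normrM; apply: le_trans h3 _.
by rewrite mul1r.
Qed.

(** [psi] is a test function on W and has no defect in the integration by parts. The defect for
    [phi] is therefore that for [chi * phi], which involves u and G only in the layer of width 3
    eps. *)
Let ext_bound (i : 'I_n) phi rho C eps eta : test_function setT phi -> 0 < rho -> vanish_off rho phi ->
  0 < C -> (forall z, `|phi z| <= C) -> (forall z, `|partial i phi z| <= C) ->
  0 < eps <= 1 -> 0 < eta ->
  (`|\int[L]_(z in cube (0 : V) rho) (u z * partial i phi z) + \int[L]_(z in cube (0 : V) rho) (H i z * phi z)|%:E <=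
   (C * (1 + 2 ^+ n * K))%:E * ((2 * eta)%:E * L (cube (0%R : V) rho) +
     (young_const eta * (touch_value_const * (3 `^ (p - n%:R) * 6 ^+ n) + 1))%:E * \int[L]_(z in layer (6 * eps)) h z))%E.
Proof.
move=> tp rho0 vp C0 pC dC /andP[e0 e1] eta0.
pose chi := cutoff (~` W) eps; pose psi z := (1 - chi z) * phi z.
have sp : smooth phi by case: tp.
have Cp N : Ck N phi by exact: (smoothP _).1.
have Cc N : Ck N chi by exact: Ck_cutoff.
have Cpsi N : Ck N psi by apply: CkM => //; apply: CkB => //; exact: Ck_cst.
have vpsi : vanish_off rho psi by exact: vanish_offM.
have mC := @measurable_cube R n 0 rho.
have dpsi z : partial i psi z = (1 - chi z) * partial i phi z - phi z * partial i chi z.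
  have d1 : derivable (fun z : V => 1 - chi z) z (delta_mx ord0 i).
    exact: (Ck_derivable (CkB (Ck_cst 1 1) (Cc 1))).
  rewrite (partialM d1 (Ck_derivable (Cp 1))) partialB; [|exact: (Ck_derivable (Ck_cst 1 1))|exact: (Ck_derivable (Cc 1))].
  by rewrite (partial_cst i 1) /= sub0r mulrN.
have iu (g : V -> R) : continuous g -> vanish_off rho g -> L.-integrable (cube (0 : V) rho) (EFin \o (fun z : X => u z * g z)).
  move=> cg vg; have := integrable_vanish_off (lebesgueRn_cube_lty 0) (continuous_mul cu cg) (vanish_offM u vg).
  by apply: integrableS.
have i1 := iu _ (Ck_continuous (Ck_partial i (Cp 1))) (vanish_off_partial i vp).
have i2 := iu _ (Ck_continuous (Ck_partial i (Cpsi 1))) (vanish_off_partial i vpsi).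
have j1 := integrable_cubeM (iH i rho) (Ck_continuous (Cp 0)).
have j2 := integrable_cubeM (iH i rho) (Ck_continuous (Cpsi 0)).
have eq0 : \int[L]_(z in cube (0 : V) rho) (u z * partial i psi z) + \int[L]_(z in cube (0 : V) rho) (H i z * psi z) = 0.
  have [_ /(_ i)[_ /(_ psi (test_function_cutoff e0 tp))]] := wG.
  have -> : (\int[L]_(z in W) (u z * partial i psi z)%:E = \int[L]_(z in cube (0 : V) rho) (u z * partial i psi z)%:E)%E.
    rewrite integral_mkcond [RHS]integral_mkcond; apply: eq_integral => z _; rewrite !patchE.
    case: ifPn => [_|/negP Wz]; case: ifPn => [_|/negP zc] //.
      rewrite (vanish_off_partial i vpsi) ?mulr0// ltNge; apply/negP => zr; apply: zc; apply: mem_set.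
      by rewrite /cube /= subr0.
    by rewrite uW ?mul0r// => Wz'; apply: Wz; exact: mem_set.
  have -> : (\int[L]_(z in W) (G z ord0 i * psi z)%:E = \int[L]_(z in cube (0 : V) rho) (H i z * psi z)%:E)%E.
    rewrite integral_mkcond [RHS]integral_mkcond; apply: eq_integral => z _; rewrite !patchE HE.
    case: ifPn => [_|/negP Wz]; case: ifPn => [_|/negP zc] //; last by rewrite mul0r.
    rewrite vpsi ?mulr0// ltNge; apply/negP => zr; apply: zc; apply: mem_set.
    by rewrite /cube /= subr0.
  by rewrite /Rintegral => ->; rewrite fineN addNr.
pose g z := (u z * partial i phi z + H i z * phi z) - (u z * partial i psi z + H i z * psi z).
have ig : L.-integrable (cube (0 : V) rho) (EFin \o (g : X -> R)).
  have ii := integrableB mC (integrableD mC i1 j1) (integrableD mC i2 j2).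
  by apply: eq_integrable ii.
have -> : \int[L]_(z in cube (0 : V) rho) (u z * partial i phi z) + \int[L]_(z in cube (0 : V) rho) (H i z * phi z) =
    \int[L]_(z in cube (0 : V) rho) g z.
  by rewrite -[LHS]subr0 -[X in _ - X]eq0; exact: esym (RintegralDBD mC i1 j1 i2 j2).
rewrite EFin_normr_Rintegral//; apply: le_trans (le_abse_integral L mC (measurable_int _ ig)) _.
set D : R := C * (1 + 2 ^+ n * K); have D0 : 0 <= D.
  by rewrite mulr_ge0 ?(ltW C0)// addr_ge0// mulr_ge0 ?exprn_ge0 ?(ltW K0).
have yc0 : 0 <= young_const eta by rewrite mulr_ge0 ?powR_ge0// ltW.
pose U : X -> \bar R := (fun z : X => (`|u z| `^ p)%:E) \_ (layer (3 * eps)).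
have U0 z : (0 <= U z)%E by apply: erestrict_ge0 => y _; rewrite lee_fin powR_ge0.
pose h6 : X -> \bar R := h \_ (layer (6 * eps)).
have h60 z : (0 <= h6 z)%E by apply: erestrict_ge0 => y _; exact: h0.
have gle z : (`|g z|%:E <= D%:E * ((2 * eta)%:E + (young_const eta)%:E * ((eps^-1 `^ p)%:E * U z + h6 z)))%E.
  have R0 : (0 <= D%:E * ((2 * eta)%:E + (young_const eta)%:E * ((eps^-1 `^ p)%:E * U z + h6 z)))%E.
    rewrite mule_ge0 ?lee_fin// adde_ge0 ?lee_fin ?mulr_ge0 ?(ltW eta0)//.
    by rewrite mule_ge0 ?lee_fin// adde_ge0// mule_ge0// lee_fin powR_ge0.
  have gE : g z = u z * (chi z * partial i phi z + phi z * partial i chi z) + H i z * (chi z * phi z).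
    by rewrite /g dpsi /psi; ring.
  have [Wz|Wz] := pselect (W z); last first.
    rewrite gE uW// HE ifF ?mul0r ?addr0 ?normr0//; apply/negbTE/negP => /set_mem; exact: Wz.
  have [zt|zt] := pselect (tube (~` W) (3 * eps) z); last first.
    by rewrite gE /chi (cutoff_eq0 e0 zt) (partial_cutoff_eq0_far i e0 zt) !(mul0r, mulr0) add0r mulr0 add0r normr0.
  have l3 : z \in layer (3 * eps) by apply: mem_set; split.
  have l6 : z \in layer (6 * eps).
    apply: mem_set; split=> //; apply: tube_le zt; by rewrite ler_wpM2r ?(ltW e0)// ler_nat.
  rewrite /U patchE l3 /h6 patchE l6 /h patchE (mem_set (Wz : (W : set X) z)) -!(EFinM, EFinD) lee_fin.
  apply: (@le_trans _ _ (D * (`|u z| / eps + `|G z|))).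
    rewrite gE; apply: cutoff_product => //.
    - by rewrite mulr_ge0 ?exprn_ge0// ltW.
    - by rewrite ger0_norm ?cutoff_ge0// cutoff_le1.
    - exact: partial_cutoff_le.
    - by rewrite HE (mem_set (Wz : (W : set X) z)); exact: rV_coord_le.
  apply: ler_wpM2l => //.
  have ue : 0 <= `|u z| / eps by rewrite divr_ge0// ltW.
  have y1 := young eta0 ue; have y2 := young eta0 (rV_norm_ge0 (G z)).
  apply: le_trans (lerD y1 y2) _.
  rewrite (powRM _ (normr_ge0 (u z)) (_ : 0 <= eps^-1)); last by rewrite invr_ge0 ltW.
  by rewrite le_eqVlt; apply/orP; left; apply/eqP; ring.
have mU : measurable_fun [set: X] U.
  have [hm _] := measurable_restrictT (fun z : X => (`|u z| `^ p)%:E) (mlayer (3 * eps)); apply: hm.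
  apply: measurable_funTS; apply/measurable_EFinP; apply: measurable_fun_powR.
  exact: measurableT_comp (@normr_measurable R setT) (continuous_measurableRn cu).
have mh6 : measurable_fun [set: X] h6.
  by have [hm _] := measurable_restrictT h (mlayer (6 * eps)); apply: hm; exact: measurable_funTS.
have me : measurable_fun [set: X] (fun z => (eps^-1 `^ p)%:E * U z)%E by exact: measurable_funeM.
have mS : measurable_fun [set: X] (fun z => (eps^-1 `^ p)%:E * U z + h6 z)%E by exact: emeasurable_funD.
have eU0 z : (0 <= (eps^-1 `^ p)%:E * U z)%E by rewrite mule_ge0// lee_fin powR_ge0.
have S0 z : (0 <= (eps^-1 `^ p)%:E * U z + h6 z)%E by rewrite adde_ge0.
have mY : measurable_fun [set: X] (fun z => (young_const eta)%:E * ((eps^-1 `^ p)%:E * U z + h6 z))%E by exact: measurable_funeM.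
have Y0 z : (0 <= (young_const eta)%:E * ((eps^-1 `^ p)%:E * U z + h6 z))%E by rewrite mule_ge0// lee_fin.
have e20 : (0 <= (2 * eta)%:E)%E by rewrite lee_fin mulr_ge0// ltW.
have T0 z : (0 <= (2 * eta)%:E + (young_const eta)%:E * ((eps^-1 `^ p)%:E * U z + h6 z))%E by rewrite adde_ge0.
apply: le_trans (le_ge0_integral L (fun z _ => _) (fun z _ => gle z)) _ => //.
rewrite ge0_integralZl_EFin//; last by apply: measurable_funTS; exact: emeasurable_funD.
apply: lee_wpmul2l; first by rewrite lee_fin.
rewrite ge0_integralD//; last exact: measurable_funTS.
rewrite integral_cst//; apply: leeD => //.
rewrite ge0_integralZl_EFin//; last exact: measurable_funTS.
rewrite (EFinM (young_const eta)) -[leRHS]muleA; apply: lee_wpmul2l; first by rewrite lee_fin.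
set I6 := (\int[L]_(z in layer (6 * eps)) h z)%E.
have I60 : (0 <= I6)%E by exact: integral_ge0.
have t0 : 0 <= touch_value_const by exact: powR_ge0.
rewrite EFinD ge0_muleDl ?lee_fin ?mulr_ge0 ?powR_ge0 ?exprn_ge0// mul1e.
rewrite ge0_integralD//; [|exact: measurable_funTS|exact: measurable_funTS]; apply: leeD; last first.
  by rewrite /I6 [leRHS]integral_mkcond; exact: le_ge0_integral_subset.
rewrite ge0_integralZl_EFin ?powR_ge0//; last exact: measurable_funTS.
apply: (@le_trans _ _ ((eps^-1 `^ p)%:E * \int[L]_(z in layer (3 * eps)) (`|u z| `^ p)%:E)%E).
  apply: lee_wpmul2l; first by rewrite lee_fin powR_ge0.
  by rewrite [leRHS]integral_mkcond; exact: le_ge0_integral_subset.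
apply: le_trans (lee_wpmul2l _ (layer_u e0)) _; first by rewrite lee_fin powR_ge0.
rewrite muleA -EFinM le_eqVlt; apply/orP; left; apply/eqP; congr (_%:E * _)%E.
rewrite mulrCA; congr (_ * _).
rewrite (powRM _ (ler0n _ 3) (ltW e0)) exprMn powRVn//.
have -> : eps `^ p = eps `^ (p - n%:R) * eps ^+ n.
  by rewrite -powR_mulrn ?(ltW e0)// -powRD ?subrK// (gt_eqF e0) implybT.
have N1 := lt0r_neq0 (powR_gt0 (p - n%:R) e0); have N2 : eps ^+ n != 0 by rewrite expf_neq0// gt_eqF.
move: (eps `^ (p - n%:R)) N1 (eps ^+ n) N2 (3 `^ (p - n%:R)) (6 ^+ n) => a a0 b b0 c d.
by field; rewrite a0 b0.
Qed.

Lemma locally_integrable_continuous (v : V -> R) : continuous v -> locally_integrableRn setT v.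
Proof.
move=> cv; split=> [|C cC _]; first exact: continuous_measurableRn.
have [B [Br hB]] := compact_bounded (continuous_compact (continuous_subspaceT cv) cC).
have [B' [Br' hB']] := compact_bounded cC.
apply: (@le_lt_trans _ _ (\int[L]_(x in C) (`|B| + 1)%:E)%E).
  apply: le_ge0_integral => x Cx; rewrite lee_fin//.
  by apply: (hB (`|B| + 1)); [rewrite (le_lt_trans (ler_norm _))// ltrDl|exists x].
have sub : C `<=` cube (0 : V) (`|B'| + 1).
  by move=> z Cz; rewrite /cube /= subr0; apply: (hB' (`|B'| + 1)) => //; rewrite (le_lt_trans (ler_norm _))// ltrDl.
apply: (@le_lt_trans _ _ (\int[L]_(x in cube (0%R : V) (`|B'| + 1)%R) (`|B| + 1)%:E)%E).
  by apply: le_ge0_integral_subset => // x _; rewrite lee_fin addr_ge0.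
rewrite integral_cst; last exact: measurable_cube.
by rewrite lebesgueRn_cube ?ltr_wpDl// ltry.
Qed.

(** The order of choices matters: [young_const eta] grows without bound as [eta] decreases, so [eta]
    is fixed first and the layer is then made thin enough for its energy to absorb that constant. *)
Lemma zero_extension : weak_gradient setT u zero_ext.
Proof.
split; first exact: locally_integrable_continuous.
move=> i; split=> [|phi tp]; first exact: locally_integrable_ext.
have [rho rho0 vp] := test_function_vanish_off tp.
have sp : smooth phi by case: tp.
have Cp N : Ck N phi by exact: (smoothP _).1.
have [C1 [C10 hC1]] := vanish_off_bounded (Ck_continuous (Cp 0)) vp.
have [C2 [C20 hC2]] := vanish_off_bounded (Ck_continuous (Ck_partial i (Cp 1))) (vanish_off_partial i vp).
pose C := C1 + C2; have C0 : 0 < C by rewrite addr_gt0.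
have pC z : `|phi z| <= C by apply: le_trans (hC1 z) _; rewrite lerDl ltW.
have dC z : `|partial i phi z| <= C by apply: le_trans (hC2 z) _; rewrite lerDr ltW.
have mC := @measurable_cube R n 0 rho.
set I1 := \int[L]_(z in cube (0 : V) rho) (u z * partial i phi z).
set I2 := \int[L]_(z in cube (0 : V) rho) (H i z * phi z).
pose c := C * (1 + 2 ^+ n * K) * (2 * (rho *+ 2) ^+ n + 1).
have A0 : 0 < 1 + 2 ^+ n * K by rewrite ltr_pwDl// mulr_ge0 ?exprn_ge0// ltW.
have r0 : 0 <= (rho *+ 2) ^+ n by rewrite exprn_ge0// mulrn_wge0// ltW.
have c0 : 0 < c by rewrite /c mulr_gt0// ?mulr_gt0// ltr_pwDr// mulr_ge0.
have bound eta : 0 < eta -> `|I1 + I2| <= c * eta.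
  move=> eta0; pose k := young_const eta * (touch_value_const * (3 `^ (p - n%:R) * 6 ^+ n) + 1).
  have k0 : 0 < k.
    rewrite /k mulr_gt0//; first by rewrite mulr_gt0// powR_gt0// invr_gt0.
    by rewrite ltr_pwDr// mulr_ge0 ?powR_ge0// mulr_ge0 ?powR_ge0// exprn_ge0.
  have ek : 0 < eta / k by rewrite divr_gt0.
  have [eps heps hl] := layer_small ek.
  have := ext_bound tp rho0 vp C0 pC dC heps eta0.
  rewrite -/I1 -/I2 -/k lebesgueRn_cube// => /le_trans h1.
  have h2 : (`|I1 + I2|%:E <= (C * (1 + 2 ^+ n * K) * (2 * eta * (rho *+ 2) ^+ n + k * (eta / k)))%:E)%E.
    apply: h1; rewrite [leRHS]EFinM; apply: lee_wpmul2l; first by rewrite lee_fin mulr_ge0 ?(ltW C0) ?(ltW A0).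
    rewrite [leRHS]EFinD; apply: leeD; first by rewrite [leRHS]EFinM.
    by rewrite [leRHS]EFinM; apply: lee_wpmul2l => //; rewrite lee_fin ltW.
  move: h2; rewrite lee_fin => /le_trans; apply.
  have -> : k * (eta / k) = eta by rewrite mulrCA divff ?mulr1// gt_eqF.
  by rewrite /c le_eqVlt; apply/orP; left; apply/eqP; ring.
have I0 : I1 + I2 = 0.
  apply/eqP; rewrite -normr_le0 leNgt; apply/negP => I0.
  have c20 : 0 < `|I1 + I2| / (2 * c) by rewrite divr_gt0// mulr_gt0.
  have := bound _ c20; have -> : c * (`|I1 + I2| / (2 * c)) = `|I1 + I2| / 2 by field; rewrite gt_eqF.
  by move=> ?; lra.
have h1 z : rho < `|z - 0| -> u z * partial i phi z = 0.
  by rewrite subr0 => hz; rewrite (vanish_off_partial i vp)// mulr0.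
have h2 z : rho < `|z - 0| -> H i z * phi z = 0 by rewrite subr0 => hz; rewrite vp// mulr0.
rewrite (integral_eq_cube L (@subsetT _ _) h1) (integral_eq_cube L (@subsetT _ _) h2).
have iu : L.-integrable (cube (0 : V) rho) (EFin \o (fun z : X => u z * partial i phi z)).
  have := integrable_vanish_off (lebesgueRn_cube_lty 0) (continuous_mul cu (Ck_continuous (Ck_partial i (Cp 1))))
    (vanish_offM u (vanish_off_partial i vp)).
  by apply: integrableS.
have jh := integrable_cubeM (iH i rho) (Ck_continuous (Cp 0)).
have f1 := integrable_fin_num mC iu; have f2 := integrable_fin_num mC jh.
rewrite -(fineK f1) -(fineK f2) -EFinN; congr (_%:E).
by apply/eqP; rewrite -addr_eq0; apply/eqP.
Qed.

End zero_extension.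

(** * Averages of the boundary function against sigma *)

Section averages.
Context {R : realType} {n : nat}.
Local Notation V := 'rV[R]_n.
Local Notation X := (borelRn R n).
Local Notation L := (@lebesgueRn R n).
Local Notation e_ i := (delta_mx ord0 i : V).
Variables (p K : R).
Hypotheses (n0 : (0 < n)%N) (pn : n%:R < p).
Hypotheses (K0 : 0 < K) (hK : forall (i : 'I_n) (z : V), `|partial i plateau z| <= K).
Variables (sigma : {measure set X -> \bar R}) (E : set V).
Hypothesis sfin : forall z r, (sigma (cube z r) < +oo)%E.
Hypotheses (cE : closed E) (sE : sigma (~` E) = 0%E).
Variables (Cs C1 : R).
Hypotheses (Cs0 : 0 < Cs) (C10 : 0 < C1).
Hypothesis spos : forall x r, E x -> 0 < r -> (0 < sigma (cube x r))%E.
Hypothesis sdbl : forall (x : V) (r k : R), E x -> 0 < r <= 1 -> 1 <= k <= r^-1 ->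
  (sigma (cube x (k * r)) <= (Cs * k ^+ n)%:E * sigma (cube x r))%E.
Hypothesis sone : forall x : V, E x -> (C1%:E <= sigma (cube x 1))%E.
Variable f : V -> R.
Hypothesis mf : measurable_fun [set: X] (f : X -> R).
Hypothesis lf : forall r, exists B, forall x, E x -> cube (0 : V) r x -> `|f x| <= B.
Implicit Types (x y z a : V) (r rho : R) (zeta b : V -> R).

Let mE : @measurable _ X E. Proof. exact: closed_measurableRn. Qed.
Let p1 : 1 < p. Proof. by rewrite (le_lt_trans _ pn)// ler1n. Qed.
Let p0 : 0 < p. Proof. by rewrite (lt_trans _ p1). Qed.
Let mEC z r : @measurable _ X (E `&` cube z r).
Proof. by apply: measurableI => //; exact: measurable_cube. Qed.

(** The factor 1/8 keeps the cubes below within the range of the doubling condition. The cutoffs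
    have width [eps k], 32 times smaller: if z is within 9 eps of a point a of E, the cube of radius
    [radius k / 8] about a lies where the bump at z equals 1, as 9/32 + 1/8 <= 1/2. *)
Definition radius (k : nat) : R := 4 ^- k / 8.
Local Notation eps k := (radius k / 32).

Lemma radius_gt0 k : 0 < radius k.
Proof. by rewrite divr_gt0// invr_gt0 exprn_gt0. Qed.

Lemma radiusS k : radius k = 4 * radius k.+1.
Proof. by rewrite /radius exprS invfM; field. Qed.

Lemma radius_le k : radius k <= 8^-1.
Proof. by rewrite ler_pdivrMr// mulVf// invf_le1 ?exprn_gt0// exprn_ege1// ler1n. Qed.

Let eps_gt0 k : 0 < eps k.
Proof. by rewrite divr_gt0// radius_gt0. Qed.

Let integrable_b (b : V -> R) : measurable_fun [set: X] (b : X -> R) ->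
  (forall r, exists B, forall x, E x -> cube (0 : V) r x -> `|b x| <= B) ->
  forall r, sigma.-integrable ((E : set X) `&` cube (0 : V) r) (EFin \o (b : X -> R)).
Proof.
move=> mb lb r; have [B hB] := lb r.
apply: measurable_bounded_integrable; first exact: mEC.
- by apply: le_lt_trans (sfin 0 r); apply: le_measure; rewrite ?inE; [exact: mEC|exact: measurable_cube|exact: subIsetr].
- exact: measurable_funTS.
- by exists B; split; [exact: num_real|move=> y By x [Ex xr]; apply: le_trans (hB x Ex xr) (ltW By)].
Qed.

Let ib_f := integrable_b mf lf.

Let lf1 (c : R) : forall r, exists B, forall x, E x -> cube (0 : V) r x -> `|f x - c| <= B.
Proof.
move=> r; have [B hB] := lf r; exists (B + `|c|) => x Ex xr.
by rewrite (le_trans (ler_normB _ _))// lerD2r hB.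
Qed.

Let ib_fc c := integrable_b (measurable_funB mf (measurable_cst c)) (lf1 c).

Let ib_1 : forall r, sigma.-integrable ((E : set X) `&` cube (0 : V) r) (EFin \o (cst 1 : X -> R)).
Proof. by apply: integrable_b; [exact: measurable_cst|move=> r; exists 1 => x _ _ /=; rewrite normr1]. Qed.

Lemma conv_le b zeta z rho B : (forall r, sigma.-integrable ((E : set X) `&` cube (0 : V) r) (EFin \o (b : X -> R))) ->
  continuous zeta -> vanish_off rho zeta -> 0 <= B -> (forall x, `|zeta x| <= B) ->
  (`|conv sigma E b zeta z|%:E <= B%:E * \int[sigma]_(x in E `&` cube z rho) `|b x|%:E)%E.
Proof.
move=> ib cz vz B0 zB; have zb : exists M, forall z, `|zeta z| <= M by exists B.
rewrite (conv_cubeE _ _ _ vz (lexx (rho + `|z|))).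
have iz := integrable_conv mE ib z (rho + `|z|) cz zb.
rewrite EFin_normr_Rintegral//; apply: le_trans (le_abse_integral sigma (mEC _ _) (measurable_int _ iz)) _.
have mb : measurable_fun ((E : set X) `&` cube z rho) (fun x : X => `|b x|%:E).
  have /measurable_int := ib (rho + `|z|) => /measurable_EFinP mbb.
  apply/measurable_EFinP; apply: measurableT_comp (@normr_measurable R setT) _.
  apply: measurable_funS mbb; first exact: mEC.
  move=> x [Ex xz]; split=> //; rewrite /cube /= subr0; have := rV_norm_dist x z.
  by rewrite /cube /= in xz => ?; lra.
rewrite -ge0_integralZl_EFin//.
rewrite integral_mkcond [leRHS]integral_mkcond; apply: le_ge0_integral => x _.
  by apply: erestrict_ge0 => y _ /=.
rewrite !patchE !in_setI; case: (boolP (x \in (E : set X))) => //= xE.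
have [xz|xz] := leP `|(x : V) - z| rho.
  have -> : x \in cube z rho by exact: mem_set.
  case: ifP => _; last by rewrite mule_ge0// lee_fin.
  by rewrite -EFinM lee_fin normrM mulrC ler_wpM2r.
rewrite (vz _ xz) mulr0 normr0; case: ifP => _; case: ifP => _ //; by rewrite mule_ge0// lee_fin.
Qed.

Lemma conv_subc c zeta rho z : continuous zeta -> vanish_off rho zeta ->
  conv sigma E (fun x => f x - c) zeta z = conv sigma E f zeta z - c * conv sigma E (cst 1) zeta z.
Proof.
move=> cz vz; have [B [B0 hB]] := vanish_off_bounded cz vz.
have zb : exists M, forall z, `|zeta z| <= M by exists B.
rewrite !(conv_cubeE _ _ _ vz (lexx (rho + `|z|))).
have i1 := integrable_conv mE ib_f z (rho + `|z|) cz zb.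
have i2 := integrable_conv mE ib_1 z (rho + `|z|) cz zb.
rewrite -RintegralZl//.
rewrite -RintegralB//; last by apply: eq_integrable (integrableZl (mEC _ _) c i2).
by apply: eq_Rintegral => x _; rewrite /= mul1r mulrBl.
Qed.

Local Notation sg x r := (fine (sigma (cube x r))).

Lemma sg_gt0 a r : E a -> 0 < r -> 0 < sg a r.
Proof. by move=> Ea r0; rewrite fine_gt0// spos//= sfin. Qed.

Let sg_dbl a r k : E a -> 0 < r <= 1 -> 1 <= k <= r^-1 -> sg a (k * r) <= Cs * k ^+ n * sg a r.
Proof.
move=> Ea hr hk; have := sdbl Ea hr hk.
by rewrite -[sigma (cube a (k * r))]fineK ?fin_sigma// -[sigma (cube a r)]fineK ?fin_sigma// -EFinM lee_fin.
Qed.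

Let sigma_EC z r : sigma (E `&` cube z r) = (sg z r)%:E.
Proof.
rewrite fineK ?fin_sigma//; apply/eqP; rewrite eq_le; apply/andP; split.
  by apply: le_measure; rewrite ?inE; [exact: mEC|exact: measurable_cube|exact: subIsetr].
have mC := @measurable_cube R n z r; have mnE := @measurableC _ X _ mE.
have e : cube z r = (E `&` cube z r) `|` (~` E `&` cube z r) :> set X by rewrite -setIUl setUCr setTI.
have h := measureU2 sigma (mEC z r) (measurableI _ _ mnE mC).
rewrite [X in (sigma X <= _)%E]e; apply: le_trans h _.
rewrite [X in (_ + X)%E](_ : _ = 0%E) ?adde0//; apply/eqP; rewrite eq_le measure_ge0 andbT -sE.
by apply: le_measure; rewrite ?inE//; exact: measurableI.
Qed.

Definition avg_num k : V -> R := conv sigma E f (bump (radius k)).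
Definition avg_den k : V -> R := conv sigma E (cst 1) (bump (radius k)).
(** Agrees with [avg_den] within 3 eps of E and is positive everywhere, so that [avg] is smooth on
    all of R^n: within 9 eps of E the first term is positive, elsewhere the second equals 1. *)
Definition avg_den1 k z : R := avg_den k z + (1 - cutoff E (3 * eps k) z).
Definition avg k z : R := avg_num k z / avg_den1 k z.

Lemma Ck_avg_num N k : Ck N (avg_num k).
Proof. exact: (Ck_conv mE ib_f (Ck_bump N _) (vanish_off_bump (radius_gt0 k))). Qed.

Lemma Ck_avg_den N k : Ck N (avg_den k).
Proof. exact: (Ck_conv mE ib_1 (Ck_bump N _) (vanish_off_bump (radius_gt0 k))). Qed.

Lemma Ck_avg_den1 N k : Ck N (avg_den1 k).
Proof.
apply: CkD; first exact: Ck_avg_den.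
by apply: CkB; [exact: Ck_cst|apply: Ck_cutoff; rewrite mulr_gt0].
Qed.

Lemma avg_den_ge k a z : E a -> `|z - a| <= 9 * eps k -> sg a (radius k / 8) <= avg_den k z.
Proof.
move=> Ea za; have r0 := radius_gt0 k; have cb := Ck_continuous (Ck_bump (n := n) 0 (radius k)).
have bb : exists M, forall x : V, `|bump (radius k) x| <= M.
  by exists 1 => x; rewrite ger0_norm ?bump_ge0// bump_le1.
have hv := @vanish_off_bump R n _ r0; have hle := lexx (radius k + `|z|).
rewrite /avg_den (conv_cubeE _ _ _ hv hle).
have iz := integrable_conv mE ib_1 z (radius k + `|z|) cb bb.
rewrite -lee_fin fineK ?fin_sigma// fineK; last by apply: integrable_fin_num iz; exact: mEC.
rewrite -[leLHS]fineK ?fin_sigma// -sigma_EC -[leLHS]mul1e -integral_cst//.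
apply: (@le_trans _ _ (\int[sigma]_(x in E `&` cube a (radius k / 8)) (cst 1 x * bump (radius k) ((x : V) - z))%:E)%E).
  apply: le_ge0_integral => x [Ex xa] //; rewrite lee_fin mul1r bump_eq1//.
  rewrite /cube /= in xa; have := rV_distD a x z; rewrite (rV_distC a z) => ?; lra.
apply: le_ge0_integral_subset => [x [Ex xa]|x _]; last by rewrite lee_fin mul1r bump_ge0.
split=> //; rewrite /cube /= subr0 in xa *; have := rV_distD a x z; have := rV_norm_dist x z.
by rewrite (rV_distC a z) => ? ?; lra.
Qed.

Lemma avg_den_ge0 k z : 0 <= avg_den k z.
Proof. by apply: Rintegral_ge0 => x _; rewrite mul1r bump_ge0. Qed.

Lemma avg_den1_gt0 k z : 0 < avg_den1 k z.
Proof.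
have e3 : 0 < 3 * eps k by rewrite mulr_gt0.
have c1 := cutoff_le1 E z e3; have d0 := avg_den_ge0 k z; rewrite /avg_den1.
have [[a Ea za]|zt] := pselect (tube E (3 * (3 * eps k)) z).
  have za9 : `|z - a| <= 9 * eps k by apply: le_trans (ltW za) _; lra.
  have r8 : 0 < radius k / 8 by rewrite divr_gt0// radius_gt0.
  have := avg_den_ge Ea za9; have := sg_gt0 Ea r8 => ? ?; lra.
by rewrite (cutoff_eq0 e3 zt); lra.
Qed.

Lemma Ck_avg N k : Ck N (avg k).
Proof.
apply: CkM; first exact: Ck_avg_num.
by apply: CkV; [move=> z; rewrite gt_eqF// avg_den1_gt0|exact: Ck_avg_den1].
Qed.

Lemma avg_den1_near k z : tube E (3 * eps k) z -> avg_den1 k z = avg_den k z.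
Proof. by move=> zt; rewrite /avg_den1 cutoff_eq1 ?subrr ?addr0// mulr_gt0. Qed.

Lemma partial_avg_den1 i k z : tube E (3 * eps k) z -> partial i (avg_den1 k) z = partial i (avg_den k) z.
Proof.
move=> zt; apply: near_eq_partial.
have : nbhs z (tube E (3 * eps k)) by apply: open_nbhs_nbhs; split; [exact: open_tube|].
by apply: filterS => y; exact: avg_den1_near.
Qed.

Definition deviation k z c : \bar R := (\int[sigma]_(x in E `&` cube z (radius k)) `|f x - c|%:E)%E.

Lemma deviation_ge0 k z c : (0 <= deviation k z c)%E.
Proof. by apply: integral_ge0 => x _; rewrite lee_fin. Qed.

Let eps_le k z a : `|z - a| < 3 * eps k -> `|z - a| <= 9 * eps k.
Proof. by move=> h; apply: le_trans (ltW h) _; have := eps_gt0 k => ?; lra. Qed.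

(** Averaging reproduces constants, so c can be subtracted from f under the integral. *)
Lemma avg_dev k z a c : E a -> `|z - a| < 3 * eps k ->
  (`|avg k z - c|%:E <= ((sg a (radius k / 8))^-1)%:E * deviation k z c)%E.
Proof.
move=> Ea za; have zt : tube E (3 * eps k) z by exists a.
have r8 : 0 < radius k / 8 by rewrite divr_gt0// radius_gt0.
have s0 := sg_gt0 Ea r8; have dg := avg_den_ge Ea (eps_le za).
have d0 : 0 < avg_den k z by exact: lt_le_trans dg.
have cb := Ck_continuous (Ck_bump (n := n) 0 (radius k)); have vb := @vanish_off_bump R n _ (radius_gt0 k).
have -> : avg k z - c = (avg_den k z)^-1 * conv sigma E (fun x => f x - c) (bump (radius k)) z.
  rewrite (conv_subc c z cb vb) /avg avg_den1_near// -/(avg_num k z) -/(avg_den k z).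
  by field; rewrite gt_eqF.
rewrite normrM gtr0_norm ?invr_gt0// EFinM.
have hb (x : V) : `|bump (radius k) x| <= 1 by rewrite ger0_norm ?bump_ge0// bump_le1.
have := conv_le z (ib_fc c) cb vb ler01 hb; rewrite mul1e => h.
apply: lee_pmul => //; first by rewrite lee_fin invr_ge0 ltW.
by rewrite lee_fin lef_pV2 ?posrE.
Qed.

(** Numerator and denominator are compared under the same bump, which gives the factor 1 in front of
    [e], where [avg_dev] would leave a quotient of masses. *)
Lemma avg_near k z a c e : E a -> `|z - a| < 3 * eps k -> 0 <= e ->
  (forall x, E x -> cube z (radius k) x -> `|f x - c| <= e) -> `|avg k z - c| <= e.
Proof.
move=> Ea za e0 fe; have zt : tube E (3 * eps k) z by exists a.
have r8 : 0 < radius k / 8 by rewrite divr_gt0// radius_gt0.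
have d0 : 0 < avg_den k z by apply: lt_le_trans (sg_gt0 Ea r8) (avg_den_ge Ea (eps_le za)).
have cb := Ck_continuous (Ck_bump (n := n) 0 (radius k)); have vb := @vanish_off_bump R n _ (radius_gt0 k).
have -> : avg k z - c = (avg_den k z)^-1 * conv sigma E (fun x => f x - c) (bump (radius k)) z.
  rewrite (conv_subc c z cb vb) /avg avg_den1_near// -/(avg_num k z) -/(avg_den k z).
  by field; rewrite gt_eqF.
rewrite normrM gtr0_norm ?invr_gt0// ler_pdivrMl// mulrC.
have bb : exists M, forall x : V, `|bump (radius k) x| <= M.
  by exists 1 => x; rewrite ger0_norm ?bump_ge0// bump_le1.
have hle := lexx (radius k + `|z|).
rewrite /avg_den !(conv_cubeE _ _ _ vb hle).
have i1 := integrable_conv mE (ib_fc c) z (radius k + `|z|) cb bb.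
have i2 := integrable_conv mE ib_1 z (radius k + `|z|) cb bb.
rewrite -lee_fin EFin_normr_Rintegral//; apply: le_trans (le_abse_integral sigma (mEC _ _) (measurable_int _ i1)) _.
rewrite EFinM /Rintegral fineK; last by apply: integrable_fin_num i2; exact: mEC.
rewrite -ge0_integralZl_EFin//; last 2 first.
- by move=> x _ /=; rewrite lee_fin mul1r bump_ge0.
- exact: measurable_int i2.
apply: le_ge0_integral => x [Ex _] //=; rewrite -EFinM lee_fin mul1r normrM.
rewrite [`|bump _ _|]ger0_norm ?bump_ge0//.
have [xz|xz] := leP `|x - z| (radius k); first by apply: ler_wpM2r; [exact: bump_ge0|exact: fe].
by rewrite vb// !mulr0.
Qed.

(** As constants are reproduced, the derivative of the quotient can be written with f - c
    throughout, see [pE]; both of its terms are then controlled by the deviation from c. *)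
Lemma partial_avg_dev i k z a c : E a -> `|z - a| < 3 * eps k ->
  (`|partial i (avg k) z|%:E <= (K / radius k * (1 + sg z (radius k) / sg a (radius k / 8)) / sg a (radius k / 8))%:E
    * deviation k z c)%E.
Proof.
move=> Ea za; have zt : tube E (3 * eps k) z by exists a.
have r0 := radius_gt0 k; have r8 : 0 < radius k / 8 by rewrite divr_gt0.
have s0 := sg_gt0 Ea r8; have dg := avg_den_ge Ea (eps_le za).
have d0 : 0 < avg_den k z by exact: lt_le_trans dg.
have vb := @vanish_off_bump R n _ r0.
have cb := Ck_continuous (Ck_bump (n := n) 0 (radius k)).
have cdb := Ck_continuous (Ck_partial i (Ck_bump (n := n) 1 (radius k))).
have vdb := vanish_off_partial i vb.
have dD1 : derivable (avg_den1 k) z (e_ i) := Ck_derivable (Ck_avg_den1 1 k).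
have dN : derivable (avg_num k) z (e_ i) := Ck_derivable (Ck_avg_num 1 k).
have D1n : avg_den1 k z != 0 by rewrite gt_eqF// avg_den1_gt0.
have dV : derivable (fun z => (avg_den1 k z)^-1) z (e_ i).
  by apply: (Ck_derivable (CkV _ (Ck_avg_den1 1 k))) => y; rewrite gt_eqF// avg_den1_gt0.
have [_ pN] := is_derive_partialE (is_derive_conv mE ib_f i z (Ck_bump 1 (radius k)) vb).
have [_ pD] := is_derive_partialE (is_derive_conv mE ib_1 i z (Ck_bump 1 (radius k)) vb).
set Q := conv sigma E (fun x => f x - c) (partial i (bump (radius k))) z.
set Q1 := conv sigma E (cst 1) (partial i (bump (radius k))) z.
have QE : Q = conv sigma E f (partial i (bump (radius k))) z - c * Q1 by exact: conv_subc cdb vdb.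
have pE : partial i (avg k) z = (avg_den k z)^-1 * (- Q) + (avg k z - c) * (Q1 / avg_den k z).
  rewrite /avg (partialM dN dV) partialV// partial_avg_den1// avg_den1_near//.
  rewrite [partial i (avg_num k) z]pN [partial i (avg_den k) z]pD -/Q1 QE.
  by field; rewrite gt_eqF.
set s := sg a (radius k / 8) in s0 dg *; set A := deviation k z c.
have A0 : (0 <= A)%E by exact: deviation_ge0.
have Kr : 0 <= K / radius k by rewrite divr_ge0 ?ltW.
have hb x := @partial_bump_le R n K hK i (radius k) x r0.
have hQ : (`|Q|%:E <= (K / radius k)%:E * A)%E := conv_le z (ib_fc c) cdb vdb Kr hb.
have hQ1 : `|Q1| <= K / radius k * sg z (radius k).
  have := conv_le z ib_1 cdb vdb Kr hb; rewrite -/Q1.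
  under [X in (_ <= _ * X)%E -> _]eq_integral do rewrite normr1.
  by rewrite integral_cst// mul1e sigma_EC -EFinM lee_fin.
have hP := avg_dev c Ea za; rewrite -/s -/A in hP.
apply: (@le_trans _ _ ((avg_den k z)^-1%:E * `|Q|%:E + `|avg k z - c|%:E * (`|Q1| / avg_den k z)%:E)%E).
  rewrite -!EFinM -EFinD lee_fin pE; apply: le_trans (ler_normD _ _) _.
  by rewrite !normrM normrN normfV (gtr0_norm d0).
have iD : (avg_den k z)^-1 <= s^-1 by rewrite lef_pV2 ?posrE.
have iD0 : 0 <= (avg_den k z)^-1 by rewrite invr_ge0 ltW.
have is0 : 0 <= s^-1 by rewrite invr_ge0 ltW.
apply: (@le_trans _ _ ((s^-1)%:E * ((K / radius k)%:E * A) + ((s^-1)%:E * A) * (K / radius k * sg z (radius k) / s)%:E)%E).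
  apply: leeD; apply: lee_pmul; rewrite ?lee_fin ?mulr_ge0//.
  by apply: ler_pM => //.
rewrite !muleA [X in (_ + X)%E]muleAC -!EFinM -ge0_muleDl; last 2 first.
- by rewrite lee_fin mulr_ge0.
- by rewrite lee_fin; exact: (mulr_ge0 is0 (mulr_ge0 (mulr_ge0 Kr (fine_sigma_ge0 _ _ _)) is0)).
rewrite -EFinD le_eqVlt; apply/orP; left; apply/eqP; congr (_%:E * _)%E.
by field; rewrite !gt_eqF.
Qed.

(** Integrated over y in a cube, this is up to constants the mean p-th power of f x - f y over pairs
    in the cube, the discrete form of the Besov integrand. *)
Definition oscillation k y : \bar R :=
  (((sg y (radius k)) ^- 2)%:E * \int[sigma]_(x in E `&` cube y (2 * radius k)) (`|f x - f y| `^ p)%:E)%E.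

Lemma oscillation_ge0 k y : (0 <= oscillation k y)%E.
Proof.
rewrite mule_ge0 ?lee_fin ?invr_ge0 ?sqr_ge0//.
by apply: integral_ge0 => x _; rewrite lee_fin powR_ge0.
Qed.

Definition local_const : R := Cs * 16 ^+ n.

Lemma sg_local a k : E a -> sg a (2 * radius k) <= local_const * sg a (radius k / 8).
Proof.
move=> Ea; have r0 := radius_gt0 k; have r1 := radius_le k.
have -> : 2 * radius k = 16 * (radius k / 8) by field.
have h8 : 0 < radius k / 8 <= 1 by apply/andP; split; lra.
have hk : 1 <= (16 : R) <= (radius k / 8)^-1.
  apply/andP; split; first by rewrite ler1n.
  by rewrite -(ler_pM2r (andP h8).1) mulVf ?gt_eqF ?(andP h8).1//; lra.
exact: (sg_dbl Ea h8 hk).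
Qed.

Lemma measurable_integral_cube2 (F : X * X -> \bar R) r : measurable_fun setT F -> (forall w, 0 <= F w)%E ->
  measurable_fun [set: X] (fun y : X => \int[sigma]_(x in E `&` cube (y : V) r) F (y, x))%E.
Proof.
move=> mF F0; pose D : set (X * X) := (setT `*` E) `&` [set xy : X * X | (`|(xy.1 : V) - xy.2| <= r)%R].
have mD : measurable D by apply: measurableI; [exact: measurableX|exact: measurable_dist_le].
have mFD : measurable_fun setT (F \_ D).
  by have [h _] := measurable_restrictT F mD; apply: h; exact: measurable_funTS.
have FD0 w : (0 <= (F \_ D) w)%E by apply: erestrict_ge0 => v _; exact: F0.
have := measurable_integral2 (sigma_finite_sigma sfin) mFD FD0; congr (measurable_fun _ _); apply/funext => y.
rewrite [RHS]integral_mkcond; apply: eq_integral => x _; rewrite !patchE; congr (if _ then _ else _).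
apply/idP/idP => [/set_mem[[_ Ex] /= h]|/set_mem[Ex h]]; apply: mem_set.
  by split=> //; rewrite /cube /= rV_distC.
by split=> //=; rewrite rV_distC.
Qed.

Lemma measurable_oscillation k : measurable_fun [set: X] (oscillation k : X -> \bar R).
Proof.
apply: emeasurable_funM.
  have mi : measurable_fun [set: X] (fun y : X => (sg (y : V) (radius k))^-1).
    by apply: measurable_inv_ge0; [move=> y; exact: fine_sigma_ge0|exact: measurable_fine_sigma_cube].
  apply/measurable_EFinP; under eq_fun do rewrite -exprVn; exact: measurable_funX.
pose F (w : X * X) : \bar R := (`|f w.2 - f w.1| `^ p)%:E.
apply: (@measurable_integral_cube2 F); last by move=> w; rewrite lee_fin powR_ge0.
apply/measurable_EFinP; apply: measurable_fun_powR; apply: measurableT_comp (@normr_measurable R setT) _.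
by apply: measurable_funB; [exact: (measurableT_comp mf measurable_snd)|exact: (measurableT_comp mf measurable_fst)].
Qed.

Let Jensen z r (g : V -> R) (s : R) : measurable_fun [set: X] (g : X -> R) -> (forall x, 0 <= g x) ->
  0 < s -> sg z r <= s ->
  ((\int[sigma]_(x in E `&` cube z r) (g x)%:E) `^ p <=
    (2 `^ p * s `^ (p - 1))%:E * \int[sigma]_(x in E `&` cube z r) (g x `^ p)%:E)%E.
Proof.
move=> mg g0 s0 zs; have := @jensen_power _ _ R sigma (E `&` cube z r) p g s (mEC _ _) p1 (measurable_funTS mg).
by apply => //; rewrite sigma_EC lee_fin.
Qed.

Let ratio_bound (c t s l : R) : 0 <= c -> 0 < t -> 0 <= l -> s `^ (p + 1) <= (l * t) `^ (p + 1) ->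
  (c / t) `^ p * (2 `^ p * s `^ (p + 1)) <= (2 * c) `^ p * l `^ (p + 1) * t.
Proof.
move=> c0 t0 l0; rewrite (powRM _ l0 (ltW t0)) => hs; have T0 := powR_gt0 p t0.
have tp : t `^ (p + 1) = t `^ p * t by rewrite powRD ?powRr1 ?(ltW t0)// (gt_eqF t0) implybT.
have it : 0 <= t^-1 by rewrite invr_ge0 ltW.
rewrite (powRM _ c0 it) powRVn// (powRM _ (ler0n _ 2) c0).
have -> : c `^ p * (t `^ p)^-1 * (2 `^ p * s `^ (p + 1)) = 2 `^ p * c `^ p * (t `^ p)^-1 * s `^ (p + 1) by ring.
have -> : 2 `^ p * c `^ p * l `^ (p + 1) * t = 2 `^ p * c `^ p * (t `^ p)^-1 * (l `^ (p + 1) * t `^ (p + 1)).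
  by rewrite tp; field; rewrite gt_eqF.
by apply: ler_wpM2l hs; rewrite mulr_ge0 ?invr_ge0 ?(ltW T0)// mulr_ge0 ?powR_ge0.
Qed.

(* The bound holds for every value [c = f y]; averaging it over [y] near [a]
   replaces a double application of Jensen's inequality. *)
Lemma average_bound k z a (q c : R) : E a -> `|z - a| < 3 * eps k -> 0 <= q -> 0 <= c ->
  (forall y, E y -> (q%:E <= (c / sg a (radius k / 8))%:E * deviation k z (f y))%E) ->
  ((q `^ p)%:E <= ((2 * c) `^ p * local_const `^ (p + 1))%:E *
    \int[sigma]_(y in E `&` cube z (radius k)) oscillation k y)%E.
Proof.
move=> Ea za q0 c0 hq; have r0 := radius_gt0 k; have r8 : 0 < radius k / 8 by rewrite divr_gt0.
set t := sg a (radius k / 8) in hq *; have t0 : 0 < t := sg_gt0 Ea r8.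
pose s := sg a (2 * radius k); have s0 : 0 < s by apply: sg_gt0 => //; rewrite mulr_gt0.
have st : s <= local_const * t by exact: sg_local.
have zs : sg z (radius k) <= s by apply: fine_sigma_le => //; apply: cube_subset; lra.
pose C := (c / t) `^ p * (2 `^ p * s `^ (p - 1)) * s ^+ 2.
have C0 : 0 <= C by exact: (mulr_ge0 (mulr_ge0 (powR_ge0 _ _) (mulr_ge0 (powR_ge0 _ _) (powR_ge0 _ _))) (sqr_ge0 _)).
have hy y : E y -> cube a (radius k / 8) y -> ((q `^ p)%:E <= C%:E * oscillation k y)%E.
  move=> Ey ya; rewrite /cube /= in ya; have ct : 0 <= c / t by rewrite divr_ge0// ltW.
  have mfy : measurable_fun [set: X] (fun x : X => `|f x - f y|).
    exact: measurableT_comp (@normr_measurable R setT) (measurable_funB mf (measurable_cst _)).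
  have sy0 : 0 < sg y (radius k) by exact: sg_gt0.
  have ys : sg y (radius k) <= s by apply: fine_sigma_le => //; apply: cube_subset; lra.
  have q0E : (0 <= q%:E)%E by rewrite lee_fin.
  have := le_poweR p0 q0E (hq y Ey); rewrite poweR_EFin => /le_trans; apply.
  rewrite (poweR_EFinM _ ct (deviation_ge0 _ _ _)).
  have h1 := Jensen mfy (fun x => normr_ge0 _) s0 zs.
  apply: (@le_trans _ _ (((c / t) `^ p * (2 `^ p * s `^ (p - 1)))%:E *
     \int[sigma]_(x in E `&` cube y (2 * radius k)) (`|f x - f y| `^ p)%:E)%E).
    rewrite EFinM -[leRHS]muleA; apply: lee_wpmul2l; first by rewrite lee_fin powR_ge0.
    apply: le_trans h1 _; apply: lee_wpmul2l; first by rewrite lee_fin mulr_ge0 ?powR_ge0.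
    apply: le_ge0_integral_subset => [x [Ex xz]|x _]; last by rewrite lee_fin powR_ge0.
    split=> //; rewrite /cube /= in xz *; have := rV_distD z x y; have := rV_distD a z y.
    rewrite (rV_distC a y) => ? ?; lra.
  rewrite /oscillation muleA -EFinM; apply: lee_wpmul2r.
    by apply: integral_ge0 => x _; rewrite lee_fin powR_ge0.
  rewrite lee_fin /C -[leRHS]mulrA ler_peMr ?mulr_ge0 ?powR_ge0//.
  rewrite ler_pdivlMr ?exprn_gt0// mul1r; apply: lerXn2r; rewrite ?nnegrE ?(ltW sy0) ?(ltW s0)//.
(* The bound for each single y is integrated over the cube of radius [radius k / 8] about a, of mass
   t; this t supplies the missing power in the normalisation. *)
have h2 : ((q `^ p)%:E * t%:E <= C%:E * \int[sigma]_(y in E `&` cube z (radius k)) oscillation k y)%E.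
  apply: (@le_trans _ _ (\int[sigma]_(y in E `&` cube a (radius k / 8)) (q `^ p)%:E)%E).
    by rewrite integral_cst// sigma_EC.
  apply: (@le_trans _ _ (\int[sigma]_(y in E `&` cube a (radius k / 8)) (C%:E * oscillation k y))%E).
    by apply: le_ge0_integral => y [Ey ya]; [rewrite lee_fin powR_ge0|exact: hy].
  rewrite -ge0_integralZl_EFin//; last 2 first.
  - by move=> y _; exact: oscillation_ge0.
  - by apply: measurable_funTS; exact: measurable_oscillation.
  apply: le_ge0_integral_subset => [y [Ey ya]|y _]; last by rewrite mule_ge0 ?lee_fin ?oscillation_ge0.
  by split=> //; rewrite /cube /= in ya *; have := rV_distD a y z; rewrite (rV_distC a z) => ?; lra.
set I := (\int[sigma]_(y in _) _)%E in h2 *.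
have I0 : (0 <= I)%E by apply: integral_ge0 => y _; exact: oscillation_ge0.
rewrite -(lee_pmul2r (x := t%:E))//; apply: le_trans h2 _.
rewrite muleAC -EFinM; apply: lee_wpmul2r => //; rewrite lee_fin /C.
have lc0 : 0 < local_const by rewrite mulr_gt0// exprn_gt0.
have hs : s `^ (p + 1) <= (local_const * t) `^ (p + 1).
  by apply: ge0_ler_powR; rewrite ?nnegrE ?addr_ge0 ?(ltW p0) ?(ltW s0)// mulr_ge0 ?ltW.
have sp : s `^ (p - 1) * s ^+ 2 = s `^ (p + 1).
  rewrite -powR_mulrn ?(ltW s0)// -powRD; [congr (_ `^ _); lra|by rewrite (gt_eqF s0) implybT].
rewrite -mulrA -(mulrA (2 `^ p)) sp; apply: ratio_bound => //; exact: ltW.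
Qed.

End averages.

(** The induction step for the bound 2 - 4^-k on 1 plus the sum of the radii below k. *)
Lemma radius_step (R : realType) k : @radius R k + (2 - 4 ^- k) <= 2 - 4 ^- k.+1.
Proof.
have i4 : 0 < 4 ^- k :> R by rewrite invr_gt0 exprn_gt0.
by rewrite /radius exprS invfM; lra.
Qed.

Lemma convex_le (R : realType) (x u v B : R) : 0 <= x <= 1 -> `|u| <= B -> `|v| <= B -> `|u + x * (v - u)| <= B.
Proof.
move=> /andP[x0 x1]; rewrite !ler_norml => /andP[u1 u2] /andP[v1 v2].
have -> : u + x * (v - u) = (1 - x) * u + x * v by ring.
by apply/andP; split; nra.
Qed.

(** * Smooth approximations of the extension and their majorant *)

Section extension.
Context {R : realType} {n : nat}.
Local Notation V := 'rV[R]_n.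
Local Notation X := (borelRn R n).
Local Notation L := (@lebesgueRn R n).
Local Notation e_ i := (delta_mx ord0 i : V).
Variables (p K : R).
Hypotheses (n0 : (0 < n)%N) (pn : n%:R < p).
Hypotheses (K0 : 0 < K) (hK : forall (i : 'I_n) (z : V), `|partial i plateau z| <= K).
Variables (sigma : {measure set X -> \bar R}) (E : set V).
Hypothesis sfin : forall z r, (sigma (cube z r) < +oo)%E.
Hypotheses (cE : closed E) (sE : sigma (~` E) = 0%E).
Variables (Cs C1 : R).
Hypotheses (Cs0 : 0 < Cs) (C10 : 0 < C1).
Hypothesis spos : forall x r, E x -> 0 < r -> (0 < sigma (cube x r))%E.
Hypothesis sdbl : forall (x : V) (r k : R), E x -> 0 < r <= 1 -> 1 <= k <= r^-1 ->
  (sigma (cube x (k * r)) <= (Cs * k ^+ n)%:E * sigma (cube x r))%E.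
Hypothesis sone : forall x : V, E x -> (C1%:E <= sigma (cube x 1))%E.
Variable f : V -> R.
Hypothesis mf : measurable_fun [set: X] (f : X -> R).
Hypothesis lf : forall r, exists B, forall x, E x -> cube (0 : V) r x -> `|f x| <= B.
Implicit Types (x y z a : V) (r : R).
Local Notation radius := (@radius R).
Local Notation eps k := (radius k / 32).
Local Notation sg x r := (fine (sigma (cube x r))).
Local Notation avg := (@avg R n sigma E f).
Local Notation oscillation := (@oscillation R n p sigma E f).
Local Notation deviation := (@deviation R n sigma E f).
Local Notation local_const := (@local_const R n Cs).

Let mE : @measurable _ X E. Proof. exact: closed_measurableRn. Qed.
Let p1 : 1 < p. Proof. by rewrite (le_lt_trans _ pn)// ler1n. Qed.
Let p0 : 0 < p. Proof. by rewrite (lt_trans _ p1). Qed.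
Let ssig : sigma_finite setT sigma. Proof. exact: sigma_finite_sigma. Qed.
Let sleb : sigma_finite setT L. Proof. exact: sigma_finite_lebesgueRn. Qed.
Let r0 k : 0 < radius k. Proof. exact: radius_gt0. Qed.
Let e0 k : 0 < eps k. Proof. by rewrite divr_gt0. Qed.
Let r80 k : 0 < radius k / 8. Proof. by rewrite divr_gt0. Qed.
Let eS k : eps k = 4 * eps k.+1. Proof. by rewrite radiusS mulrA. Qed.
Let lc0 : 0 < local_const. Proof. by rewrite mulr_gt0// exprn_gt0. Qed.

Let dbl a r k : E a -> 0 < r <= 1 -> 1 <= k <= r^-1 -> sg a (k * r) <= Cs * k ^+ n * sg a r.
Proof.
move=> Ea hr hk; have := sdbl Ea hr hk.
by rewrite -[sigma (cube a (k * r))]fineK ?fin_sigma// -[sigma (cube a r)]fineK ?fin_sigma// -EFinM lee_fin.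
Qed.

Let dist3 (u v w : R) : `|u - v| <= `|v - w| + `|u - w|.
Proof. by rewrite [leRHS]addrC (distrC v w) ler_distD. Qed.

Let addsub (u v : R) : u + (v - u) = v. Proof. by rewrite addrC subrK. Qed.

Let sgp a r : E a -> 0 < r -> 0 < sg a r.
Proof. by move=> Ea h; rewrite fine_gt0// spos//= sfin. Qed.

Let slocal k a : E a -> sg a (2 * radius k) <= local_const * sg a (radius k / 8).
Proof. by move=> Ea; exact: (sg_local sfin sdbl k Ea). Qed.

Let dbl8 a r k : E a -> 0 < r -> 1 <= k -> k * r <= 1 -> sg a (k * r) <= Cs * k ^+ n * sg a r.
Proof.
move=> Ea h k1 kr; apply: dbl => //.
  by rewrite h (le_trans _ kr)// ler_peMl// ltW.
by rewrite k1 -(ler_pM2r h) mulVf ?gt_eqF.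
Qed.

Definition mean_osc k z : \bar R := (\int[sigma]_(y in E `&` cube z (radius k)) oscillation k y)%E.

(** The weight, the p-th power of the inverse radius, is that of a difference quotient at scale k.
    Summing over all scales gives a function that does not depend on the stage of the
    approximation. *)
Definition majorant z : \bar R := (\int[sigma]_(x in E `&` cube z (radius 0)) (`|f x| `^ p)%:E +
  \sum_(0 <= k <oo) ((radius k)^-1 `^ p)%:E * mean_osc k z)%E.

Lemma mean_osc_ge0 k z : (0 <= mean_osc k z)%E.
Proof. by apply: integral_ge0 => y _; exact: oscillation_ge0. Qed.

Let term_ge0 z k : (0 <= ((radius k)^-1 `^ p)%:E * mean_osc k z)%E.
Proof. by rewrite mule_ge0 ?mean_osc_ge0// lee_fin powR_ge0. Qed.

Let fp0 x : (0 <= (`|f x| `^ p)%:E)%E. Proof. by rewrite lee_fin powR_ge0. Qed.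

Lemma majorant_ge0 z : (0 <= majorant z)%E.
Proof. by apply: adde_ge0; [apply: integral_ge0 => x _; exact: fp0|apply: nneseries_ge0 => k _ _; exact: term_ge0]. Qed.

Let mfp : measurable_fun [set: X] (fun x : X => (`|f x| `^ p)%:E).
Proof. by apply/measurable_EFinP; apply: measurable_fun_powR; exact: measurableT_comp (@normr_measurable R setT) mf. Qed.

Let mosc k : measurable_fun [set: X] (oscillation k : X -> \bar R).
Proof. exact: (measurable_oscillation _ sfin cE mf). Qed.

Let osc0 k (y : X) : (0 <= oscillation k y)%E. Proof. exact: oscillation_ge0. Qed.

Let mmean k : measurable_fun [set: X] (mean_osc k : X -> \bar R).
Proof. exact: (measurable_integral_cube _ ssig mE (mosc k) (osc0 k)). Qed.

Lemma measurable_majorant : measurable_fun [set: X] (majorant : X -> \bar R).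
Proof.
apply: emeasurable_funD; first exact: (measurable_integral_cube _ ssig mE mfp fp0).
apply: ge0_emeasurable_sum => [k x _ _|k _]; first exact: term_ge0.
by apply: measurable_funeM.
Qed.

Lemma partial_avg_bound i k z : tube E (3 * eps k) z ->
  ((`|partial i (avg k) z| `^ p)%:E <=
    ((2 * (K * (1 + local_const))) `^ p * local_const `^ (p + 1))%:E * majorant z)%E.
Proof.
move=> [a Ea za]; have s0 := sgp Ea (r80 k); have rk := r0 k.
have c0 : 0 <= K * (1 + local_const) / radius k by rewrite divr_ge0 ?(ltW rk)// mulr_ge0 ?(ltW K0)// addr_ge0 ?ltW.
have zs : sg z (radius k) <= local_const * sg a (radius k / 8).
  apply: le_trans (slocal k Ea); apply: fine_sigma_le => //; apply: cube_subset; lra.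
have hq y : E y -> (`|partial i (avg k) z|%:E <= (K * (1 + local_const) / radius k / sg a (radius k / 8))%:E * deviation k z (f y))%E.
  move=> Ey; apply: le_trans (partial_avg_dev K0 hK sfin cE sE spos mf lf i (f y) Ea za) _.
  apply: lee_wpmul2r; first exact: deviation_ge0.
  rewrite lee_fin; apply: ler_wpM2r; first by rewrite invr_ge0 ltW.
  rewrite mulrAC; apply: ler_wpM2r; first by rewrite invr_ge0 ltW.
  by apply: ler_wpM2l; [exact: ltW|rewrite lerD2l ler_pdivrMr].
have := average_bound n0 pn sfin cE sE Cs0 spos sdbl mf Ea za (normr_ge0 _) c0 hq => /le_trans; apply.
have kc : 0 <= 2 * (K * (1 + local_const)) by rewrite mulr_ge0// mulr_ge0 ?(ltW K0)// addr_ge0 ?ltW.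
have ir : 0 <= (radius k)^-1 by rewrite invr_ge0 ltW.
rewrite (mulrA 2) (powRM _ kc ir) mulrAC [X in (X * _ <= _)%E]EFinM -[leLHS]muleA; apply: lee_wpmul2l.
  by rewrite lee_fin mulr_ge0 ?powR_ge0.
apply: le_trans (nneseries_term_le k (term_ge0 z)) _.
by rewrite /majorant leeDr//; apply: integral_ge0 => x _; exact: fp0.
Qed.

Definition jump_const : R := (2 * (1 + Cs * 4 ^+ n)) `^ p * local_const `^ (p + 1).

(** Both averages deviate from f y by at most a multiple of the deviation over the coarser cube, so
    [average_bound] applies to their difference. *)
Lemma avg_jump_bound k z : tube E (3 * eps k.+1) z ->
  (((`|avg k.+1 z - avg k z| / radius k) `^ p)%:E <= jump_const%:E * majorant z)%E.
Proof.
move=> [a Ea za]; have rk := r0 k; have rS := radiusS k : radius k = 4 * radius k.+1.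
have rS0 := r0 k.+1; have r1 : radius k <= 8^-1 := radius_le k.
have za' : `|z - a| < 3 * eps k by apply: lt_le_trans za _; rewrite rS; lra.
have s0 := sgp Ea (r80 k); have s1 := sgp Ea (r80 k.+1).
have c0 : 0 <= 1 + Cs * 4 ^+ n by rewrite addr_ge0// mulr_ge0 ?exprn_ge0// ltW.
have hs : sg a (radius k / 8) <= Cs * 4 ^+ n * sg a (radius k.+1 / 8).
  by rewrite rS -mulrA; apply: dbl8 => //; lra.
have hq y : E y -> (`|avg k.+1 z - avg k z|%:E <= ((1 + Cs * 4 ^+ n) / sg a (radius k / 8))%:E * deviation k z (f y))%E.
  move=> Ey; have h1 := avg_dev sfin cE sE spos mf lf (f y) Ea za.
  have h2 := avg_dev sfin cE sE spos mf lf (f y) Ea za'.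
  apply: (@le_trans _ _ (`|avg k z - f y|%:E + `|avg k.+1 z - f y|%:E)%E).
    by rewrite -EFinD lee_fin; exact: dist3.
  rewrite mulrDl mul1r EFinD ge0_muleDl; last 2 first.
  - by rewrite lee_fin invr_ge0 ltW.
  - by rewrite lee_fin divr_ge0 ?(ltW s0)// mulr_ge0 ?exprn_ge0// ltW.
  apply: leeD; first exact: h2.
  apply: le_trans h1 _; apply: lee_pmul.
  - by rewrite lee_fin invr_ge0 (ltW s1).
  - exact: deviation_ge0.
  - by rewrite lee_fin (ler_pdivlMr _ _ s0) mulrC (ler_pdivrMr _ _ s1).
  apply: le_ge0_integral_subset => [x [Ex xz]|x _]; last by rewrite lee_fin.
  by split=> //; rewrite /cube /= in xz *; apply: le_trans xz _; lra.
have := average_bound n0 pn sfin cE sE Cs0 spos sdbl mf Ea za' (normr_ge0 _) c0 hq; rewrite -/jump_const => h.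
have ir : 0 <= (radius k)^-1 by rewrite invr_ge0 ltW.
rewrite (powRM _ (normr_ge0 _) ir) mulrC [leLHS]EFinM.
apply: le_trans (lee_wpmul2l _ h) _; first by rewrite lee_fin powR_ge0.
rewrite muleCA; apply: lee_wpmul2l; first by rewrite lee_fin mulr_ge0 ?powR_ge0.
apply: le_trans (nneseries_term_le k (term_ge0 z)) _.
by rewrite /majorant leeDr//; apply: integral_ge0 => x _; exact: fp0.
Qed.

Definition base_const : R := 2 `^ p * local_const `^ (p - 1) * (Cs * 64 ^+ n / C1).

Lemma avg0_bound z : tube E (3 * eps 0) z -> ((`|avg 0 z| `^ p)%:E <= base_const%:E * majorant z)%E.
Proof.
move=> [a Ea za]; have s0 := sgp Ea (r80 0); set t := sg a (radius 0 / 8) in s0.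
have rk := r0 0; have R0 : radius 0 = 8^-1 by rewrite /radius expr0 invr1 mul1r.
have ls : 0 < local_const * t by rewrite mulr_gt0.
have zs : sg z (radius 0) <= local_const * t.
  apply: le_trans (slocal 0 Ea); apply: fine_sigma_le => //; apply: cube_subset; lra.
have mEC : @measurable _ X (E `&` cube z (radius 0)) by apply: measurableI => //; exact: measurable_cube.
have sEC : (sigma (E `&` cube z (radius 0)) <= (local_const * t)%:E)%E.
  apply: (@le_trans _ _ (sigma (cube z (radius 0)))).
    by apply: le_measure; rewrite ?inE//; exact: measurable_cube.
  by rewrite -(fineK (fin_sigma sfin _ _)) lee_fin.
have := avg_dev sfin cE sE spos mf lf 0 Ea za; rewrite -/t subr0 => h.
have q0 : (0 <= `|avg 0 z|%:E)%E by rewrite lee_fin.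
have := le_poweR p0 q0 h; rewrite poweR_EFin => /le_trans; apply.
have it : 0 <= t^-1 by rewrite invr_ge0 ltW.
rewrite (poweR_EFinM _ it (deviation_ge0 _ _ _ _ _ _)) /deviation.
have mnf : measurable_fun (E `&` cube z (radius 0) : set X) (fun x : X => `|f x - 0|).
  by apply: measurable_funTS; apply: measurableT_comp (@normr_measurable R setT) _; exact: measurable_funB.
have J := jensen_power mEC p1 mnf (fun x _ => normr_ge0 _) ls sEC.
apply: le_trans (lee_wpmul2l _ J) _; first by rewrite lee_fin powR_ge0.
under eq_integral do rewrite subr0.
rewrite muleA -EFinM.
have t1 : C1 <= Cs * 64 ^+ n * t.
  have h1 : C1 <= sg a 1 by have := sone Ea; rewrite -(fineK (fin_sigma sfin a 1)) lee_fin.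
  apply: le_trans h1 _; rewrite /t R0 {1}(_ : 1 = 64 * (8^-1 / 8)); last by field.
  by apply: dbl8 => //; lra.
have hc : t^-1 `^ p * (2 `^ p * (local_const * t) `^ (p - 1)) <= base_const.
  have tp : t `^ (p - 1) = t `^ p / t by rewrite -opprB powRN powR_1B// invf_div.
  rewrite (powRM _ (ltW lc0) (ltW s0)) powRVn// tp.
  have T0 := powR_gt0 p s0.
  have -> : (t `^ p)^-1 * (2 `^ p * (local_const `^ (p - 1) * (t `^ p / t))) = 2 `^ p * local_const `^ (p - 1) * t^-1.
    by field; rewrite !gt_eqF.
  apply: ler_wpM2l; first by rewrite mulr_ge0 ?powR_ge0.
  by rewrite ler_pdivlMr// mulrC ler_pdivrMr.
have I0 : (0 <= \int[sigma]_(x in E `&` cube z (radius 0)) (`|f x| `^ p)%:E)%E by apply: integral_ge0 => x _; exact: fp0.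
apply: lee_pmul => //; first by rewrite lee_fin mulr_ge0 ?powR_ge0// mulr_ge0 ?powR_ge0.
by rewrite /majorant leeDl//; apply: nneseries_ge0 => k _ _; exact: term_ge0.
Qed.

(** As eps k = 4 eps k.+1, the new cutoff vanishes unless z is within eps k of E, where the
    preceding function is still [avg k]; there the result is a convex combination of two consecutive
    averages. *)
Fixpoint ext_approx (k : nat) z : R := if k is j.+1
  then ext_approx j z + cutoff E (eps j.+1) z * (avg j.+1 z - avg j z)
  else cutoff E (eps 0) z * avg 0 z.

Lemma Ck_avg_ext N k : Ck N (avg k).
Proof. exact: (Ck_avg sfin cE sE spos mf lf N k). Qed.

Lemma Ck_ext_approx N k : Ck N (ext_approx k).
Proof.
elim: k => [|k IHk]; first by apply: CkM; [exact: Ck_cutoff|exact: Ck_avg_ext].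
by apply: CkD => //; apply: CkM; [exact: Ck_cutoff|apply: CkB; exact: Ck_avg_ext].
Qed.

Let dav k z i : derivable (avg k) z (e_ i). Proof. exact: (Ck_derivable (Ck_avg_ext 1 k)). Qed.
Let dcu k z i : derivable (cutoff E (eps k)) z (e_ i). Proof. exact: (Ck_derivable (Ck_cutoff 1 E (e0 k))). Qed.
Let dex k z i : derivable (ext_approx k) z (e_ i). Proof. exact: (Ck_derivable (Ck_ext_approx 1 k)). Qed.

Let partial_ext0 i z : partial i (ext_approx 0) z =
  cutoff E (eps 0) z * partial i (avg 0) z + avg 0 z * partial i (cutoff E (eps 0)) z.
Proof. exact (partialM (@dcu 0 z i) (@dav 0 z i)). Qed.

Let partial_extS i k z : partial i (ext_approx k.+1) z = partial i (ext_approx k) z +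
  (cutoff E (eps k.+1) z * (partial i (avg k.+1) z - partial i (avg k) z) +
   (avg k.+1 z - avg k z) * partial i (cutoff E (eps k.+1)) z).
Proof.
have d1 : derivable (fun z => avg k.+1 z - avg k z) z (e_ i).
  exact: (Ck_derivable (CkB (Ck_avg_ext 1 _) (Ck_avg_ext 1 _))).
have d2 : derivable (fun z => cutoff E (eps k.+1) z * (avg k.+1 z - avg k z)) z (e_ i).
  exact: (Ck_derivable (CkM (Ck_cutoff 1 E (e0 _)) (CkB (Ck_avg_ext 1 _) (Ck_avg_ext 1 _)))).
have e := partialD (@dex k z i) d2.
rewrite (partialM (@dcu k.+1 z i) d1) (partialB (@dav k.+1 z i) (@dav k z i)) in e.
exact e.
Qed.

Let tube_eps k z : tube E (3 * eps k.+1) z -> tube E (eps k) z.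
Proof. by apply: tube_le; rewrite (eS k); have := e0 k.+1 => ?; lra. Qed.

Let tube3 k z : tube E (eps k) z -> tube E (3 * eps k) z.
Proof. by apply: tube_le; have := e0 k => ?; lra. Qed.

Lemma ext_approx_near k z : tube E (eps k) z ->
  ext_approx k z = avg k z /\ forall i, partial i (ext_approx k) z = partial i (avg k) z.
Proof.
elim: k => [|k IHk] zt.
  by split=> [|i]; rewrite ?partial_ext0 /= cutoff_eq1// mul1r// partial_cutoff_eq0_near// mulr0 addr0.
have [h1 h2] := IHk (tube_eps (tube3 zt)).
split=> [|i]; first by rewrite [ext_approx k.+1 z]/= h1 (cutoff_eq1 (e0 k.+1) zt) mul1r; exact: addsub.
rewrite partial_extS h2 (cutoff_eq1 (e0 k.+1) zt) (partial_cutoff_eq0_near i (e0 k.+1) zt) mulr0 addr0 mul1r.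
exact: addsub.
Qed.

Lemma ext_approx_far k z : ~ tube E (3 * eps k.+1) z ->
  ext_approx k.+1 z = ext_approx k z /\ forall i, partial i (ext_approx k.+1) z = partial i (ext_approx k) z.
Proof.
move=> zt; split=> [|i]; first by rewrite [ext_approx k.+1 z]/= (cutoff_eq0 (e0 k.+1) zt) mul0r addr0.
by rewrite partial_extS (cutoff_eq0 (e0 k.+1) zt) (partial_cutoff_eq0_far i (e0 k.+1) zt) mul0r mulr0 !addr0.
Qed.

Definition approx_const : R := ((2 * (K * (1 + local_const))) `^ p * local_const `^ (p + 1)) + jump_const + base_const.

Lemma approx_const_gt0 : 0 < approx_const.
Proof.
have h1 : 0 < 1 + local_const by rewrite addr_gt0.
have h2 : 0 < 1 + Cs * 4 ^+ n by rewrite addr_gt0// mulr_gt0// exprn_gt0.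
by rewrite !addr_gt0// !(mulr_gt0, powR_gt0, invr_gt0, exprn_gt0).
Qed.

(** 256 is the inverse of [eps 0]; at later stages the quotient of [radius j] by [eps j.+1] is only
    128. *)
Definition deriv_const : R := 2 + 256 * (2 ^+ n * K).

(** Let m be the p-th root of [approx_const] times the majorant. Jumps are at most m [radius k], so
    averages stay below 2 m, and the derivative of a cutoff, of order 1 / eps k.+1, only multiplies
    such a jump. Nothing accumulates, since within each new neighbourhood the preceding function is
    a single average. *)
Lemma ext_approx_bound k z :
  ((`|ext_approx k z| `^ p)%:E <= (2 `^ p * approx_const)%:E * majorant z)%E /\
  forall i, ((`|partial i (ext_approx k) z| `^ p)%:E <= (deriv_const `^ p * approx_const)%:E * majorant z)%E.
Proof.
have A0 := approx_const_gt0; have M0 := majorant_ge0 z.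
have KK : 0 <= 2 ^+ n * K by rewrite mulr_ge0 ?exprn_ge0// ltW.
have d0 : 0 < deriv_const by rewrite ltr_pwDl// mulr_ge0.
have [Mf|] := ltP (majorant z) +oo%E; last first.
  rewrite leye_eq => /eqP ->; split=> [|i]; by rewrite gt0_muley ?leey// lte_fin mulr_gt0// powR_gt0.
have Mfin : majorant z \is a fin_num by rewrite ge0_fin_numE.
pose m := (approx_const * fine (majorant z)) `^ p^-1.
have f0 : 0 <= approx_const * fine (majorant z) by rewrite mulr_ge0 ?(ltW A0)// fine_ge0.
have m0 : 0 <= m by exact: powR_ge0.
have mp : m `^ p = approx_const * fine (majorant z) by rewrite powRVK.
have lem (c q : R) : 0 <= q -> c <= approx_const -> ((q `^ p)%:E <= c%:E * majorant z)%E -> q <= m.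
  move=> q0 cA; rewrite -(fineK Mfin) -EFinM lee_fin => h.
  rewrite -(powRKV p0 q0); apply: ge0_ler_powR; rewrite ?nnegrE ?invr_ge0 ?(ltW p0) ?powR_ge0//.
  by apply: le_trans h _; apply: ler_wpM2r => //; exact: fine_ge0.
have B0 : 0 <= base_const by rewrite !mulr_ge0 ?powR_ge0 ?exprn_ge0 ?invr_ge0 ?ltW.
have J0 : 0 <= jump_const by rewrite mulr_ge0 ?powR_ge0.
have D0 : 0 <= (2 * (K * (1 + local_const))) `^ p * local_const `^ (p + 1) by rewrite mulr_ge0 ?powR_ge0.
have b1 i k' : tube E (3 * eps k') z -> `|partial i (avg k') z| <= m.
  by move=> zt; apply: lem (partial_avg_bound i zt) => //; rewrite /approx_const; lra.
have b2 k' : tube E (3 * eps k'.+1) z -> `|avg k'.+1 z - avg k' z| <= m * radius k'.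
  move=> zt; rewrite -ler_pdivrMr//; apply: lem (avg_jump_bound zt); rewrite ?divr_ge0 ?(ltW (r0 _))//.
  by rewrite /approx_const; lra.
have b3 : tube E (3 * eps 0) z -> `|avg 0 z| <= m.
  by move=> zt; apply: lem (avg0_bound zt) => //; rewrite /approx_const; lra.
have b4 k' : tube E (3 * eps k') z -> `|avg k' z| <= m * (2 - 4 ^- k').
  elim: k' => [|k' IH] zt; first by rewrite expr0 invr1 (_ : 2 - 1 = 1) ?mulr1 ?b3//; lra.
  have h1 := IH (tube3 (tube_eps zt)); have h2 := b2 _ zt.
  have h3 := ler_normD (avg k'.+1 z - avg k' z) (avg k' z); rewrite subrK in h3.
  apply: le_trans h3 _; apply: le_trans (lerD h2 h1) _; rewrite -mulrDr; apply: ler_wpM2l => //.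
  exact: radius_step.
have b5 k' : tube E (3 * eps k') z -> `|avg k' z| <= 2 * m.
  move=> zt; apply: le_trans (b4 _ zt) _; rewrite mulrC; apply: ler_wpM2r => //.
  by rewrite gerBl invr_ge0 exprn_ge0.
have c01 k' : 0 <= cutoff E (eps k') z <= 1 by rewrite cutoff_ge0// cutoff_le1.
have cc := @convex_le R.
have bpos j : `|ext_approx j z| <= 2 * m.
  elim: j => [|j IHj].
    have [zt|zt] := pselect (tube E (3 * eps 0) z); last by rewrite [ext_approx 0 z]/= (cutoff_eq0 (e0 0) zt) mul0r normr0 mulr_ge0.
    have := cc (cutoff E (eps 0) z) 0 (avg 0 z) (2 * m) (c01 0); rewrite subr0 add0r normr0.
    by apply; rewrite ?mulr_ge0// b5.
  have [zt|zt] := pselect (tube E (3 * eps j.+1) z); last by rewrite (ext_approx_far zt).1.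
  rewrite [ext_approx j.+1 z]/= (ext_approx_near (tube_eps zt)).1.
  by apply: cc => //; [exact: b5 (tube3 (tube_eps zt))|exact: b5].
have dpos i j : `|partial i (ext_approx j) z| <= deriv_const * m.
  have pc k' := partial_cutoff_le K0 hK i E z (e0 k').
  have mK : 0 <= 256 * (2 ^+ n * K) * m by rewrite mulr_ge0// mulr_ge0.
  elim: j => [|j IHj].
    have [zt|zt] := pselect (tube E (3 * eps 0) z); last first.
      by rewrite partial_ext0 (cutoff_eq0 (e0 0) zt) (partial_cutoff_eq0_far i (e0 0) zt) mul0r mulr0 addr0 normr0 mulr_ge0// ltW.
    rewrite partial_ext0; apply: le_trans (ler_normD _ _) _; rewrite /deriv_const mulrDl; apply: lerD.
      rewrite normrM ger0_norm ?cutoff_ge0//; apply: le_trans (_ : 1 * m <= _); last by lra.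
      by apply: ler_pM => //; [rewrite cutoff_ge0|rewrite cutoff_le1|exact: b1].
    rewrite normrM; apply: le_trans (ler_pM _ _ (b3 zt) (pc 0)) _ => //.
    by rewrite /radius expr0 invr1 mul1r mulrC le_eqVlt; apply/orP; left; apply/eqP; field.
  have [zt|zt] := pselect (tube E (3 * eps j.+1) z); last by rewrite (ext_approx_far zt).2.
  rewrite partial_extS (ext_approx_near (tube_eps zt)).2 addrA; apply: le_trans (ler_normD _ _) _.
  have -> : deriv_const * m = 2 * m + 256 * (2 ^+ n * K) * m by rewrite /deriv_const mulrDl.
  apply: lerD.
    apply: le_trans (_ : m <= _); last by apply: ler_peMl => //; rewrite ler1n.
    by apply: cc => //; [exact: b1 (tube3 (tube_eps zt))|exact: b1].
  rewrite normrM; apply: le_trans (ler_pM _ _ (b2 _ zt) (pc j.+1)) _ => //.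
  have rS : radius j = 4 * radius j.+1 by exact: radiusS.
  have -> : m * radius j * (2 ^+ n * K / (radius j.+1 / 32)) = 128 * (2 ^+ n * K) * m.
    have fl (a b c : R) : b != 0 -> a * (4 * b) * (c / (b / 32)) = 128 * c * a by move=> hb; field.
    by rewrite rS; apply: fl; exact: lt0r_neq0 (r0 j.+1).
  by apply: ler_wpM2r => //; apply: ler_wpM2r => //; rewrite ler_nat.
have fin (q c : R) : 0 <= q -> 0 <= c -> q <= c * m -> ((q `^ p)%:E <= (c `^ p * approx_const)%:E * majorant z)%E.
  move=> q0 c0 h; rewrite -(fineK Mfin) -EFinM lee_fin -mulrA -mp -powRM//.
  by apply: ge0_ler_powR; rewrite ?nnegrE ?(ltW p0) ?mulr_ge0.
split=> [|i]; first exact: fin (normr_ge0 _) (ler0n R 2) (bpos k).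
exact: fin (normr_ge0 _) (ltW d0) (dpos i k).
Qed.

End extension.

(** * Scaling of integrals of nonnegative functions *)

Section scaling.
Context d (T : measurableType d) (R : realType) (mu : {measure set T -> \bar R}).
Import HBNNSimple.
Local Open Scope ereal_scope.

(* The integral of a nonnegative function is a supremum over simple functions, whence scaling without measurability. *)
Lemma ge0_integralZ_le (D : set T) (c : R) (f : T -> \bar R) : (0 < c)%R ->
  (forall x, D x -> 0 <= f x) ->
  \int[mu]_(x in D) (c%:E * f x) <= c%:E * \int[mu]_(x in D) f x.
Proof.
have key (g : T -> \bar R) (a : R) : (0 < a)%R -> (forall x, 0 <= g x) ->
    a%:E * \int[mu]_x g x <= \int[mu]_x (a%:E * g x).
  move=> a0 g0; rewrite -lee_pdivlMl//  ge0_integralTE//.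
  apply: ge_ereal_sup => _ [h /= hg <-]; rewrite lee_pdivlMl// -integralT_nnsfun -ge0_integralZl//.
  - have aE0 : 0 <= a%:E by rewrite lee_fin ltW.
  apply: le_ge0_integral => x _; first by apply: mule_ge0; [exact: aE0|by rewrite lee_fin].
    by apply: lee_wpmul2l; [rewrite lee_fin ltW|exact: hg].
  - by apply/measurable_EFinP.
  - by move=> x _; rewrite lee_fin.
  - by rewrite lee_fin ltW.
move=> c0 f0; rewrite !(integral_mkcond D).
have r0 x : 0 <= (f \_ D) x by exact: erestrict_ge0.
have e : (fun x => c%:E * f x) \_ D = (fun x => c%:E * (f \_ D) x).
  by apply/funext => x; rewrite !patchE; case: ifP => _; rewrite ?mule0.
rewrite e -lee_pdivrMl//; apply: le_trans (key _ _ _ _) _; rewrite ?invr_gt0//.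
  by move=> x; rewrite mule_ge0// lee_fin ltW.
by rewrite le_eqVlt; apply/orP; left; apply/eqP; apply: eq_integral => x _; rewrite muleA -EFinM mulVf ?mul1e// gt_eqF.
Qed.
End scaling.

(** * Integral of the majorant *)

Section majorant_bound.
Context {R : realType} {n : nat}.
Local Notation V := 'rV[R]_n.
Local Notation X := (borelRn R n).
Local Notation L := (@lebesgueRn R n).
Variable p : R.
Hypotheses (n0 : (0 < n)%N) (pn : n%:R < p).
Variables (sigma : {measure set X -> \bar R}) (E : set V).
Hypothesis sfin : forall z r, (sigma (cube z r) < +oo)%E.
Hypotheses (cE : closed E).
Variables (Cs : R).
Hypotheses (Cs0 : 0 < Cs).
Hypothesis spos : forall x r, E x -> 0 < r -> (0 < sigma (cube x r))%E.
Hypothesis sdbl : forall (x : V) (r k : R), E x -> 0 < r <= 1 -> 1 <= k <= r^-1 ->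
  (sigma (cube x (k * r)) <= (Cs * k ^+ n)%:E * sigma (cube x r))%E.
Variable f : V -> R.
Hypothesis mf : measurable_fun [set: X] (f : X -> R).
Implicit Types (x y z : V) (r : R).
Local Notation radius := (@radius R).
Local Notation sg x r := (fine (sigma (cube x r))).
Local Notation oscillation := (@oscillation R n p sigma E f).
Local Notation kernel := (@besov_kernel R n p sigma f).

Let mE : @measurable _ X E. Proof. exact: closed_measurableRn. Qed.
Let p1 : 1 < p. Proof. by rewrite (le_lt_trans _ pn)// ler1n. Qed.
Let p0 : 0 < p. Proof. by rewrite (lt_trans _ p1). Qed.
Let ssig : sigma_finite setT sigma. Proof. exact: sigma_finite_sigma. Qed.
Let sleb : sigma_finite setT L. Proof. exact: sigma_finite_lebesgueRn. Qed.
Let r0 k : 0 < radius k. Proof. exact: radius_gt0. Qed.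

Lemma integral_mean r (g : X -> \bar R) : 0 < r -> measurable_fun setT g -> (forall x, 0 <= g x)%E ->
  (\int[L]_z (\int[sigma]_(y in E `&` cube z r) g y) = ((r *+ 2) ^+ n)%:E * \int[sigma]_(y in E) g y)%E.
Proof.
move=> h mg g0.
have := @tonelli_cube_prod R n L sigma setT E r (cst 1%E) g sleb ssig measurableT mE (measurable_cst _) mg (fun=> lee01) g0.
under eq_integral do rewrite mul1e.
move=> ->; rewrite -ge0_integralZl//; last by rewrite lee_fin exprn_ge0// mulrn_wge0// ltW.
  apply: eq_integral => y _; rewrite setTI integral_cst; last exact: measurable_cube.
  by rewrite mul1e lebesgueRn_cube// muleC.
exact: measurable_funTS.
Qed.

Definition growth4 : R := 4 `^ (p - n%:R).

Lemma growth4_gt1 : 1 < growth4.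
Proof. by rewrite -[ltLHS](@one_powR R (p - n%:R)); apply: gt0_ltr_powR; rewrite ?nnegrE ?subr_gt0 ?ltr1n. Qed.

Let powNn (t : R) : 0 < t -> t `^ (n%:R - p) = (t `^ (p - n%:R))^-1.
Proof. by move=> t0; rewrite -powRN opprB. Qed.

Lemma radius_powR k : radius k `^ (n%:R - p) = 8^-1 `^ (n%:R - p) * growth4 ^+ k.
Proof.
rewrite /radius -exprVn powRM ?exprn_ge0// mulrC; congr (_ * _).
by rewrite powR_exprn//; congr (_ ^+ _); rewrite powNn// powRVn// invrK.
Qed.

(** The summands grow geometrically with k, so the sum is of the order of its last active term,
    whose radius is at least d / 2. *)
Lemma sum_radius_le (d : R) J : 0 < d ->
  \sum_(k < J) radius k `^ (n%:R - p) * (d <= 2 * radius k)%R%:R <=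
    growth4 / (growth4 - 1) * (d / 2) `^ (n%:R - p).
Proof.
move=> d0; have t1 := growth4_gt1; have t0 : 0 < growth4 by rewrite (lt_trans _ t1).
elim: J => [|J IH]; first by rewrite big_ord0 mulr_ge0 ?powR_ge0// divr_ge0 ?subr_ge0 ?(ltW t0) ?(ltW t1).
case: (boolP (d <= 2 * radius J)) => dJ; last by rewrite big_ord_recr/= (negbTE dJ) mulr0 addr0.
apply: le_trans (_ : \sum_(k < J.+1) 8^-1 `^ (n%:R - p) * growth4 ^+ k <= _).
  by apply: ler_sum => k _; rewrite radius_powR; apply: ler_piMr; [by rewrite mulr_ge0 ?powR_ge0 ?exprn_ge0 ?(ltW t0)|by rewrite lern1 leq_b1].
rewrite -mulr_sumr; apply: le_trans (ler_wpM2l (powR_ge0 _ _) (sum_geometric_gt1 _ t1)) _.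
have re (a b c g : R) : a * (g * b * c) = g * c * (a * b) by ring.
rewrite exprS re -radius_powR.
apply: ler_wpM2l; first by rewrite divr_ge0 ?subr_ge0 ?(ltW t0) ?(ltW t1).
rewrite !powNn ?divr_gt0// lef_pV2 ?posrE ?powR_gt0 ?divr_gt0//.
apply: ge0_ler_powR; rewrite ?nnegrE ?subr_ge0 ?(ltW pn) ?(ltW (r0 _)) ?divr_ge0 ?(ltW d0)//.
by rewrite ler_pdivrMr// mulrC.
Qed.

Definition kernel_sum_const : R :=
  (Cs * 4 ^+ n) ^+ 2 * 2 ^+ n * (growth4 / (growth4 - 1) * 2^-1 `^ (n%:R - p)).

Lemma kernel_sum_const_gt0 : 0 < kernel_sum_const.
Proof.
have t1 := growth4_gt1; have t0 : 0 < growth4 by rewrite (lt_trans _ t1).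
by rewrite !mulr_gt0 ?exprn_gt0 ?powR_gt0 ?invr_gt0 ?subr_gt0 ?mulr_gt0 ?exprn_gt0.
Qed.

Local Notation weight k := ((radius k)^-1 `^ p * (radius k *+ 2) ^+ n).

Let weightE k : weight k = 2 ^+ n * radius k `^ (n%:R - p).
Proof.
have -> : radius k *+ 2 = 2 * radius k by rewrite mulr_natl.
rewrite powRVn// exprMn mulrCA; congr (_ * _).
rewrite powRD ?powRN ?powR_mulrn ?(ltW (r0 _)) 1?mulrC//.
by rewrite (gt_eqF (r0 k)) implybT.
Qed.

Let sgp a r : E a -> 0 < r -> 0 < sg a r.
Proof. by move=> Ea h; rewrite fine_gt0// spos//= sfin. Qed.

(** The cube of radius d about x lies in the one of radius 2 d about y, which doubling compares with
    radius d / 2 <= radius k; since d <= 1/4, this stays in the range of the doubling condition. *)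
Let sg_compare x y (d : R) k : E x -> E y -> d = `|x - y| -> 0 < d -> d <= 2 * radius k ->
  sg x d <= Cs * 4 ^+ n * sg y (radius k).
Proof.
move=> Ex Ey dE d0 dk; have rk := @radius_le R k; have d4 : d <= 4^-1 by lra.
apply: le_trans (_ : sg y (4 * (d / 2)) <= _).
  by apply: fine_sigma_le => //; apply: cube_subset; rewrite -dE; lra.
apply: le_trans (_ : Cs * 4 ^+ n * sg y (d / 2) <= _).
  have h : (sigma (cube y (4 * (d / 2))) <= (Cs * 4 ^+ n)%:E * sigma (cube y (d / 2)))%E.
    by apply: sdbl => //; [lra|apply/andP; split; [lra|rewrite -[leLHS]invrK lef_pV2 ?posrE ?invr_gt0 ?divr_gt0//; lra]].
  by move: h; rewrite -[sigma (cube y (4 * _))]fineK ?fin_sigma// -[sigma (cube y (d / 2))]fineK ?fin_sigma// -EFinM lee_fin.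
apply: ler_wpM2l; first by rewrite mulr_ge0 ?exprn_ge0// ltW.
by apply: fine_sigma_le => //; apply: cube_subset; rewrite subrr normr0 add0r; lra.
Qed.

(** At every active scale the mass at y dominates, up to a constant, the mass of the cube of radius
    |x - y| at x. What is left is [sum_radius_le], which rebuilds the power of |x - y| in the
    kernel. Active scales force |x - y| <= 1/4, inside the domain of the Besov integral. *)
Lemma kernel_sum_le J x y : E x -> E y ->
  \sum_(k < J) weight k * sg y (radius k) ^- 2 * (`|f x - f y| `^ p * (x \in cube y (2 * radius k))%:R) <=
  kernel_sum_const * (if (0 < `|x - y| < 1)%R then kernel x y else 0).
Proof.
move=> Ex Ey; have [->|xy] := eqVneq x y.
  rewrite big1 => [|k _]; last by rewrite subrr normr0 powR0 ?gt_eqF// mul0r mulr0.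
  by rewrite mulr_ge0 ?(ltW kernel_sum_const_gt0)//; case: ifP => // _; rewrite divr_ge0 ?powR_ge0// mulr_ge0 ?powR_ge0// exprn_ge0// fine_sigma_ge0.
have d0 : 0 < `|x - y| by rewrite normr_gt0 subr_eq0.
rewrite d0/=; set d := `|x - y| in d0 *.
have cu k : (x \in cube y (2 * radius k)) = (d <= 2 * radius k) by apply/idP/idP; rewrite inE.
case: ltP => d1; last first.
  rewrite big1 ?mulr0// => k _; rewrite cu leNgt (_ : _ < d) ?mulr0//.
  by have := @radius_le R k; lra.
have s0 : 0 < sg x d by exact: sgp.
pose A : R := `|f x - f y| `^ p; have A0 : 0 <= A by exact: powR_ge0.
have t1 := growth4_gt1.
apply: le_trans (_ : \sum_(k < J) ((Cs * 4 ^+ n) ^+ 2 * 2 ^+ n * (sg x d ^- 2 * A)) * (radius k `^ (n%:R - p) * (d <= 2 * radius k)%R%:R) <= _).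
  apply: ler_sum => k _; rewrite cu; case: (boolP (d <= _)) => dk; last by rewrite !mulr0.
  rewrite !mulr1 weightE; have sy := sgp Ey (r0 k).
  have h : sg y (radius k) ^- 2 <= (Cs * 4 ^+ n) ^+ 2 * sg x d ^- 2.
    rewrite -[leLHS]div1r ler_pdivrMr ?exprn_gt0// mulrAC ler_pdivlMr ?exprn_gt0// mul1r -exprMn.
    by apply: lerXn2r; rewrite ?nnegrE ?mulr_ge0 ?exprn_ge0 ?fine_sigma_ge0 ?(ltW Cs0)//; exact: sg_compare dk.
  have re (u P T c v a : R) : u <= c * v -> 0 <= P -> 0 <= T -> 0 <= a -> T * P * u * a <= c * T * (v * a) * P.
    move=> ucv P0 T0 a0; have -> : c * T * (v * a) * P = T * P * (c * v) * a by ring.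
    by apply: ler_wpM2r => //; apply: ler_wpM2l => //; exact: mulr_ge0.
  by apply: re; rewrite ?powR_ge0 ?exprn_ge0.
rewrite -mulr_sumr; apply: le_trans (ler_wpM2l _ (sum_radius_le _ d0)) _.
  by rewrite !mulr_ge0 ?exprn_ge0 ?invr_ge0 ?exprn_ge0 ?fine_sigma_ge0 ?mulr_ge0 ?exprn_ge0 ?(ltW Cs0).
rewrite powRM ?(ltW d0)// /besov_kernel /kernel_sum_const -/d -/A powNn// le_eqVlt; apply/orP; left; apply/eqP.
have dp : 0 < d `^ (p - n%:R) by exact: powR_gt0.
have re (a b c e g h v : R) : a != 0 -> b != 0 ->
  g * e * (b ^- 2 * v) * (h * (a^-1 * c)) = g * e * (h * c) * (v / (a * b ^+ 2)).
  by move=> a0 b0; field; rewrite a0 b0.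
by apply: re; rewrite gt_eqF.
Qed.

Local Notation inner y :=
  (\int[sigma]_(x in E `&` [set x : V | (0 < `|x - (y : V)| < 1)%R]) (kernel x y)%:E)%E.

Let kernel_ge0 x y : 0 <= kernel x y.
Proof. by rewrite divr_ge0 ?powR_ge0// mulr_ge0 ?powR_ge0// exprn_ge0// fine_sigma_ge0. Qed.

Lemma sum_oscillation_le J y : E y ->
  (\sum_(k < J) (weight k)%:E * oscillation k y <= kernel_sum_const%:E * inner y)%E.
Proof.
move=> Ey; have k0 := kernel_sum_const_gt0.
have w0 k : 0 <= weight k by rewrite mulr_ge0 ?powR_ge0// exprn_ge0// mulrn_wge0// ltW.
have mg : measurable_fun [set: X] (fun x : X => `|f x - f y| `^ p).
  by apply: measurable_fun_powR; apply: measurableT_comp => //; apply: measurable_funB => //; exact: measurable_cst.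
have mi k : measurable_fun [set: X] (fun x : X => ((x \in cube y (2 * radius k))%:R : R)).
  by have := measurable_indic (@measurable_cube R n y (2 * radius k)); apply.
pose q k (x : X) : R := weight k * sg y (radius k) ^- 2 * (`|f x - f y| `^ p * (x \in cube y (2 * radius k))%:R).
have q0 k x : 0 <= q k x.
  by apply: mulr_ge0; [apply: mulr_ge0 => //; rewrite invr_ge0 exprn_ge0// fine_sigma_ge0|rewrite mulr_ge0 ?powR_ge0].
have mq k : measurable_fun (E : set X) (fun x : X => (q k x)%:E).
  by apply: measurable_funTS; apply/measurable_EFinP; apply: measurable_funM; [exact: measurable_cst|exact: measurable_funM].
have qE k : ((weight k)%:E * oscillation k y = \int[sigma]_(x in E) (q k x)%:E)%E.
  rewrite /oscillation muleA -EFinM integral_mkcondr.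
  rewrite -ge0_integralZl//.
  - apply: eq_integral => x _; rewrite patchE; case: ifP => h; rewrite /q h ?mulr0 ?mule0 ?mulr1 -?EFinM//.
  - apply: measurable_funTS; apply/(measurable_restrictT _ _).1; first exact: measurable_cube.
    by apply: measurable_funTS; apply/measurable_EFinP.
  - by move=> x _; apply: erestrict_ge0 => *; rewrite lee_fin powR_ge0.
  - by rewrite lee_fin mulr_ge0// invr_ge0 exprn_ge0// fine_sigma_ge0.
under eq_bigr do rewrite qE.
rewrite -ge0_integral_sum//; last by move=> k x _; rewrite lee_fin.
apply: le_trans (_ : \int[sigma]_(x in E) (kernel_sum_const%:E * ((EFin \o kernel^~ y) \_ [set x : V | (0 < `|x - (y : V)| < 1)%R]) x) <= _)%E.
  apply: le_ge0_integral => x Ex; first by apply: sume_ge0 => k _; rewrite lee_fin.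
  rewrite sumEFin patchE; apply: le_trans (_ : (kernel_sum_const * (if (0 < `|(x : V) - y| < 1)%R then kernel x y else 0))%:E <= _)%E.
    by rewrite lee_fin; exact: kernel_sum_le.
  rewrite (_ : (x \in _) = (0 < `|(x : V) - y| < 1)%R); last by apply/idP/idP; rewrite inE.
  by case: ifP => _; rewrite ?mulr0 ?mule0 -?EFinM.
apply: le_trans (ge0_integralZ_le _ k0 _) _; last by rewrite -integral_mkcondr.
by move=> x _; apply: erestrict_ge0 => *; rewrite lee_fin.
Qed.

Definition majorant_const : R := (2 * radius 0) ^+ n + kernel_sum_const.

Lemma majorant_const_gt0 : 0 < majorant_const.
Proof. by rewrite addr_gt0// ?kernel_sum_const_gt0// exprn_gt0// mulr_gt0. Qed.

(** Tonelli turns the integral in z of each mean into a volume factor, after which the sum over the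
    scales is performed pointwise in x and y. *)
Lemma integral_majorant :
  (\int[L]_z majorant p sigma E f z <=
   majorant_const%:E * (\int[sigma]_(x in E) (`|f x| `^ p)%:E + \int[sigma]_(y in E) inner y))%E.
Proof.
have k0 := kernel_sum_const_gt0.
have mfp : measurable_fun [set: X] (fun x : X => (`|f x| `^ p)%:E).
  by apply/measurable_EFinP; apply: measurable_fun_powR; exact: measurableT_comp.
have mo k : measurable_fun [set: X] (oscillation k : X -> \bar R) by exact: measurable_oscillation.
have o0 k (y : X) : (0 <= oscillation k y)%E by exact: oscillation_ge0.
have fp0 (x : X) : (0 <= (`|f x| `^ p)%:E)%E by rewrite lee_fin powR_ge0.
have mm k : measurable_fun [set: X] (mean_osc p sigma E f k : X -> \bar R) by exact: measurable_integral_cube.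
have c0 k : (0 <= ((radius k)^-1 `^ p)%:E)%E by rewrite lee_fin powR_ge0.
have mo0 k z : (0 <= mean_osc p sigma E f k z)%E by exact: mean_osc_ge0.
have mt k : measurable_fun [set: X] (fun z : X => ((radius k)^-1 `^ p)%:E * mean_osc p sigma E f k z)%E.
  by apply: emeasurable_funM => //; exact: measurable_cst.
have t0 k z : (0 <= ((radius k)^-1 `^ p)%:E * mean_osc p sigma E f k z)%E by rewrite mule_ge0.
have I0 (y : X) : (0 <= inner y)%E by apply: integral_ge0 => *; rewrite lee_fin.
rewrite /majorant ge0_integralD//; last first.
- by apply: ge0_emeasurable_sum => // *.
- by move=> z _; apply: nneseries_ge0.
- exact: measurable_integral_cube.
- by move=> z _; apply: integral_ge0 => *.
rewrite integral_mean// integral_nneseries//.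
have A0 : (0 <= \int[sigma]_(x in E) (`|f x| `^ p)%:E)%E by apply: integral_ge0 => *.
have B0 : (0 <= \int[sigma]_(y in E) inner y)%E by apply: integral_ge0 => *.
rewrite /majorant_const; apply: le_trans (_ : ((2 * radius 0) ^+ n)%:E * \int[sigma]_(x in E) (`|f x| `^ p)%:E +
    kernel_sum_const%:E * \int[sigma]_(y in E) inner y <= _)%E; last first.
  have rr : 0 <= (2 * radius 0) ^+ n by rewrite exprn_ge0// mulr_ge0// ltW.
  have re (a b : R) (x y : \bar R) : 0 <= a -> 0 <= b -> (0 <= x -> 0 <= y -> a%:E * x + b%:E * y <= (a + b)%:E * (x + y))%E.
    move=> a0 b0 x0 y0; rewrite ge0_muleDr//.
    by apply: leeD; apply: lee_wpmul2r; rewrite // lee_fin ?lerDl ?lerDr.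
  exact: re rr (ltW k0) A0 B0.
have -> : radius 0 *+ 2 = 2 * radius 0 by rewrite mulr_natl.
apply: leeD => //.
apply: nneseries_le_bound => [k|J]; first by apply: integral_ge0 => *.
have iE k : (\int[L]_z (((radius k)^-1 `^ p)%:E * mean_osc p sigma E f k z) = \int[sigma]_(y in E) ((weight k)%:E * oscillation k y))%E.
  rewrite ge0_integralZl// integral_mean// muleA -EFinM -ge0_integralZl//.
  - exact: measurable_funTS.
  - by rewrite lee_fin mulr_ge0 ?powR_ge0// exprn_ge0// mulrn_wge0// ltW.
under eq_bigr do rewrite iE.
have wk k : (0 <= (weight k)%:E)%E by rewrite lee_fin mulr_ge0 ?powR_ge0// exprn_ge0// mulrn_wge0// ltW.
rewrite -ge0_integral_sum//; first last.
- by move=> k x _; rewrite mule_ge0.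
- by move=> k; apply: measurable_funTS; apply: emeasurable_funM => //; exact: measurable_cst.
(* The inner Besov integral is not shown to be measurable in y, so the constant is taken out by an
   inequality. *)
apply: le_trans (ge0_integralZ_le _ k0 _) => //.
apply: le_ge0_integral => y Ey; last exact: sum_oscillation_le.
by apply: sume_ge0 => k _; rewrite mule_ge0.
Qed.

End majorant_bound.

Lemma radius_small (R : realType) (e : R) : 0 < e -> exists k0, forall k, (k0 <= k)%N -> radius k < e.
Proof.
move=> e0; have [k0 _ /(_ k0 (leqnn k0)) /= h] := near_infty_natSinv_lt (PosNum e0).
exists k0 => k kk; apply: le_lt_trans h; rewrite /radius.
have h4 : k0.+1%:R <= 4 ^+ k :> R by rewrite -natrX ler_nat; apply: leq_ltn_trans kk (ltn_expl k _).
have p4 : 0 < 4 ^+ k :> R by rewrite exprn_gt0.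
apply: le_trans (_ : 4 ^- k <= _); first by rewrite ler_pdivrMr// ler_peMr ?invr_ge0 ?(ltW p4)// ler1n.
by rewrite lef_pV2 ?posrE.
Qed.

Lemma powR_rV_norm_le (R : realType) n (v : 'rV[R]_n) (p : R) (Y : \bar R) : (0 < n)%N -> 0 < p ->
  (forall i, ((`|v ord0 i| `^ p)%:E <= Y)%E) -> ((`|v| `^ p)%:E <= Y)%E.
Proof.
move=> n0 p0 h; case: Y h => [y| |] h.
- have y0 : 0 <= y by have := h (Ordinal n0); rewrite lee_fin; apply: le_trans; exact: powR_ge0.
  have b : `|v| <= y `^ p^-1.
    apply/(rV_norm_leP _ (powR_ge0 _ _)) => i; rewrite -(powRKV p0 (normr_ge0 (v ord0 i))).
    by apply: ge0_ler_powR; rewrite ?nnegrE ?invr_ge0 ?(ltW p0) ?powR_ge0//; have := h i; rewrite lee_fin.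
  by rewrite lee_fin -(powRVK p0 y0); apply: ge0_ler_powR; rewrite ?nnegrE ?(ltW p0) ?powR_ge0 ?rV_norm_ge0.
- by rewrite leey.
- by have := h (Ordinal n0); rewrite leeNy_eq.
Qed.

(** * The limit of the approximations and its weak gradient *)

Section extension_limit.
Context {R : realType} {n : nat}.
Local Notation V := 'rV[R]_n.
Local Notation X := (borelRn R n).
Local Notation L := (@lebesgueRn R n).
Variables (p K : R).
Hypotheses (n0 : (0 < n)%N) (pn : n%:R < p).
Hypotheses (K0 : 0 < K) (hK : forall (i : 'I_n) (z : V), `|partial i plateau z| <= K).
Variables (sigma : {measure set X -> \bar R}) (E : set V).
Hypothesis sfin : forall z r, (sigma (cube z r) < +oo)%E.
Hypotheses (cE : closed E) (sE : sigma (~` E) = 0%E) (LE : L E = 0%E).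
Variables (Cs C1 : R).
Hypotheses (Cs0 : 0 < Cs) (C10 : 0 < C1).
Hypothesis spos : forall x r, E x -> 0 < r -> (0 < sigma (cube x r))%E.
Hypothesis sdbl : forall (x : V) (r k : R), E x -> 0 < r <= 1 -> 1 <= k <= r^-1 ->
  (sigma (cube x (k * r)) <= (Cs * k ^+ n)%:E * sigma (cube x r))%E.
Hypothesis sone : forall x : V, E x -> (C1%:E <= sigma (cube x 1))%E.
Variable f : V -> R.
Hypothesis mf : measurable_fun [set: X] (f : X -> R).
Hypothesis lf : forall r, exists B, forall x, E x -> cube (0 : V) r x -> `|f x| <= B.
Hypothesis cf : forall x, E x -> forall e : R, 0 < e -> exists2 d : R, 0 < d & forall y, E y -> `|y - x| < d -> `|f y - f x| <= e.
Local Notation majorant := (@majorant R n p sigma E f).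
Hypothesis iM : (\int[L]_z majorant z < +oo)%E.
Implicit Types (x y z a : V) (r : R).
Local Notation radius := (@radius R).
Local Notation eps k := (radius k / 32).
Local Notation avg := (@avg R n sigma E f).
Local Notation ext_approx := (@ext_approx R n sigma E f).
Local Notation c1 := (2 `^ p * @approx_const R n p K Cs C1).
Local Notation c2 := (@deriv_const R n K `^ p * @approx_const R n p K Cs C1).

Let mE : @measurable _ X E. Proof. exact: closed_measurableRn. Qed.
Let p1 : 1 < p. Proof. by rewrite (le_lt_trans _ pn)// ler1n. Qed.
Let p0 : 0 < p. Proof. by rewrite (lt_trans _ p1). Qed.
Let r0 k : 0 < radius k. Proof. exact: radius_gt0. Qed.
Let M0 (z : X) : (0 <= majorant z)%E. Proof. exact: majorant_ge0. Qed.
Let mM : measurable_fun [set: X] (majorant : X -> \bar R). Proof. exact: measurable_majorant. Qed.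
Let a0 : 0 < @approx_const R n p K Cs C1. Proof. exact: approx_const_gt0. Qed.

Let bound k z : ((`|ext_approx k z| `^ p)%:E <= c1%:E * majorant z)%E /\
  forall i, ((`|partial i (ext_approx k) z| `^ p)%:E <= c2%:E * majorant z)%E.
Proof. exact: ext_approx_bound. Qed.

Let Ck_ext N k : Ck N (ext_approx k). Proof. exact: Ck_ext_approx. Qed.

Let far k z : ~ tube E (3 * eps k.+1) z ->
  ext_approx k.+1 z = ext_approx k z /\ forall i, partial i (ext_approx k.+1) z = partial i (ext_approx k) z.
Proof. exact: ext_approx_far. Qed.

Let near_ k z : tube E (eps k) z -> ext_approx k z = avg k z.
Proof.
move=> zt; suff [] : ext_approx k z = avg k z /\ forall i, partial i (ext_approx k) z = partial i (avg k) z by [].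
exact: ext_approx_near.
Qed.

Let avg_close k z a c e : E a -> `|z - a| < 3 * eps k -> 0 <= e ->
  (forall x, E x -> cube z (radius k) x -> `|f x - c| <= e) -> `|avg k z - c| <= e.
Proof. exact: avg_near. Qed.

Definition stable k0 z := forall k, (k0 <= k)%N -> ext_approx k z = ext_approx k0 z /\
  forall i, partial i (ext_approx k) z = partial i (ext_approx k0) z.

Lemma stable_off z : ~ E z -> exists k0, exists2 d : R, 0 < d & forall y, `|y - z| < d -> stable k0 y.
Proof.
move=> Ez; have /nbhs_ballP[e /= e0 he] : nbhs z (~` E) by apply: open_nbhs_nbhs; split => //; exact: closed_openC.
have e2 : 0 < e / 2 by rewrite divr_gt0.
have [k0 hk] := radius_small e2; exists k0, (e / 2) => // y yz.
elim=> [|k IH]; first by rewrite leqn0 => /eqP ->.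
rewrite leq_eqVlt => /predU1P[<-//|kk].
have [h1 h2] : ext_approx k.+1 y = ext_approx k y /\ forall i, partial i (ext_approx k.+1) y = partial i (ext_approx k) y.
  apply: far => -[x Ex yx]; apply: (he x) => //; rewrite -ball_normE /=.
  have := hk _ (ltnW kk); have := rV_distD y z x; rewrite (rV_distC z y); have := r0 k.+1; rewrite ltnS in kk.
  by move=> ? ? ?; lra.
by have [g1 g2] := IH kk; split=> [|i]; rewrite ?h1 ?h2.
Qed.

(** By [stageP] the default of [xget] can occur only on E, where [ext_lim] and [ext_grad] do not
    consult the stage. *)
Definition stage z : nat := xget 0%N [set k0 | stable k0 z].

Definition ext_lim z : R := if z \in E then f z else ext_approx (stage z) z.

(** E is null, so the value there is a matter of choice; 0 makes the bound by the majorant hold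
    everywhere. *)
Definition ext_grad z : V := if z \in E then 0 else \row_i partial i (ext_approx (stage z)) z.

Let stageP z : ~ E z -> stable (stage z) z.
Proof.
move=> /stable_off[k0 [d d0 h]]; rewrite /stage; case: xgetP => [k -> //|/(_ k0)[]].
by apply: h; rewrite subrr normr0.
Qed.

Let offE z : ~ E z -> (z \in E) = false. Proof. by move=> Ez; apply/negP => /set_mem. Qed.

Lemma ext_lim_stable k z : ~ E z -> stable k z -> ext_lim z = ext_approx k z /\
  forall i, ext_grad z ord0 i = partial i (ext_approx k) z.
Proof.
move=> Ez hk; have hs := stageP Ez; rewrite /ext_lim /ext_grad (offE Ez).
have [h1 h2] := hk _ (leq_maxl k (stage z)); have [g1 g2] := hs _ (leq_maxr k (stage z)).
by split=> [|i]; rewrite ?mxE -?g1 -?g2.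
Qed.

Lemma ext_lim_on x : E x -> ext_lim x = f x.
Proof. by move=> Ex; rewrite /ext_lim mem_set. Qed.

Let shift_convex (x u v c B : R) : 0 <= x <= 1 -> `|u - c| <= B -> `|v - c| <= B -> `|u + x * (v - u) - c| <= B.
Proof.
move=> hx hu hv; have -> : u + x * (v - u) - c = (u - c) + x * ((v - c) - (u - c)) by ring.
exact: convex_le.
Qed.

(** From index k0 on, the value at y is an average of f over points of E close to a, a convex
    combination of two such averages, or the unchanged preceding value. The bound is uniform in k,
    hence passes to the limit. *)
Let approx_near a y c e delta k0 : 0 <= e -> (forall x, E x -> `|x - a| < delta -> `|f x - c| <= e) ->
  `|y - a| < delta / 2 -> (forall k, (k0 <= k)%N -> radius k < delta / 2) -> tube E (eps k0) y ->
  forall k, (k0 <= k)%N -> `|ext_approx k y - c| <= e.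
Proof.
move=> e0 hf ya hr yt.
have av k : (k0 <= k)%N -> tube E (3 * eps k) y -> `|avg k y - c| <= e.
  move=> kk [b Eb yb]; apply: avg_close Eb yb e0 _ => x Ex xy; apply: hf => //.
  have := hr _ kk; have := rV_distD y x a; rewrite /cube /= in xy.
  by move=> ? ?; lra.
elim=> [|k IH].
  by rewrite leqn0 => /eqP k00; rewrite k00 in av yt; rewrite near_//; apply: av => //; apply: tube_le yt; have := r0 0; lra.
rewrite leq_eqVlt => /predU1P[k00|kk].
  by rewrite k00 in av yt; rewrite near_//; apply: av => //; apply: tube_le yt; have := r0 k.+1; lra.
have [zt|zt] := pselect (tube E (3 * eps k.+1) y); last by rewrite (far zt).1; exact: IH.
have rS : radius k = 4 * radius k.+1 by exact: radiusS.
have zk : tube E (eps k) y by apply: tube_le zt; have := r0 k.+1; lra.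
have zk3 : tube E (3 * eps k) y by apply: tube_le zk; have := r0 k; lra.
rewrite [ext_approx k.+1 y]/= (near_ zk); apply: shift_convex.
- have h : 0 < eps k.+1 by rewrite divr_gt0.
  by rewrite (cutoff_ge0 E y h) (cutoff_le1 E y h).
- exact: av.
- by apply: av => //; exact: ltnW.
Qed.

Lemma continuous_ext_lim : continuous ext_lim.
Proof.
move=> z; have [Ez|Ez] := pselect (E z).
  have FF : Filter (nbhs z) by typeclasses eauto.
  apply/(@cvgrPdist_le _ _ _ _ FF) => e e0; have [d d0 hd] := cf Ez e0.
  have d2 : 0 < d / 2 by rewrite divr_gt0.
  have [k0 hk] := radius_small d2.
  have m0 : 0 < Num.min (d / 2) (eps k0) by rewrite lt_min d2 divr_gt0.
  have := near_dist z m0; apply: filterS => y; rewrite lt_min => /andP[y1 y2].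
  rewrite distrC (ext_lim_on Ez); have [Ey|Ey] := pselect (E y).
    by rewrite ext_lim_on//; apply: hd => //; lra.
  have hs := stageP Ey; rewrite /ext_lim offE//.
  (* The value is read off at an index beyond both k0 and the stabilisation of y. *)
  have [<- _] := hs _ (leq_maxr k0 (stage y)).
  by apply: (approx_near (ltW e0) hd y1 hk _ (leq_maxl _ _)); exists z.
have [k0 [d d0 hd]] := stable_off Ez.
have /nbhs_ballP[e /= e0 he] : nbhs z (~` E) by apply: open_nbhs_nbhs; split => //; exact: closed_openC.
have dz : `|z - z| < d by rewrite subrr normr0.
have m0 : 0 < Num.min d e by rewrite lt_min d0.
have nr : \forall y \near z, ext_approx k0 y = ext_lim y.
  have := near_dist z m0; apply: filterS => y; rewrite lt_min => /andP[y1 y2].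
  rewrite (ext_lim_stable _ (hd _ y1)).1//; apply: he; rewrite -ball_normE /=.
  by rewrite (rV_distC z y).
rewrite /continuous_at (ext_lim_stable Ez (hd _ dz)).1.
have FF : Filter (nbhs z) by typeclasses eauto.
have cc : ext_approx k0 x @[x --> z] --> ext_approx k0 z := Ck_continuous (Ck_ext 0 k0) (x := z).
apply/(@cvgrPdist_le _ _ _ _ FF) => t t0; have /(@cvgrPdist_le _ _ _ _ FF)/(_ _ t0) := cc.
by apply: filterS2 nr => y ->.
Qed.

Lemma ext_lim_bound z : ~ E z -> ((`|ext_lim z| `^ p)%:E <= c1%:E * majorant z)%E.
Proof. by move=> Ez; rewrite (ext_lim_stable Ez (stageP Ez)).1; exact: (bound _ z).1. Qed.

Lemma ext_grad_bound z : ((`|ext_grad z| `^ p)%:E <= c2%:E * majorant z)%E.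
Proof.
have c20 : 0 <= c2 by rewrite mulr_ge0 ?powR_ge0 ?(ltW a0).
have [Ez|Ez] := pselect (E z).
  by rewrite /ext_grad mem_set// normr0 powR0 ?gt_eqF// mule_ge0.
apply: powR_rV_norm_le => // i.
by rewrite (ext_lim_stable Ez (stageP Ez)).2; exact: (bound _ z).2.
Qed.

Let cvg_off (h_ : nat -> V -> R) (h : V -> R) : (forall k z, stable k z -> ~ E z -> h z = h_ k z) ->
  forall z, ~ E z -> \forall k \near \oo, h_ k z = h z.
Proof.
move=> hh z Ez; have hs := stageP Ez; exists (stage z) => // k /= kk.
rewrite (hh k)// => j jk.
have [g1 g2] := hs _ kk; have [g3 g4] := hs _ (leq_trans kk jk).
by split=> [|i]; rewrite ?g1 ?g3 ?g2 ?g4.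
Qed.

Lemma measurable_ext_grad i : measurable_fun [set: X] (fun z : X => ext_grad z ord0 i).
Proof.
have gE z : ext_grad z ord0 i = if z \in E then 0 else partial i (ext_approx (stage z)) z.
  by rewrite /ext_grad; case: ifP; rewrite mxE.
apply: (@measurable_fun_cvg _ _ _ setT (fun k (z : X) => \1_(~` E) z * partial i (ext_approx k) z)).
  move=> k; apply: measurable_funM.
    by apply: measurable_indic; exact: measurableC.
  by apply: continuous_measurableRn; exact: Ck_continuous (Ck_partial i (Ck_ext 1 k)).
move=> z _; have [Ez|Ez] := pselect (E z).
  rewrite gE mem_set//; apply: cvg_near_cst; apply: nearW => k.
  by rewrite indicE memNset ?mul0r//; apply.
apply: cvg_near_cst.
have := cvg_off (h_ := fun k => partial i (ext_approx k)) (h := fun z => ext_grad z ord0 i) (fun k y sy Ey => (ext_lim_stable Ey sy).2 i) Ez.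
by apply: filterS => k <-; rewrite indicE mem_set// mul1r.
Qed.

Let iMcube (c : R) r : 0 <= c -> (\int[L]_(z in cube (0 : V) r) (c%:E * majorant z + 1%:E) < +oo)%E.
Proof.
move=> c0; have mC := @measurable_cube R n 0 r.
rewrite ge0_integralD//; first last.
- by apply: measurable_funTS; apply: emeasurable_funM => //; exact: measurable_cst.
- by move=> z _; rewrite mule_ge0.
rewrite lte_add_pinfty//; last by rewrite integral_cst// mul1e lebesgueRn_cube_lty.
rewrite ge0_integralZl//; last exact: measurable_funTS.
rewrite lte_mul_pinfty//; apply: le_lt_trans iM; exact: le_ge0_integral_subset.
Qed.

Let pow1 (x c : R) z : ((`|x| `^ p)%:E <= c%:E * majorant z)%E -> (`|x|%:E <= c%:E * majorant z + 1%:E)%E.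
Proof.
move=> h; apply: le_trans (leeD h (lexx 1%:E)); rewrite -EFinD lee_fin.
by apply: le_powRD1 => //; exact: ltW.
Qed.

Let c20 : 0 <= c2. Proof. by rewrite mulr_ge0 ?powR_ge0 ?(ltW a0). Qed.
Let c10 : 0 <= c1. Proof. by rewrite mulr_ge0 ?powR_ge0 ?(ltW a0). Qed.

Lemma locally_integrable_ext_grad i : locally_integrableRn setT (fun z => ext_grad z ord0 i).
Proof.
split=> [|C cC _]; first exact: measurable_ext_grad.
have [B [Br hB]] := compact_bounded cC.
have sub : C `<=` cube (0 : V) (`|B| + 1).
  by move=> z Cz; rewrite /cube /= subr0; apply: (hB (`|B| + 1)) => //; rewrite (le_lt_trans (ler_norm _))// ltrDl.
apply: le_lt_trans (iMcube (`|B| + 1) c20).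
apply: (@le_trans _ _ (\int[L]_(z in cube (0 : V) (`|B| + 1)) `|ext_grad z ord0 i|%:E)%E).
  by apply: le_ge0_integral_subset => // z _; rewrite lee_fin.
apply: le_ge0_integral => z _; first by rewrite lee_fin.
apply: le_trans (pow1 (_ : ((`| `|ext_grad z| | `^ p)%:E <= c2%:E * majorant z)%E)).
  by rewrite lee_fin [leRHS]ger0_norm ?rV_norm_ge0//; exact: rV_coord_le.
by rewrite ger0_norm ?rV_norm_ge0//; exact: ext_grad_bound.
Qed.

(** The bound is on p-th powers; a <= a^p + 1 turns it into an integrable one on the cube that
    carries [psi]. Convergence fails at most on the null set E. *)
Let cvg_integral (h_ : nat -> V -> R) (h psi : V -> R) rho c : 0 <= c ->
  (forall k, continuous (h_ k)) -> measurable_fun [set: X] (h : X -> R) ->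
  (forall z, ~ E z -> \forall k \near \oo, h_ k z = h z) ->
  (forall k z, ((`|h_ k z| `^ p)%:E <= c%:E * majorant z)%E) ->
  continuous psi -> vanish_off rho psi ->
  (\int[L]_z (h_ k z * psi z)%:E)%E @[k --> \oo] --> (\int[L]_z (h z * psi z)%:E)%E.
Proof.
move=> c0 ch mh hc hb cpsi vpsi; have [B [B0 hB]] := vanish_off_bounded cpsi vpsi.
have mC := @measurable_cube R n 0 rho.
have mpsi : measurable_fun [set: X] (psi : X -> R) by exact: continuous_measurableRn.
pose g : X -> \bar R := (fun z : X => (B%:E * (c%:E * majorant z + 1%:E))%E) \_ (cube (0 : V) rho).
have g1 (z : X) : (0 <= B%:E * (c%:E * majorant z + 1%:E))%E.
  by rewrite mule_ge0 ?lee_fin ?(ltW B0)// adde_ge0// mule_ge0.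
have mg1 : measurable_fun [set: X] (fun z : X => c%:E * majorant z + 1%:E)%E.
  by apply: emeasurable_funD => //; apply: emeasurable_funM => //; exact: measurable_cst.
have mg : measurable_fun [set: X] g.
  have [hm _] := measurable_restrictT (fun z : X => (B%:E * (c%:E * majorant z + 1%:E))%E) mC.
  apply: hm; apply: measurable_funTS.
  by apply: emeasurable_funM => //; exact: measurable_cst.
have g0 z : (0 <= g z)%E by apply: erestrict_ge0.
have ig : L.-integrable [set: X] g.
  apply/integrableP; split => //.
  under eq_integral do rewrite gee0_abs//.
  rewrite /g -integral_mkcond ge0_integralZl//.
  - by rewrite lte_mul_pinfty ?lee_fin ?(ltW B0)//; exact: iMcube.
  - exact: measurable_funTS.
  - by move=> z _; rewrite adde_ge0// mule_ge0.
  - by rewrite lee_fin ltW.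
have m1 k : measurable_fun [set: X] (fun z : X => (h_ k z * psi z)%:E).
  by apply/measurable_EFinP; apply: measurable_funM => //; exact: continuous_measurableRn.
have m2 : measurable_fun [set: X] (fun z : X => (h z * psi z)%:E).
  by apply/measurable_EFinP; exact: measurable_funM.
have ae1 : {ae L, forall z, [set: X] z -> (fun k => (h_ k z * psi z)%:E) @ \oo --> (h z * psi z)%:E}.
  exists E; split => // z /= hz; apply: contrapT => Ez; apply: hz => _.
  by apply: cvg_near_cst; have := hc _ Ez; apply: filterS => k ->.
suff ae2 : {ae L, forall z k, [set: X] z -> (`|(h_ k z * psi z)%:E| <= g z)%E}.
  by have [_ _] := dominated_convergence measurableT m1 m2 ae1 ig ae2.
apply: aeW => z k _; rewrite /g patchE; case: ifPn => [_|/negP zC].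
  rewrite abse_EFin normrM mulrC EFinM; apply: lee_pmul; rewrite ?lee_fin//.
  exact: pow1.
rewrite vpsi ?mulr0 ?abse0// ltNge; apply/negP => hz; apply: zC; apply/mem_set.
by rewrite /cube /= subr0.
Qed.

Lemma weak_gradient_ext : weak_gradient setT ext_lim ext_grad.
Proof.
split; first exact: locally_integrable_continuous continuous_ext_lim.
move=> i; split; first exact: locally_integrable_ext_grad.
move=> phi tphi; have [rho rho0 vphi] := test_function_vanish_off tphi.
have [sphi _ _] := tphi; have Cphi := (smoothP phi).1 sphi.
have h1 : (\int[L]_z (ext_approx k z * partial i phi z)%:E)%E @[k --> \oo] --> (\int[L]_z (ext_lim z * partial i phi z)%:E)%E.
  apply: (@cvg_integral ext_approx ext_lim (partial i phi) rho c1 c10).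
  - by move=> k; exact: Ck_continuous (Ck_ext 0 k).
  - exact: continuous_measurableRn continuous_ext_lim.
  - by apply: (cvg_off (h_ := ext_approx) (h := ext_lim)) => k z sz Ez; exact: (ext_lim_stable Ez sz).1.
  - by move=> k z; exact: (bound k z).1.
  - exact: Ck_continuous (Ck_partial i (Cphi 1%N)).
  - exact: vanish_off_partial vphi.
have h2 : (\int[L]_z (partial i (ext_approx k) z * phi z)%:E)%E @[k --> \oo] --> (\int[L]_z (ext_grad z ord0 i * phi z)%:E)%E.
  apply: (@cvg_integral (fun k => partial i (ext_approx k)) (fun z => ext_grad z ord0 i) phi rho c2 c20) => //.
  - by move=> k; exact: Ck_continuous (Ck_partial i (Ck_ext 1 k)).
  - exact: measurable_ext_grad.
  - by apply: (cvg_off (h_ := fun k => partial i (ext_approx k)) (h := fun z => ext_grad z ord0 i)) => k z sz Ez; exact: (ext_lim_stable Ez sz).2.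
  - by move=> k z; exact: (bound k z).2.
  - exact: Ck_continuous (Cphi 0%N).
have e k := integral_by_parts i (Ck_ext 1 k) (Cphi 1%N) vphi.
have h3 : (- \int[L]_z (partial i (ext_approx k) z * phi z)%:E)%E @[k --> \oo] --> (- \int[L]_z (ext_grad z ord0 i * phi z)%:E)%E.
  by apply: cvgeN; exact: h2.
have ee : (fun k => \int[L]_z (ext_approx k z * partial i phi z)%:E)%E = (fun k => - \int[L]_z (partial i (ext_approx k) z * phi z)%:E)%E.
  by apply/funext => k; rewrite e.
apply: (etrans (esym (cvg_lim (@ereal_hausdorff R) h1))); rewrite ee.
exact: (cvg_lim (@ereal_hausdorff R) h3).
Qed.

Lemma integral_ext_lim : (\int[L]_z (`|ext_lim z| `^ p)%:E <= c1%:E * \int[L]_z majorant z)%E.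
Proof.
have m1 : measurable_fun [set: X] (fun z : X => (`|ext_lim z| `^ p)%:E).
  apply/measurable_EFinP; apply: measurable_fun_powR; apply: measurableT_comp => //.
  exact: continuous_measurableRn continuous_ext_lim.
have m0 (z : X) : setT z -> (0 <= (`|ext_lim z| `^ p)%:E)%E by rewrite lee_fin powR_ge0.
rewrite (ge0_negligible_integral mE measurableT m1 m0 LE) -ge0_integralZl//.
apply: (@le_trans _ _ (\int[L]_(z in (setT `\` E : set X)) (c1%:E * majorant z))%E).
  by apply: le_ge0_integral => z [_ Ez]; [rewrite lee_fin powR_ge0|exact: ext_lim_bound].
by apply: le_ge0_integral_subset => // z _; rewrite mule_ge0.
Qed.

Lemma integral_ext_grad : (\int[L]_z (`|ext_grad z| `^ p)%:E <= c2%:E * \int[L]_z majorant z)%E.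
Proof.
rewrite -ge0_integralZl//.
by apply: le_ge0_integral => z _; [rewrite lee_fin powR_ge0|exact: ext_grad_bound].
Qed.

End extension_limit.

(** * Support of a measure, and functions continuous on a closed set *)

Section support.
Context {R : realType} {n : nat}.
Local Notation V := 'rV[R]_n.
Local Notation X := (borelRn R n).

Lemma closed_boundary (A : set V) : closed (boundary A).
Proof.
have -> : boundary A = closure A `&` ~` interior A by apply/seteqP; split.
by apply: closedI; [exact: closed_closure|exact/open_closedC/open_interior].
Qed.

Lemma support_positive (mu : {measure set X -> \bar R}) (x : V) r :
  support_measure mu x -> 0 < r -> (0 < mu (cube x r))%E.
Proof.
move=> sx r0; have h : (0 < mu (tube [set x] r))%E.
  by apply: sx; [exact: open_tube|exists x => //; rewrite subrr normr0].
apply: lt_le_trans h _.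
apply: le_measure; rewrite ?inE; [exact: measurable_tube|exact: measurable_cube|].
by move=> z [_ -> hz]; exact: ltW.
Qed.

(** A point off the support has a null open neighbourhood, hence lies in a null ball with rational
    centre and radius 1 / (k + 1); such balls are countably many. *)
Lemma measure_off_support (mu : {measure set X -> \bar R}) : closed (support_measure mu) ->
  mu (~` support_measure mu) = 0%E.
Proof.
move=> cS; set S := support_measure mu.
pose B (qk : 'rV[rat]_n * nat) : set X := ball (map_mx ratr qk.1 : V) qk.2.+1%:R^-1.
have mB qk : measurable (B qk) by apply: open_measurableRn; apply: ball_open; rewrite invr_gt0.
pose F m : set X := if unpickle m is Some qk then (if mu (B qk) == 0%E then B qk else set0) else set0.
have nF m : mu.-negligible (F m).
  rewrite /F; case: unpickle => [qk|]; last exact: negligible_set0.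
  by case: eqP => [h|_]; [exists (B qk); split|exact: negligible_set0].
have mS : measurable (~` S : set X) by apply: open_measurableRn; exact: closed_openC.
apply: measure_negligible => //; apply: negligibleS (negligible_bigcup nF) => x Sx.
have [U /not_implyP[oU /not_implyP[Ux /negP]]] := (existsNP (fun U : set V => open U -> U x -> (0 < mu U)%E)).2 Sx.
rewrite lt0e measure_ge0 andbT negbK => /eqP U0.
have := Ux; rewrite [X in X x](open_rat_balls oU) => -[qk /= qU xq].
exists (pickle qk) => //; rewrite /F pickleK.
have -> : mu (B qk) = 0%E.
  by apply/eqP; rewrite -measure_le0 -U0; apply: le_measure => //; rewrite inE//; exact: open_measurableRn.
by rewrite eqxx.
Qed.

Lemma within_continuous_near (S : set V) (f : V -> R) (x : V) (e : R) :
  {within S, continuous f} -> S x -> 0 < e ->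
  exists2 d : R, 0 < d & forall y, S y -> `|y - x| < d -> `|f y - f x| <= e.
Proof.
move=> cf Sx e0; have /subspace_continuousP/(_ x Sx) cx := cf.
have FF : Filter (within S (nbhs x)) by typeclasses eauto.
have /(@cvgrPdist_le _ _ _ _ FF)/(_ _ e0) := cx.
rewrite /prop_near1 /within => /nbhs_ballP[d /= d0 hd]; exists d => // y Sy yx.
by rewrite distrC; apply: hd => //; rewrite -ball_normE /= (rV_distC x y).
Qed.

Lemma within_continuous_measurable (E : set V) (f : V -> R) : closed E ->
  {within E, continuous f} -> measurable_fun [set: X] ((f \_ E) : X -> R).
Proof.
move=> cE cf; have mE : measurable (E : set X) by exact: closed_measurableRn.
have [hm _] := measurable_restrictT (f : X -> R) mE; apply: hm.
apply: (measurability _ (RGenOpens.measurableE R)) => _ [_ [a [b ->] <-]].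
pose U : set R := `]a, b[%classic; have oU : open U by exact: interval_open.
rewrite -/U.
(* Near a point of E mapped into U all points of E are mapped into U, so the preimage is the trace
   on E of an open set. *)
have -> : E `&` f @^-1` U = E `&` interior [set y | E y -> U (f y)].
  apply/seteqP; split=> x [Ex]; last by move=> /interior_subset/(_ Ex).
  move=> Ux; split=> //; have /subspace_continuousP/(_ x Ex) cx := cf.
  by apply: (cx U); apply: open_nbhs_nbhs.
by apply: measurableI => //; apply: open_measurableRn; exact: open_interior.
Qed.

Lemma within_continuous_bounded (E : set V) (f : V -> R) r : closed E -> {within E, continuous f} ->
  exists B, forall x, E x -> cube (0 : V) r x -> `|f x| <= B.
Proof.
move=> cE cf; have cC : compact (E `&` cube (0 : V) r).
  by rewrite setIC; apply: compact_closedI; [exact: compact_cube|exact: cE].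
have cf' : {within E `&` cube (0 : V) r, continuous f} by apply: continuous_subspaceW cf => z [].
have [B [_ hB]] := compact_bounded (continuous_compact cf' cC).
exists (`|B| + 1) => x Ex xr; apply: (hB (`|B| + 1)); first by rewrite (le_lt_trans (ler_norm _))// ltrDl.
by exists x.
Qed.

End support.

(** * Restriction and linear combination of weak gradients *)

Section weak_gradients.
Context {R : realType} {n : nat}.
Local Notation V := 'rV[R]_n.
Local Notation X := (borelRn R n).
Local Notation L := (@lebesgueRn R n).
Implicit Types (W : set V) (u v psi : V -> R) (G H : V -> V).

Lemma partial_off_support psi i z : ~ closure [set x | psi x != 0] z -> partial i psi z = 0.
Proof.
move=> hz; rewrite (@near_eq_partial _ _ i _ (cst 0)) ?partial_cst//.
have : nbhs z (~` closure [set x | psi x != 0]) by apply: open_nbhs_nbhs; split => //; exact/closed_openC/closed_closure.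
by apply: filterS => y hy; apply/eqP/negPn/negP => py; apply: hy; exact: subset_closure.
Qed.

Lemma off_support psi z : ~ closure [set x | psi x != 0] z -> psi z = 0.
Proof. by move=> hz; apply/eqP/negPn/negP => py; apply: hz; exact: subset_closure. Qed.

Lemma weak_gradient_restrict W u v G : open W -> weak_gradient setT v G -> (forall x, W x -> u x = v x) ->
  weak_gradient W u G.
Proof.
move=> oW [[mv iv] hG] uv; have mW : measurable (W : set X) by exact: open_measurableRn.
have li w : locally_integrableRn setT w -> locally_integrableRn W w.
  by move=> [mw iw]; split=> [|C cC _]; [exact: measurable_funTS|exact: iw].
split.
  split=> [|C cC CW].
    apply: (eq_measurable_fun (v : X -> R)); last exact: measurable_funTS.
    by move=> x /set_mem Wx; rewrite uv.
  by rewrite (eq_integral (fun x : X => `|v x|%:E)); [exact: iv|move=> x /set_mem Cx; rewrite uv//; exact: CW].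
move=> i; have [hi hphi] := hG i; split; first exact: li.
move=> phi [sp cp Wp]; have tp : test_function setT phi by split.
have := hphi phi tp; rewrite !(integral_mkcond (W : set X)).
have -> : (fun x => (u x * partial i phi x)%:E) \_ W = (fun x => (v x * partial i phi x)%:E).
  apply/funext => x; rewrite patchE; case: ifPn => [/set_mem Wx|/negP Wx]; first by rewrite uv.
  by rewrite partial_off_support ?mulr0// => /Wp h; apply: Wx; exact: mem_set.
have -> // : (fun x => (G x ord0 i * phi x)%:E) \_ W = (fun x => (G x ord0 i * phi x)%:E).
apply/funext => x; rewrite patchE; case: ifPn => // /negP Wx.
by rewrite off_support ?mulr0// => /Wp h; apply: Wx; exact: mem_set.
Qed.

Lemma weak_gradient_eq W u v G : weak_gradient W v G -> (forall x, W x -> u x = v x) -> weak_gradient W u G.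
Proof.
move=> [[mv iv] hG] uv; split.
  split=> [|C cC CW].
    apply: (eq_measurable_fun (v : X -> R)); last exact: mv.
    by move=> x /set_mem Wx; rewrite uv.
  by rewrite (eq_integral (fun x : X => `|v x|%:E)); [exact: iv|move=> x /set_mem Cx; rewrite uv//; exact: CW].
move=> i; have [hi hphi] := hG i; split=> // phi tp; rewrite -(hphi phi tp).
by apply: eq_integral => x /set_mem Wx; rewrite uv.
Qed.

Lemma integrable_locally W u psi (C : set V) : open W -> locally_integrableRn W u -> continuous psi ->
  compact C -> C `<=` W -> (forall z, ~ C z -> psi z = 0) ->
  L.-integrable (W : set X) (EFin \o (fun x : X => u x * psi x)).
Proof.
move=> oW [mu iu] cpsi cC CW hpsi; have mW : measurable (W : set X) by exact: open_measurableRn.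
have mC : measurable (C : set X) by apply: closed_measurableRn; apply: compact_closed => //; exact: norm_hausdorff.
have [B [_ hB]] : exists B, 0 < B /\ forall z, C z -> `|psi z| <= B.
  have [B [_ hB]] := compact_bounded (continuous_compact (continuous_subspaceT cpsi) cC).
  exists (`|B| + 1); split; first by rewrite ltr_wpDl.
  by move=> z Cz; apply: (hB (`|B| + 1)); [rewrite (le_lt_trans (ler_norm _))// ltrDl|exists z].
have mup : measurable_fun (W : set X) (fun x : X => u x * psi x).
  by apply: measurable_funM => //; apply: measurable_funTS; exact: continuous_measurableRn.
apply/integrableP; split; first exact/measurable_EFinP.
apply: (@le_lt_trans _ _ (\int[L]_(x in C) (`|B|%:E * `|u x|%:E))%E).
  rewrite (integral_mkcond (W : set X)) (integral_mkcond (C : set X)); apply: le_ge0_integral => x _.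
    by apply: erestrict_ge0 => y _.
  rewrite !patchE; have [Cx|Cx] := pselect (C x).
    rewrite (mem_set Cx) (mem_set (CW _ Cx)) /= -EFinM lee_fin normrM mulrC ler_wpM2r//.
    exact: le_trans (hB _ Cx) (ler_norm _).
  have -> : (x \in (C : set X)) = false by apply/negP => /set_mem.
  by case: ifP => _ //=; rewrite hpsi// mulr0 normr0.
rewrite ge0_integralZl//.
- by apply: lte_mul_pinfty => //; exact: iu.
- apply/measurable_EFinP; apply: measurableT_comp => //; exact: measurable_funS mu.
Qed.

Lemma weak_gradient_lin W u v G H (c : R) : open W -> weak_gradient W u G -> weak_gradient W v H ->
  weak_gradient W (fun x => u x + c * v x) (fun x => G x + c *: H x).
Proof.
move=> oW [lu hG] [lv hH]; have mW : measurable (W : set X) by exact: open_measurableRn.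
have li w w' : locally_integrableRn W w -> locally_integrableRn W w' -> locally_integrableRn W (fun x => w x + c * w' x).
  move=> [mw iw] [mw' iw']; split=> [|C cC CW].
    by apply: measurable_funD => //; apply: measurable_funM => //; exact: measurable_cst.
  have mC : measurable (C : set X) by apply: closed_measurableRn; apply: compact_closed => //; exact: norm_hausdorff.
  have m1 : measurable_fun (C : set X) (fun x : X => `|w x|%:E).
    by apply/measurable_EFinP; apply: measurableT_comp => //; exact: measurable_funS mw.
  have m2 : measurable_fun (C : set X) (fun x : X => `|w' x|%:E).
    by apply/measurable_EFinP; apply: measurableT_comp => //; exact: measurable_funS mw'.
  apply: (@le_lt_trans _ _ (\int[L]_(x in C) (`|w x|%:E + `|c|%:E * `|w' x|%:E))%E).
    by apply: le_ge0_integral => x _; [rewrite lee_fin|rewrite -EFinM -EFinD lee_fin -normrM; exact: ler_normD].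
  rewrite ge0_integralD//; last by apply: emeasurable_funM => //; exact: measurable_cst.
  rewrite ge0_integralZl//; apply: lte_add_pinfty; first exact: iw.
  by apply: lte_mul_pinfty => //; exact: iw'.
split; first exact: li.
move=> i; have [lG eG] := hG i; have [lH eH] := hH i; split.
  rewrite (_ : (fun x => _) = (fun x => G x ord0 i + c * H x ord0 i)); first exact: li.
  by apply/funext => x; rewrite !mxE.
move=> phi tp; have [sp cp Wp] := tp; have Cp := (smoothP phi).1 sp.
have c0 : continuous phi by exact: Ck_continuous (Cp 0%N).
have c1 : continuous (partial i phi) by exact: Ck_continuous (Ck_partial i (Cp 1%N)).
have iu := integrable_locally oW lu c1 cp Wp (fun z hz => partial_off_support i hz).
have iv := integrable_locally oW lv c1 cp Wp (fun z hz => partial_off_support i hz).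
have iG := integrable_locally oW lG c0 cp Wp (fun z hz => off_support hz).
have iH := integrable_locally oW lH c0 cp Wp (fun z hz => off_support hz).
have comb (a b : V -> R) (psi : V -> R) : L.-integrable (W : set X) (EFin \o (fun x : X => a x * psi x)) ->
    L.-integrable (W : set X) (EFin \o (fun x : X => b x * psi x)) ->
    (\int[L]_(x in W) ((a x + c * b x) * psi x)%:E = \int[L]_(x in W) (a x * psi x)%:E + c%:E * \int[L]_(x in W) (b x * psi x)%:E)%E.
  move=> ia ib; rewrite -integralZl// -integralD//; last exact: integrableZl.
  by apply: eq_integral => x _; rewrite /= -EFinM -EFinD mulrDl mulrA.
rewrite comb// (eG _ tp) (eH _ tp).
have -> : (\int[L]_(x in W) ((G x + c *: H x) ord0 i * phi x)%:E = \int[L]_(x in W) ((G x ord0 i + c * H x ord0 i) * phi x)%:E)%E.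
  by apply: eq_integral => x _; rewrite !mxE.
rewrite (comb (fun x => G x ord0 i) (fun x => H x ord0 i))// muleN fin_num_oppeD//.
by rewrite fin_numM//; exact: integrable_fin_num iH.
Qed.

End weak_gradients.

(** * Sums of powers and powers of sums *)

Section norm_sums.
Context {R : realType}.
Local Open Scope ereal_scope.

Lemma poweR_sum_le (p c : R) (a b : \bar R) : (0 < p)%R -> (0 <= c)%R -> 0 <= a -> 0 <= b ->
  c%:E * (a `^ p + b `^ p) <= (((2 * c) `^ p^-1)%:E * (a + b)) `^ p.
Proof.
move=> p0 c0 a0 b0; have ab : 0 <= a + b by exact: adde_ge0.
rewrite poweR_EFinM ?powR_ge0// powRVK ?mulr_ge0// mulrC EFinM -muleA.
apply: lee_wpmul2l; first by rewrite lee_fin.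
apply: (@le_trans _ _ ((a + b) `^ p + (a + b) `^ p)).
  by apply: leeD; apply: le_poweR => //; [exact: leeDl|exact: leeDr].
by rewrite -mule2n mule_natl.
Qed.

End norm_sums.

(** * The two inequalities between the norms *)

Section equivalence.
Context {R : realType} {n : nat}.
Local Notation V := 'rV[R]_n.
Local Notation X := (borelRn R n).
Local Notation L := (@lebesgueRn R n).
Variable p : R.
Hypotheses (n0 : (0 < n)%N) (pn : n%:R < p).

Let p1 : 1 < p. Proof. by rewrite (le_lt_trans _ pn)// ler1n. Qed.
Let p0 : 0 < p. Proof. by rewrite (lt_trans _ p1). Qed.

Lemma Lp_norm_powE (mu : {measure set X -> \bar R}) (A : set V) (u : V -> R) :
  (Lp_norm mu A p u `^ p = \int[mu]_(x in A) (`|u x| `^ p)%:E)%E.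
Proof. by rewrite Lp_normE// poweRVK// integral_ge0// => x _; rewrite lee_fin powR_ge0. Qed.

Lemma Lp_norm_le_setT (mu : {measure set X -> \bar R}) (A : set V) (u v : V -> R) :
  (forall x, A x -> u x = v x) -> (Lp_norm mu A p u <= Lp_norm mu setT p v)%E.
Proof.
move=> uv; rewrite Lp_norm_le ?Lp_norm_ge0// Lp_norm_powE.
rewrite (eq_integral (fun x : X => (`|v x| `^ p)%:E)); last by move=> x /set_mem Ax; rewrite uv.
by apply: le_ge0_integral_subset => // x _; rewrite lee_fin powR_ge0.
Qed.

Lemma integral_glue (W : set V) (u v w : V -> R) : open W ->
  measurable_fun (W : set X) (u : X -> R) -> measurable_fun [set: X] (v : X -> R) ->
  (forall x, W x -> w x = u x) -> (forall x, ~ W x -> w x = v x) ->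
  (\int[L]_x (`|w x| `^ p)%:E <= \int[L]_(x in W) (`|u x| `^ p)%:E + \int[L]_x (`|v x| `^ p)%:E)%E.
Proof.
move=> oW mu mv wu wv; have mW : measurable (W : set X) by exact: open_measurableRn.
have mu' : measurable_fun (W : set X) (fun x : X => (`|u x| `^ p)%:E).
  by apply/measurable_EFinP; apply: measurable_fun_powR; exact: measurableT_comp.
have mv' : measurable_fun [set: X] (fun x : X => (`|v x| `^ p)%:E).
  by apply/measurable_EFinP; apply: measurable_fun_powR; exact: measurableT_comp.
have pos (x : R) : (0 <= (`|x| `^ p)%:E)%E by rewrite lee_fin powR_ge0.
have [hm _] := measurable_restrictT (fun x : X => (`|u x| `^ p)%:E) mW.
rewrite (integral_mkcond (W : set X)) -ge0_integralD//; last 2 first.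
- by move=> x _; apply: erestrict_ge0.
- exact: hm.
apply: le_ge0_integral => x _ //; rewrite patchE; have [Wx|Wx] := pselect (W x).
  by rewrite (mem_set Wx) wu// leeDl.
by rewrite wv// leeDr//; case: ifP.
Qed.

Lemma le_ereal_inf_bound (A : set (\bar R)) (x : \bar R) : (forall y, A y -> (x <= y)%E) -> (x <= ereal_inf A)%E.
Proof. by move=> h; rewrite leNgt; apply/negP => /ereal_inf_lt[y Ay]; rewrite ltNge h. Qed.

Section fixed_data.
Variables (S : set V) (sigma : {measure set X -> \bar R}) (Cs C1 C2 : R) (m : nat).
Local Notation E := (boundary S).
Local Notation Omega := (interior S).
Hypotheses (Cs0 : 0 < Cs) (C10 : 0 < C1) (C20 : 0 < C2) (cS : closed S).
Hypotheses (rs : regular_measure sigma) (ss : support_measure sigma = E).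
Hypothesis sdbl : forall (x : V) (r k : R), E x -> 0 < r <= 1 -> 1 <= k <= r^-1 ->
  (sigma (cube x (k * r)) <= (Cs * k ^+ n)%:E * sigma (cube x r))%E.
Hypothesis sone : forall x : V, E x -> (C1%:E <= sigma (cube x 1) <= C2%:E)%E.
Hypotheses (m6 : (6 <= m)%N) (hE : has_holes m E).
Variables (M K : R).
Hypotheses (M0 : 0 < M) (hM : forall t : R, dstep t <= M).
Hypotheses (K0 : 0 < K) (hK : forall (i : 'I_n) (z : V), `|partial i plateau z| <= K).
Variable f : V -> R.
Hypothesis cf : {within S, continuous f}.

Let cE : closed E. Proof. exact: closed_boundary. Qed.
Let mE : @measurable _ X E. Proof. exact: closed_measurableRn. Qed.
Let ES : E `<=` S. Proof. by move=> x [cx _]; rewrite ((closure_id S).1 cS). Qed.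
Let oO : open Omega. Proof. exact: open_interior. Qed.
Let OS : Omega `<=` S. Proof. exact: interior_subset. Qed.
Let offO x : S x -> ~ Omega x -> E x.
Proof. by move=> Sx Ox; split => //; exact: subset_closure. Qed.
Let sfin z r : (sigma (cube z r) < +oo)%E.
Proof. by have [h _ _] := rs; apply: h; exact: compact_cube. Qed.
Let spos x r : E x -> 0 < r -> (0 < sigma (cube x r))%E.
Proof. by move=> Ex; apply: support_positive; rewrite ss. Qed.
Let sE : sigma (~` E) = 0%E.
Proof. by rewrite -ss; apply: measure_off_support; rewrite ss. Qed.
Let LE : L E = 0%E. Proof. by apply: (porous_null n0 _ cE hE); exact: leq_trans m6. Qed.
Let sone1 x : E x -> (C1%:E <= sigma (cube x 1))%E. Proof. by move=> /sone/andP[]. Qed.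

Local Notation besov_sum u :=
  (\int[sigma]_(y in E) \int[sigma]_(x in E `&` [set x : V | (0 < `|x - (y : V)| < 1)%R])
     (besov_kernel p sigma u x y)%:E)%E.

Let besov_sum_ge0 (u : V -> R) : (0 <= besov_sum u)%E.
Proof.
apply: integral_ge0 => y _; apply: integral_ge0 => x _; rewrite lee_fin.
by rewrite divr_ge0 ?powR_ge0// mulr_ge0 ?powR_ge0// exprn_ge0// fine_sigma_ge0.
Qed.

Let besovE : besov_seminorm sigma E p f = (besov_sum f `^ p^-1)%E. Proof. by []. Qed.

Let eq_besov (u v : V -> R) : (forall x, E x -> u x = v x) -> besov_sum u = besov_sum v.
Proof.
move=> uv; apply: eq_integral => y /set_mem Ey; apply: eq_integral => x /set_mem[Ex _].
by rewrite /besov_kernel !uv.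
Qed.

(** The maximum with 0 supplies the sign required by [poweR_sum_le], which is also the origin of the
    factor 2 and of the exponent 1/p. *)
Definition lower_Lp_const : R := (2 * Num.max 0 (@trace_Lp_const R n p M m C2)) `^ p^-1.
Definition lower_besov_const : R := (2 * Num.max 0 (@besov_const R n p M m Cs C1 C2)) `^ p^-1.

Let weighted_sum (x y z N : \bar R) (s t : R) : (0 <= N)%E -> 0 <= s -> 0 <= t ->
  (x <= N -> y <= s%:E * N -> z <= t%:E * N -> x + y + z <= (1 + s + t)%:E * N)%E.
Proof.
move=> N0 s0 t0 h1 h2 h3; rewrite !EFinD !ge0_muleDl ?lee_fin ?addr_ge0// mul1e.
by apply: leeD => //; exact: leeD.
Qed.

Lemma trace_lower F G : continuous F -> weak_gradient setT F G -> (forall x, S x -> F x = f x) ->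
  (W1p_norm Omega p f + Lp_norm sigma E p f + besov_seminorm sigma E p f <=
   (1 + lower_Lp_const + lower_besov_const)%:E * (Lp_norm L setT p F + Lp_norm L setT p (fun x => `|G x|%R)))%E.
Proof.
move=> cF wG FS; have FO x : Omega x -> f x = F x by move=> Ox; rewrite FS//; exact: OS.
have mG : measurable_fun [set: X] (fun z : X => `|G z|).
  by apply: measurable_rV_norm => i; have [_ /(_ i)[[mGi _] _]] := wG.
set a := Lp_norm L setT p F; set g := Lp_norm L setT p _.
have ga0 : (0 <= a)%E by exact: Lp_norm_ge0.
have gg0 : (0 <= g)%E by exact: Lp_norm_ge0.
have aE : (a `^ p = \int[L]_z (`|F z| `^ p)%:E)%E by exact: Lp_norm_powE.
have gE : (g `^ p = \int[L]_z (`|G z| `^ p)%:E)%E.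
  by rewrite /g Lp_norm_powE; apply: eq_integral => x _; rewrite ger0_norm ?rV_norm_ge0.
have ap0 : (0 <= a `^ p)%E by exact: poweR_ge0.
have gp0 : (0 <= g `^ p)%E by exact: poweR_ge0.
have max0 (c : R) : 0 <= Num.max 0 c by rewrite le_max lexx.
have maxr (c : R) : c <= Num.max 0 c by rewrite le_max lexx orbT.
have N0 : (0 <= a + g)%E by exact: adde_ge0.
apply: weighted_sum => //; try exact: powR_ge0.
- apply: ge_ereal_inf; exists (Lp_norm L Omega p f + Lp_norm L Omega p (fun x => `|G x|%R))%E.
    by exists G => //; exact: weak_gradient_restrict wG FO.
  by apply: leeD; apply: Lp_norm_le_setT.
- rewrite Lp_norm_le ?mule_ge0 ?lee_fin ?powR_ge0//.
  apply: le_trans (poweR_sum_le p0 (max0 _) ga0 gg0).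
  rewrite (eq_integral (fun x : X => (`|F x| `^ p)%:E)); last by move=> x /set_mem Ex; rewrite FS//; exact: ES.
  apply: le_trans (trace_Lp n0 pn m6 M0 hM sfin cE hE C20 spos sone cF wG mG) _.
  rewrite aE gE addeC; apply: lee_wpmul2r; last by rewrite lee_fin.
  by rewrite -aE -gE adde_ge0.
- rewrite besovE poweRV_leP ?mule_ge0 ?lee_fin ?powR_ge0//.
  apply: le_trans (poweR_sum_le p0 (max0 _) ga0 gg0).
  rewrite (@eq_besov f F); last by move=> x Ex; rewrite FS//; exact: ES.
  apply: le_trans (besov_trace n0 pn m6 M0 hM sfin cE hE Cs0 C10 C20 spos sdbl sone cF wG mG) _.
  rewrite -gE; apply: (@le_trans _ _ ((Num.max 0 (@besov_const R n p M m Cs C1 C2))%:E * g `^ p)%E).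
    by apply: lee_wpmul2r => //; rewrite lee_fin.
  by apply: lee_wpmul2l; [rewrite lee_fin|exact: leeDr].
Qed.

Local Notation A1 := (2 `^ p * @approx_const R n p K Cs C1).
Local Notation A2 := (@deriv_const R n K `^ p * @approx_const R n p K Cs C1).
Local Notation cM := (@majorant_const R n p Cs).

(** The 1 accounts for the norms on Omega, [(A1 + A2) * cM] for the integral of the majorant, and 4
    for replacing four p-th powers by the p-th power of the sum. *)
Definition upper_const : R := (4 * (1 + (A1 + A2) * cM)) `^ p^-1.

Let four_powers (a g l s T : \bar R) : (0 <= a -> 0 <= g -> 0 <= l -> 0 <= s -> T = a + g + l + s ->
  (1 + (A1 + A2) * cM)%:E * (a `^ p + g `^ p + l `^ p + s `^ p) <= (upper_const%:E * T) `^ p)%E.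
Proof.
move=> a0 g0 l0 s0 ->; have cM0 := majorant_const_gt0 pn Cs0; have ac := approx_const_gt0 p K0 Cs0 C10.
have D0 : 0 <= 1 + (A1 + A2) * cM by rewrite addr_ge0// mulr_ge0 ?(ltW cM0)// addr_ge0// mulr_ge0 ?powR_ge0// ltW.
have ag0 : (0 <= a + g)%E by exact: adde_ge0.
have agl0 : (0 <= a + g + l)%E by exact: adde_ge0.
rewrite poweR_EFinM ?powR_ge0 ?adde_ge0// powRVK ?mulr_ge0// (mulrC 4) EFinM -muleA.
apply: lee_wpmul2l; first by rewrite lee_fin.
have h1 : (a `^ p <= (a + g + l + s) `^ p)%E by apply: le_poweR => //; rewrite -addeA -addeA leeDl// !adde_ge0.
have h2 : (g `^ p <= (a + g + l + s) `^ p)%E.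
  by apply: le_poweR => //; rewrite -addeA; apply: le_trans (leeDr g a0) _; apply: leeDl; exact: adde_ge0.
have h3 : (l `^ p <= (a + g + l + s) `^ p)%E.
  by apply: le_poweR => //; apply: le_trans (leeDr l ag0) _; exact: leeDl.
have h4 : (s `^ p <= (a + g + l + s) `^ p)%E by apply: le_poweR => //; exact: leeDr.
apply: le_trans (leeD (leeD (leeD h1 h2) h3) h4) _.
have -> : 4%:E = (1 + 1 + 1 + 1)%:E :> \bar R by congr (_%:E); ring.
by rewrite !EFinD !ge0_muleDl ?lee_fin// !mul1e.
Qed.

Let D_le (x y a g l s I : \bar R) (A : R) : (0 <= a -> 0 <= g -> 0 <= l -> 0 <= s)%E -> A <= A1 + A2 -> 0 <= A ->
  (0 <= a -> 0 <= g -> 0 <= l -> 0 <= s -> x <= y + A%:E * I -> I <= cM%:E * (l + s) -> y <= a + g ->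
  x <= (1 + (A1 + A2) * cM)%:E * (a + g + l + s))%E.
Proof.
move=> _ AA A0 a0 g0 l0 s0 hx hI hy; have cM0 := majorant_const_gt0 pn Cs0.
have B0 : 0 <= (A1 + A2) * cM by rewrite mulr_ge0 ?(ltW cM0)//; exact: le_trans AA.
have ls0 : (0 <= l + s)%E by exact: adde_ge0.
have ag0 : (0 <= a + g)%E by exact: adde_ge0.
apply: le_trans hx _; rewrite -addeA EFinD ge0_muleDl ?lee_fin// mul1e; apply: leeD.
  by apply: le_trans hy _; exact: leeDl.
apply: (@le_trans _ _ (((A1 + A2) * cM)%:E * (l + s))%E).
  rewrite EFinM -muleA; apply: (@le_trans _ _ (A%:E * (cM%:E * (l + s)))%E).
    by apply: lee_wpmul2l => //; rewrite lee_fin.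
  by apply: lee_wpmul2r; rewrite ?lee_fin// mule_ge0// lee_fin ltW.
by apply: lee_wpmul2l; rewrite ?lee_fin//; exact: leeDr.
Qed.

Lemma trace_upper G : weak_gradient Omega f G ->
  (trace_norm S p f <= (2 * upper_const)%:E *
    ((Lp_norm L Omega p f + Lp_norm L Omega p (fun x => `|G x|%R)) + (Lp_norm sigma E p f + besov_seminorm sigma E p f)))%E.
Proof.
move=> wG; have cM0 := majorant_const_gt0 pn Cs0; have ac := approx_const_gt0 p K0 Cs0 C10.
have A10 : 0 <= A1 by rewrite mulr_ge0 ?powR_ge0// ltW.
have A20 : 0 <= A2 by rewrite mulr_ge0 ?powR_ge0// ltW.
have u0 : 0 < upper_const.
  by apply: powR_gt0; rewrite mulr_gt0// ltr_pwDl// mulr_ge0 ?(ltW cM0)// addr_ge0.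
set a := Lp_norm L Omega p f; set g := Lp_norm L Omega p _; set l := Lp_norm sigma E p f; set s := besov_seminorm _ _ _ _.
have a0 : (0 <= a)%E by exact: Lp_norm_ge0.
have g0 : (0 <= g)%E by exact: Lp_norm_ge0.
have l0 : (0 <= l)%E by exact: Lp_norm_ge0.
have s0 : (0 <= s)%E by exact: poweR_ge0.
rewrite addeA; set T := (a + g + l + s)%E.
have T0 : (0 <= T)%E by rewrite !adde_ge0.
have [Tf|] := ltP T +oo%E; last by rewrite leye_eq => /eqP ->; rewrite gt0_muley ?leey// lte_fin mulr_gt0.
have sub (x y : \bar R) : (0 <= y -> x + y < +oo -> x < +oo)%E by move=> y0; apply: le_lt_trans; exact: leeDl.
have subr (x y : \bar R) : (0 <= x -> x + y < +oo -> y < +oo)%E by move=> x0; apply: le_lt_trans; exact: leeDr.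
have aglf : (a + g + l < +oo)%E by exact: sub s0 Tf.
have sf : (s < +oo)%E by apply: subr Tf; rewrite !adde_ge0.
have lf : (l < +oo)%E by apply: subr aglf; rewrite adde_ge0.
have gf : (g < +oo)%E by apply: (subr a); [exact: a0|exact: sub l0 aglf].
have pf (x : \bar R) : (0 <= x -> x < +oo -> x `^ p < +oo)%E.
  by move=> x0 xf; rewrite -(fineK (_ : x \is a fin_num)) ?ge0_fin_numE// poweR_EFin ltry.
have cfE : {within E, continuous f} by exact: continuous_subspaceW cf.
(* f is continuous on S only; its restriction to E extended by 0 is Borel on all of R^n, and the
   averages see nothing but its values on E. *)
pose h := f \_ E; have hf x : E x -> h x = f x by move=> Ex; rewrite /h patchE mem_set.
have mh : measurable_fun [set: X] (h : X -> R) by exact: within_continuous_measurable.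
have bh r : exists B, forall x, E x -> cube (0 : V) r x -> `|h x| <= B.
  have [B hB] := within_continuous_bounded r cE cfE.
  by exists B => x Ex; rewrite hf//; exact: hB.
have ch x : E x -> forall e : R, 0 < e -> exists2 d : R, 0 < d & forall y, E y -> `|y - x| < d -> `|h y - h x| <= e.
  move=> Ex e e0; have [d d0 hd] := within_continuous_near cfE Ex e0.
  by exists d => // y Ey; rewrite !hf//; exact: hd.
have lE : (l `^ p = \int[sigma]_(x in E) (`|f x| `^ p)%:E)%E by exact: Lp_norm_powE.
have sE' : (s `^ p = besov_sum f)%E by rewrite /s besovE poweRVK.
have iM := integral_majorant n0 pn sfin cE Cs0 spos sdbl mh.
have hE' : (\int[sigma]_(x in E) (`|h x| `^ p)%:E = l `^ p)%E by rewrite lE; apply: eq_integral => x /set_mem Ex; rewrite hf.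
rewrite (eq_besov hf) -sE' hE' in iM.
have iMf : (\int[L]_z majorant p sigma E h z < +oo)%E.
  apply: le_lt_trans iM _; apply: lte_mul_pinfty; rewrite ?lee_fin ?(ltW cM0)//.
  by apply: lte_add_pinfty; exact: pf.
pose P := ext_lim sigma E h; pose GP := ext_grad sigma E h.
have cP : continuous P := @continuous_ext_lim R n sigma E sfin cE sE spos h mh bh ch.
have wP : weak_gradient setT P GP := weak_gradient_ext n0 pn K0 hK sfin cE sE LE Cs0 C10 spos sdbl sone1 mh bh ch iMf.
have iP := integral_ext_lim n0 pn K0 hK sfin cE sE LE Cs0 C10 spos sdbl sone1 mh bh ch.
have iGP := integral_ext_grad n0 pn K0 hK sfin cE sE Cs0 C10 spos sdbl sone1 mh bh.
have PE x : E x -> P x = f x by move=> Ex; rewrite /P ext_lim_on// hf.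
have mGP : measurable_fun [set: X] (fun z : X => `|GP z|).
  by apply: measurable_rV_norm => i; have [_ /(_ i)[[mi _] _]] := wP.
have mGO : measurable_fun (Omega : set X) (fun z : X => `|G z|).
  by apply: measurable_rV_norm => i; have [_ /(_ i)[[mi _] _]] := wG.
pose u z := if z \in S then f z + (- 1) * P z else 0.
have uO z : ~ Omega z -> u z = 0.
  move=> Oz; rewrite /u; case: ifPn => // /set_mem Sz.
  by rewrite PE ?mulN1r ?subrr//; exact: offO.
have uS z : S z -> u z = f z + (- 1) * P z by move=> Sz; rewrite /u mem_set.
have nS z : ~ S z -> u z = 0 by move=> Sz; rewrite /u; case: ifPn => // /set_mem.
(* At a boundary point u is 0, so neighbours off S cause no difficulty; on S both f and P are close
   to their values at the point. *)
have cu : continuous u.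
  move=> z; have FF : Filter (nbhs z) by typeclasses eauto.
  apply/(@cvgrPdist_le _ _ _ _ FF) => e e0.
  have [Sz|Sz] := pselect (S z); last first.
    have : nbhs z (~` S) by apply: open_nbhs_nbhs; split => //; exact: closed_openC.
    by apply: filterS => y Sy; rewrite !nS// subrr normr0 ltW.
  have e2 : 0 < e / 2 by rewrite divr_gt0.
  have [d d0 hd] := within_continuous_near cf Sz e2.
  have cPz : P x @[x --> z] --> P z by exact: cP.
  have key y : S y -> `|y - z| < d -> `|P z - P y| <= e / 2 -> `|u z - u y| <= e.
    move=> Sy yz hP; rewrite !uS//; have h1 := hd y Sy yz.
    have -> : f z + -1 * P z - (f y + -1 * P y) = - (f y - f z) - (P z - P y) by ring.
    by apply: le_trans (ler_normB _ _) _; rewrite normrN (splitr e); exact: lerD.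
  have /(@cvgrPdist_le _ _ _ _ FF)/(_ _ e2) := cPz.
  have [Oz|Oz] := pselect (Omega z).
    have nO : nbhs z Omega by exact: open_nbhs_nbhs.
    apply: filterS3 nO (near_dist z d0) => y Oy yz hP.
    by apply: key => //; exact: OS.
  apply: filterS2 (near_dist z d0) => y yz hP.
  have [Sy|Sy] := pselect (S y); first exact: key.
  by rewrite (uO z)// nS// subrr normr0 ltW.
pose G' x := G x + (- 1) *: GP x.
have wu : weak_gradient Omega u G'.
  have wPO : weak_gradient Omega P GP by exact: weak_gradient_restrict wP _.
  apply: weak_gradient_eq (weak_gradient_lin (- 1) oO wG wPO) _.
  by move=> x Ox; rewrite uS//; exact: OS.
have gE : (g `^ p = \int[L]_(x in Omega) (`|G x| `^ p)%:E)%E.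
  by rewrite /g Lp_norm_powE; apply: eq_integral => x _; rewrite ger0_norm ?rV_norm_ge0.
have aE : (a `^ p = \int[L]_(x in Omega) (`|f x| `^ p)%:E)%E by exact: Lp_norm_powE.
have iGPf : (\int[L]_z (`|GP z| `^ p)%:E < +oo)%E.
  by apply: le_lt_trans iGP _; apply: lte_mul_pinfty => //.
have G'f : (\int[L]_(x in Omega) (`|G' x| `^ p)%:E < +oo)%E.
  have m1 : measurable_fun (Omega : set X) (fun x : X => (`|G x| `^ p)%:E).
    by apply/measurable_EFinP; exact: measurable_fun_powR.
  have m2 : measurable_fun (Omega : set X) (fun x : X => (`|GP x| `^ p)%:E).
    by apply: measurable_funTS; apply/measurable_EFinP; exact: measurable_fun_powR.
  have mO : measurable (Omega : set X) by exact: open_measurableRn.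
  have pos (x : R) : (0 <= (x `^ p)%:E)%E by rewrite lee_fin powR_ge0.
  apply: (@le_lt_trans _ _ (\int[L]_(x in Omega) ((3 `^ p)%:E * ((`|G x| `^ p)%:E + (`|GP x| `^ p)%:E)))%E).
    apply: le_ge0_integral => x _ //; rewrite -EFinD -EFinM lee_fin.
    (* The inequality for three terms, used with third term 0. *)
    have h3 := le3_powR pn (rV_norm_ge0 (G x)) (rV_norm_ge0 (GP x)) (lexx 0).
    rewrite (powR0 (lt0r_neq0 p0)) !addr0 in h3; apply: le_trans h3.
    apply: ge0_ler_powR; rewrite ?nnegrE ?(ltW p0) ?rV_norm_ge0 ?addr_ge0 ?rV_norm_ge0//.
    by apply: le_trans (rV_normD _ _) _; rewrite rV_normZ normrN normr1 mul1r.
  rewrite ge0_integralZl//; first last.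
  - by move=> x _; exact: adde_ge0.
  - exact: emeasurable_funD.
  apply: lte_mul_pinfty => //; rewrite ge0_integralD//; apply: lte_add_pinfty.
    by rewrite -gE; exact: pf.
  by apply: le_lt_trans iGPf; exact: le_ge0_integral_subset.
have wH := zero_extension n0 pn M0 hM K0 hK oO cu uO wu G'f.
pose F x := P x + 1 * u x; pose GF x := GP x + 1 *: zero_ext Omega G' x.
have wF : weak_gradient setT F GF by exact: weak_gradient_lin 1 openT wP wH.
have FS x : S x -> F x = f x by move=> Sx; rewrite /F uS//; ring.
have FO x : ~ Omega x -> F x = P x by move=> Ox; rewrite /F uO// mulr0 addr0.
have GFO x : Omega x -> GF x = G x.
  by move=> Ox; rewrite /GF /zero_ext mem_set// scale1r /G' scaleN1r addrC subrK.
have GFn x : ~ Omega x -> GF x = GP x.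
  by move=> Ox; rewrite /GF /zero_ext; case: ifPn => [/set_mem//|_]; rewrite scaler0 addr0.
have c1 : continuous (fun _ : V => 1 : R) := Ck_continuous (Ck_cst 0 (1 : R)).
have cF : continuous F := continuous_add cP (continuous_mul c1 cu).
have pp (x : \bar R) : (0 <= x `^ p)%E := poweR_ge0 x p.
have NF : (Lp_norm L setT p F <= upper_const%:E * T)%E.
  rewrite Lp_norm_le ?mule_ge0 ?lee_fin ?(ltW u0)//; apply: le_trans (four_powers a0 g0 l0 s0 erefl).
  have := integral_glue oO wG.1.1 (continuous_measurableRn cP) (fun x Ox => FS x (OS Ox)) FO.
  rewrite -aE => hF; apply: (@D_le _ (a `^ p)%E _ _ _ _ _ A1) iM _ => //.
  - by rewrite lerDl.
  - by apply: le_trans hF _; exact: leeD.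
  - exact: leeDl.
have NG : (Lp_norm L setT p (fun x => `|GF x|%R) <= upper_const%:E * T)%E.
  rewrite Lp_norm_le ?mule_ge0 ?lee_fin ?(ltW u0)//; apply: le_trans (four_powers a0 g0 l0 s0 erefl).
  have := integral_glue oO mGO mGP (w := fun x => `|GF x|) (fun x Ox => congr1 _ (GFO x Ox)) (fun x Ox => congr1 _ (GFn x Ox)).
  have e1 : (\int[L]_(x in Omega) (`| `|G x|%R |%R `^ p)%:E = g `^ p)%E.
    by rewrite gE; apply: eq_integral => x _; rewrite ger0_norm ?rV_norm_ge0.
  have e2 : (\int[L]_x (`| `|GP x|%R |%R `^ p)%:E = \int[L]_x (`|GP x| `^ p)%:E)%E.
    by apply: eq_integral => x _; rewrite ger0_norm ?rV_norm_ge0.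
  rewrite e1 e2 => hF; apply: (@D_le _ (g `^ p)%E _ _ _ _ _ A2) iM _ => //.
  - by rewrite lerDr.
  - by apply: le_trans hF _; exact: leeD.
  - exact: leeDr.
have fin : (upper_const%:E * T < +oo)%E by apply: lte_mul_pinfty; rewrite ?lee_fin ?(ltW u0).
apply: (@le_trans _ _ (Lp_norm L setT p F + Lp_norm L setT p (fun x => `|GF x|%R))%E).
  apply: ge_ereal_inf; exists (W1p_norm setT p F).
    by exists F => //; split=> //; exists GF; split=> //; [exact: le_lt_trans NF fin|exact: le_lt_trans NG fin].
  by apply: ge_ereal_inf; exists (Lp_norm L setT p F + Lp_norm L setT p (fun x => `|GF x|%R))%E => //; exists GF.
apply: le_trans (leeD NF NG) _.
have -> : 2 * upper_const = upper_const + upper_const by ring.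
by rewrite EFinD ge0_muleDl ?lee_fin ?(ltW u0).
Qed.

End fixed_data.
End equivalence.

(** * The equivalence of norms *)

Theorem theorem1p10 (R : realType) (n : nat) (p Csigma C'sigma C''sigma beta : R)
  (n_gt0 : (0 < n)%N) (p_gtn : n%:R < p)
  (Csigma_gt0 : 0 < Csigma) (C'sigma_gt0 : 0 < C'sigma)
  (C''sigma_gt0 : 0 < C''sigma) (beta_gt0 : 0 < beta) :
  exists C : R, 1 <= C /\
  forall (S : set 'rV[R]_n) (sigma : {measure set (borelRn R n) -> \bar R}),
    closed S ->
    regular_measure sigma ->
    support_measure sigma = boundary S ->
    (forall (x : 'rV[R]_n) (r k : R),
       boundary S x -> 0 < r <= 1 -> 1 <= k <= r^-1 ->
       (sigma (cube x (k * r)) <= (Csigma * k ^+ n)%:E * sigma (cube x r))%E) ->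
    (forall x : 'rV[R]_n, boundary S x ->
       (C'sigma%:E <= sigma (cube x 1) <= C''sigma%:E)%E) ->
    ball_condition beta (boundary S) ->
    forall f : 'rV[R]_n -> R, {within S, continuous f} ->
      equivalent_up_to C
        (trace_norm S p f)
        (W1p_norm (interior S) p f
         + Lp_norm sigma (boundary S) p f
         + besov_seminorm sigma (boundary S) p f)%E.
Proof.
have [M [M0 hM]] := @dstep_bounded R.
have [K [K0 hK]] := @partial_plateau_bounded R n.
(* The number of subdivisions depends on n and beta alone, and every later constant on m and the
   given data, so that C is fixed before S, sigma and f. *)
have [m m6 mb] : exists2 m : nat, (6 <= m)%N & 12 * n%:R * beta < m%:R.
  have t0 : 0 < (12 * n%:R * beta + 1)^-1 by rewrite invr_gt0 ltr_pwDr// !mulr_ge0// ltW.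
  have [k _ /(_ k (leqnn k)) /= hk] := near_infty_natSinv_lt (PosNum t0).
  have k1 : 12 * n%:R * beta + 1 < k.+1%:R by move: hk; rewrite ltf_pV2 ?posrE// -invr_gt0.
  exists (6 + k.+1)%N; first exact: leq_addr.
  by rewrite natrD; have : 0 <= 6 :> R by []; move: k1; lra.
pose c1 : R := 1 + @lower_Lp_const R n p C''sigma m M + @lower_besov_const R n p Csigma C'sigma C''sigma m M.
pose c2 : R := 2 * @upper_const R n p Csigma C'sigma K.
have c10 : 0 < c1 by rewrite /c1 -addrA ltr_pwDl// addr_ge0 ?powR_ge0.
pose C := Num.max 1 (Num.max c1 (Num.max c2 1)).
have C1 : 1 <= C by rewrite /C le_max lexx.
have Cc1 : c1 <= C by rewrite /C !le_max lexx !orbT.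
have Cc2 : c2 <= C by rewrite /C !le_max lexx !orbT.
have C0 : 0 < C by rewrite (lt_le_trans _ C1).
exists C; split=> // S sigma cS rs ss sdbl sone ball f cf.
have hE := ball_condition_holes beta_gt0 m6 mb ball.
have n1 A u : (0 <= Lp_norm (lebesgueRn n) A p u)%E by exact: Lp_norm_ge0.
set a := trace_norm S p f; set l := Lp_norm sigma _ p f; set s := besov_seminorm _ _ _ _.
have l0 : (0 <= l)%E by exact: Lp_norm_ge0.
have s0 : (0 <= s)%E by exact: poweR_ge0.
have a0 : (0 <= a)%E.
  apply: le_ereal_inf_bound => _ [F _ <-]; apply: le_ereal_inf_bound => _ [G _ <-].
  exact: adde_ge0.
set w := W1p_norm _ p f.
have w0 : (0 <= w)%E by apply: le_ereal_inf_bound => _ [G _ <-]; exact: adde_ge0.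
apply/andP; split; last first.
  apply: (@le_trans _ _ (c1%:E * a)%E); last by apply: lee_wpmul2r => //; rewrite lee_fin.
  rewrite -lee_pdivrMl//; apply: le_ereal_inf_bound => _ [F [cF _ FS] <-].
  apply: le_ereal_inf_bound => _ [G wG <-]; rewrite lee_pdivrMl//.
  exact: (trace_lower n_gt0 p_gtn Csigma_gt0 C'sigma_gt0 C''sigma_gt0 cS rs ss sdbl sone m6 hE M0 hM cF wG FS).
rewrite lee_pdivrMl// -addeA.
(* Finiteness of [l + s] is needed below to subtract it and isolate [W1p_norm]; the estimate can
   then be proved for each weak gradient separately and passed to the infimum. *)
have [lsf|] := ltP (l + s)%E +oo%E; last first.
  by rewrite leye_eq => /eqP ->; rewrite addey ?gt0_muley ?leey ?lte_fin// gt_eqF// (lt_le_trans _ w0)// ltNy0.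
have lsn : (l + s)%E \is a fin_num by rewrite ge0_fin_numE// adde_ge0.
rewrite -lee_pdivrMl// -leeBlDr//; apply: le_ereal_inf_bound => _ [G wG <-].
rewrite leeBlDr// lee_pdivrMl//.
have tu := trace_upper n_gt0 p_gtn Csigma_gt0 C'sigma_gt0 cS rs ss sdbl sone m6 hE M0 hM K0 hK cf wG.
apply: (le_trans tu).
by apply: lee_wpmul2r; [apply: adde_ge0; exact: adde_ge0|rewrite lee_fin].
Qed.
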